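(* Let $(\Gamma,Z,\Omega)$ be a finite, uncoupled, integral BPS structure with twisted torus $\mathbb{T}$. Suppose that $\xi\in\mathbb{T}$ satisfies $\xi(\gamma)=1$ for all active classes $\gamma\in\Gamma$. Then the Riemann-Hilbert problem associated to $(\Gamma,Z,\Omega)$ with constant term $\xi$ has a unique solution. In terms of the functions $Y_{r,\beta}(t)=\exp(Z(\beta)/t)\cdot X_{r,\beta}(t)\cdot \xi(\beta)^{-1}$, the solution associates to each non-active ray $r\subset\mathbb{C}^*$ and each $\beta\in\Gamma$ the function on $\mathbb{H}_r$ $$Y_{r,\beta}(t)=\prod_{Z(\gamma)\in i\mathbb{H}_r}\Lambda\Big(\frac{Z(\gamma)}{2\pi i t}\Big)^{\Omega(\gamma)\langle\beta,\gamma\rangle},$$ where the product is taken over the finitely many active classes $\gamma\in\Gamma$ for which $Z(\gamma)\in i\mathbb{H}_r$.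
   Context: **BPS structures.** A BPS structure $(\Gamma,Z,\Omega)$ consists of a finite-rank free abelian group $\Gamma$ with a skew-symmetric form $\langle-,-\rangle:\Gamma\times\Gamma\to\mathbb{Z}$, a group homomorphism $Z:\Gamma\to\mathbb{C}$, and a map of sets $\Omega:\Gamma\to\mathbb{Q}$, such that $\Omega(-\gamma)=\Omega(\gamma)$ for all $\gamma$, and (support property) for a fixed norm $\|\cdot\|$ on $\Gamma\otimes_{\mathbb{Z}}\mathbb{R}$ there is $C>0$ such that $\Omega(\gamma)\neq0$ implies $|Z(\gamma)|>C\|\gamma\|$. A class $\gamma$ is active if $\Omega(\gamma)\ne0$. Set $\mathrm{DT}(\gamma)=\sum_{\gamma=m\alpha}\frac{1}{m^2}\Omega(\alpha)$, the sum over integers $m>0$ such that $\gamma=m\alpha$ for some $\alpha\in\Gamma$. The structure is finite if there are only finitely many active classes; uncoupled if $\langle\gamma_1,\gamma_2\rangle=0$ for any two active classes; integral if $\Omega(\gamma)\in\mathbb{Z}$ for all $\gamma$. **Twisted torus.** $\mathbb{T}=\{g:\Gamma\to\mathbb{C}^*: g(\gamma_1+\gamma_2)=(-1)^{\langle\gamma_1,\gamma_2\rangle}g(\gamma_1)g(\gamma_2)\}$. It is a torsor for $\mathbb{T}_+=\mathrm{Hom}_{\mathbb{Z}}(\Gamma,\mathbb{C}^* )\cong(\mathbb{C}^* )^n$ under $(f\cdot g)(\gamma)=f(\gamma)g(\gamma)$, which gives it the structure of an algebraic variety and complex manifold. The twisted characters are $x_\gamma:\mathbb{T}\to\mathbb{C}^*$,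 $x_\gamma(g)=g(\gamma)$, and the Poisson structure is $\{x_\alpha,x_\beta\}=\langle\alpha,\beta\rangle x_\alpha x_\beta$. **Rays and BPS automorphisms.** A ray is a subset $\ell=\mathbb{R}_{>0}\cdot z\subset\mathbb{C}^*$; it is active if it contains $Z(\gamma)$ for some active $\gamma$. A convex sector is a sector in $\mathbb{C}^*$ of angle less than $\pi$. For a convex sector $\Delta$ and $R>0$, $U_\Delta(R)\subset\mathbb{T}$ is the interior of $\{g\in\mathbb{T}: Z(\gamma)\in\Delta,\ \Omega(\gamma)\neq0\Rightarrow|g(\gamma)|<\exp(-R\|\gamma\|)\}$. For a ray $\ell\subset\Delta$ put $\mathrm{DT}(\ell)=-\sum_{Z(\gamma)\in\ell}\mathrm{DT}(\gamma)x_\gamma$; for $R$ sufficiently large this is a holomorphic function on $U_\Delta(R)$ and $\mathbb{S}(\ell):U_\Delta(R)\to\mathbb{T}$ denotes its time 1 Hamiltonian flow (for the flow $\frac{d}{ds}x_\beta=\{\mathrm{DT}(\ell),x_\beta\}$). $\mathbb{S}(\Delta)=\mathbb{S}(\ell_1)\circ\cdots\circ\mathbb{S}(\ell_k)$, where $\ell_1,\dots,\ell_k$ are the (finitely many) active rays in $\Delta$ in anti-clockwise order; this is defined on $U_\Delta(R)$ for $R$ sufficiently large. **The Riemann-Hilbert problem.** For a ray $r$ let $\mathbb{H}_r=\{z v: z\in r,\ \mathrm{Re}(v)>0\}\subset\mathbb{C}^*$. Given $\xi\in\mathbb{T}$ (the constant term), a solution is a collection of holomorphic functions $X_r:\mathbb{H}_r\to\mathbb{T}$,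 one for each non-active ray $r$, with $X_{r,\gamma}=x_\gamma\circ X_r$, such that: - (RH1) If two non-active rays $r_-,r_+$ are the boundary rays of a convex sector $\Delta$, taken in clockwise order, then $X_{r_+}(t)=\mathbb{S}(\Delta)(X_{r_-}(t))$ for all $t\in\mathbb{H}_{r_-}\cap\mathbb{H}_{r_+}$ with $0<|t|\ll1$. - (RH2) For each non-active ray $r$ and each $\gamma\in\Gamma$, $\exp(Z(\gamma)/t)\cdot X_{r,\gamma}(t)\to\xi(\gamma)$ as $t\to0$ in $\mathbb{H}_r$. - (RH3) For each $\gamma\in\Gamma$ and each non-active ray $r$ there is $k>0$ such that $|t|^{-k}<|X_{r,\gamma}(t)|<|t|^k$ for $t\in\mathbb{H}_r$ with $|t|\gg0$. **The function $\Lambda$.** $\Lambda(w)=\dfrac{e^w\,\Gamma(w)}{\sqrt{2\pi}\,w^{w-\frac12}}$, holomorphic on $\mathbb{C}^*\setminus\mathbb{R}_{<0}$, where $\Gamma(w)$ here is the gamma function and $w^{w-\frac12}=\exp((w-\frac12)\log w)$ with the principal branch of $\log$. *)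

(* Defs.v *)
From HB Require Import structures.
From mathcomp Require Import all_boot all_order all_algebra.
From mathcomp Require Import all_classical all_reals all_analysis.
From mathcomp Require Import complex.
From mathcomp Require summability.

Set Implicit Arguments.
Unset Strict Implicit.
Unset Printing Implicit Defensive.

Import Order.TTheory GRing.Theory Num.Theory.
Import numFieldNormedType.Exports.

Local Open Scope classical_set_scope.
Local Open Scope ring_scope.
Local Open Scope complex_scope.

(* The topology and the normed-module structure of the complex numbers [R[i]]
   over themselves are carried by the regular module [R[i]^o]; the casts to
   [R[i]^o] below have no other purpose. *)

Definition cabs (R : realType) (z : R[i]) : R := ComplexField.Normc.normc z.

Definition cexp (R : realType) (z : R[i]) : R[i] :=
  (expR (complex.Re z))%:C * (cos (complex.Im z) +i* sin (complex.Im z)).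

(* Principal argument, with values in ]-pi, pi] for z != 0. *)
Definition carg (R : realType) (z : R[i]) : R :=
  if 0 <= complex.Im z then acos (complex.Re z / cabs z)
  else - acos (complex.Re z / cabs z).

Definition clog (R : realType) (z : R[i]) : R[i] := ln (cabs z) +i* carg z.

(* Gamma function as Euler's limit k! k^w / (w (w+1) ... (w+k)), which converges
   for every w that is not a nonpositive integer. *)
Definition cGamma (R : realType) (w : R[i]) : R[i] :=
  lim ((fun k : nat =>
    k`!%:R * cexp (w * (ln (k%:R : R))%:C)
      / (\prod_(0 <= j < k.+1) (w + j%:R)) : R[i]^o) @ \oo).

Definition Lambda (R : realType) (w : R[i]) : R[i] :=
  cexp w * cGamma w /
    ((Num.sqrt (2 * pi))%:C * cexp ((w - 2^-1) * clog w)).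

(* A BPS structure on G. A Z-basis ([bps_basis], with inverse [bps_coord])
   presents G as a free abelian group of rank n and identifies the real vector
   space G (x) R, on which the norm lives, with 'rV[R]_n. *)
Record bps (R : realType) (G : zmodType) (n : nat) := BPS {
  bps_basis : 'I_n -> G;
  bps_coord : G -> 'rV[int]_n;
  bps_coordK : forall g : G, \sum_(i < n) bps_basis i *~ bps_coord g 0 i = g;
  bps_basisK : forall v : 'rV[int]_n,
    bps_coord (\sum_(i < n) bps_basis i *~ v 0 i) = v;
  bps_form : G -> G -> int;
  bps_formDl : forall a b c : G,
    bps_form (a + b) c = bps_form a c + bps_form b c;
  bps_form_skew : forall a b : G, bps_form a b = - bps_form b a;
  bps_Z : {additive G -> R[i]};
  bps_Omega : G -> rat;
  bps_OmegaN : forall g : G, bps_Omega (- g) = bps_Omega g;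
  bps_norm : 'rV[R]_n -> R;
  bps_norm_eq0 : forall v, bps_norm v = 0 -> v = 0;
  bps_normZ : forall (a : R) v, bps_norm (a *: v) = `|a| * bps_norm v;
  bps_normD : forall v w, bps_norm (v + w) <= bps_norm v + bps_norm w;
  bps_support : exists2 C : R, 0 < C &
    forall g : G, bps_Omega g != 0 ->
      C * bps_norm (map_mx intr (bps_coord g)) < cabs (bps_Z g)
}.

(* ||gamma|| *)
Definition lnorm (R : realType) (G : zmodType) (n : nat) (S : bps R G n)
    (g : G) : R :=
  bps_norm S (map_mx intr (bps_coord S g)).

Definition active (R : realType) (G : zmodType) (n : nat) (S : bps R G n)
    : set G :=
  [set g | bps_Omega S g != 0].

Definition bps_finite (R : realType) (G : zmodType) (n : nat) (S : bps R G n)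
    : Prop :=
  finite_set (active S).

Definition bps_uncoupled (R : realType) (G : zmodType) (n : nat)
    (S : bps R G n) : Prop :=
  forall a b : G, active S a -> active S b -> bps_form S a b = 0.

Definition bps_integral (R : realType) (G : zmodType) (n : nat)
    (S : bps R G n) : Prop :=
  forall g : G, bps_Omega S g \is a Num.int.

(* The sum has finite support: gamma != 0 has finitely many divisors m, and all
   terms vanish for gamma = 0 since Omega 0 = 0 by the support property. *)
Definition DT (R : realType) (G : zmodType) (n : nat) (S : bps R G n)
    (g : G) : rat :=
  \sum_(p \in [set p : nat * G | (0 < p.1)%N /\ g = p.2 *+ p.1])
    bps_Omega S p.2 / (p.1%:R ^+ 2).

Definition torus (R : realType) (G : zmodType) (n : nat) (S : bps R G n)
    : set (G -> R[i]) :=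
  [set x | (forall a, x a != 0) /\
           (forall a b, x (a + b) = (-1) ^ bps_form S a b * x a * x b)].

(* The action on the twisted torus of the element a |-> exp (sum_i s_i a_i) of
   T_+, the group of homomorphisms from G to the nonzero complex numbers. For x
   in the torus, s |-> torus_act S s x is a local biholomorphism from a
   neighbourhood of 0 in C^n to a neighbourhood of x, so it serves as a
   holomorphic chart of the torus centred at x. *)
Definition torus_act (R : realType) (G : zmodType) (n : nat) (S : bps R G n)
    (s : 'rV[R[i]]_n) (x : G -> R[i]) : G -> R[i] :=
  fun a => cexp (\sum_(i < n) s 0 i * (bps_coord S a 0 i)%:~R) * x a.

Definition torus_interior (R : realType) (G : zmodType) (n : nat)
    (S : bps R G n) (A : set (G -> R[i])) : set (G -> R[i]) :=
  [set x | torus S x /\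
           exists2 e : R, 0 < e & forall s : 'rV[R[i]]_n,
             (forall i, cabs (s 0 i) < e) -> A (torus_act S s x)].

Definition torus_holomorphic (R : realType) (G : zmodType) (n : nat)
    (S : bps R G n) (U : set (G -> R[i])) (f : (G -> R[i]) -> R[i]) : Prop :=
  forall x, U x ->
    differentiable (fun s : 'rV[R[i]]_n => f (torus_act S s x) : R[i]^o) 0.

(* The vector field x_i d/dx_i, where x_i is the twisted character of the i-th
   basis vector; it multiplies the character x_a by the i-th coordinate of a. *)
Definition log_deriv (R : realType) (G : zmodType) (n : nat) (S : bps R G n)
    (i : 'I_n) (f : (G -> R[i]) -> R[i]) (x : G -> R[i]) : R[i] :=
  'D_(delta_mx 0 i) (fun s : 'rV[R[i]]_n => f (torus_act S s x) : R[i]^o) 0.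

(* The biderivation such that {x_a, x_b} = <a, b> x_a x_b. *)
Definition poisson (R : realType) (G : zmodType) (n : nat) (S : bps R G n)
    (f h : (G -> R[i]) -> R[i]) (x : G -> R[i]) : R[i] :=
  \sum_(i < n) \sum_(j < n)
    (bps_form S (bps_basis S i) (bps_basis S j))%:~R
      * log_deriv S i f x * log_deriv S j h x.

Definition tchar (R : realType) (G : zmodType) (a : G) (x : G -> R[i]) : R[i] :=
  x a.

Definition ray_of (R : realType) (z : R[i]) : set R[i] :=
  [set w | exists2 c : R, 0 < c & w = c%:C * z].

Definition is_ray (R : realType) (l : set R[i]) : Prop :=
  exists2 z : R[i], z != 0 & l = ray_of z.

Definition cis (R : realType) (theta : R) : R[i] := cexp (0 +i* theta).

(* The sector of the points with an argument strictly between a and b; its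
   boundary rays, in clockwise order, are those of arguments b and a. It is a
   convex sector when 0 < b - a < pi. *)
Definition sector (R : realType) (a b : R) : set R[i] :=
  [set z | exists2 theta : R, a < theta < b & ray_of (cis theta) z].

Definition active_ray (R : realType) (G : zmodType) (n : nat) (S : bps R G n)
    (l : set R[i]) : Prop :=
  is_ray l /\ exists2 g : G, active S g & l (bps_Z S g).

Definition nonactive_ray (R : realType) (G : zmodType) (n : nat)
    (S : bps R G n) (l : set R[i]) : Prop :=
  is_ray l /\ ~ active_ray S l.

(* U_Delta(r) *)
Definition Udom (R : realType) (G : zmodType) (n : nat) (S : bps R G n)
    (Delta : set R[i]) (r : R) : set (G -> R[i]) :=
  torus_interior S [set x | torus S x /\
    forall g : G, Delta (bps_Z S g) -> bps_Omega S g != 0 ->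
      cabs (x g) < expR (- r * lnorm S g)].

Definition DT_term (R : realType) (G : zmodType) (n : nat) (S : bps R G n)
    (l : set R[i]) (x : G -> R[i]) (g : G) : R[i]^o :=
  if bps_Z S g \in l then ratr (DT S g) * x g else 0.

Definition DT_summable (R : realType) (G : zmodType) (n : nat) (S : bps R G n)
    (l : set R[i]) (x : G -> R[i]) : Prop :=
  cvg (summability.partial_sum (DT_term S l x) @ summability.totally).

(* DT(l), an unordered (equivalently, absolutely convergent) sum over G. *)
Definition DT_ray (R : realType) (G : zmodType) (n : nat) (S : bps R G n)
    (l : set R[i]) (x : G -> R[i]) : R[i] :=
  - summability.sum (DT_term S l x).

(* c is an integral curve on the time interval [0, 1], inside U, of the
   Hamiltonian vector field d/ds x_b = {f, x_b}. The time derivative of a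
   complex-valued function of a real variable is taken componentwise. *)
Definition ham_curve (R : realType) (G : zmodType) (n : nat) (S : bps R G n)
    (f : (G -> R[i]) -> R[i]) (U : set (G -> R[i])) (c : R -> G -> R[i])
    : Prop :=
  forall s : R, 0 <= s <= 1 ->
    U (c s) /\
    forall b : G,
      is_derive s 1 (fun u => complex.Re (c u b))
        (complex.Re (poisson S f (tchar b) (c s))) /\
      is_derive s 1 (fun u => complex.Im (c u b))
        (complex.Im (poisson S f (tchar b) (c s))).

(* The graph of SS(l), for a ray l in Delta: y is the value at x of the time 1
   Hamiltonian flow of DT(l). The flow takes place in some U_Delta(r) on which
   DT(l) is a holomorphic function; y does not depend on r, since the integral
   curve starting at x is unique. *)
Definition bps_ray_aut (R : realType) (G : zmodType) (n : nat) (S : bps R G n)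
    (Delta l : set R[i]) (x y : G -> R[i]) : Prop :=
  exists2 r : R, 0 < r &
    [/\ (forall z, Udom S Delta r z -> DT_summable S l z),
        torus_holomorphic S (Udom S Delta r) (DT_ray S l) &
        exists c : R -> G -> R[i],
          [/\ ham_curve S (DT_ray S l) (Udom S Delta r) c, c 0 = x & c 1 = y]].

(* The graph of the composite SS(l_1) o ... o SS(l_k): the last one acts first. *)
Fixpoint bps_comp_aut (R : realType) (G : zmodType) (n : nat) (S : bps R G n)
    (Delta : set R[i]) (ls : seq (set R[i])) (x y : G -> R[i]) : Prop :=
  match ls with
  | [::] => y = x
  | l :: ls' => exists2 z, bps_comp_aut S Delta ls' x z
                         & bps_ray_aut S Delta l z y
  end.

(* The graph of SS(Delta), Delta = sector a b. Increasing arguments give the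
   anti-clockwise order of the active rays. *)
Definition bps_sector_aut (R : realType) (G : zmodType) (n : nat)
    (S : bps R G n) (a b : R) (x y : G -> R[i]) : Prop :=
  exists thetas : seq R,
    [/\ sorted (fun u v : R => u < v) thetas,
        (forall theta, theta \in thetas -> a < theta < b),
        (forall l : set R[i], active_ray S l /\ l `<=` sector a b <->
           exists2 theta, theta \in thetas & l = ray_of (cis theta)) &
        bps_comp_aut S (sector a b) [seq ray_of (cis theta) | theta <- thetas]
          x y].

Definition half_plane (R : realType) (r : set R[i]) : set R[i] :=
  [set w | exists z v : R[i], [/\ r z, 0 < complex.Re v & w = z * v]].

(* A family (X_r), with X r t a = X_{r,a}(t). Only its values for non-active
   rays r and t in H_r are meaningful. *)
Definition ray_family (R : realType) (G : zmodType) : Type :=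
  set R[i] -> R[i] -> G -> R[i].

(* Holomorphy of a map into the torus is that of its composites with all the
   twisted characters. *)
Definition RH_holomorphic (R : realType) (G : zmodType) (n : nat)
    (S : bps R G n) (X : ray_family R G) : Prop :=
  forall r, nonactive_ray S r -> forall t, half_plane r t ->
    torus S (X r t) /\
    forall g : G, derivable (fun u : R[i]^o => X r u g : R[i]^o) t 1.

Definition RH1 (R : realType) (G : zmodType) (n : nat) (S : bps R G n)
    (X : ray_family R G) : Prop :=
  forall a b : R, 0 < b - a < pi ->
    let rplus := ray_of (cis a) in
    let rminus := ray_of (cis b) in
    nonactive_ray S rminus -> nonactive_ray S rplus ->
    \forall rho \near +oo, \forall t \near (0 : R[i]^o),
      half_plane rminus t -> half_plane rplus t ->
      Udom S (sector a b) rho (X rminus t) /\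
      bps_sector_aut S a b (X rminus t) (X rplus t).

Definition RH2 (R : realType) (G : zmodType) (n : nat) (S : bps R G n)
    (xi : G -> R[i]) (X : ray_family R G) : Prop :=
  forall r, nonactive_ray S r -> forall g : G,
    (cexp (bps_Z S g / t) * X r t g : R[i]^o)
      @[t --> within (half_plane r) (nbhs (0 : R[i]^o))] --> (xi g : R[i]^o).

Definition RH3 (R : realType) (G : zmodType) (n : nat) (S : bps R G n)
    (X : ray_family R G) : Prop :=
  forall (g : G) r, nonactive_ray S r ->
    exists2 k : R, 0 < k &
      exists M : R, forall t, half_plane r t -> M < cabs t ->
        cabs t `^ (- k) < cabs (X r t g) < cabs t `^ k.

Definition RH_solution (R : realType) (G : zmodType) (n : nat) (S : bps R G n)
    (xi : G -> R[i]) (X : ray_family R G) : Prop :=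
  [/\ RH_holomorphic S X, RH1 S X, RH2 S xi X & RH3 S X].

(* Main.v *)
Require Import Defs.
From HB Require Import structures.
From mathcomp Require Import all_boot all_order all_algebra.
From mathcomp Require Import all_classical all_reals all_analysis.
From mathcomp Require Import complex ring lra zify.

(** In an uncoupled structure the characters of the active classes Poisson
    commute with one another, so they are constant along the Hamiltonian flow
    of each DT(l), and the flow is explicit: since the logarithmic derivative
    of the dilogarithm is - log (1 - x), its time 1 map multiplies x_h by the
    product of (1 - x_g)^(Omega(g) <g, h>) over the active g with Z(g) on l.
    Composing the rays of a sector gives the product over the sector
    ([ray_autP], [sector_autP]). The jumps of a solution therefore depend on
    its active coordinates only, and these do not jump.

    Existence. If Z(g) lies in i H_r and t in H_r, then w = Z(g) / (2 pi i t)
    stays in a closed subsector of the plane slit along the negative half-line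
    ([argument_sector]). Stirling's formula [Lambda_sector] there gives the
    limit at t = 0, and the behaviour of Lambda at w = 0 [Lambda_near0] gives
    polynomial growth at infinity. When r crosses a sector, the factors of the
    classes g with Z(g) in the sector enter and those of the classes - g leave;
    the quotient is the required jump by the reflection formula
    [Lambda_reflection], Lambda(w) Lambda(- w) (1 - exp (2 pi i w)) = 1 for
    Im w > 0 ([solY_jump]).

    Uniqueness. For an active class the quotient of two solutions does not
    jump near 0, hence nowhere by the identity theorem on cones
    ([cone_identity]), so it glues to a holomorphic function on C^* with limit
    1 at 0, polynomial growth at infinity and no zeros. Such a function is a
    polynomial without roots, that is, the constant 1 ([sectorial_trivial]).
    Once the active coordinates of the two solutions agree, so do their jumps,
    and the same argument applies to every class ([RH_unique]).

    The complex analysis is done for functions g that factor through exp, in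
    the variable w with t = exp w: a circle around 0 becomes a vertical segment
    of length 2 pi, Cauchy's theorem on a rectangle ([Goursat_rect]) makes the
    Laurent coefficients of g independent of the segment, and these
    coefficients determine g ([Laurent_uniqueness]). The identity theorem and
    Liouville's theorem ([Liouville_exp]) follow. Exceptional vertical lines on
    which g is only continuous are allowed; this is what the reflection formula
    needs. Its proof compares the sine product, read off from Euler's limit for
    the gamma function at w and - w, with 2 sinh (u / 2): the quotient of the
    two is known to be holomorphic off the imaginary axis, where
    [Lambda_logLam] expresses it by Gudermann's series, and to be continuous
    across, so that Liouville's theorem applies. *)

Set Implicit Arguments.
Unset Strict Implicit.
Unset Printing Implicit Defensive.
Import Order.TTheory GRing.Theory Num.Theory.
Import numFieldNormedType.Exports.
Local Open Scope classical_set_scope.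
Local Open Scope ring_scope.
Local Open Scope complex_scope.

(** * Complex modulus, exponential and derivative *)

Arguments cabs : simpl never.
Arguments cexp : simpl never.
Arguments clog : simpl never.

Section ComplexModulus.
Variable R : realType.
Implicit Types (z w u : R[i]) (x y : R).

Lemma complexP z w : complex.Re z = complex.Re w -> complex.Im z = complex.Im w -> z = w.
Proof. by case: z w => [a b] [c d] /= -> ->. Qed.

Lemma cReD z w : complex.Re (z + w) = complex.Re z + complex.Re w.
Proof. by case: z w => [a b] [c d]. Qed.
Lemma cImD z w : complex.Im (z + w) = complex.Im z + complex.Im w.
Proof. by case: z w => [a b] [c d]. Qed.
Lemma cReN z : complex.Re (- z) = - complex.Re z.
Proof. by case: z. Qed.
Lemma cImN z : complex.Im (- z) = - complex.Im z.
Proof. by case: z. Qed.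
Lemma cReM z w : complex.Re (z * w) =
  complex.Re z * complex.Re w - complex.Im z * complex.Im w.
Proof. by case: z w => [a b] [c d]. Qed.
Lemma cImM z w : complex.Im (z * w) =
  complex.Re z * complex.Im w + complex.Im z * complex.Re w.
Proof. by case: z w => [a b] [c d]. Qed.
Lemma cReC x : complex.Re x%:C = x. Proof. by []. Qed.
Lemma cImC x : complex.Im x%:C = 0. Proof. by []. Qed.
Lemma cReMn z n : complex.Re (z *+ n) = complex.Re z *+ n.
Proof. by elim: n => // n ih; rewrite !mulrS cReD ih. Qed.
Lemma cImMn z n : complex.Im (z *+ n) = complex.Im z *+ n.
Proof. by elim: n => // n ih; rewrite !mulrS cImD ih. Qed.
Lemma cRe1 : complex.Re (1 : R[i]) = 1. Proof. by []. Qed.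
Lemma cIm1 : complex.Im (1 : R[i]) = 0. Proof. by []. Qed.
Lemma cRei : complex.Re ('i%C : R[i]) = 0. Proof. by []. Qed.
Lemma cImi : complex.Im ('i%C : R[i]) = 1. Proof. by []. Qed.
Lemma Re_mk x y : complex.Re (x +i* y) = x. Proof. by []. Qed.
Lemma Im_mk x y : complex.Im (x +i* y) = y. Proof. by []. Qed.
(** An identity between complex expressions reduces to polynomial identities
    between real and imaginary parts by rewriting with this list. *)
Definition cReImE := (Re_mk, Im_mk, cReD, cImD, cReN, cImN, cReM, cImM, cReC, cImC, cReMn, cImMn, cRe1, cIm1, cRei, cImi).

Lemma cabsE z : cabs z = Num.sqrt (complex.Re z ^+ 2 + complex.Im z ^+ 2).
Proof. by case: z. Qed.
Lemma cabs_ge0 z : 0 <= cabs z.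
Proof. by rewrite cabsE sqrtr_ge0. Qed.
Lemma cabs0 : cabs (0 : R[i]) = 0. Proof. exact: ComplexField.Normc.normc0. Qed.
Lemma cabs1 : cabs (1 : R[i]) = 1. Proof. exact: ComplexField.Normc.normc1. Qed.
Lemma cabs_eq0 z : (cabs z == 0) = (z == 0).
Proof.
apply/eqP/eqP => [|->]; last exact: cabs0.
exact: ComplexField.Normc.eq0_normc.
Qed.
Lemma cabs_gt0 z : (0 < cabs z) = (z != 0).
Proof. by rewrite lt_def cabs_ge0 andbT cabs_eq0. Qed.
Lemma cabsM z w : cabs (z * w) = cabs z * cabs w.
Proof. exact: ComplexField.Normc.normcM. Qed.
Lemma cabsV z : cabs z^-1 = (cabs z)^-1.
Proof. exact: ComplexField.Normc.normcV. Qed.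
Lemma cabs_div z w : cabs (z / w) = cabs z / cabs w.
Proof. by rewrite cabsM cabsV. Qed.
Lemma cabsN z : cabs (- z) = cabs z.
Proof. by rewrite !cabsE !cReImE !sqrrN. Qed.
Lemma cabsD z w : cabs (z + w) <= cabs z + cabs w.
Proof. by have := le_normcD z w. Qed.
Lemma cabsBC z w : cabs (z - w) = cabs (w - z).
Proof. by rewrite -cabsN opprB. Qed.
Lemma cabsB z w : cabs (z - w) <= cabs z + cabs w.
Proof. by rewrite -(cabsN w) cabsD. Qed.
Lemma cabs_subr z w : cabs z - cabs w <= cabs (z - w).
Proof. by rewrite lerBlDr -{1}(subrK w z) cabsD. Qed.
Lemma cabs_real x : cabs x%:C = `|x|.
Proof. by rewrite cabsE !cReImE expr0n /= addr0 sqrtr_sqr. Qed.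
Lemma cabsX z n : cabs (z ^+ n) = cabs z ^+ n.
Proof. by elim: n => [|n ih]; rewrite ?expr0 ?cabs1// !exprS cabsM ih. Qed.
Lemma cabs_nat n : cabs (n%:R : R[i]) = n%:R.
Proof. by rewrite -(rmorph_nat (real_complex R)) cabs_real ger0_norm. Qed.
Lemma cabs_i : cabs ('i%C : R[i]) = 1.
Proof. by rewrite cabsE /= expr0n /= add0r expr1n sqrtr1. Qed.
Lemma cabs_Re z : `|complex.Re z| <= cabs z.
Proof. by rewrite cabsE -sqrtr_sqr ler_wsqrtr// lerDl sqr_ge0. Qed.
Lemma cabs_Im z : `|complex.Im z| <= cabs z.
Proof. by rewrite cabsE -sqrtr_sqr ler_wsqrtr// lerDr sqr_ge0. Qed.
Lemma cabs_le_ReIm z : cabs z <= `|complex.Re z| + `|complex.Im z|.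
Proof.
rewrite {1}(complexE z) (le_trans (cabsD _ _))// cabsM cabs_i mul1r !cabs_real.
by [].
Qed.
Lemma cabs_normC z : `|z| = (cabs z)%:C.
Proof. by rewrite normc_def cabsE. Qed.
Lemma cabs_sum (I : Type) (s : seq I) (P : pred I) (F : I -> R[i]) :
  cabs (\sum_(i <- s | P i) F i) <= \sum_(i <- s | P i) cabs (F i).
Proof.
elim/big_rec2 : _ => [|i x y _ h]; first by rewrite cabs0.
by rewrite (le_trans (cabsD _ _))// lerD2l.
Qed.
Lemma cabs_prod (I : Type) (s : seq I) (P : pred I) (F : I -> R[i]) :
  cabs (\prod_(i <- s | P i) F i) = \prod_(i <- s | P i) cabs (F i).
Proof. by elim/big_rec2 : _ => [|i x y _ <-]; rewrite ?cabs1 ?cabsM. Qed.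

(** Turns an estimate of a modulus into an estimate of a real part. *)
Lemma rotate_to_real z : exists2 u, cabs u = 1 & u * z = (cabs z)%:C.
Proof.
have [->|z0] := eqVneq z 0; first by exists 1; rewrite ?cabs1// mulr0 cabs0.
exists ((cabs z)%:C / z); last by rewrite mulfVK.
by rewrite cabs_div cabs_real ger0_norm ?cabs_ge0// divff// cabs_eq0.
Qed.

Lemma Re_cexp z : complex.Re (cexp z) = expR (complex.Re z) * cos (complex.Im z).
Proof. by rewrite /cexp !cReImE /= mul0r subr0. Qed.
Lemma Im_cexp z : complex.Im (cexp z) = expR (complex.Re z) * sin (complex.Im z).
Proof. by rewrite /cexp !cReImE /= mul0r addr0. Qed.
Lemma cexpD z w : cexp (z + w) = cexp z * cexp w.
Proof.
by apply: complexP; rewrite ?(Re_cexp, Im_cexp, cReImE) expRD ?cosD ?sinD; ring.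
Qed.
Lemma cexp0 : cexp (0 : R[i]) = 1.
Proof. by apply: complexP; rewrite ?Re_cexp ?Im_cexp /= expR0 ?cos0 ?sin0 mul1r. Qed.
Lemma cabs_cexp z : cabs (cexp z) = expR (complex.Re z).
Proof.
rewrite cabsE Re_cexp Im_cexp !exprMn -mulrDr cos2Dsin2 mulr1 sqrtr_sqr.
by rewrite ger0_norm// expR_ge0.
Qed.
Lemma cexp_neq0 z : cexp z != 0.
Proof. by rewrite -cabs_gt0 cabs_cexp expR_gt0. Qed.
Lemma cexpN z : cexp (- z) = (cexp z)^-1.
Proof.
apply: (mulIf (cexp_neq0 z)); rewrite mulVf ?cexp_neq0//.
by rewrite -cexpD addNr cexp0.
Qed.
Lemma cexpB z w : cexp (z - w) = cexp z / cexp w.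
Proof. by rewrite cexpD cexpN. Qed.
Lemma cexp_natl n z : cexp (n%:R * z) = cexp z ^+ n.
Proof.
by elim: n => [|n ih]; rewrite ?mul0r ?cexp0// exprS -ih -cexpD -natr1; congr cexp; ring.
Qed.
Lemma cexp_sum (I : Type) (s : seq I) (P : pred I) (F : I -> R[i]) :
  cexp (\sum_(i <- s | P i) F i) = \prod_(i <- s | P i) cexp (F i).
Proof. by elim/big_rec2 : _ => [|i x y _ <-]; rewrite ?cexp0 ?cexpD. Qed.
Lemma cexp_real x : cexp x%:C = (expR x)%:C.
Proof. by apply: complexP; rewrite ?Re_cexp ?Im_cexp !cReImE ?cos0 ?sin0 ?mulr1 ?mulr0. Qed.
Lemma cexp_2pii z : cexp (z + 2 * pi%:C * 'i%C) = cexp z.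
Proof.
rewrite cexpD; suff -> : cexp (2 * pi%:C * 'i%C : R[i]) = 1 by rewrite mulr1.
have -> : 2 * pi%:C * 'i%C = (0 +i* (pi *+ 2)) :> R[i].
  apply: complexP; rewrite !cReImE; ring.
by apply: complexP; rewrite ?Re_cexp ?Im_cexp /= expR0 mul1r ?cos2pi ?sin2pi.
Qed.
Lemma cexp_pii : cexp (pi%:C * 'i%C : R[i]) = -1.
Proof.
have -> : pi%:C * 'i%C = (0 +i* pi) :> R[i].
  by apply: complexP; rewrite !cReImE; ring.
by apply: complexP; rewrite ?Re_cexp ?Im_cexp /= expR0 mul1r ?cospi ?sinpi ?oppr0.
Qed.

(** The logarithms of a number are 2 pi i apart. *)
Lemma cexp_inj_strip z w : cexp z = cexp w ->
  `|complex.Im z - complex.Im w| < pi *+ 2 -> z = w.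
Proof.
move=> e h.
have eR : complex.Re z = complex.Re w.
  by apply: (@expR_inj R); rewrite -!cabs_cexp e.
apply: complexP => //.
have e1 : cexp (z - w) = 1 by rewrite cexpB e divff// cexp_neq0.
have cI : cos (complex.Im z - complex.Im w) = 1.
  have := congr1 (@complex.Re R) e1; rewrite Re_cexp !cReImE eR subrr expR0 mul1r.
  by [].
set d := complex.Im z - complex.Im w in h cI.
apply/eqP; rewrite -subr_eq0 -/d -normr_eq0; apply/eqP.
have half0 : sin (`|d| / 2) = 0.
  have : cos `|d| = 1 by rewrite cos_norm.
  rewrite [X in cos X](_ : _ = (`|d| / 2) *+ 2); last by rewrite mulr2n; field.
  rewrite cos_mulr2n cos2sin2 => h1.
  by apply/eqP; rewrite -sqrf_eq0; apply/eqP; lra.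
have [//|d0] := eqVneq `|d| 0.
suff : 0 < sin (`|d| / 2) by rewrite half0 ltxx.
apply: sin_gt0_pi; have dp : 0 < `|d| by rewrite lt_def d0 normr_ge0.
rewrite mulr2n in h; apply/andP; split; lra.
Qed.

End ComplexModulus.

Section ComplexDifferentiation.
Variable R : realType.
Implicit Types (z w u l : R[i]) (f g : R[i] -> R[i]) (e d : R).

(** Continuity and differentiability are spelled out with the real modulus
    [cabs], so that estimates take place in the ordered field; [cdiff_derive]
    relates them to the derivative of the normed module. *)
Definition ccont f z := forall e, 0 < e -> exists2 d, 0 < d &
  forall u, cabs u < d -> cabs (f (z + u) - f z) < e.

Definition cdiff f z l := forall e, 0 < e -> exists2 d, 0 < d &
  forall u, cabs u < d -> cabs (f (z + u) - f z - l * u) <= e * cabs u.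

Lemma cdiff_eq f z l l' : cdiff f z l -> l = l' -> cdiff f z l'.
Proof. by move=> + <-. Qed.

Lemma cdiff_near f g z l : (exists2 d, 0 < d & forall u, cabs u < d -> f (z + u) = g (z + u)) ->
  cdiff f z l -> cdiff g z l.
Proof.
move=> [d d0 fg] df e e0; have [d' d'0 h] := df e e0.
exists (Num.min d d'); first by rewrite lt_min d0.
move=> u; rewrite lt_min => /andP[u1 u2]; rewrite -fg// -[in g z](addr0 z) -fg ?cabs0//.
by rewrite addr0; exact: h.
Qed.

Lemma ccont_near f g z : (exists2 d, 0 < d & forall u, cabs u < d -> f (z + u) = g (z + u)) ->
  ccont f z -> ccont g z.
Proof.
move=> [d d0 fg] df e e0; have [d' d'0 h] := df e e0.
exists (Num.min d d'); first by rewrite lt_min d0.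
move=> u; rewrite lt_min => /andP[u1 u2]; rewrite -fg// -[in g z](addr0 z) -fg ?cabs0//.
by rewrite addr0; exact: h.
Qed.

Lemma cdiff_ext f g z l : (forall u, f u = g u) -> cdiff f z l -> cdiff g z l.
Proof. by move=> h; apply: cdiff_near; exists 1. Qed.

Lemma ccont_ext f g z : (forall u, f u = g u) -> ccont f z -> ccont g z.
Proof. by move=> h; apply: ccont_near; exists 1. Qed.

(** A differentiable function is Lipschitz at the point; this gives both its
    continuity and the error terms of products and composites. *)
Lemma cdiff_lip f z l : cdiff f z l -> exists2 d, 0 < d & forall u, cabs u < d ->
  cabs (f (z + u) - f z) <= (cabs l + 1) * cabs u.
Proof.
move=> df; have [d d0 h] := df 1 ltr01; exists d => // u /h.
rewrite mul1r => h1; rewrite -(subrK (l * u) (f _ - _)).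
by rewrite (le_trans (cabsD _ _))// mulrDl mul1r cabsM addrC lerD2l.
Qed.

Lemma cdiff_ccont f z l : cdiff f z l -> ccont f z.
Proof.
move=> /cdiff_lip[d d0 h] e e0.
have l1 : 0 < cabs l + 1 by rewrite ltr_wpDl ?cabs_ge0.
exists (Num.min d (e / (cabs l + 1))); first by rewrite lt_min d0 divr_gt0.
move=> u; rewrite lt_min => /andP[/h h1].
by rewrite ltr_pdivlMr// mulrC; exact: le_lt_trans.
Qed.

Lemma cdiff_cst c z : cdiff (fun=> c) z 0.
Proof.
by move=> e e0; exists 1 => // u _; rewrite subrr mul0r subr0 cabs0 mulr_ge0// ?cabs_ge0// ltW.
Qed.

Lemma cdiff_id z : cdiff id z 1.
Proof.
move=> e e0; exists 1 => // u _; rewrite mul1r addrAC addrK subrr cabs0.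
by rewrite mulr_ge0 ?cabs_ge0// ltW.
Qed.

Lemma cdiffD f g z l m : cdiff f z l -> cdiff g z m ->
  cdiff (fun w => f w + g w) z (l + m).
Proof.
move=> df dg e e0; have e2 : 0 < e / 2 by rewrite divr_gt0.
have [d d0 h] := df _ e2; have [d' d'0 h'] := dg _ e2.
exists (Num.min d d'); first by rewrite lt_min d0.
move=> u; rewrite lt_min => /andP[/h h1 /h' h2].
rewrite (_ : _ - _ = (f (z + u) - f z - l * u) + (g (z + u) - g z - m * u)); last by ring.
by rewrite (le_trans (cabsD _ _))// (splitr e) mulrDl lerD.
Qed.

Lemma ccont_cdiffM f g z l m : cdiff f z l -> cdiff g z m ->
  cdiff (fun w => f w * g w) z (l * g z + f z * m).
Proof.
move=> df dg e e0.
have := cdiff_lip df; move=> [d1 d10 h1].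
have [d2 d20 h2] := cdiff_ccont dg (e:=e / 3 / (cabs l + 1))
   (ltac:(by rewrite !divr_gt0// ltr_wpDl ?cabs_ge0)).
have [d3 d30 h3] := df (e / 3 / (cabs (g z) + 1))
   (ltac:(by rewrite !divr_gt0// ltr_wpDl ?cabs_ge0)).
have [d4 d40 h4] := dg (e / 3 / (cabs (f z) + 1))
   (ltac:(by rewrite !divr_gt0// ltr_wpDl ?cabs_ge0)).
exists (Num.min (Num.min d1 d2) (Num.min d3 d4)); first by rewrite !lt_min d10 d20 d30.
move=> u; rewrite !lt_min => /andP[/andP[u1 u2] /andP[u3 u4]].
rewrite (_ : _ - _ = (f (z + u) - f z) * (g (z + u) - g z)
  + ((f (z + u) - f z - l * u) * g z + f z * (g (z + u) - g z - m * u))); last by ring.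
have P (x : R[i]) : 0 < cabs x + 1 by rewrite ltr_wpDl ?cabs_ge0.
have k1 : cabs ((f (z + u) - f z) * (g (z + u) - g z)) <= e / 3 * cabs u.
  rewrite cabsM (le_trans (ler_pM (cabs_ge0 _) (cabs_ge0 _) (h1 _ u1) (ltW (h2 _ u2))))//.
  by rewrite mulrAC mulrCA mulfV ?mulr1// gt_eqF// P.
have k2 : cabs ((f (z + u) - f z - l * u) * g z) <= e / 3 * cabs u.
  rewrite cabsM (le_trans (ler_wpM2r (cabs_ge0 _) (h3 _ u3)))//.
  rewrite mulrAC ler_wpM2r ?cabs_ge0// mulrAC ler_pdivrMr ?P//.
  by rewrite ler_wpM2l ?lerDl// divr_ge0// ltW.
have k3 : cabs (f z * (g (z + u) - g z - m * u)) <= e / 3 * cabs u.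
  rewrite cabsM mulrC (le_trans (ler_wpM2r (cabs_ge0 _) (h4 _ u4)))//.
  rewrite mulrAC ler_wpM2r ?cabs_ge0// mulrAC ler_pdivrMr ?P//.
  by rewrite ler_wpM2l ?lerDl// divr_ge0// ltW.
rewrite (le_trans (cabsD _ _))//; have := cabsD ((f (z + u) - f z - l * u) * g z)
  (f z * (g (z + u) - g z - m * u)).
lra.
Qed.

Lemma cdiffM f g z l m : cdiff f z l -> cdiff g z m ->
  cdiff (fun w => f w * g w) z (l * g z + f z * m).
Proof. exact: ccont_cdiffM. Qed.

Lemma cdiffZ c f z l : cdiff f z l -> cdiff (fun w => c * f w) z (c * l).
Proof. by move=> df; apply: cdiff_eq (cdiffM (cdiff_cst c z) df) _; ring. Qed.

Lemma cdiffN f z l : cdiff f z l -> cdiff (fun w => - f w) z (- l).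
Proof.
move=> df; apply: (cdiff_eq (l:=-1 * l)); last by rewrite mulN1r.
by apply: (cdiff_ext (f:=fun w => -1 * f w)) => [u|]; [rewrite mulN1r|exact: cdiffZ].
Qed.

Lemma cdiffB f g z l m : cdiff f z l -> cdiff g z m ->
  cdiff (fun w => f w - g w) z (l - m).
Proof. by move=> df /cdiffN; exact: cdiffD. Qed.

Lemma cdiffX f z l n : cdiff f z l -> cdiff (fun w => f w ^+ n) z (n%:R * f z ^+ n.-1 * l).
Proof.
move=> df; elim: n => [|n ih]; first by rewrite !mul0r; exact: cdiff_cst.
apply: (cdiff_ext (f:=fun w => f w * f w ^+ n)) => [u|]; first by rewrite exprS.
apply: cdiff_eq (cdiffM df ih) _ => /=.
case: n {ih} => [|n] /=; first by rewrite expr0; ring.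
by rewrite -[in RHS]natr1 exprS; ring.
Qed.

Lemma cdiff_sum (I : Type) (s : seq I) (F : I -> R[i] -> R[i]) (L : I -> R[i]) z :
  (forall i, cdiff (F i) z (L i)) ->
  cdiff (fun w => \sum_(i <- s) F i w) z (\sum_(i <- s) L i).
Proof.
move=> h; elim: s => [|i s ih].
  rewrite big_nil; apply: cdiff_ext (cdiff_cst 0 z) => u; by rewrite big_nil.
rewrite big_cons; apply: cdiff_ext (cdiffD (h i) ih) => u; by rewrite big_cons.
Qed.

Lemma cdiff_comp f g z l m : cdiff g z m -> cdiff f (g z) l ->
  cdiff (fun w => f (g w)) z (l * m).
Proof.
move=> dg df e e0.
have P (x : R[i]) : 0 < cabs x + 1 by rewrite ltr_wpDl ?cabs_ge0.
have [d1 d10 h1] := cdiff_lip dg.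
have [d2 d20 h2] := df (e / 2 / (cabs m + 1)) (ltac:(by rewrite !divr_gt0)).
have [d3 d30 h3] := dg (e / 2 / (cabs l + 1)) (ltac:(by rewrite !divr_gt0)).
have [d4 d40 h4] := cdiff_ccont dg d20.
exists (Num.min (Num.min d1 d4) d3); first by rewrite !lt_min d10 d40 d30.
move=> u; rewrite !lt_min => /andP[/andP[u1 u4] u3].
have := h2 _ (h4 _ u4); rewrite addrCA subrr addr0 => k1.
rewrite (_ : _ - _ = (f (g (z + u)) - f (g z) - l * (g (z + u) - g z))
   + l * (g (z + u) - g z - m * u)); last by ring.
rewrite (le_trans (cabsD _ _))// (splitr e) mulrDl lerD//.
  rewrite (le_trans k1)// (le_trans (ler_wpM2l _ (h1 _ u1)))//.
    by rewrite !divr_ge0// ?ltW// P.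
  by rewrite mulrA mulfVK// gt_eqF// P.
rewrite cabsM (le_trans (ler_wpM2l (cabs_ge0 _) (h3 _ u3)))// mulrA.
rewrite ler_wpM2r ?cabs_ge0// mulrCA -[leRHS]mulr1 ler_wpM2l ?divr_ge0 ?(ltW e0)//.
by rewrite ler_pdivrMr ?P// mul1r lerDl.
Qed.

Lemma ccont_comp f g z : ccont g z -> ccont f (g z) -> ccont (fun w => f (g w)) z.
Proof.
move=> cg cf e e0; have [d1 d10 h1] := cf _ e0; have [d2 d20 h2] := cg _ d10.
by exists d2 => // u /h2 /h1; rewrite addrCA subrr addr0.
Qed.

Lemma cdiffV z : z != 0 -> cdiff (fun w => w^-1) z (- z ^- 2).
Proof.
move=> z0 e e0; have a0 : 0 < cabs z by rewrite cabs_gt0.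
exists (Num.min (cabs z / 2) (e * cabs z ^+ 3 / 2)).
  by rewrite lt_min !divr_gt0// mulr_gt0// exprn_gt0.
move=> u; rewrite lt_min => /andP[u1 u2].
have zu : cabs z / 2 <= cabs (z + u).
  by have := cabs_subr z (- u); rewrite opprK cabsN; lra.
have zu0 : z + u != 0 by rewrite -cabs_gt0; apply: lt_le_trans zu; rewrite divr_gt0.
have -> : (z + u)^-1 - z^-1 - - z ^- 2 * u = u ^+ 2 / (z ^+ 2 * (z + u)).
  by field; rewrite z0 zu0.
rewrite cabs_div cabsM !cabsX ler_pdivrMr; last by rewrite mulr_gt0 ?exprn_gt0// cabs_gt0.
rewrite expr2 [leRHS]mulrAC; apply: ler_wpM2r; first exact: cabs_ge0.
apply: (le_trans (ltW u2)).
rewrite (_ : e * _ / 2 = e * cabs z ^+ 2 * (cabs z / 2)); last by ring.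
by rewrite [leRHS]mulrA ler_wpM2l// mulr_ge0 ?sqr_ge0 ?(ltW e0).
Qed.

Lemma cdiff_inv f z l : f z != 0 -> cdiff f z l ->
  cdiff (fun w => (f w)^-1) z (- l / f z ^+ 2).
Proof.
by move=> f0 df; apply: cdiff_eq (cdiff_comp df (cdiffV f0)) _; ring.
Qed.

Lemma cdiff_div f g z l m : g z != 0 -> cdiff f z l -> cdiff g z m ->
  cdiff (fun w => f w / g w) z ((l * g z - f z * m) / g z ^+ 2).
Proof.
by move=> g0 df dg; apply: cdiff_eq (cdiffM df (cdiff_inv g0 dg)) _; field.
Qed.

End ComplexDifferentiation.

(** * Holomorphy of the exponential and the mean value inequality *)

Section DerivativeBridge.

(** The limit of difference quotients and the linear approximation with error
    at most e |h| define the same derivative; the second form has no division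
    and survives products and composites. *)
Lemma is_derive_lin (K : numFieldType) (f : K^o -> K^o) (x l : K^o) :
  is_derive x 1 f l <->
  (forall e : K, 0 < e -> exists2 d : K, 0 < d & forall h : K, `|h| < d ->
    `|f (x + h) - f x - l * h| <= e * `|h|).
Proof.
split=> [df e e0|H].
- have : h^-1 *: (f (h + x) - f x) @[h --> 0^'] --> l.
    have <- : 'D_1 f x = l by exact: derive_val.
    have := @ex_derive _ _ _ _ _ _ _ df; rewrite /derivable /derive.
    by under eq_fun do rewrite scaler1.
  move/cvgrPdist_le => /(_ _ e0); rewrite near_withinE => -[d /= d0 h].
  exists d => // u ud; have [->|u0] := eqVneq u 0.
    by rewrite addr0 subrr mulr0 subrr normr0 mulr0.
  have := h u; rewrite /ball_ /= sub0r normrN => /(_ ud u0) hu.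
  have -> : f (x + u) - f x - l * u = - (l - u^-1 *: (f (u + x) - f x)) * u.
    by rewrite /GRing.scale /= (addrC u x); field.
  by rewrite normrM normrN ler_wpM2r.
- suff c : h^-1 *: (f (h *: 1 + x) - f x) @[h --> 0^'] --> l.
    by split; [apply/cvg_ex; exists l|exact/cvg_lim].
  apply/cvgrPdist_le => e e0; rewrite near_withinE; have [d d0 h] := H _ e0.
  exists d => //= u; rewrite /ball_ /= sub0r normrN => ud u0.
  have k : l - u^-1 *: (f (u *: 1 + x) - f x) = - (f (x + u) - f x - l * u) / u.
    by rewrite /GRing.scale /= mulr1 (addrC u x); field.
  by rewrite k normrM normrN normfV ler_pdivrMr ?normr_gt0// h.
Qed.


Lemma cdiff_derive (R : realType) (f : R[i] -> R[i]) (z l : R[i]) :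
  is_derive (z : R[i]^o) 1 (f : R[i]^o -> R[i]^o) l <-> cdiff f z l.
Proof.
rewrite is_derive_lin; split => H e e0.
- have [|d d0 h] := H e%:C; first by rewrite ltcE /= eqxx.
  have := d0; rewrite ltcE => /andP[/eqP dI dR].
  have dE : d = (complex.Re d)%:C by apply: complexP; rewrite ?cReImE.
  exists (complex.Re d) => // u ud; have := h u; rewrite !cabs_normC {1}dE ltcR => /(_ ud).
  by rewrite -rmorphM lecR.
- have := e0; rewrite ltcE => /andP[/eqP eI eR].
  have eE : e = (complex.Re e)%:C by apply: complexP; rewrite ?cReImE.
  have [d d0 h] := H _ eR; exists d%:C; first by rewrite ltcR.
  by move=> u; rewrite !cabs_normC ltcR eE -rmorphM lecR; exact: h.
Qed.

Lemma cdiff_derivable (R : realType) (f : R[i] -> R[i]) (z : R[i]) :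
  derivable (f : R[i]^o -> R[i]^o) (z : R[i]^o) 1 <-> exists l, cdiff f z l.
Proof.
split=> [df|[l /cdiff_derive df]]; last exact: (@ex_derive _ _ _ _ _ _ _ df).
by exists ('D_1 (f : R[i]^o -> R[i]^o) (z : R[i]^o)); apply/cdiff_derive/derivableP.
Qed.

Lemma rderive_lin (R : realType) (f : R -> R) (x l : R) :
  is_derive x 1 f l <->
  (forall e : R, 0 < e -> exists2 d : R, 0 < d & forall h : R, `|h| < d ->
    `|f (x + h) - f x - l * h| <= e * `|h|).
Proof. exact: is_derive_lin. Qed.

End DerivativeBridge.

Section ExpAndMeanValue.
Variable R : realType.
Implicit Types (z w u l : R[i]) (f g : R[i] -> R[i]) (e d : R).

Lemma small_part (F : R -> R) (l e : R) : is_derive (0 : R) 1 F l -> 0 < e ->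
  exists2 d, 0 < d & forall h, `|h| < d -> `|F h - F 0 - l * h| <= e * `|h|.
Proof.
by move=> /rderive_lin H /H[d d0 h]; exists d => // u /h; rewrite add0r.
Qed.

(** exp u - 1 - u splits into the first order errors of exp, cos and sin and
    the product (e^x - 1) (e^{iy} - 1), which is quadratic in u. *)
Lemma cdiff_cexp0 : cdiff (@cexp R) 0 1.
Proof.
move=> e e0.
have e4 : 0 < Num.min (e / 8) 1 by rewrite lt_min divr_gt0/=.
have [d1 d10 h1] := small_part (is_derive_expR 0) e4.
have [d2 d20 h2] := small_part (is_derive_cos 0) e4.
have [d3 d30 h3] := small_part (is_derive_sin 0) e4.
set ee := Num.min (e / 8) 1 in h1 h2 h3.
have ee1 : ee <= 1 by rewrite ge_min lexx orbT.
have ee8 : ee <= e / 8 by rewrite ge_min lexx.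
exists (Num.min (Num.min d1 (e / 16)) (Num.min d2 d3)).
  by rewrite !lt_min d10 d20 d30 divr_gt0.
case=> x y; rewrite !lt_min => /andP[/andP[u1 ue] /andP[u2 u3]].
set u := x +i* y in u1 u2 u3 ue *.
have xu : `|x| <= cabs u := cabs_Re u.
have yu : `|y| <= cabs u := cabs_Im u.
have := h1 x (le_lt_trans xu u1); rewrite expR0 mul1r => k1.
have := h2 y (le_lt_trans yu u2); rewrite cos0 sin0 oppr0 mul0r subr0 => k2.
have := h3 y (le_lt_trans yu u3); rewrite cos0 sin0 subr0 mul1r => k3.
rewrite add0r cexp0 mul1r.
set A := (expR x)%:C; set B := cos y +i* sin y.
have -> : cexp u - 1 - u = (expR x - 1 - x)%:C + (B - 1 - y%:C * 'i%C) + (A - 1) * (B - 1).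
  by rewrite /cexp /A /B /u; apply: complexP; rewrite !cReImE; ring.
have kA : cabs (A - 1) <= 2 * cabs u.
  rewrite -[1](rmorph1 (real_complex R)) -rmorphB cabs_real.
  rewrite (_ : expR x - 1 = (expR x - 1 - x) + x); last by ring.
  rewrite (le_trans (ler_normD _ _))//.
  have : ee * `|x| <= 1 * `|x| by rewrite ler_wpM2r.
  lra.
have kB1 : cabs (B - 1 - y%:C * 'i%C) <= 2 * ee * cabs u.
  rewrite (le_trans (cabs_le_ReIm _))// /B !cReImE.
  rewrite (_ : cos y - 1 - _ = cos y - 1); last by ring.
  rewrite (_ : sin y - 0 - _ = sin y - y); last by ring.
  have : ee * `|y| <= ee * cabs u by rewrite ler_wpM2l// ltW.
  lra.
have kB : cabs (B - 1) <= 3 * cabs u.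
  rewrite (_ : B - 1 = (B - 1 - y%:C * 'i%C) + y%:C * 'i%C); last by ring.
  rewrite (le_trans (cabsD _ _))// cabsM cabs_i cabs_real mulr1.
  have : ee * cabs u <= 1 * cabs u by rewrite ler_wpM2r ?cabs_ge0.
  lra.
have kx : cabs (expR x - 1 - x)%:C <= ee * cabs u.
  by rewrite cabs_real (le_trans k1)// ler_wpM2l// ltW.
have kAB : cabs ((A - 1) * (B - 1)) <= 6 * (e / 16) * cabs u.
  rewrite cabsM (le_trans (ler_pM (cabs_ge0 _) (cabs_ge0 _) kA kB))//.
  have : cabs u * cabs u <= e / 16 * cabs u by rewrite ler_wpM2r ?cabs_ge0// ltW.
  lra.
rewrite (le_trans (cabsD _ _))//.
have : ee * cabs u <= e / 8 * cabs u by rewrite ler_wpM2r ?cabs_ge0.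
have := cabsD (expR x - 1 - x)%:C (B - 1 - y%:C * 'i%C).
have : 0 <= e * cabs u by rewrite mulr_ge0 ?cabs_ge0// ltW.
lra.
Qed.

Lemma cdiff_cexp z : cdiff (@cexp R) z (cexp z).
Proof.
have h : cdiff (fun w => cexp z * cexp (w - z)) z (cexp z * (1 * 1)).
  apply: cdiffZ; apply: cdiff_comp; last by rewrite subrr; exact: cdiff_cexp0.
  by apply: cdiff_eq (cdiffB (cdiff_id z) (cdiff_cst z z)) _; rewrite subr0.
apply: (cdiff_eq (l:=cexp z * (1 * 1))); last by rewrite !mulr1.
by apply: cdiff_ext h => u; rewrite -cexpD addrC subrK.
Qed.

Lemma cdiff_cexp_comp f z l : cdiff f z l -> cdiff (fun w => cexp (f w)) z (cexp (f z) * l).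
Proof. by move=> df; apply: cdiff_comp df (cdiff_cexp _). Qed.

(** Restricting to a line and taking the real part of a multiple reduces
    statements about complex derivatives to real calculus. *)
Lemma is_derive_Re_line f z u l c (t : R) : cdiff f (z + t%:C * u) l ->
  is_derive t 1 (fun s : R => complex.Re (c * f (z + s%:C * u))) (complex.Re (c * (l * u))).
Proof.
move=> df; apply/rderive_lin => e e0.
have P (x : R[i]) : 0 < cabs x + 1 by rewrite ltr_wpDl ?cabs_ge0.
have [|d d0 h] := df (e / (cabs c + 1) / (cabs u + 1)); first by rewrite !divr_gt0.
exists (d / (cabs u + 1)); first by rewrite divr_gt0.
move=> s; rewrite ltr_pdivlMr// => sd.
have su : cabs (s%:C * u) < d.
  by rewrite cabsM cabs_real (le_lt_trans _ sd)// ler_wpM2l// lerDl.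
have := h _ su.
rewrite (_ : z + (t + s)%:C * u = z + t%:C * u + s%:C * u); last by rewrite rmorphD; ring.
set D := f _ - f _ - _ => hD.
rewrite (_ : _ - _ = complex.Re (c * D)); last by rewrite /D !cReImE; ring.
rewrite (le_trans (cabs_Re _))// cabsM.
rewrite (le_trans (ler_wpM2l (cabs_ge0 _) hD))// cabsM cabs_real.
have a1 : cabs c / (cabs c + 1) <= 1 by rewrite ler_pdivrMr// mul1r lerDl.
have a2 : cabs u / (cabs u + 1) <= 1 by rewrite ler_pdivrMr// mul1r lerDl.
rewrite [leLHS](_ : _ = (cabs c / (cabs c + 1)) * (cabs u / (cabs u + 1)) * (e * `|s|)); last first.
  by field; rewrite !gt_eqF.
rewrite -[leRHS]mul1r ler_wpM2r ?mulr_ge0// ?(ltW e0)//.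
rewrite -[leRHS]mul1r ler_pM// divr_ge0 ?cabs_ge0// ltW//.
Qed.

(** Rotate the increment to the positive real axis and apply the real mean
    value theorem to the real part. *)
Lemma mean_value_cdiff f f' z u (K : R) :
  (forall t : R, 0 <= t <= 1 -> cdiff f (z + t%:C * u) (f' (z + t%:C * u))) ->
  (forall t : R, 0 <= t <= 1 -> cabs (f' (z + t%:C * u)) <= K) ->
  cabs (f (z + u) - f z) <= K * cabs u.
Proof.
move=> df fK; have [c c1 hc] := rotate_to_real (f (z + u) - f z).
pose F (s : R) := complex.Re (c * f (z + s%:C * u)).
pose dF (s : R) := complex.Re (c * (f' (z + s%:C * u) * u)).
have dFF (t : R) : 0 <= t <= 1 -> is_derive t 1 F (dF t).
  by move=> /df; exact: is_derive_Re_line.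
have [||s] := @MVT_segment R F dF 0 1 ler01.
- move=> t; rewrite in_itv/= => /andP[t0 t1]; apply: dFF; by rewrite !ltW.
- apply: continuous_in_subspaceT => t; rewrite inE/= in_itv/= => /dFF dt.
  by apply: differentiable_continuous; apply/derivable1_diffP; exact: ex_derive.
rewrite in_itv/= => s01; rewrite /F /dF mul1r mul0r addr0 subr0 mulr1.
have -> : complex.Re (c * f (z + u)) - complex.Re (c * f z) = cabs (f (z + u) - f z).
  by rewrite -[RHS](cReC) -hc mulrBr !cReImE.
move=> ->; rewrite (le_trans (ler_norm _))// (le_trans (cabs_Re _))//.
by rewrite !cabsM c1 mul1r ler_wpM2r ?cabs_ge0// fK.
Qed.

End ExpAndMeanValue.

(** * Integrals of complex functions along segments *)

Section ComplexIntegral.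
Variable R : realType.
Implicit Types (z w u l c : R[i]) (h k : R -> R[i]) (a b e d x : R).
Local Notation mu := (@lebesgue_measure R).

(** Continuity at the points of the interval with respect to all nearby reals,
    because the integrands are restrictions of functions on the plane. *)
Definition rcont_on a b h := forall x, a <= x <= b -> forall e, 0 < e ->
  exists2 d, 0 < d & forall y, `|y - x| < d -> cabs (h y - h x) < e.

Definition cint a b h : R[i] :=
  (\int[mu]_(x in `[a, b]) complex.Re (h x)) +i*
  (\int[mu]_(x in `[a, b]) complex.Im (h x)).

Arguments cint : simpl never.

Lemma rcont_Re_continuous a b h c : rcont_on a b h ->
  {within `[a, b], continuous (fun x => complex.Re (c * h x))}.
Proof.
move=> ch; apply: continuous_in_subspaceT => x; rewrite inE/= in_itv/= => xab.
apply/cvgrPdist_lt => e e0.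
have c1 : 0 < cabs c + 1 by rewrite ltr_wpDl ?cabs_ge0.
have [|d d0 H] := ch x xab (e / (cabs c + 1)); first by rewrite divr_gt0.
exists d => //= y; rewrite /ball_/= distrC => /H hy.
rewrite distrC -raddfN -raddfD -mulrBr (le_lt_trans (cabs_Re _))// cabsM.
rewrite -(mulfVK (lt0r_neq0 c1) e) mulrC.
apply: (@le_lt_trans _ _ (cabs (h y - h x) * (cabs c + 1))).
  by rewrite ler_wpM2l ?cabs_ge0// lerDl.
by rewrite ltr_pM2r.
Qed.

Lemma rcont_integrable a b h c : rcont_on a b h ->
  mu.-integrable `[a, b] (EFin \o (fun x => complex.Re (c * h x))).
Proof.
move=> ch; apply: continuous_compact_integrable; first exact: segment_compact.
exact: rcont_Re_continuous.
Qed.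

Lemma rcont_integrable_Re a b h : rcont_on a b h ->
  mu.-integrable `[a, b] (EFin \o (fun x => complex.Re (h x))).
Proof.
move=> /(@rcont_integrable _ _ _ 1).
by congr (integrable _ _ _); apply/funext => x /=; rewrite mul1r.
Qed.

Lemma rcont_integrable_Im a b h : rcont_on a b h ->
  mu.-integrable `[a, b] (EFin \o (fun x => complex.Im (h x))).
Proof.
move=> /(@rcont_integrable _ _ _ (- 'i%C)).
by congr (integrable _ _ _); apply/funext => x /=; rewrite !cReImE; congr (_%:E); ring.
Qed.

Lemma cint_ext a b h k : (forall x, a <= x <= b -> h x = k x) -> cint a b h = cint a b k.
Proof.
move=> hk; rewrite /cint; congr (_ +i* _); apply: eq_Rintegral => x;
  by rewrite inE/= in_itv/= => /hk ->.
Qed.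

Lemma cintD a b h k : rcont_on a b h -> rcont_on a b k ->
  cint a b (fun x => h x + k x) = cint a b h + cint a b k.
Proof.
move=> ch ck; apply: complexP; rewrite /cint !cReImE.
- under eq_Rintegral do rewrite cReD.
  by rewrite RintegralD//; exact: rcont_integrable_Re.
- under eq_Rintegral do rewrite cImD.
  by rewrite RintegralD//; exact: rcont_integrable_Im.
Qed.

Lemma cintZ a b c h : rcont_on a b h ->
  cint a b (fun x => (c : R[i]) * h x) = c * cint a b h.
Proof.
move=> ch.
have iR := rcont_integrable_Re ch; have iI := rcont_integrable_Im ch.
have iZ (f : R -> R) r : mu.-integrable `[a, b] (EFin \o f) ->
    mu.-integrable `[a, b] (EFin \o (fun x => r * f x)).
  move=> fi; rewrite (_ : _ \o _ = (fun x => r%:E * (f x)%:E)%E); last by apply/funext.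
  exact: integrableZl.
apply: complexP; rewrite /cint !cReImE.
- transitivity (\int[mu]_(x in `[a, b])
      (complex.Re c * complex.Re (h x) - complex.Im c * complex.Im (h x))).
    by apply: eq_Rintegral => x _; rewrite cReM.
  by rewrite RintegralB//; [rewrite !RintegralZl//|exact: iZ|exact: iZ].
- transitivity (\int[mu]_(x in `[a, b])
      (complex.Re c * complex.Im (h x) + complex.Im c * complex.Re (h x))).
    by apply: eq_Rintegral => x _; rewrite cImM.
  by rewrite RintegralD//; [rewrite !RintegralZl//|exact: iZ|exact: iZ].
Qed.

Lemma rcont_onD a b h k : rcont_on a b h -> rcont_on a b k -> rcont_on a b (fun x => h x + k x).
Proof.
move=> ch ck x xab e e0; have e2 : 0 < e / 2 by rewrite divr_gt0.
have [d d0 H] := ch x xab _ e2; have [d' d'0 H'] := ck x xab _ e2.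
exists (Num.min d d'); first by rewrite lt_min d0.
move=> y; rewrite lt_min => /andP[/H h1 /H' h2].
rewrite opprD addrACA (le_lt_trans (cabsD _ _))//; lra.
Qed.

Lemma rcont_onZ a b c h : rcont_on a b h -> rcont_on a b (fun x => c * h x).
Proof.
move=> ch x xab e e0.
have c1 : 0 < cabs c + 1 by rewrite ltr_wpDl ?cabs_ge0.
have [|d d0 H] := ch x xab (e / (cabs c + 1)); first by rewrite divr_gt0.
exists d => // y /H hy; rewrite -mulrBr cabsM.
rewrite -(mulfVK (lt0r_neq0 c1) e) mulrC.
apply: (@le_lt_trans _ _ (cabs (h y - h x) * (cabs c + 1))).
  by rewrite ler_wpM2l ?cabs_ge0// lerDl.
by rewrite ltr_pM2r.
Qed.

Lemma cintB a b h k : rcont_on a b h -> rcont_on a b k ->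
  cint a b (fun x => h x - k x) = cint a b h - cint a b k.
Proof.
move=> ch ck; rewrite -mulN1r -cintZ// -cintD//; last exact: rcont_onZ.
by apply: cint_ext => x _; rewrite mulN1r.
Qed.

Lemma rcont_on_ext a b h k : (forall x, h x = k x) -> rcont_on a b h -> rcont_on a b k.
Proof. by move=> /funext ->. Qed.

Lemma rcont_on_cst a b c : rcont_on a b (fun=> c).
Proof. by move=> x _ e e0; exists 1 => // y _; rewrite subrr cabs0. Qed.

Lemma rcont_on_sum a b (I : Type) (s : seq I) (F : I -> R -> R[i]) :
  (forall i, rcont_on a b (F i)) -> rcont_on a b (fun x => \sum_(i <- s) F i x).
Proof.
move=> H; elim: s => [|i s ih].
  by apply: rcont_on_ext (@rcont_on_cst a b 0) => x; rewrite big_nil.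
by apply: rcont_on_ext (rcont_onD (H i) ih) => x; rewrite big_cons.
Qed.

Lemma cint_cst a b c : a <= b -> cint a b (fun=> c) = (b - a)%:C * c.
Proof.
move=> ab; have -> : cint a b (fun=> c) = complex.Re c * fine (mu `[a, b]) +i* (complex.Im c * fine (mu `[a, b])).
  by rewrite /cint !Rintegral_cst.
have -> : fine (mu `[a, b]) = b - a.
  rewrite lebesgue_measure_itv/= lte_fin; case: ifPn => [_|]//.
  by rewrite -leNgt => ba; apply/esym/eqP; rewrite subr_eq0 eq_le ba.
by apply: complexP; rewrite !cReImE; ring.
Qed.

Lemma cint_sum a b (I : Type) (s : seq I) (F : I -> R -> R[i]) : a <= b ->
  (forall i, rcont_on a b (F i)) ->
  cint a b (fun x => \sum_(i <- s) F i x) = \sum_(i <- s) cint a b (F i).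
Proof.
move=> ab H; elim: s => [|i s ih].
  rewrite big_nil -[RHS](mulr0 (b - a)%:C) -(cint_cst 0 ab).
  by apply: cint_ext => x _; rewrite big_nil.
rewrite big_cons -ih -cintD//; last exact: rcont_on_sum.
by apply: cint_ext => x _; rewrite big_cons.
Qed.

(** Rotating the integral to the positive real axis bounds it by the integral
    of a real part. *)
Lemma cint_bound a b h K : a <= b -> rcont_on a b h ->
  (forall x, a <= x <= b -> cabs (h x) <= K) -> cabs (cint a b h) <= K * (b - a).
Proof.
move=> ab ch hK; have [c c1 E] := rotate_to_real (cint a b h).
rewrite -[leLHS]cReC -E -cintZ//.
have -> : K * (b - a) = \int[mu]_(x in `[a, b]) K.
  have /(congr1 (@complex.Re R)) := cint_cst K%:C ab.
  by rewrite /cint !cReImE => ->; ring.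
rewrite [leLHS]cReImE; apply: le_Rintegral => //.
- exact: rcont_integrable.
- by have := rcont_integrable_Re (@rcont_on_cst a b K%:C).
- move=> x; rewrite /= in_itv/= => /hK h1.
  by rewrite (le_trans (ler_norm _))// (le_trans (cabs_Re _))// cabsM c1 mul1r.
Qed.

Lemma cint_split a m b h : a <= m -> m <= b -> rcont_on a b h ->
  cint a b h = cint a m h + cint m b h.
Proof.
move=> am mb ch.
have key (f : R -> R) : mu.-integrable `[a, b] (EFin \o f) ->
    \int[mu]_(x in `[a, b]) f x = \int[mu]_(x in `[a, m]) f x + \int[mu]_(x in `[m, b]) f x.
  move=> fi; apply/eqP; rewrite addrC -subr_eq; apply/eqP.
  rewrite (@Rintegral_itvB _ f (BLeft a) (BRight b) m)//.
  apply: Rintegral_itv_obnd_cbnd; apply: integrableS fi => //.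
  by move=> x /=; rewrite !in_itv/= => /andP[x1 ->]; rewrite (le_trans am)// ltW.
rewrite /cint [in LHS]key; last exact: rcont_integrable_Re.
rewrite [X in _ +i* X]key; last exact: rcont_integrable_Im.
by [].
Qed.

(** The integral along the segment from z + a u to z + b u, without the factor
    u. *)
Definition lint (f : R[i] -> R[i]) z u a b := cint a b (fun t => f (z + t%:C * u)).

Lemma ccont_line f z u a b : (forall t, a <= t <= b -> ccont f (z + t%:C * u)) ->
  rcont_on a b (fun t => f (z + t%:C * u)).
Proof.
move=> cf x xab e e0; have [d d0 H] := cf x xab e e0.
have u1 : 0 < cabs u + 1 by rewrite ltr_wpDl ?cabs_ge0.
exists (d / (cabs u + 1)); first by rewrite divr_gt0.
move=> y; rewrite ltr_pdivlMr// => yd.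
have := H ((y - x)%:C * u); rewrite cabsM cabs_real => /(_ (le_lt_trans _ yd)).
rewrite (_ : z + x%:C * u + _ = z + y%:C * u); last by rewrite rmorphB; ring.
by apply; rewrite ler_wpM2l// lerDl.
Qed.

(** Componentwise fundamental theorem of calculus on the segment. *)
Lemma lint_FTC f F z u a b : a <= b ->
  (forall t, a <= t <= b -> cdiff F (z + t%:C * u) (f (z + t%:C * u))) ->
  (forall t, a <= t <= b -> ccont f (z + t%:C * u)) ->
  u * lint f z u a b = F (z + b%:C * u) - F (z + a%:C * u).
Proof.
rewrite le_eqVlt => /predU1P[<- _ _|ab dF cf].
  rewrite subrr /lint; suff -> : cint a a (fun t => f (z + t%:C * u)) = 0 by rewrite mulr0.
  by rewrite /cint !set_itv1 !Rintegral_set1.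
have crf := ccont_line cf.
rewrite /lint -cintZ//.
have key (c : R[i]) : \int[mu]_(x in `[a, b]) complex.Re (c * (u * f (z + x%:C * u))) =
    complex.Re (c * (F (z + b%:C * u) - F (z + a%:C * u))).
  pose G (s : R) := complex.Re (c * F (z + s%:C * u)).
  pose g (s : R) := complex.Re (c * (u * f (z + s%:C * u))).
  have dG (t : R) : a <= t <= b -> is_derive t 1 G (g t).
    by move=> /dF /is_derive_Re_line -/(_ c); rewrite /g [u * _]mulrC.
  have cG (t : R) : a <= t <= b -> {for t, continuous G}.
    move=> /dG dt; apply: differentiable_continuous; apply/derivable1_diffP.
    exact: ex_derive.
  have : (\int[mu]_(x in `[a, b]) (g x)%:E = (G b)%:E - (G a)%:E)%E.
    apply: continuous_FTC2 => //.
    - exact: rcont_Re_continuous (rcont_onZ u crf).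
    - split.
      + move=> t; rewrite in_itv/= => /andP[t1 t2].
        have dt : is_derive t 1 G (g t) by apply: dG; rewrite !ltW.
        exact: ex_derive.
      + by apply: cvg_at_right_filter; apply: cG; rewrite lexx ltW.
      + by apply: cvg_at_left_filter; apply: cG; rewrite lexx ltW.
    - move=> t; rewrite in_itv/= => /andP[t1 t2].
      have dt : is_derive t 1 G (g t) by apply: dG; rewrite !ltW.
      by rewrite derive1E; exact: derive_val.
  rewrite /Rintegral => -> /=; rewrite /G mulrBr !cReImE; ring.
apply: complexP.
- have := key 1; rewrite mul1r => <-; rewrite /cint cReImE.
  by apply: eq_Rintegral => x _; rewrite mul1r.
- have := key (- 'i%C); set W := F _ - F _ => k.
  rewrite -[RHS](_ : complex.Re (- 'i%C * W) = _); last by rewrite !cReImE; ring.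
  rewrite -k /cint cReImE; apply: eq_Rintegral => x _.
  by set V := u * _; rewrite !cReImE; ring.
Qed.

End ComplexIntegral.

(** * Cauchy's theorem for rectangles *)

Section Goursat.
Variable R : realType.
Implicit Types (f g F : R[i] -> R[i]) (z w u l : R[i]) (a b c d e : R).

Definition in_rect a b c d w :=
  a <= complex.Re w <= b /\ c <= complex.Im w <= d.

(** The integral along the positively oriented boundary. *)
Definition rect_int f a b c d : R[i] :=
  lint f (0 +i* c) 1 a b - lint f (0 +i* d) 1 a b
  + 'i%C * (lint f b%:C 'i%C c d - lint f a%:C 'i%C c d).

Lemma in_rect_h a b c d t y : a <= t <= b -> c <= y <= d ->
  in_rect a b c d ((0 +i* y) + t%:C * 1).
Proof. by move=> tab ycd; rewrite /in_rect !cReImE ; split; [move: tab|move: ycd]; lra. Qed.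

Lemma in_rect_v a b c d t x : a <= x <= b -> c <= t <= d ->
  in_rect a b c d (x%:C + t%:C * 'i%C).
Proof. by move=> xab tcd; rewrite /in_rect !cReImE; split; [move: xab|move: tcd]; lra. Qed.

Lemma rect_rcont_h f a b c d y : (forall w, in_rect a b c d w -> ccont f w) ->
  c <= y <= d -> rcont_on a b (fun t => f ((0 +i* y) + t%:C * 1)).
Proof. by move=> cf ycd; apply: ccont_line => t tab; apply/cf/in_rect_h. Qed.

Lemma rect_rcont_v f a b c d x : (forall w, in_rect a b c d w -> ccont f w) ->
  a <= x <= b -> rcont_on c d (fun t => f (x%:C + t%:C * 'i%C)).
Proof. by move=> cf xab; apply: ccont_line => t tcd; apply/cf/in_rect_v. Qed.

Lemma rect_intD f g a b c d : a <= b -> c <= d ->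
  (forall w, in_rect a b c d w -> ccont f w) ->
  (forall w, in_rect a b c d w -> ccont g w) ->
  rect_int (fun w => f w + g w) a b c d = rect_int f a b c d + rect_int g a b c d.
Proof.
move=> ab cd cf cg; rewrite /rect_int /lint.
rewrite !cintD; try by apply: rect_rcont_h; eauto; rewrite ?lexx ?ab ?cd.
ring.
all: try by apply: rect_rcont_v; eauto; rewrite ?lexx ?ab ?cd.
Qed.

(** The four contributions telescope over the corners. *)
Lemma rect_int_primitive f F a b c d : a <= b -> c <= d ->
  (forall w, in_rect a b c d w -> ccont f w) ->
  (forall w, in_rect a b c d w -> cdiff F w (f w)) ->
  rect_int f a b c d = 0.
Proof.
move=> ab cd cf dF.
have H y : c <= y <= d -> lint f (0 +i* y) 1 a b = F (b +i* y) - F (a +i* y).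
  move=> ycd; rewrite -[LHS]mul1r (@lint_FTC _ f F)//.
  - by congr (F _ - F _); apply: complexP; rewrite !cReImE; ring.
  - by move=> t tab; apply/dF/in_rect_h.
  - by move=> t tab; apply/cf/in_rect_h.
have V x : a <= x <= b -> 'i%C * lint f x%:C 'i%C c d = F (x +i* d) - F (x +i* c).
  move=> xab; rewrite (@lint_FTC _ f F)//.
  - by congr (F _ - F _); apply: complexP; rewrite !cReImE; ring.
  - by move=> t tab; apply/dF/in_rect_v.
  - by move=> t tab; apply/cf/in_rect_v.
rewrite /rect_int mulrBr !H ?V ?lexx ?ab ?cd//; ring.
Qed.

Lemma rect_int_bound f a b c d K : a <= b -> c <= d -> 
  (forall w, in_rect a b c d w -> ccont f w) ->
  (forall w, in_rect a b c d w -> cabs (f w) <= K) ->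
  cabs (rect_int f a b c d) <= K * (2 * ((b - a) + (d - c))).
Proof.
move=> ab cd cf fK; rewrite /rect_int.
have H y : c <= y <= d -> cabs (lint f (0 +i* y) 1 a b) <= K * (b - a).
  move=> ycd; apply: cint_bound => //; first exact: rect_rcont_h cf ycd.
  by move=> t tab; apply/fK/in_rect_h.
have V x : a <= x <= b -> cabs (lint f x%:C 'i%C c d) <= K * (d - c).
  move=> ycd; apply: cint_bound => //; first exact: rect_rcont_v cf ycd.
  by move=> t tab; apply/fK/in_rect_v.
have := cabsD (lint f (0 +i* c) 1 a b - lint f (0 +i* d) 1 a b)
  ('i%C * (lint f b%:C 'i%C c d - lint f a%:C 'i%C c d)).
rewrite cabsM cabs_i mul1r.
have := cabsB (lint f (0 +i* c) 1 a b) (lint f (0 +i* d) 1 a b).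
have := cabsB (lint f b%:C 'i%C c d) (lint f a%:C 'i%C c d).
have := H c; have := H d; have := V a; have := V b; rewrite !lexx ab cd => /(_ isT) ? /(_ isT) ? /(_ isT) ? /(_ isT) ?.
lra.
Qed.

Lemma rect_int_hsplit f a m b c d : a <= m -> m <= b -> c <= d ->
  (forall w, in_rect a b c d w -> ccont f w) ->
  rect_int f a b c d = rect_int f a m c d + rect_int f m b c d.
Proof.
move=> am mb cd cf; rewrite /rect_int.
have H y : c <= y <= d -> lint f (0 +i* y) 1 a b = lint f (0 +i* y) 1 a m + lint f (0 +i* y) 1 m b.
  by move=> ycd; apply: cint_split => //; exact: rect_rcont_h cf ycd.
by rewrite !H ?lexx ?cd//; ring.
Qed.

Lemma rect_int_vsplit f a b c m d : a <= b -> c <= m -> m <= d ->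
  (forall w, in_rect a b c d w -> ccont f w) ->
  rect_int f a b c d = rect_int f a b c m + rect_int f a b m d.
Proof.
move=> ab cm md cf; rewrite /rect_int.
have V x : a <= x <= b -> lint f x%:C 'i%C c d = lint f x%:C 'i%C c m + lint f x%:C 'i%C m d.
  by move=> ycd; apply: cint_split => //; exact: rect_rcont_v cf ycd.
by rewrite !V ?lexx ?ab//; ring.
Qed.

Lemma in_rect_sub a b c d a' b' c' d' w : a <= a' -> b' <= b -> c <= c' -> d' <= d ->
  in_rect a' b' c' d' w -> in_rect a b c d w.
Proof. by rewrite /in_rect; move=> *; lra. Qed.

(** The boundary integrals of the four quarters add up to that of the
    rectangle. *)
Lemma rect_quarter f a b c d K : a <= b -> c <= d ->
  (forall w, in_rect a b c d w -> ccont f w) ->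
  K < cabs (rect_int f a b c d) ->
  exists a' c', [/\ a <= a', a' + (b - a) / 2 <= b, c <= c', c' + (d - c) / 2 <= d &
    K / 4 < cabs (rect_int f a' (a' + (b - a) / 2) c' (c' + (d - c) / 2))].
Proof.
move=> ab cd cf Kf.
pose m := (a + b) / 2; pose n := (c + d) / 2.
have am : a <= m by rewrite /m; lra.
have mb : m <= b by rewrite /m; lra.
have cn : c <= n by rewrite /n; lra.
have nd : n <= d by rewrite /n; lra.
have E : rect_int f a b c d = (rect_int f a m c n + rect_int f a m n d)
    + (rect_int f m b c n + rect_int f m b n d).
  rewrite (rect_int_hsplit am mb cd cf) (rect_int_vsplit am cn nd) ?(rect_int_vsplit mb cn nd)//.
  - by move=> w hw; apply: cf; apply: in_rect_sub hw.
  - by move=> w hw; apply: cf; apply: in_rect_sub hw.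
apply: contrapT => /forallNP H.
have Q a' c' : a <= a' -> a' + (b - a) / 2 <= b -> c <= c' -> c' + (d - c) / 2 <= d ->
   cabs (rect_int f a' (a' + (b - a) / 2) c' (c' + (d - c) / 2)) <= K / 4.
  move=> h1 h2 h3 h4; rewrite leNgt; apply/negP => h5.
  by apply: (H a'); exists c'; split.
have em : m = a + (b - a) / 2 by rewrite /m; field.
have eb : b = m + (b - a) / 2 by rewrite /m; field.
have en : n = c + (d - c) / 2 by rewrite /n; field.
have ed : d = n + (d - c) / 2 by rewrite /n; field.
have q1 : cabs (rect_int f a m c n) <= K / 4 by rewrite em en; apply: Q; rewrite -?em -?eb -?en -?ed ?lexx.
have q2 : cabs (rect_int f a m n d) <= K / 4 by rewrite em [X in rect_int _ _ _ _ X]ed; apply: Q; rewrite -?em -?eb -?en -?ed ?lexx.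
have q3 : cabs (rect_int f m b c n) <= K / 4 by rewrite [X in rect_int _ _ X]eb en; apply: Q; rewrite -?em -?eb -?en -?ed ?lexx.
have q4 : cabs (rect_int f m b n d) <= K / 4.
  by rewrite [X in rect_int _ _ X]eb [X in rect_int _ _ _ _ X]ed; apply: Q; rewrite -?em -?eb -?en -?ed ?lexx.
move: Kf; rewrite ltNge => /negP; apply; rewrite E.
rewrite (le_trans (cabsD _ _))//.
have := cabsD (rect_int f a m c n) (rect_int f a m n d).
have := cabsD (rect_int f m b c n) (rect_int f m b n d).
lra.
Qed.

(** The supremum of the left ends lies in every interval of a nested sequence.
    *)
Lemma nested_left_limit (a h : R^nat) : (forall n, a n <= a n.+1) ->
  (forall n, a n.+1 + h n.+1 <= a n + h n) -> (forall n, 0 <= h n) ->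
  exists p, forall n, a n <= p <= a n + h n.
Proof.
move=> aS ahS h0.
have am n m : (n <= m)%N -> a n <= a m.
  by move=> /subnK <-; elim: (m - n)%N => // k ih; rewrite addSn (le_trans ih).
have bm n m : (n <= m)%N -> a m + h m <= a n + h n.
  by move=> /subnK <-; elim: (m - n)%N => // k ih; rewrite addSn (le_trans _ ih).
have ab n m : a n <= a m + h m.
  have [nm|mn] := leqP n m.
    by rewrite (le_trans (am _ _ nm))// lerDl.
  by rewrite (le_trans _ (bm _ _ (ltnW mn)))// lerDl.
have hs : has_sup (range a).
  split; first by exists (a 0%N), 0%N.
  by exists (a 0%N + h 0%N) => _ [n _ <-].
exists (sup (range a)) => n; apply/andP; split.
  by apply: ub_le_sup; [exact: hs.2|exists n].
by apply: ge_sup; [exact: hs.1|move=> _ [m _ <-]].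
Qed.

(** Goursat's bisection: if the integral were larger than e (h + k)^2, some
    nested sequence of quarters would keep at least 4^-n of it. Near the common
    point f is affine up to e / 4 times the distance; the affine part has a
    primitive and integrates to 0, and the remainder is too small. *)
Lemma Goursat_rect f a b c d : a <= b -> c <= d ->
  (forall w, in_rect a b c d w -> exists l, cdiff f w l) ->
  rect_int f a b c d = 0.
Proof.
move=> ab cd df.
have cf w : in_rect a b c d w -> ccont f w by move=> /df[l]; exact: cdiff_ccont.
pose h := b - a; pose k := d - c.
have h0 : 0 <= h by rewrite /h subr_ge0.
have k0 : 0 <= k by rewrite /k subr_ge0.
apply/eqP; rewrite -cabs_eq0 eq_le cabs_ge0 andbT.
suff H e : 0 < e -> cabs (rect_int f a b c d) <= e * (h + k) ^+ 2.
  apply/ler_addgt0Pr => e e0; rewrite add0r.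
  (* the added 1 covers a degenerate rectangle *)
  have L1 : 0 < (h + k) ^+ 2 + 1 by rewrite ltr_wpDl ?sqr_ge0.
  rewrite (le_trans (H (e / ((h + k) ^+ 2 + 1)) _))// ?divr_gt0//.
  by rewrite mulrAC ler_pdivrMr// ler_wpM2l ?lerDl// ltW.
move=> e0; rewrite leNgt; apply/negP => big.
pose hn n := h / 2 ^+ n; pose kn n := k / 2 ^+ n.
have hn0 n : 0 <= hn n by rewrite divr_ge0// exprn_ge0.
have kn0 n : 0 <= kn n by rewrite divr_ge0// exprn_ge0.
pose P n (q : R * R) := [/\ a <= q.1, q.1 + hn n <= b, c <= q.2, q.2 + kn n <= d &
   e * (h + k) ^+ 2 / 4 ^+ n < cabs (rect_int f q.1 (q.1 + hn n) q.2 (q.2 + kn n))].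
(* q is the lower left corner of the n-th rectangle *)
have step n (q : R * R) : exists q' : R * R, P n q -> [/\ P n.+1 q', q.1 <= q'.1, q'.1 + hn n.+1 <= q.1 + hn n,
    q.2 <= q'.2 & q'.2 + kn n.+1 <= q.2 + kn n].
  have [[p1 p2 p3 p4 p5]|nP] := pselect (P n q); last by exists q.
  have [||w hw|a' [c' []]] := rect_quarter (a:=q.1) (b:=q.1 + hn n) (c:=q.2) (d:=q.2 + kn n) _ _ _ p5.
  - by rewrite lerDl.
  - by rewrite lerDl.
  - by apply: cf; apply: in_rect_sub hw.
  have -> : (q.1 + hn n - q.1) / 2 = hn n.+1.
    by rewrite [q.1 + _]addrC addrK /hn exprSr invfM mulrA.
  have -> : (q.2 + kn n - q.2) / 2 = kn n.+1.
    by rewrite [q.2 + _]addrC addrK /kn exprSr invfM mulrA.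
  move=> r1 r2 r3 r4 r5.
  have r6 : e * (h + k) ^+ 2 / 4 ^+ n.+1 <
      cabs (rect_int f a' (a' + hn n.+1) c' (c' + kn n.+1)).
    by rewrite [4 ^+ n.+1]exprSr invfM mulrA.
  have r7 : a <= a' := le_trans p1 r1.
  have r8 : a' + hn n.+1 <= b := le_trans r2 p2.
  have r9 : c <= c' := le_trans p3 r3.
  have r10 : c' + kn n.+1 <= d := le_trans r4 p4.
  by exists (a', c') => _; split => //; split.
have [nx nxP] : {nx : nat -> R * R -> R * R | forall n q, P n q -> [/\ P n.+1 (nx n q), q.1 <= (nx n q).1,
   (nx n q).1 + hn n.+1 <= q.1 + hn n, q.2 <= (nx n q).2 & (nx n q).2 + kn n.+1 <= q.2 + kn n]}.
  exists (fun n q => projT1 (cid (step n q))) => n q; exact: (projT2 (cid (step n q))).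
pose Q := fix Q n := if n is m.+1 then nx m (Q m) else (a, c).
have QP n : P n (Q n).
  elim: n => [|n ih]; last by have [] := nxP _ _ ih.
  rewrite /P /= /hn /kn expr0 !divr1 /h /k; split => //; try lra.
  by rewrite [a + _]addrC [c + _]addrC !subrK.
have [p1 hp1] : exists p, forall n, (Q n).1 <= p <= (Q n).1 + hn n.
  by apply: nested_left_limit => // n; have [] := nxP _ _ (QP n).
have [p2 hp2] : exists p, forall n, (Q n).2 <= p <= (Q n).2 + kn n.
  by apply: nested_left_limit => // n; have [] := nxP _ _ (QP n).
pose p := p1 +i* p2.
have pin : in_rect a b c d p.
  have := hp1 0%N; have := hp2 0%N; rewrite /= /hn /kn expr0 !divr1 /in_rect /h /k /=; lra.
have [l dl] := df _ pin.
have e4 : 0 < e / 4 by rewrite divr_gt0.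
have [dd dd0 Hd] := dl _ e4.
have [n hkn] : exists n, hn n + kn n < dd.
  exists (Num.bound ((h + k) / dd)); set N := Num.bound _.
  rewrite /hn /kn -mulrDl ltr_pdivrMr ?exprn_gt0// mulrC -ltr_pdivrMr//.
  have : (h + k) / dd < N%:R.
    by apply: archi_boundP; apply: divr_ge0; [exact: addr_ge0|exact: ltW].
  move=> /lt_trans; apply; rewrite -natrX ltr_nat; exact: ltn_expl.
have [_ _ _ _] := QP n; set A := (Q n).1; set C := (Q n).2; set L := hn n + kn n.
have L0 : 0 <= L by rewrite addr_ge0.
rewrite ltNge => /negP; apply.
(* the boundary has length 2 L and the remainder is at most (e / 4) L, which
   yields e L^2 / 2 *)
pose lin w := f p + l * (w - p); pose rem w := f w - lin w.
have An : a <= A by have [] := QP n.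
have Bn : A + hn n <= b by have [] := QP n.
have Cn : c <= C by have [] := QP n.
have Dn : C + kn n <= d by have [] := QP n.
have dlin w : cdiff lin w l.
  apply: cdiff_eq (cdiffD (cdiff_cst _ _) (cdiffZ _ (cdiffB (cdiff_id _) (cdiff_cst _ _)))) _; ring.
have clin w : in_rect A (A + hn n) C (C + kn n) w -> ccont lin w.
  by move=> _; exact: cdiff_ccont (dlin w).
have sub w : in_rect A (A + hn n) C (C + kn n) w -> in_rect a b c d w.
  exact: in_rect_sub.
have crem w : in_rect A (A + hn n) C (C + kn n) w -> ccont rem w.
  by move=> /sub /df[l' dl']; exact: cdiff_ccont (cdiffB dl' (dlin w)).
have fE : (fun w => lin w + rem w) = f by apply/funext => w; rewrite /rem addrC subrK.
rewrite -fE.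
have Ah : A <= A + hn n by rewrite lerDl.
have Ck : C <= C + kn n by rewrite lerDl.
rewrite rect_intD// (@rect_int_primitive lin (fun w => f p * w + l / 2 * (w - p) ^+ 2))//; last first.
  move=> w _; apply: cdiff_eq (cdiffD (cdiffZ _ (cdiff_id _)) (cdiffZ _ (cdiffX 2 (cdiffB (cdiff_id _) (cdiff_cst _ _))))) _.
  by rewrite /lin expr1; field.
rewrite add0r (le_trans (rect_int_bound (K:=e / 4 * L) _ _ crem _))//.
  move=> w [/andP[w1 w2] /andP[w3 w4]].
  have hw : cabs (w - p) <= L.
    rewrite (le_trans (cabs_le_ReIm _))// !cReImE /L.
    have := hp1 n; have := hp2 n; rewrite -/A -/C => /andP[? ?] /andP[? ?].
    by apply: lerD; rewrite ler_norml; apply/andP; split; lra.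
  have := Hd (w - p) (le_lt_trans hw hkn); rewrite (addrC p) subrK => hr.
  rewrite (_ : rem w = f w - f p - l * (w - p)); last by rewrite /rem /lin; ring.
  by rewrite (le_trans hr)// ler_wpM2l// ltW.
have EL : L = (h + k) / 2 ^+ n by rewrite /L /hn /kn -mulrDl.
have EL2 : A + hn n - A + (C + kn n - C) = L by rewrite /L; ring.
have E4 : (4 : R) ^+ n = 2 ^+ n * 2 ^+ n by rewrite -exprMn -natrM.
have E2 (x y : R) : e * x ^+ 2 / (y * y) = e * (x / y) ^+ 2.
  by rewrite expr_div_n (expr2 y) -[LHS]mulrA.
rewrite EL2 E4 E2 -EL (_ : _ * (2 * _) = e * L ^+ 2 / 2); last by field.
by rewrite ler_pdivrMr// ler_peMr ?ler1n// mulr_ge0 ?sqr_ge0// ltW.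
Qed.

End Goursat.

(** * Laurent coefficients of functions of the exponential *)

Section ContinuityRules.
Variable R : realType.
Implicit Types (f g : R[i] -> R[i]) (z w u l : R[i]) (e d : R).

Lemma ccont_cst c z : ccont (fun=> c : R[i]) z.
Proof. exact: cdiff_ccont (cdiff_cst c z). Qed.

Lemma ccontD f g z : ccont f z -> ccont g z -> ccont (fun w => f w + g w) z.
Proof.
move=> cf cg e e0; have e2 : 0 < e / 2 by rewrite divr_gt0.
have [d d0 h] := cf _ e2; have [d' d'0 h'] := cg _ e2.
exists (Num.min d d'); first by rewrite lt_min d0.
move=> u; rewrite lt_min => /andP[/h h1 /h' h2].
rewrite opprD addrACA (le_lt_trans (cabsD _ _))//; lra.
Qed.

Lemma ccontM f g z : ccont f z -> ccont g z -> ccont (fun w => f w * g w) z.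
Proof.
move=> cf cg e e0.
have P (x : R[i]) : 0 < cabs x + 1 by rewrite ltr_wpDl ?cabs_ge0.
have [|d1 d10 h1] := cf (Num.min 1 (e / 3 / (cabs (g z) + 1))).
  by rewrite lt_min ltr01 !divr_gt0.
have [|d2 d20 h2] := cg (Num.min (e / 3) (e / 3 / (cabs (f z) + 1))).
  by rewrite lt_min !divr_gt0.
exists (Num.min d1 d2); first by rewrite lt_min d10.
move=> u; rewrite lt_min => /andP[/h1 + /h2]; rewrite !lt_min => /andP[a1 a2] /andP[b1 b2].
rewrite (_ : _ - _ = (f (z + u) - f z) * (g (z + u) - g z)
  + ((f (z + u) - f z) * g z + f z * (g (z + u) - g z))); last by ring.
set x := f (z + u) - f z in a1 a2 *; set y := g (z + u) - g z in b1 b2 *.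
have k1 : cabs (x * y) <= e / 3.
  rewrite cabsM -[leRHS]mul1r; apply: ler_pM; rewrite ?cabs_ge0 ?(ltW a1) ?(ltW b1)//.
have k2 : cabs (x * g z) < e / 3.
  rewrite cabsM; apply: (@le_lt_trans _ _ (cabs x * (cabs (g z) + 1))).
    by rewrite ler_wpM2l ?cabs_ge0// lerDl.
  by rewrite -ltr_pdivlMr.
have k3 : cabs (f z * y) < e / 3.
  rewrite cabsM mulrC; apply: (@le_lt_trans _ _ (cabs y * (cabs (f z) + 1))).
    by rewrite ler_wpM2l ?cabs_ge0// lerDl.
  by rewrite -ltr_pdivlMr.
have := cabsD (x * y) (x * g z + f z * y).
have := cabsD (x * g z) (f z * y).
lra.
Qed.

Lemma ccontV f z : f z != 0 -> ccont f z -> ccont (fun w => (f w)^-1) z.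
Proof. by move=> f0 cf; apply: ccont_comp cf (cdiff_ccont (cdiffV f0)). Qed.

Lemma ccont_sum (I : Type) (s : seq I) (F : I -> R[i] -> R[i]) z :
  (forall i, ccont (F i) z) -> ccont (fun w => \sum_(i <- s) F i w) z.
Proof.
move=> H; elim: s => [|i s ih].
  by apply: ccont_ext (ccont_cst 0 z) => w; rewrite big_nil.
by apply: ccont_ext (ccontD (H i) ih) => w; rewrite big_cons.
Qed.

Definition slope f z l u := if u == 0 then l else (f (z + u) - f z) / u.

Lemma slope_ccont f z l : cdiff f z l -> ccont (slope f z l) 0.
Proof.
move=> df e e0; have [d d0 h] := df (e / 2) (divr_gt0 e0 (ltr0n _ 2)).
exists d => // u ud; rewrite add0r /slope eqxx; case: ifPn => [_|u0].
  by rewrite subrr cabs0.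
have := h _ ud; rewrite -ler_pdivrMr ?cabs_gt0// -cabs_div.
rewrite (_ : _ / u = (f (z + u) - f z) / u - l); last by field.
by move=> /le_lt_trans; apply; lra.
Qed.

Lemma expr_lt_eventually (r M e : R) : 0 <= r < 1 -> 0 < e -> exists n : nat, r ^+ n * M < e.
Proof.
move=> /andP[r0 r1] e0.
have : (r ^+ n * M) @[n --> \oo] --> (0 * M : R).
  by apply: cvgMl; apply: cvg_expr; rewrite ger0_norm.
rewrite mul0r => /cvgrPdist_lt /(_ _ e0) [N _ H].
exists N; have := H N (leqnn _); rewrite sub0r normrN.
exact: le_lt_trans (ler_norm _).
Qed.

Lemma le0_geometric (r M x : R) : 0 <= r < 1 -> (forall n : nat, x <= r ^+ n * M) -> x <= 0.
Proof.
move=> r01 H; apply/ler_addgt0Pr => e e0; rewrite add0r.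
by have [n /ltW hn] := expr_lt_eventually M r01 e0; rewrite (le_trans (H n)).
Qed.

Lemma rcont_bounded a b (h : R -> R[i]) : a <= b -> rcont_on a b h ->
  exists2 M, 0 < M & forall x, a <= x <= b -> cabs (h x) <= M.
Proof.
move=> ab ch.
have : {within `[a, b], continuous (fun x => cabs (h x))}.
  apply: continuous_in_subspaceT => x; rewrite inE/= in_itv/= => xab.
  apply/cvgrPdist_lt => e e0; have [d d0 H] := ch x xab e e0.
  exists d => //= y; rewrite /ball_/= distrC => /H hy.
  rewrite ltr_norml; apply/andP; split.
    by have := cabs_subr (h y) (h x); lra.
  by have := cabs_subr (h x) (h y); rewrite cabsBC; lra.
move=> /(EVT_max ab)[c _ H]; exists (cabs (h c) + 1); first by rewrite ltr_wpDl ?cabs_ge0.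
by move=> x xab; rewrite (le_trans (H x _)) ?lerDl// in_itv.
Qed.

End ContinuityRules.

Section Laurent.
Variable R : realType.
Implicit Types (f g h : R[i] -> R[i]) (z w u l : R[i]) (s a b c d e : R).

(** A vertical segment of length 2 pi is mapped to a circle by exp; for g = f o
    exp this is the integral of f(z) / (i z) over the circle of radius exp s.
    *)
Definition vmean g s : R[i] := lint g s%:C 'i%C 0 (2 * pi).

Definition exp_periodic g := forall w w', cexp w = cexp w' -> g w = g w'.

Lemma twopi_ge0 : 0 <= 2 * pi :> R.
Proof. by rewrite mulr_ge0// pi_ge0. Qed.

Lemma vline_Re s (t : R) : complex.Re (s%:C + t%:C * 'i%C) = s.
Proof. by rewrite !cReImE; ring. Qed.

Lemma vline_rcont g s : (forall w, complex.Re w = s -> ccont g w) ->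
  rcont_on 0 (2 * pi) (fun t => g (s%:C + t%:C * 'i%C)).
Proof. by move=> cg; apply: ccont_line => t _; apply: cg; rewrite vline_Re. Qed.

Lemma vmean_ext g h s : (forall w, complex.Re w = s -> g w = h w) -> vmean g s = vmean h s.
Proof. by move=> gh; apply: cint_ext => t _; apply: gh; rewrite vline_Re. Qed.

Lemma vmeanD g h s : (forall w, complex.Re w = s -> ccont g w) ->
  (forall w, complex.Re w = s -> ccont h w) ->
  vmean (fun w => g w + h w) s = vmean g s + vmean h s.
Proof. by move=> cg ch; rewrite /vmean /lint cintD//; exact: vline_rcont. Qed.

Lemma vmeanB g h s : (forall w, complex.Re w = s -> ccont g w) ->
  (forall w, complex.Re w = s -> ccont h w) ->
  vmean (fun w => g w - h w) s = vmean g s - vmean h s.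
Proof. by move=> cg ch; rewrite /vmean /lint cintB//; exact: vline_rcont. Qed.

Lemma vmeanZ (c : R[i]) g s : (forall w, complex.Re w = s -> ccont g w) ->
  vmean (fun w => c * g w) s = c * vmean g s.
Proof. by move=> cg; rewrite /vmean /lint cintZ//; exact: vline_rcont. Qed.

Lemma vmean_sum (I : Type) (r : seq I) (F : I -> R[i] -> R[i]) s :
  (forall i w, complex.Re w = s -> ccont (F i) w) ->
  vmean (fun w => \sum_(i <- r) F i w) s = \sum_(i <- r) vmean (F i) s.
Proof.
move=> cF; rewrite /vmean /lint cint_sum//; first exact: twopi_ge0.
by move=> i; apply: vline_rcont; exact: cF.
Qed.

Lemma vmean_bound g s K : (forall w, complex.Re w = s -> ccont g w) ->
  (forall w, complex.Re w = s -> cabs (g w) <= K) -> cabs (vmean g s) <= K * (2 * pi).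
Proof.
move=> cg gK; rewrite -[2 * pi]subr0; apply: cint_bound; first exact: twopi_ge0.
- exact: vline_rcont.
- by move=> t _; apply: gK; rewrite vline_Re.
Qed.

(** In Cauchy's theorem for the rectangle between two vertical segments the
    horizontal sides cancel by periodicity. *)
Lemma vmean_const_closed g s0 s1 : exp_periodic g -> s0 <= s1 ->
  (forall w, s0 <= complex.Re w <= s1 -> exists l, cdiff g w l) ->
  vmean g s0 = vmean g s1.
Proof.
move=> pg s01 dg.
have := @Goursat_rect R g s0 s1 0 (2 * pi) s01 twopi_ge0.
move=> /(_ (fun w hw => dg w hw.1)).
rewrite /rect_int; have -> : lint g (0 +i* (2 * pi)) 1 s0 s1 = lint g (0 +i* 0) 1 s0 s1.
  apply: cint_ext => t _; apply: pg; rewrite -[in RHS]cexp_2pii; congr cexp.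
  by apply: complexP; rewrite !cReImE; ring.
rewrite subrr add0r => /eqP; rewrite mulf_eq0 subr_eq0 => /orP[/eqP /(congr1 (@complex.Im R))|/eqP//].
by rewrite !cReImE => /eqP; rewrite oner_eq0.
Qed.

(** Uniform continuity on the compact segment. *)
Lemma vmean_cont g s e : (forall w, complex.Re w = s -> ccont g w) -> 0 < e ->
  exists2 d, 0 < d & forall s', `|s' - s| < d ->
    (forall w, complex.Re w = s' -> ccont g w) -> cabs (vmean g s' - vmean g s) <= e.
Proof.
move=> cg e0.
pose P (s' t : R) := cabs (g (s'%:C + t%:C * 'i%C) - g (s%:C + t%:C * 'i%C)) < e / (2 * pi).
have ep : 0 < e / (2 * pi) by rewrite divr_gt0// mulr_gt0// pi_gt0.
have : \forall s' \near nbhs s, forall t, `[0, 2 * pi]%classic t -> P s' t.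
  have /compact_near_coveringP cpt := @segment_compact R 0 (2 * pi).
  (* near-covering form of compactness of the segment *)
  apply: cpt => t _.
  have [|d d0 H] := cg (s%:C + t%:C * 'i%C) (vline_Re _ _) (e / (2 * pi) / 2).
    by rewrite divr_gt0.
  exists (ball t (d / 2), ball s (d / 2)) => /=.
    by split; apply: nbhsx_ballx; rewrite divr_gt0.
  move=> [t' s'] [/=]; rewrite /ball/= => t't s's; rewrite /P.
  have h1 := H ((t' - t)%:C * 'i%C); have h2 := H ((s' - s)%:C + (t' - t)%:C * 'i%C).
  have e1 : s%:C + t%:C * 'i%C + (t' - t)%:C * 'i%C = s%:C + t'%:C * 'i%C.
    by rewrite rmorphB; ring.
  have e2 : s%:C + t%:C * 'i%C + ((s' - s)%:C + (t' - t)%:C * 'i%C) = s'%:C + t'%:C * 'i%C.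
    by rewrite !rmorphB; ring.
  rewrite e1 in h1; rewrite e2 in h2.
  have k1 : cabs ((t' - t)%:C * 'i%C) < d / 2 by rewrite cabsM cabs_i mulr1 cabs_real distrC.
  have k2 : cabs ((s' - s)%:C + (t' - t)%:C * 'i%C) < d.
    rewrite (le_lt_trans (cabsD _ _))// cabs_real distrC; lra.
  have /h1 {}h1 : cabs ((t' - t)%:C * 'i%C) < d by lra.
  have {}h2 := h2 k2.
  set A := g (s%:C + t%:C * _) in h1 h2; set B := g (s%:C + t'%:C * _) in h1 *.
  set C := g _ in h2 *.
  rewrite (_ : C - B = (C - A) - (B - A)); last by ring.
  by rewrite (le_lt_trans (cabsB _ _))//; lra.
move=> [d d0 H]; exists d; first exact: d0.
move=> s' s'd cg'.
have -> : e = e / (2 * pi) * (2 * pi - 0) by rewrite subr0 mulfVK// gt_eqF// mulr_gt0// pi_gt0.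
rewrite /vmean /lint -cintB; try exact: vline_rcont.
apply: cint_bound => //; first exact: twopi_ge0.
  apply: rcont_onD; first exact: vline_rcont.
  apply: rcont_on_ext (rcont_onZ (-1) (vline_rcont cg)) => x; by rewrite mulN1r.
by move=> t t01; apply/ltW/(H s'); rewrite /ball_/= ?in_itv//= distrC.
Qed.

(** The integrals over interior segments are equal and converge to those over
    the boundary lines, where g is only continuous. *)
Lemma vmean_const_open g s0 s1 : exp_periodic g -> s0 < s1 ->
  (forall w, s0 <= complex.Re w <= s1 -> ccont g w) ->
  (forall w, s0 < complex.Re w < s1 -> exists l, cdiff g w l) ->
  vmean g s0 = vmean g s1.
Proof.
move=> pg s01 cg dg; pose m := (s0 + s1) / 2.
have m0 : s0 < m by rewrite /m; lra.
have m1 : m < s1 by rewrite /m; lra.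
have small x : (forall e, 0 < e -> cabs x <= e) -> x = 0 :> R[i].
  move=> H; apply/eqP; rewrite -cabs_eq0 eq_le cabs_ge0 andbT.
  by apply/ler_addgt0Pr => e /H; rewrite add0r.
transitivity (vmean g m); apply/eqP; rewrite -subr_eq0; apply/eqP/small => e e0.
- have [w ws|d d0 H] := @vmean_cont g s0 e _ e0; first by apply: cg; rewrite ws lexx ltW.
  pose s' := Num.min m (s0 + d / 2).
  have s's : s0 < s' by rewrite lt_min m0 /=; lra.
  have s'm : s' <= m by rewrite ge_min lexx.
  have s'd : s' <= s0 + d / 2 by rewrite ge_min lexx orbT.
  rewrite -(@vmean_const_closed g s' m)//.
    rewrite cabsBC; apply: H; first by rewrite ltr_norml; apply/andP; split; lra.
    by move=> w ws; apply: cg; rewrite ws; apply/andP; split; lra.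
  by move=> w /andP[w1 w2]; apply: dg; apply/andP; split; lra.
- have [w ws|d d0 H] := @vmean_cont g s1 e _ e0; first by apply: cg; rewrite ws lexx ltW.
  pose s' := Num.max m (s1 - d / 2).
  have s's : s' < s1 by rewrite gt_max m1 /=; lra.
  have s'm : m <= s' by rewrite le_max lexx.
  have s'd : s1 - d / 2 <= s' by rewrite le_max lexx orbT.
  rewrite (@vmean_const_closed g m s')//.
    apply: H; first by rewrite ltr_norml; apply/andP; split; lra.
    by move=> w ws; apply: cg; rewrite ws; apply/andP; split; lra.
  by move=> w /andP[w1 w2]; apply: dg; apply/andP; split; lra.
Qed.

Definition cexpz (k : int) w : R[i] := cexp (k%:~R * w).

Lemma cdiff_cexpz k w : cdiff (cexpz k) w (k%:~R * cexpz k w).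
Proof.
apply: cdiff_eq (cdiff_cexp_comp (cdiffZ k%:~R (cdiff_id w))) _.
by rewrite /cexpz mulr1 mulrC.
Qed.

Lemma ccont_cexpz k w : ccont (cexpz k) w.
Proof. exact: cdiff_ccont (cdiff_cexpz k w). Qed.

Lemma cexpzE k w : cexpz k w = cexp w ^ k.
Proof.
case: k => n; first by rewrite /cexpz -[_%:~R]/(n%:R) cexp_natl.
by rewrite /cexpz NegzE mulrNz mulNr cexpN -[n.+1%:~R]/(n.+1%:R) cexp_natl.
Qed.

Lemma cexpz_periodic k : exp_periodic (cexpz k).
Proof. by move=> w w' ww; rewrite !cexpzE ww. Qed.

Lemma cexpzD k m w : cexpz k w * cexpz m w = cexpz (k + m) w.
Proof. by rewrite /cexpz -cexpD rmorphD -mulrDl. Qed.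

Lemma cabs_cexpz k w : cabs (cexpz k w) = expR (k%:~R * complex.Re w).
Proof.
rewrite cabs_cexp; congr expR.
have -> : k%:~R = (k%:~R)%:C :> R[i] by rewrite rmorph_int.
by rewrite !cReImE; ring.
Qed.

(** Orthogonality of the powers of exp w on a period. *)
Lemma vmean_cexpz k s : vmean (cexpz k) s = if k == 0 then (2 * pi)%:C else 0.
Proof.
case: ifPn => [/eqP ->|k0].
  rewrite (@vmean_ext _ (fun=> 1)); last by move=> w _; rewrite /cexpz mul0r cexp0.
  by rewrite /vmean /lint cint_cst ?subr0 ?mulr1//; exact: twopi_ge0.
have kC : (k%:~R : R[i]) != 0 by rewrite intr_eq0.
have : 'i%C * lint (cexpz k) s%:C 'i%C 0 (2 * pi) =
    k%:~R^-1 * cexpz k (s%:C + (2 * pi)%:C * 'i%C) - k%:~R^-1 * cexpz k (s%:C + 0%:C * 'i%C).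
  apply: (@lint_FTC R (cexpz k) (fun w => k%:~R^-1 * cexpz k w)) => [|t _|t _].
  - exact: twopi_ge0.
  - by apply: cdiff_eq (cdiffZ _ (cdiff_cexpz _ _)) _; rewrite mulKf.
  - exact: ccont_cexpz.
rewrite -[lint _ _ _ _ _]/(vmean (cexpz k) s).
rewrite (@cexpz_periodic k _ (s%:C + 0%:C * 'i%C)); last first.
  rewrite -[RHS]cexp_2pii; congr cexp.
  by apply: complexP; rewrite !cReImE; ring.
rewrite subrr => /eqP; rewrite mulf_eq0 => /orP[/eqP /(congr1 (@complex.Im R))|/eqP//].
by rewrite !cReImE => /eqP; rewrite oner_eq0.
Qed.

End Laurent.

(** * Laurent coefficients determine a function *)

Section LaurentUniqueness.
Variable R : realType.
Implicit Types (f g h : R[i] -> R[i]) (z w u l : R[i]) (s a b c d e : R).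

Lemma realC_eq0 (x : R) : (x%:C == 0 :> R[i]) = (x == 0).
Proof. by rewrite eq_complex /= eqxx andbT. Qed.

Lemma twopiC_neq0 : (2 * pi)%:C != 0 :> R[i].
Proof. by rewrite realC_eq0 gt_eqF// mulr_gt0// pi_gt0. Qed.

Lemma cabs_eq0_le (x : R[i]) : cabs x <= 0 -> x = 0.
Proof. by move=> x0; apply/eqP; rewrite -cabs_eq0 eq_le x0 cabs_ge0. Qed.

(** The values on a vertical line are those on a segment of length 2 pi. *)
Lemma vmean_line_bounded g s : (forall w, complex.Re w = s -> ccont g w) -> exp_periodic g ->
  exists2 M, 0 < M & forall w, complex.Re w = s -> cabs (g w) <= M.
Proof.
move=> cg pg; have [M M0 H] := rcont_bounded (twopi_ge0 R) (vline_rcont cg).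
exists M => // w ws.
have p0 : 0 < 2 * pi :> R by rewrite mulr_gt0// pi_gt0.
pose k := Num.floor (complex.Im w / (2 * pi)).
pose t := complex.Im w - k%:~R * (2 * pi).
have t02 : 0 <= t <= 2 * pi.
  have /andP[] := floor_itv (complex.Im w / (2 * pi)).
  rewrite ler_pdivlMr// ltr_pdivrMr// intrD mulr1z -/k => k1 k2.
  by rewrite /t; apply/andP; split; lra.
suff -> : g w = g (s%:C + t%:C * 'i%C) by exact: H.
apply: pg; have -> : w = s%:C + t%:C * 'i%C + k%:~R * (2 * pi%:C * 'i%C).
  have -> : (k%:~R : R[i]) = (k%:~R)%:C by rewrite rmorph_int.
  by apply: complexP; rewrite !cReImE -?ws /t; ring.
rewrite cexpD; suff -> : cexp (k%:~R * (2 * pi%:C * 'i%C) : R[i]) = 1 by rewrite mulr1.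
rewrite -[LHS]/(cexpz k _) cexpzE (_ : cexp _ = 1) ?exp1rz//.
by have := cexp_2pii (0 : R[i]); rewrite add0r cexp0.
Qed.

(** The partial sums of the geometric series of (t - x)^-1, with remainder. *)
Lemma geometric_split (t x : R[i]) n : t != x -> x != 0 ->
  (t - x)^-1 + \sum_(j < n) t ^+ j / x ^+ j.+1 = (t / x) ^+ n / (t - x).
Proof.
move=> tx x0; have tx0 : t - x != 0 by rewrite subr_eq0.
elim: n => [|n ih]; first by rewrite big_ord0 addr0 expr0 mul1r.
rewrite big_ord_recr /= addrA ih !expr_div_n !exprS.
by field; rewrite expf_neq0// x0 tx0.
Qed.

(** To the left of the pole, 1 / (exp w - exp a) is a geometric series in
    nonnegative powers of exp w. The moments of g against positive powers
    vanish, so only the constant term survives. *)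
Lemma vmean_geometric_lt g s (a : R[i]) : s < complex.Re a ->
  exp_periodic g -> (forall w, complex.Re w = s -> ccont g w) ->
  (forall n : nat, vmean (fun w => g w * cexpz n.+1 w) s = 0) ->
  vmean (fun w => g w / (cexp w - cexp a)) s = - (cexp a)^-1 * vmean g s.
Proof.
move=> sa pg cg g0.
have ne w : complex.Re w = s -> cexp w - cexp a != 0.
  move=> ws; rewrite subr_eq0; apply/eqP => /(congr1 (@cabs R)).
  by rewrite !cabs_cexp => /expR_inj; rewrite ws => sE; rewrite sE ltxx in sa.
have cE w : ccont (fun w => cexp w - cexp a) w.
  exact: cdiff_ccont (cdiffB (cdiff_cexp w) (cdiff_cst _ _)).
pose q w := g w / (cexp w - cexp a).
have cq w : complex.Re w = s -> ccont q w.
  by move=> ws; apply: ccontM; [exact: cg|apply: ccontV; [exact: ne|exact: cE]].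
have pq : exp_periodic q by move=> w w' ww; rewrite /q ww (pg _ _ ww).
have [M M0 qM] := vmean_line_bounded cq pq.
apply/eqP; rewrite mulNr -subr_eq0 opprK; apply/eqP/cabs_eq0_le.
pose r := expR (s - complex.Re a).
have r01 : 0 <= r < 1 by rewrite expR_ge0 expR_lt1 subr_lt0.
suff H n : cabs (vmean q s + (cexp a)^-1 * vmean g s) <= r ^+ n.+1 * (M * (2 * pi)).
  apply: (le0_geometric (M:=r * (M * (2 * pi))) r01) => n.
  by rewrite mulrA -exprSr; exact: H.
(* the remainder of the geometric series *)
pose T w := cexpz n.+1 w * (cexp a)^-1 ^+ n.+1 * q w.
have E w : complex.Re w = s -> T w = q w + \sum_(j < n.+1) (cexp a ^+ j.+1)^-1 * (g w * cexpz j w).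
  move=> ws; rewrite /T /q cexpzE -exprnP -exprMn.
  have := geometric_split n.+1 (_ : cexp w != cexp a) (cexp_neq0 a).
  rewrite -subr_eq0 => /(_ (ne _ ws)) k.
  rewrite mulrCA -k mulrDr mulr_sumr; congr (_ + _); apply: eq_bigr => j _.
  by rewrite cexpzE -exprnP; ring.
have cgz (k : int) w : complex.Re w = s -> ccont (fun w => g w * cexpz k w) w.
  by move=> ws; apply: ccontM; [exact: cg|exact: ccont_cexpz].
have cS w : complex.Re w = s -> ccont (fun w => \sum_(j < n.+1) (cexp a ^+ j.+1)^-1 * (g w * cexpz j w)) w.
  by move=> ws; apply: ccont_sum => j; apply: ccontM; [exact: ccont_cst|exact: cgz].
have -> : vmean q s + (cexp a)^-1 * vmean g s = vmean T s.
  rewrite (vmean_ext E) vmeanD// vmean_sum; last first.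
    by move=> j w ws; apply: ccontM; [exact: ccont_cst|exact: cgz].
  congr (_ + _); rewrite big_ord_recl /= big1 => [|j _]; last first.
    rewrite vmeanZ; last by move=> w; exact: cgz.
    by rewrite g0 mulr0.
  rewrite addr0 vmeanZ; last by move=> w; exact: cgz.
  rewrite expr1; congr (_ * _); apply: vmean_ext => w _.
  by rewrite /cexpz mul0r cexp0 mulr1.
have -> : r ^+ n.+1 * (M * (2 * pi)) = (r ^+ n.+1 * M) * (2 * pi) by rewrite -[RHS]mulrA.
apply: vmean_bound.
  move=> w ws; apply: ccontM; last exact: cq.
  by apply: ccontM; [exact: ccont_cexpz|exact: ccont_cst].
move=> w ws; rewrite /T cabsM; apply: ler_pM; rewrite ?cabs_ge0 ?qM//.
by rewrite cabsM cexpzE -exprnP !cabsX cabsV !cabs_cexp -exprMn ws /r expRB lexx.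
Qed.

(** To the right of the pole the geometric series runs over negative powers of
    exp w, against which g has no moments. *)
Lemma vmean_geometric_gt g s (a : R[i]) : complex.Re a < s ->
  exp_periodic g -> (forall w, complex.Re w = s -> ccont g w) ->
  (forall n : nat, vmean (fun w => g w * cexpz (- n.+1%:Z) w) s = 0) ->
  vmean (fun w => g w / (cexp w - cexp a)) s = 0.
Proof.
move=> sa pg cg g0.
have ne w : complex.Re w = s -> cexp w - cexp a != 0.
  move=> ws; rewrite subr_eq0; apply/eqP => /(congr1 (@cabs R)).
  by rewrite !cabs_cexp => /expR_inj; rewrite ws => sE; rewrite sE ltxx in sa.
have cE w : ccont (fun w => cexp w - cexp a) w.
  exact: cdiff_ccont (cdiffB (cdiff_cexp w) (cdiff_cst _ _)).
pose q w := g w / (cexp w - cexp a).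
have cq w : complex.Re w = s -> ccont q w.
  by move=> ws; apply: ccontM; [exact: cg|apply: ccontV; [exact: ne|exact: cE]].
have pq : exp_periodic q by move=> w w' ww; rewrite /q ww (pg _ _ ww).
have [M M0 qM] := vmean_line_bounded cq pq.
apply: cabs_eq0_le.
pose r := expR (complex.Re a - s).
have r01 : 0 <= r < 1 by rewrite expR_ge0 expR_lt1 subr_lt0.
suff H n : cabs (vmean q s) <= r ^+ n * (M * (2 * pi)) by exact: (le0_geometric r01 H).
(* the remainder of the geometric series *)
pose T w := cexp a ^+ n * (cexpz (- n%:Z) w * q w).
have E w : complex.Re w = s -> q w = T w + \sum_(j < n) cexp a ^+ j * (g w * cexpz (- j.+1%:Z) w).
  move=> ws; have := geometric_split n (_ : cexp a != cexp w) (cexp_neq0 w).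
  rewrite eq_sym -subr_eq0 => /(_ (ne _ ws)).
  rewrite -[cexp a - _]opprB invrN => /(canRL (addKr _)); rewrite opprK => k.
  rewrite /T /q.
  have -> : \sum_(j < n) cexp a ^+ j * (g w * cexpz (- j.+1%:Z) w) =
      g w * \sum_(j < n) cexp a ^+ j / cexp w ^+ j.+1.
    rewrite mulr_sumr; apply: eq_bigr => j _.
    by rewrite cexpzE -exprnN; ring.
  rewrite k cexpzE -exprnN expr_div_n -[(_ ^+ n)^-1]exprVn; ring.
have cgz (k : int) w : complex.Re w = s -> ccont (fun w => g w * cexpz k w) w.
  by move=> ws; apply: ccontM; [exact: cg|exact: ccont_cexpz].
have cS w : complex.Re w = s -> ccont (fun w => \sum_(j < n) cexp a ^+ j * (g w * cexpz (- j.+1%:Z) w)) w.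
  by move=> ws; apply: ccont_sum => j; apply: ccontM; [exact: ccont_cst|exact: cgz].
have cT w : complex.Re w = s -> ccont T w.
  move=> ws; apply: ccontM; first exact: ccont_cst.
  by apply: ccontM; [exact: ccont_cexpz|exact: cq].
rewrite -/q; have -> : vmean q s = vmean T s.
  rewrite (vmean_ext E) vmeanD// vmean_sum; last first.
    by move=> j w ws; apply: ccontM; [exact: ccont_cst|exact: cgz].
  rewrite big1 ?addr0// => j _.
  rewrite vmeanZ; last by move=> w; exact: cgz.
  by rewrite g0 mulr0.
have -> : r ^+ n * (M * (2 * pi)) = (r ^+ n * M) * (2 * pi) by rewrite -[RHS]mulrA.
apply: vmean_bound => //.
move=> w ws; rewrite /T mulrA cabsM; apply: ler_pM; rewrite ?cabs_ge0 ?qM//.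
rewrite cabsM cexpzE -exprnN cabsV !cabsX !cabs_cexp ws /r expRB.
by rewrite expr_div_n lexx.
Qed.

Lemma vmean_mulz_const g (k : int) s0 s1 : exp_periodic g -> s0 < s1 ->
  (forall w, s0 <= complex.Re w <= s1 -> ccont g w) ->
  (forall w, s0 < complex.Re w < s1 -> exists l, cdiff g w l) ->
  vmean (fun w => g w * cexpz k w) s0 = vmean (fun w => g w * cexpz k w) s1.
Proof.
move=> pg s01 cg dg; apply: vmean_const_open => //.
- by move=> w w' ww; rewrite (pg _ _ ww) (cexpz_periodic k ww).
- by move=> w /cg cw; apply: ccontM => //; exact: ccont_cexpz.
- by move=> w /dg [l dw]; eexists; apply: cdiffM dw (cdiff_cexpz k w).
Qed.

(** Cauchy's integral formula in disguise. For v = g(a), the quotient q of g -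
    v by exp w - exp a is continuous at a, so its integral is the same on both
    sides of the line through a. Expanding 1 / (exp w - exp a) into a geometric
    series on either side, the moments of g contribute nothing and those of v
    contribute a nonzero multiple of v on the left and 0 on the right; hence v
    = 0. *)
Theorem Laurent_uniqueness g B sigma : exp_periodic g ->
  (forall w, complex.Re w < B -> ccont g w) ->
  (forall w, complex.Re w < B -> complex.Re w != sigma -> exists l, cdiff g w l) ->
  (forall (k : int) s, s < B -> vmean (fun w => g w * cexpz k w) s = 0) ->
  forall w, complex.Re w < B -> g w = 0.
Proof.
move=> pg cg dg g0.
suff main (a : R[i]) : complex.Re a < B -> complex.Re a != sigma -> g a = 0.
  (* on the exceptional line g vanishes by continuity *)
  move=> a aB; have [as_|] := eqVneq (complex.Re a) sigma; last exact: main.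
  apply: cabs_eq0_le; apply/ler_addgt0Pr => e e0; rewrite add0r.
  have [d d0 H] := cg a aB e e0.
  pose x := Num.min (d / 2) ((B - complex.Re a) / 2).
  have x0 : 0 < x by rewrite lt_min !divr_gt0// subr_gt0.
  have xd : x <= d / 2 by rewrite ge_min lexx.
  have xB : x <= (B - complex.Re a) / 2 by rewrite ge_min lexx orbT.
  have := H x%:C; rewrite cabs_real gtr0_norm// main ?sub0r ?cabsN.
  - by move=> h; apply/ltW/h; lra.
  - by rewrite !cReImE; lra.
  - by rewrite !cReImE -as_; apply/eqP; lra.
move=> aB asig; have [l dl] := dg a aB asig.
set alpha := complex.Re a in aB asig.
(* the strip of half-width eta around Re w = Re a avoids the exceptional line
   *)
pose eta := Num.min `|alpha - sigma| (B - alpha) / 2.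
have min0 : 0 < Num.min `|alpha - sigma| (B - alpha).
  by rewrite lt_min normr_gt0 subr_eq0 asig subr_gt0.
have eta0 : 0 < eta by rewrite divr_gt0.
have eta1 : eta < `|alpha - sigma|.
  have : Num.min `|alpha - sigma| (B - alpha) <= `|alpha - sigma| by rewrite ge_min lexx.
  by rewrite /eta; lra.
have eta2 : eta < B - alpha.
  have : Num.min `|alpha - sigma| (B - alpha) <= B - alpha by rewrite ge_min lexx orbT.
  by rewrite /eta; lra.
have sigma_out x : `|x - alpha| <= eta -> x != sigma.
  move=> xa; apply/eqP => xs; move: xa; rewrite xs distrC leNgt eta1; exact/negP.
pose v := g a; pose h w := g w - v.
pose q w := if cexp w == cexp a then l / cexp a else h w / (cexp w - cexp a).
have ph : exp_periodic h by move=> w w' ww; rewrite /h (pg _ _ ww).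
have pq : exp_periodic q by move=> w w' ww; rewrite /q ww (ph _ _ ww).
have ch w : complex.Re w < B -> ccont h w.
  by move=> wB; apply: ccontD; [exact: cg|exact: ccont_cst].
have dE w : cdiff (fun w => cexp w - cexp a) w (cexp w).
  by apply: cdiff_eq (cdiffB (cdiff_cexp w) (cdiff_cst _ _)) _; rewrite subr0.
have qne w : cexp w != cexp a -> exists2 d, 0 < d & forall u, cabs u < d -> h (w + u) / (cexp (w + u) - cexp a) = q (w + u).
  move=> ne; have [|d d0 H] := cdiff_ccont (cdiff_cexp w) (e:=cabs (cexp w - cexp a)).
    by rewrite cabs_gt0 subr_eq0.
  exists d => // u /H hu; rewrite /q; case: ifPn => // /eqP E.
  by move: hu; rewrite E cabsBC ltxx.
have cq w : complex.Re w < B -> ccont q w.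
  move=> wB; have [E|ne] := eqVneq (cexp w) (cexp a); last first.
    apply: (@ccont_near _ (fun w => h w / (cexp w - cexp a))) (qne _ ne) _; apply: ccontM; first exact: ch.
    by apply: ccontV; [rewrite subr_eq0|exact: cdiff_ccont (dE w)].
  have s0 : slope (@cexp R) a (cexp a) 0 = cexp a by rewrite /slope eqxx.
  (* at a point over a the quotient is a quotient of slopes at a *)
  have cS : ccont (fun u => slope g a l u / slope (@cexp R) a (cexp a) u) 0.
    apply: ccontM; first exact: slope_ccont.
    by apply: ccontV; [rewrite s0 cexp_neq0|exact: slope_ccont (cdiff_cexp a)].
  have cS' : ccont (fun z => slope g a l (z - w) / slope (@cexp R) a (cexp a) (z - w)) w.
    apply: (@ccont_comp _ (fun u => slope g a l u / slope (@cexp R) a (cexp a) u) (fun z => z - w)).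
      exact: cdiff_ccont (cdiffB (cdiff_id w) (cdiff_cst w w)).
    by rewrite subrr.
  apply: ccont_near cS'; exists 1 => // u u1.
  rewrite (addrC w) addrK /q /slope.
  have -> : cexp (u + w) = cexp (a + u) by rewrite !cexpD E mulrC.
  have -> : h (u + w) = g (a + u) - g a.
    by rewrite /h /v; congr (_ - _); apply: pg; rewrite !cexpD E mulrC.
  have [->|u0] := eqVneq u 0; first by rewrite addr0 eqxx.
  have ne : cexp (a + u) != cexp a.
    apply/eqP; rewrite cexpD => /(canRL (mulKf (cexp_neq0 a))); rewrite mulVf ?cexp_neq0// => E1.
    move/eqP: u0; apply; apply: cexp_inj_strip; first by rewrite E1 cexp0.
    rewrite subr0 (le_lt_trans (cabs_Im _))// (lt_trans u1)//.
    by have := pi_ge2 R; rewrite mulr2n; lra.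
  rewrite (negbTE ne); field.
  by rewrite u0 subr_eq0 ne.
have dq w : complex.Re w < B -> complex.Re w != alpha -> complex.Re w != sigma ->
    exists l', cdiff q w l'.
  move=> wB wa ws; have ne : cexp w != cexp a.
    apply/eqP => /(congr1 (@cabs R)); rewrite !cabs_cexp => /expR_inj.
    by apply/eqP.
  have [l' dl'] := dg w wB ws.
  eexists; apply: (@cdiff_near _ (fun w => h w / (cexp w - cexp a))) (qne _ ne) _.
  by apply: cdiff_div (cdiffB dl' (cdiff_cst _ _)) (dE w); rewrite subr_eq0.
have hk s (k : int) : s < B -> k != 0 -> vmean (fun w => h w * cexpz k w) s = 0.
  move=> sB k0.
  rewrite (@vmean_ext _ _ (fun w => g w * cexpz k w - v * cexpz k w)); last by move=> w _; rewrite /h mulrBl.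
  rewrite vmeanB; first last.
  - by move=> w _; apply: ccontM; [exact: ccont_cst|exact: ccont_cexpz].
  - by move=> w ws; apply: ccontM; [by apply: cg; rewrite ws|exact: ccont_cexpz].
  rewrite g0// vmeanZ; last by move=> w _; exact: ccont_cexpz.
  by rewrite vmean_cexpz (negbTE k0) mulr0 subr0.
have chs s w : s < B -> complex.Re w = s -> ccont h w by move=> sB ws; apply: ch; rewrite ws.
have q3 : vmean q (alpha - eta) = vmean q alpha.
  apply: vmean_const_open => //; first by lra.
  - by move=> w /andP[w1 w2]; apply: cq; lra.
  - move=> w /andP[w1 w2]; apply: dq; [lra|by apply/eqP; lra|].
    by apply: sigma_out; rewrite ler_norml; apply/andP; split; lra.
have q4 : vmean q alpha = vmean q (alpha + eta).
  clear q3.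
  apply: vmean_const_open => //; first by lra.
  - by move=> w /andP[w1 w2]; apply: cq; lra.
  - move=> w /andP[w1 w2]; apply: dq; [lra|by apply/eqP; lra|].
    by apply: sigma_out; rewrite ler_norml; apply/andP; split; lra.
(* for k = 0 the moment of g vanishes and that of - v remains *)
have q1 : vmean q (alpha - eta) = (cexp a)^-1 * (v * (2 * pi)%:C).
  clear q3 q4.
  have sB : alpha - eta < B by lra.
  rewrite (@vmean_ext _ _ (fun w => h w / (cexp w - cexp a))); last first.
    move=> w ws; rewrite /q; case: ifPn => // /eqP /(congr1 (@cabs R)).
    by rewrite !cabs_cexp => /expR_inj; rewrite ws -/alpha => E; exfalso; lra.
  rewrite vmean_geometric_lt//; last 3 first.
  - by rewrite -/alpha; lra.
  - by move=> w; exact: chs.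
  - by move=> n; exact: hk.
  rewrite vmeanB; last 2 first.
  - by move=> w ws; apply: cg; rewrite ws.
  - by move=> w _; exact: ccont_cst.
  have -> : vmean g (alpha - eta) = 0.
    rewrite -[RHS](g0 0 (alpha - eta))//; apply: vmean_ext => w _.
    by rewrite /cexpz mul0r cexp0 mulr1.
  rewrite (@vmean_ext _ (fun=> v) (fun w => v * cexpz 0 w)); last first.
    by move=> w _; rewrite /cexpz mul0r cexp0 mulr1.
  rewrite vmeanZ; last by move=> w _; exact: ccont_cexpz.
  by rewrite vmean_cexpz eqxx sub0r mulrNN.
have q2 : vmean q (alpha + eta) = 0.
  clear q1 q3 q4.
  have sB : alpha + eta < B by lra.
  rewrite (@vmean_ext _ _ (fun w => h w / (cexp w - cexp a))); last first.
    move=> w ws; rewrite /q; case: ifPn => // /eqP /(congr1 (@cabs R)).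
    by rewrite !cabs_cexp => /expR_inj; rewrite ws -/alpha => E; exfalso; lra.
  rewrite vmean_geometric_gt//.
  - by rewrite -/alpha; lra.
  - by move=> w; exact: chs.
  - by move=> n; exact: hk.
move: q1; rewrite q3 q4 q2 => /esym/eqP.
by rewrite !mulf_eq0 invr_eq0 (negbTE (cexp_neq0 a)) (negbTE twopiC_neq0) orbF /= => /eqP.
Qed.

End LaurentUniqueness.

(** * Liouville's theorem and the identity theorem *)

Section Logarithm.
Variable R : realType.
Implicit Types (z w u : R[i]).

Lemma Re_div_cabs_itv z : -1 <= complex.Re z / cabs z <= 1.
Proof.
have [->|z0] := eqVneq z 0; first by rewrite cabs0 invr0 mulr0; apply/andP; split; lra.
have a0 : 0 < cabs z by rewrite cabs_gt0.
have := cabs_Re z; rewrite ler_norml ler_pdivlMr// ler_pdivrMr// mulN1r mul1r.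
by [].
Qed.

Lemma cos_carg z : cos (carg z) = complex.Re z / cabs z.
Proof.
by rewrite /carg; case: ifP => _; rewrite ?cosN acosK// in_itv/= Re_div_cabs_itv.
Qed.

Lemma sin_carg z : z != 0 -> sin (carg z) = complex.Im z / cabs z.
Proof.
move=> z0; have a0 : 0 < cabs z by rewrite cabs_gt0.
have E : Num.sqrt (1 - (complex.Re z / cabs z) ^+ 2) = `|complex.Im z| / cabs z.
  have -> : 1 - (complex.Re z / cabs z) ^+ 2 = (`|complex.Im z| / cabs z) ^+ 2.
    rewrite !expr_div_n real_normK ?num_real//.
    have : cabs z ^+ 2 = complex.Re z ^+ 2 + complex.Im z ^+ 2.
      by rewrite cabsE sqr_sqrtr// addr_ge0 ?sqr_ge0.
    move=> e; have e0 : cabs z ^+ 2 != 0 by rewrite expf_neq0// gt_eqF.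
    by apply: (mulIf e0); rewrite mulrBl mul1r !mulfVK// e; ring.
  by rewrite sqrtr_sqr ger0_norm// divr_ge0// ltW.
rewrite /carg; case: ifPn => [i0|]; rewrite ?sinN sin_acos ?Re_div_cabs_itv// E.
  by rewrite ger0_norm.
by rewrite -ltNge => i0; rewrite ltr0_norm//; field; rewrite gt_eqF.
Qed.

Lemma carg_itv z : - pi <= carg z <= pi.
Proof.
have h1 := acos_ge0 (Re_div_cabs_itv z); have h2 := acos_lepi (Re_div_cabs_itv z).
have := pi_ge0 R; rewrite /carg; case: ifP => _ p0; apply/andP; split; lra.
Qed.

Lemma cexp_clog z : z != 0 -> cexp (clog z) = z.
Proof.
move=> z0; have a0 : 0 < cabs z by rewrite cabs_gt0.
apply: complexP; rewrite ?Re_cexp ?Im_cexp /clog !cReImE lnK ?posrE// ?cos_carg ?sin_carg//.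
  by rewrite mulrC mulfVK// gt_eqF.
by rewrite mulrC mulfVK// gt_eqF.
Qed.

End Logarithm.

Section Liouville.
Variable R : realType.
Implicit Types (f g h : R[i] -> R[i]) (z w u l : R[i]) (s a b c d e : R).

(** The line Re w = sigma is a boundary of the strips on which the integral is
    constant. *)
Lemma vmean_mulz_indep g sigma (k : int) s0 s1 : exp_periodic g ->
  (forall w, ccont g w) ->
  (forall w, complex.Re w != sigma -> exists l, cdiff g w l) ->
  vmean (fun w => g w * cexpz k w) s0 = vmean (fun w => g w * cexpz k w) s1.
Proof.
move=> pg cg dg.
have H x y : x < y -> (y <= sigma \/ sigma <= x) ->
    vmean (fun w => g w * cexpz k w) x = vmean (fun w => g w * cexpz k w) y.
  move=> xy xys; apply: vmean_mulz_const => // w /andP[w1 w2]; apply: dg.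
  by apply/eqP => ws; case: xys; lra.
suff K x : vmean (fun w => g w * cexpz k w) x = vmean (fun w => g w * cexpz k w) sigma.
  by rewrite K [RHS]K.
have [xs|sx|->//] := ltgtP x sigma; first by apply: H => //; left.
by apply/esym/H => //; right.
Qed.

(** The integral does not depend on the line, and tends to 0 as the line moves
    to - oo. *)
Lemma vmean_decay_left g M A (x : R[i]) (k : nat) : 0 < M -> (forall w, ccont g w) ->
  (forall w, complex.Re w <= A -> cabs (g w) <= M * expR (k.+1%:R * complex.Re w)) ->
  (forall s, vmean g s = x) -> x = 0.
Proof.
move=> M0 cg gM gx; apply: cabs_eq0_le.
have r01 : 0 <= expR (-1 : R) < 1 by rewrite expR_ge0 expR_lt1 oppr_lt0 ltr01.
apply: (le0_geometric (M:=M * expR (k.+1%:R * Num.min A 0) * (2 * pi)) r01) => n.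
rewrite -(gx (Num.min A 0 - n%:R)) mulrA.
apply: vmean_bound => // w ws.
have m1 : Num.min A 0 <= A by rewrite ge_min lexx.
have n0 : 0 <= n%:R :> R by [].
rewrite (le_trans (gM w _))//; first by rewrite ws; lra.
rewrite mulrCA ler_wpM2l ?(ltW M0)// -expRM_natl -expRD ler_expR ws mulrBr addrC lerD2r mulrN1 lerN2.
by rewrite ler_peMl// ler1n.
Qed.

Lemma vmean_decay_right g M A (x : R[i]) (k : nat) : 0 < M -> (forall w, ccont g w) ->
  (forall w, A <= complex.Re w -> cabs (g w) <= M * expR (- k.+1%:R * complex.Re w)) ->
  (forall s, vmean g s = x) -> x = 0.
Proof.
move=> M0 cg gM gx; apply: cabs_eq0_le.
have r01 : 0 <= expR (-1 : R) < 1 by rewrite expR_ge0 expR_lt1 oppr_lt0 ltr01.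
apply: (le0_geometric (M:=M * expR (- k.+1%:R * Num.max A 0) * (2 * pi)) r01) => n.
rewrite -(gx (Num.max A 0 + n%:R)) mulrA.
apply: vmean_bound => // w ws.
have m1 : A <= Num.max A 0 by rewrite le_max lexx.
have n0 : 0 <= n%:R :> R by [].
rewrite (le_trans (gM w _))//; first by rewrite ws; lra.
rewrite mulrCA ler_wpM2l ?(ltW M0)// -expRM_natl -expRD ler_expR ws mulrDr addrC lerD2r mulrN1 mulNr lerN2.
by rewrite ler_peMl// ler1n.
Qed.

(** Boundedness near - oo kills the moments against positive powers, growth of
    order K near + oo those against powers below - K. Subtracting from g the
    combination of exp (k w), k <= K, with the remaining moments leaves a
    function all of whose moments vanish. *)
Theorem Liouville_exp g sigma M A (K : nat) : exp_periodic g -> 0 < M ->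
  (forall w, ccont g w) ->
  (forall w, complex.Re w != sigma -> exists l, cdiff g w l) ->
  (forall w, complex.Re w <= - A -> cabs (g w) <= M) ->
  (forall w, A <= complex.Re w -> cabs (g w) <= M * expR (K%:R * complex.Re w)) ->
  exists c : nat -> R[i], forall w, g w = \sum_(k < K.+1) c k * cexpz k w.
Proof.
move=> pg M0 cg dg gl gr.
have p0 : 0 < 2 * pi :> R by rewrite mulr_gt0// pi_gt0.
pose m (k : int) := vmean (fun w => g w * cexpz k w) 0.
have mE k s : vmean (fun w => g w * cexpz k w) s = m k by exact: vmean_mulz_indep pg cg dg.
have cgz (k : int) w : ccont (fun w => g w * cexpz k w) w.
  by apply: ccontM; [exact: cg|exact: ccont_cexpz].
have m_pos (n : nat) : m n.+1 = 0.
  apply: (vmean_decay_left M0 (cgz n.+1) (A:=- A) (k:=n)); last exact: mE.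
  move=> w /gl gw; rewrite cabsM ler_pM ?cabs_ge0// cabs_cexpz.
  by [].
have m_neg (n : nat) : m (- (K + n.+1)%:Z) = 0.
  apply: (vmean_decay_right M0 (cgz _) (A:=A) (k:=n)); last exact: mE.
  move=> w /gr gw; rewrite cabsM (le_trans (ler_wpM2r (cabs_ge0 _) gw))//.
  rewrite cabs_cexpz -mulrA -expRD ler_wpM2l ?(ltW M0)// ler_expR.
  rewrite -mulrDl mulrNz -[(K + n.+1)%:~R]/((K + n.+1)%:R) natrD opprD addrA subrr add0r.
  by [].
(* the coefficient of exp (k w) is the moment against exp (- k w) *)
pose c (k : nat) := m (- k%:Z) / (2 * pi)%:C.
exists c => w; apply/eqP; rewrite -subr_eq0; apply/eqP.
pose S w := \sum_(k < K.+1) c k * cexpz k w.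
rewrite -/(S w).
have cS w' : ccont S w'.
  by apply: ccont_sum => k; apply: ccontM; [exact: ccont_cst|exact: ccont_cexpz].
apply: (@Laurent_uniqueness R (fun w => g w - S w) (complex.Re w + 1) sigma).
- move=> w1 w2 ww; rewrite /S (pg _ _ ww); congr (_ - _).
  by apply: eq_bigr => k _; rewrite (cexpz_periodic _ ww).
- move=> w' _; apply: ccontD; first exact: cg.
  by apply: ccont_ext (ccontM (ccont_cst (-1) w') (cS w')) => u; rewrite mulN1r.
- move=> w' _ ws; have [l dl] := dg w' ws; eexists; apply: cdiffB dl _.
  by apply: cdiff_sum => k; exact: cdiffZ (cdiff_cexpz _ _).
- move=> k s _.
  have cz : forall (j : 'I_K.+1) w, complex.Re w = s -> ccont (fun w => c j * cexpz (j%:Z + k) w) w.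
    by move=> j w' _; apply: ccontM; [exact: ccont_cst|exact: ccont_cexpz].
  rewrite (@vmean_ext _ _ (fun w => g w * cexpz k w - \sum_(j < K.+1) c j * cexpz (j%:Z + k) w)); last first.
    move=> w' _; rewrite mulrBl /S mulr_suml; congr (_ - _); apply: eq_bigr => j _.
    by rewrite -mulrA cexpzD.
  rewrite vmeanB => [||w' ws]; last 2 first.
  + by move=> w' _; exact: cgz.
  + by apply: ccont_sum => j; exact: cz.
  rewrite mE vmean_sum//.
  rewrite (eq_bigr (fun j : 'I_K.+1 => c j * (if j%:Z + k == 0 then (2 * pi)%:C else 0))); last first.
    by move=> j _; rewrite vmeanZ ?vmean_cexpz// => w' _; exact: ccont_cexpz.
  have [kn|kp] := lerP k 0; last first.
    rewrite big1 => [|j _]; last first.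
      by rewrite gt_eqF ?mulr0// ltr_wpDl.
    case: k kp {cz} => [[|n]|n] // _; by rewrite m_pos subr0.
  have [n nk] : exists n : nat, k = - n%:Z.
    by case: k kn {cz} => [[|n]|n] // _; [exists 0%N; rewrite oppr0|exists n.+1; rewrite NegzE].
  have [nK|Kn] := leqP n K; last first.
    rewrite big1 => [|j _]; last first.
      rewrite nk subr_eq0 eqz_nat ltn_eqF ?mulr0// (leq_trans _ Kn)//.
    have -> : k = - (K + (n - K.+1).+1)%:Z by rewrite nk addnS -addSn subnKC.
    by rewrite m_neg subr0.
  rewrite (bigD1 (Ordinal (nK : (n < K.+1)%N)))//= big1 => [|j jn]; last first.
    rewrite nk subr_eq0 eqz_nat; case: eqP => [E|_]; last by rewrite mulr0.
    by move: jn; rewrite -val_eqE /= E eqxx.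
  by rewrite nk subrr eqxx addr0 /c mulfVK ?twopiC_neq0// subrr.
- by rewrite ltrDl.
Qed.

(** In the variable log (z - z0) the moments of f can be computed on a circle
    inside the small disc, where f vanishes. *)
Theorem disc_identity f (z0 : R[i]) rho rho' : 0 < rho' -> 0 < rho ->
  (forall z, cabs (z - z0) < rho -> exists l, cdiff f z l) ->
  (forall z, cabs (z - z0) < rho' -> f z = 0) ->
  forall z, cabs (z - z0) < rho -> f z = 0.
Proof.
move=> r'0 r0 df f0 z zr.
have [->|zz] := eqVneq z z0; first by apply: f0; rewrite subrr cabs0.
pose g w := f (z0 + cexp w).
have zz0 : z - z0 != 0 by rewrite subr_eq0.
have Ew w s : 0 < s -> (complex.Re w < ln s) = (cabs (z0 + cexp w - z0) < s).
  move=> s0; rewrite addrAC subrr add0r cabs_cexp -[in RHS](lnK (_ : s \in Num.pos))//.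
  by rewrite ltr_expR.
have -> : f z = g (clog (z - z0)) by rewrite /g cexp_clog// addrC subrK.
have dg w : complex.Re w < ln rho -> exists l, cdiff g w l.
  rewrite Ew// => /df [l dl]; eexists; apply: (@cdiff_comp _ f (fun w => z0 + cexp w) w l _ _ dl).
  by apply: cdiffD (cdiff_cst _ _) (cdiff_cexp w).
have pg : exp_periodic g by move=> w w' ww; rewrite /g ww.
have cg w : complex.Re w < ln rho -> ccont g w by move=> /dg[l]; exact: cdiff_ccont.
apply: (@Laurent_uniqueness R g (ln rho) (ln rho)) => //.
- by move=> w wr _; exact: dg.
- move=> k s sr; pose s' := Num.min s (ln rho') - 1.
  have m1 : Num.min s (ln rho') <= s by rewrite ge_min lexx.
  have m2 : Num.min s (ln rho') <= ln rho' by rewrite ge_min lexx orbT.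
  rewrite -(@vmean_mulz_const R g k s' s)//.
  + rewrite (@vmean_ext _ _ (fun=> 0)); last first.
      move=> w ws; rewrite /g f0 ?mul0r// -Ew// ws /s'; lra.
    by rewrite /vmean /lint cint_cst ?mulr0//; exact: twopi_ge0.
  + by rewrite /s'; lra.
  + by move=> w /andP[w1 w2]; apply: cg; lra.
  + by move=> w /andP[w1 w2]; apply: dg; lra.
- by rewrite Ew// cexp_clog// (addrC z0) subrK.
Qed.

(** Propagation along the chain of discs with centres (1 + k)^-n z0 and
    proportional radii, each of which contains a disc around the next centre;
    far along the chain the discs lie in the ball where f vanishes. *)
Theorem cone_identity f (z0 : R[i]) d e : 0 < d -> 0 < e ->
  (forall s u, 0 < s <= 1 -> cabs u < d -> exists l, cdiff f (s%:C * (z0 + u)) l) ->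
  (forall s u, 0 < s <= 1 -> cabs u < d -> cabs (s%:C * (z0 + u)) < e -> f (s%:C * (z0 + u)) = 0) ->
  f z0 = 0.
Proof.
move=> d0 e0 df f0.
have a1 : 0 < cabs z0 + 1 by rewrite ltr_wpDl ?cabs_ge0.
(* consecutive centres are closer than half the radius of the disc around the
   outer one *)
pose k := d / 2 / (cabs z0 + 1).
have k0 : 0 < k by rewrite !divr_gt0.
have kz : k * cabs z0 <= d / 2.
  by rewrite /k mulrAC ler_pdivrMr// ler_wpM2l ?lerDl// divr_ge0// ltW.
pose s n := (1 + k)^-1 ^+ n.
have k1 : 0 < 1 + k by lra.
have s01 n : 0 < s n <= 1.
  rewrite exprn_gt0 ?invr_gt0//= exprn_ile1 ?invr_ge0 ?(ltW k1)// invf_le1// lerDl ltW//.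
have sS n : s n = (1 + k) * s n.+1 by rewrite /s exprS mulrA mulfV ?mul1r// gt_eqF.
pose P n := forall z, cabs (z - (s n)%:C * z0) < s n * d -> f z = 0.
have inC n z : cabs (z - (s n)%:C * z0) < s n * d -> exists2 u, cabs u < d & z = (s n)%:C * (z0 + u).
  have /andP[sn0 _] := s01 n.
  have snC : (s n)%:C != 0 :> R[i].
    by rewrite realC_eq0 gt_eqF.
  move=> h; exists ((z - (s n)%:C * z0) / (s n)%:C); last by field.
  by rewrite cabs_div cabs_real gtr0_norm// ltr_pdivrMr// (mulrC d).
have PS n : P n.+1 -> P n.
  move=> Pn; have /andP[s0 _] := s01 n; have /andP[s0' _] := s01 n.+1.
  apply: (@disc_identity f ((s n)%:C * z0) (s n * d) (s n.+1 * d / 2)).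
  - by rewrite divr_gt0// mulr_gt0.
  - by rewrite mulr_gt0.
  - by move=> z /inC[u ud ->]; exact: df.
  move=> z zs; apply: Pn.
  rewrite (_ : z - _ = (z - (s n)%:C * z0) + (k * s n.+1)%:C * z0); last first.
    have -> : (s n)%:C = (k * s n.+1)%:C + (s n.+1)%:C :> R[i].
      by rewrite -rmorphD (sS n); congr (_%:C); rewrite mulrDl mul1r addrC.
    by move: (k * s n.+1)%:C (s n.+1)%:C => X Y; ring.
  rewrite (le_lt_trans (cabsD _ _))// cabsM cabs_real ger0_norm; last by rewrite mulr_ge0// ltW.
  have : k * s n.+1 * cabs z0 <= s n.+1 * (d / 2).
    by rewrite mulrAC mulrC ler_wpM2l// ltW.
  lra.
have [N hN] : exists N, (1 + k)^-1 ^+ N * (cabs z0 + d) < e.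
  apply: expr_lt_eventually => //.
  by rewrite invr_ge0 (ltW k1)/= invf_lt1// ltrDl.
have PN : P N.
  move=> z /inC[u ud ->]; have /andP[s0 s1] := s01 N; apply: f0; rewrite ?s0//.
  rewrite cabsM cabs_real gtr0_norm// (le_lt_trans _ hN)// ler_wpM2l ?(ltW s0)//.
  by rewrite (le_trans (cabsD _ _))// lerD2l ltW.
have P0 : P 0%N by elim: N PN {hN} => // n ih /PS.
apply: P0; have -> : (s 0%N)%:C * z0 = z0 by rewrite /s expr0 rmorph1 mul1r.
by rewrite subrr cabs0 /s expr0 mul1r.
Qed.

End Liouville.

(** * The logarithm on the slit plane *)

Section LogarithmAnalytic.
Variable R : realType.
Implicit Types (f g : R[i] -> R[i]) (z w u l : R[i]) (e d x : R).

(** The complement of the closed negative half-line, written as a boolean. *)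
Definition slit z := (complex.Im z != 0) || (0 < complex.Re z).

Lemma slit_neq0 z : slit z -> z != 0.
Proof. by rewrite /slit; apply: contraL => /eqP -> /=; rewrite eqxx ltxx. Qed.

Lemma slit_pos x : 0 < x -> slit x%:C.
Proof. by move=> x0; rewrite /slit cReImE x0 orbT. Qed.

Lemma Im_sin_carg z : complex.Im z = cabs z * sin (carg z).
Proof.
have [->|z0] := eqVneq z 0; first by rewrite cabs0 mul0r.
by rewrite sin_carg// mulrC divfK// cabs_eq0.
Qed.

Lemma carg_slit z : slit z -> - pi < carg z < pi.
Proof.
move=> sz; have z0 := slit_neq0 sz.
have /andP[c1 c2] := carg_itv z.
have a0 : 0 < cabs z by rewrite cabs_gt0.
suff : carg z != pi /\ carg z != - pi.
  by move=> [n1 n2]; rewrite !lt_neqAle c1 c2 n1 eq_sym n2.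
have key : cos (carg z) = -1 -> sin (carg z) = 0 -> False.
  rewrite cos_carg sin_carg// => h1 h2.
  have iz : complex.Im z = 0.
    by rewrite -(mulfVK (lt0r_neq0 a0) (complex.Im z)) h2 mul0r.
  have rz : complex.Re z = - cabs z.
    by rewrite -[LHS](mulfVK (lt0r_neq0 a0)) h1 mulN1r.
  by move: sz; rewrite /slit iz eqxx rz oppr_gt0 ltNge ltW.
split; apply/eqP => h; apply: key; rewrite h ?cosN ?sinN ?cospi ?sinpi ?oppr0//.
Qed.

Lemma clog_unique z l : cexp l = z -> - pi < complex.Im l < pi -> clog z = l.
Proof.
move=> E /andP[l1 l2].
have z0 : z != 0 by rewrite -E cexp_neq0.
apply: cexp_inj_strip; first by rewrite cexp_clog// E.
rewrite /clog cReImE; have /andP[c1 c2] := carg_itv z.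
by rewrite mulr2n ltr_norml; apply/andP; split; lra.
Qed.

Lemma clog_real x : 0 < x -> clog x%:C = (ln x)%:C.
Proof.
move=> x0; apply: clog_unique; first by rewrite cexp_real lnK.
by rewrite cReImE oppr_lt0 pi_gt0.
Qed.

Lemma carg_gt0 z : 0 < complex.Im z -> 0 < carg z < pi.
Proof.
move=> i0; have sz : slit z by rewrite /slit gt_eqF.
have /andP[_ ->] := carg_slit sz; rewrite andbT.
have : 0 <= carg z.
  by rewrite /carg (ltW i0) acos_ge0// Re_div_cabs_itv.
rewrite le_eqVlt => /predU1P[h|//].
by move: i0; rewrite Im_sin_carg -h sin0 mulr0 ltxx.
Qed.

Lemma carg_lt0 z : complex.Im z < 0 -> - pi < carg z < 0.
Proof.
move=> i0; have sz : slit z by rewrite /slit lt_eqF.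
have /andP[-> _] := carg_slit sz; rewrite /=.
have : carg z <= 0.
  by rewrite /carg [0 <= complex.Im z]leNgt i0 /= oppr_le0 acos_ge0// Re_div_cabs_itv.
rewrite le_eqVlt => /predU1P[h|//].
by move: i0; rewrite Im_sin_carg h sin0 mulr0 ltxx.
Qed.

Lemma carg_pos_real z : complex.Im z = 0 -> 0 < complex.Re z -> carg z = 0.
Proof.
move=> i0 r0; have -> : z = (complex.Re z)%:C by apply: complexP; rewrite ?cReImE.
by have := clog_real r0; rewrite /clog => -[].
Qed.

(** Multiplying by - 1 rotates the upper half-plane clockwise by pi. *)
Lemma clog_opp_gt0 w : 0 < complex.Im w -> clog (- w) = clog w - (pi%:C * 'i%C).
Proof.
move=> w0; have wn0 : w != 0 by apply: contraTneq w0 => ->; rewrite ltxx.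
apply: clog_unique; first by rewrite cexpB cexp_clog// cexp_pii invrN1 mulrN1.
have /andP[h1 h2] := carg_gt0 w0; rewrite /clog !cReImE; apply/andP; split; lra.
Qed.

(** A continuous right inverse of a function with nonzero derivative is
    differentiable, with the inverse derivative. *)
Lemma cdiff_local_inverse f g z m : ccont f z -> m != 0 -> cdiff g (f z) m ->
  (exists2 d, 0 < d & forall u, cabs u < d -> g (f (z + u)) = z + u) ->
  cdiff f z m^-1.
Proof.
move=> cf m0 dg [d0 d00 fg] e e0.
have am : 0 < cabs m by rewrite cabs_gt0.
pose e1 := Num.min (cabs m / 2) (e * cabs m ^+ 2 / 2).
have e10 : 0 < e1 by rewrite lt_min !divr_gt0// mulr_gt0// exprn_gt0.
have e1a : e1 <= cabs m / 2 by rewrite ge_min lexx.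
have e1b : e1 <= e * cabs m ^+ 2 / 2 by rewrite ge_min lexx orbT.
have [d1 d10 h1] := dg _ e10.
have [d2 d20 h2] := cf _ d10.
exists (Num.min d0 d2); first by rewrite lt_min d00.
move=> u; rewrite lt_min => /andP[u0 u2].
set v := f (z + u) - f z.
have := h1 v (h2 _ u2); rewrite /v (addrC (f z)) subrK fg// -/v.
have -> : g (f z) = z by have := fg 0; rewrite addr0 cabs0; exact.
rewrite (addrC z) addrK => k.
have vb : cabs v * (cabs m / 2) <= cabs u.
  have := cabsB u (u - m * v); rewrite opprB addrCA subrr addr0 cabsM.
  have : e1 * cabs v <= cabs m / 2 * cabs v by rewrite ler_wpM2r ?cabs_ge0.
  lra.
rewrite (_ : v - m^-1 * u = - (u - m * v) / m); last by field.
rewrite cabs_div cabsN ler_pdivrMr// (le_trans k)//.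
rewrite -(ler_pM2r (_ : 0 < cabs m / 2)) ?divr_gt0//.
rewrite -mulrA (le_trans (ler_wpM2l (ltW e10) vb))//.
rewrite (_ : e * cabs u * cabs m * (cabs m / 2) = e * cabs m ^+ 2 / 2 * cabs u); last by field.
by rewrite ler_wpM2r ?cabs_ge0.
Qed.

Lemma clog1 : clog (1 : R[i]) = 0.
Proof.
by apply: clog_unique; rewrite ?cexp0// oppr_lt0 pi_gt0.
Qed.

(** Near 1 the argument is the arcsine of Im z / |z|. *)
Lemma ccont_clog1 : ccont (@clog R) 1.
Proof.
move=> e e0.
have /cvgrPdist_lt/(_ (e / 4)) : {for 1, continuous (@ln R)} by apply: continuous_ln.
rewrite divr_gt0// => /(_ isT)[d1 /= d10 h1].
have /cvgrPdist_lt/(_ (e / 4)) : {for 0, continuous (@asin R)}.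
  by apply: continuous_asin; rewrite ltrN10 ltr01.
rewrite divr_gt0// => /(_ isT)[d2 /= d20 h2].
exists (Num.min (Num.min d1 (d2 / 2)) 2^-1).
  by rewrite !lt_min d10 divr_gt0// invr_gt0 ltr0n.
move=> u; rewrite !lt_min => /andP[/andP[u1 u2] u3].
rewrite clog1 subr0.
have a1 : 2^-1 < cabs (1 + u).
  by have := cabs_subr 1 (- u); rewrite opprK cabsN cabs1; lra.
have r0 : 0 < complex.Re (1 + u).
  by have := cabs_Re u; rewrite !cReImE ler_norml => /andP[h _]; lra.
have ne : 1 + u != 0 by rewrite -cabs_gt0; lra.
have dist : `|1 - cabs (1 + u)| <= cabs u.
  have k1 := cabs_subr 1 (- u); have k2 := cabsD 1 u.
  rewrite opprK cabsN cabs1 in k1; rewrite cabs1 in k2.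
  by rewrite ler_norml; apply/andP; split; lra.
have l1 : `|ln (cabs (1 + u))| < e / 4.
  have := h1 (cabs (1 + u)); rewrite /ball_/= ln1 sub0r normrN; apply.
  exact: le_lt_trans dist u1.
(* the cosine of the argument is positive, so it lies in ]- pi/2, pi/2[ where
   the arcsine inverts the sine *)
have carg_asin : carg (1 + u) = asin (complex.Im (1 + u) / cabs (1 + u)).
  rewrite -sin_carg// sinK// in_itv /=.
  have c0 : 0 < cos (carg (1 + u)) by rewrite cos_carg divr_gt0//; lra.
  have /andP[b1 b2] := carg_itv (1 + u).
  have p0 := pi_gt0 R.
  apply/andP; split; rewrite leNgt; apply/negP => h.
    have : 0 <= cos (carg (1 + u) + pi).
      by apply: cos_ge0_pihalf; apply/andP; split; lra.
    rewrite cosDpi; lra.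
  have : 0 <= cos (carg (1 + u) - pi).
    by apply: cos_ge0_pihalf; apply/andP; split; lra.
  rewrite -cosN opprB cosB cospi sinpi; lra.
have l2 : `|carg (1 + u)| < e / 4.
  have := h2 (complex.Im (1 + u) / cabs (1 + u)).
  have asin0 : asin 0 = 0 :> R by rewrite -[X in asin X]sin0 sinK// in_itv/= oppr_le0 divr_ge0// pi_ge0.
  rewrite /ball_/= asin0 !sub0r !normrN -carg_asin; apply.
  rewrite normrM normfV [`|cabs _|]ger0_norm ?cabs_ge0// ltr_pdivrMr; last by lra.
  rewrite cReImE add0r (le_lt_trans (cabs_Im _))// (lt_trans u2)// -[X in X < _]mulrC.
  by rewrite mulrC ltr_pM2l.
by rewrite (le_lt_trans (cabs_le_ReIm _))// /clog !cReImE; lra.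
Qed.

(** Continuity at 1 is transported by multiplication: log (z v) - log z is a
    logarithm of v that is small when v is close to 1, up to a multiple of 2 pi
    i excluded by the slit. *)
Lemma ccont_clog z : slit z -> ccont (@clog R) z.
Proof.
move=> sz; have z0 := slit_neq0 sz.
have /andP[c1 c2] := carg_slit sz.
pose f w := clog z + clog (w / z).
have cw w : ccont (fun w => w / z) w by apply: cdiff_ccont (cdiffM (cdiff_id _) (cdiff_cst _ _)).
have cf : ccont (fun w => clog (w / z)) z.
  by apply: ccont_comp; [exact: cw|rewrite divff//; exact: ccont_clog1].
pose r := Num.min (pi - carg z) (pi + carg z).
have r0 : 0 < r by rewrite lt_min; apply/andP; split; lra.
have r1 : r <= pi - carg z by rewrite ge_min lexx.
have r2 : r <= pi + carg z by rewrite ge_min lexx orbT.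
have [d d0 h] := cf _ r0.
apply: (@ccont_near _ f); last by apply: ccontD => //; exact: ccont_cst.
have az : 0 < cabs z by rewrite cabs_gt0.
exists (Num.min d (cabs z)); first by rewrite lt_min d0.
move=> u; rewrite lt_min => /andP[ud uz]; apply/esym.
have zu : z + u != 0.
  by rewrite -cabs_gt0; have := cabs_subr z (- u); rewrite opprK cabsN; lra.
apply: clog_unique.
  by rewrite /f cexpD !cexp_clog// ?mulf_neq0 ?invr_eq0// mulrC divfK.
have := h _ ud; rewrite divff// clog1 subr0 => k.
have := le_lt_trans (cabs_Im _) k; rewrite ltr_norml /f cImD [complex.Im (clog z)]/= => /andP[k1 k2].
by apply/andP; split; lra.
Qed.

Lemma slit_open z : slit z -> exists2 d, 0 < d & forall u, cabs u < d -> slit (z + u).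
Proof.
rewrite /slit => /orP[i0|r0].
  exists `|complex.Im z|; first by rewrite normr_gt0.
  move=> u ud; rewrite cImD; apply/orP; left; apply/eqP => E.
  have : complex.Im z = - complex.Im u by lra.
  move=> E2; have := le_lt_trans (cabs_Im u) ud; rewrite E2 normrN ltxx//.
exists (complex.Re z) => // u ud; rewrite cReD; apply/orP; right.
by have := le_lt_trans (cabs_Re u) ud; rewrite ltr_norml => /andP[h _]; lra.
Qed.

Lemma cdiff_clog z : slit z -> cdiff (@clog R) z z^-1.
Proof.
move=> sz; have z0 := slit_neq0 sz.
apply: (@cdiff_local_inverse _ (@cexp R)) => //; first exact: ccont_clog.
  by apply: cdiff_eq (cdiff_cexp _) _; rewrite cexp_clog.
have [d d0 h] := slit_open sz; exists d => // u /h /slit_neq0; exact: cexp_clog.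
Qed.

Lemma cdiff_clog_comp f z l : slit (f z) -> cdiff f z l -> cdiff (fun w => clog (f w)) z (l / f z).
Proof.
by move=> sz df; apply: cdiff_eq (cdiff_comp df (cdiff_clog sz)) _; rewrite mulrC.
Qed.

Lemma slitD w x : slit w -> 0 <= x -> slit (w + x%:C).
Proof.
rewrite /slit !cReImE addr0 => /orP[->//|r0] x0.
by apply/orP; right; rewrite ltr_wpDr.
Qed.

(** Adding a positive real moves the argument towards 0 without passing it, so
    that the difference of the arguments is again a principal argument. *)
Lemma clog_addr_div w x : slit w -> 0 <= x -> clog (w + x%:C) - clog w = clog (1 + x%:C / w).
Proof.
move=> sw x0; have w0 := slit_neq0 sw; have sw' := slitD sw x0; have w'0 := slit_neq0 sw'.
apply/esym/clog_unique.
  by rewrite cexpB !cexp_clog//; field.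
rewrite cImD cImN [complex.Im (clog _)]/= [X in _ < _ - X < _]/=.
have [h|h|h] := ltgtP (complex.Im w) 0.
- have h' : complex.Im (w + x%:C) < 0 by rewrite !cReImE addr0.
  have /andP[a1 a2] := carg_lt0 h; have /andP[b1 b2] := carg_lt0 h'.
  by apply/andP; split; lra.
- have h' : 0 < complex.Im (w + x%:C) by rewrite !cReImE addr0.
  have /andP[a1 a2] := carg_gt0 h; have /andP[b1 b2] := carg_gt0 h'.
  by apply/andP; split; lra.
- have r0 : 0 < complex.Re w by move: sw; rewrite /slit h eqxx.
  rewrite !carg_pos_real ?subrr ?oppr_lt0 ?pi_gt0// !cReImE ?h ?addr0//.
  by rewrite ltr_wpDr.
Qed.

Lemma slit_near1 u : cabs u < 1 -> slit (1 + u).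
Proof.
move=> u1; apply/orP; right; rewrite !cReImE.
by have := le_lt_trans (cabs_Re u) u1; rewrite ltr_norml => /andP[h _]; lra.
Qed.

(** Mean value inequality for the remainder, whose derivative is u^2 / (1 + u).
    *)
Lemma clog_taylor2 u : cabs u <= 2^-1 ->
  cabs (clog (1 + u) - u + u ^+ 2 / 2) <= 2 * cabs u ^+ 3.
Proof.
move=> u2.
pose phi w := clog (1 + w) - w + w ^+ 2 / 2.
have E : phi 0 = 0 by rewrite /phi addr0 clog1 expr0n /= mul0r subr0 addr0.
have := @mean_value_cdiff _ phi (fun w => w ^+ 2 / (1 + w)) 0 u (2 * cabs u ^+ 2).
rewrite add0r E subr0 -mulrA -exprSr; apply.
- move=> t /andP[t0 t1]; rewrite add0r; set w := t%:C * u.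
  have w2 : cabs w <= 2^-1.
    rewrite cabsM cabs_real ger0_norm// (le_trans _ u2)// ler_piMl ?cabs_ge0//.
  have sw : slit (1 + w) by apply: slit_near1; lra.
  have w0 := slit_neq0 sw.
  have d1 : cdiff (fun w => 1 + w) w 1.
    by apply: cdiff_eq (cdiffD (cdiff_cst 1 _) (cdiff_id _)) _; rewrite add0r.
  apply: cdiff_eq (cdiffD (cdiffB (cdiff_clog_comp sw d1) (cdiff_id w))
     (cdiffM (cdiffX 2 (cdiff_id w)) (cdiff_cst 2^-1 w))) _.
  by rewrite /=; field.
- move=> t /andP[t0 t1]; rewrite add0r; set w := t%:C * u.
  have wu : cabs w <= cabs u.
    by rewrite cabsM cabs_real ger0_norm// ler_piMl ?cabs_ge0.
  have k := cabs_subr 1 (- w); rewrite opprK cabsN cabs1 in k.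
  rewrite cabs_div cabsX ler_pdivrMr; last by lra.
  apply: (le_trans (_ : _ <= cabs u ^+ 2)); first by rewrite lerXn2r ?nnegrE ?cabs_ge0.
  rewrite -mulrA mulrCA ler_peMr ?sqr_ge0//; lra.
Qed.

(** The derivative of the remainder after k terms is - u^k / (1 - u). *)
Lemma clog_mercator u k : cabs u < 1 ->
  cabs (clog (1 - u) + \sum_(j < k) u ^+ j.+1 / j.+1%:R) <= cabs u ^+ k / (1 - cabs u) * cabs u.
Proof.
move=> u1.
pose phi w := clog (1 - w) + \sum_(j < k) w ^+ j.+1 / j.+1%:R.
have E : phi 0 = 0.
  rewrite /phi subr0 clog1 add0r big1// => j _.
  by rewrite expr0n /= mul0r.
have := @mean_value_cdiff _ phi (fun w => - w ^+ k / (1 - w)) 0 u (cabs u ^+ k / (1 - cabs u)).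
rewrite add0r E subr0; apply.
- move=> t /andP[t0 t1]; rewrite add0r; set w := t%:C * u.
  have w2 : cabs w < 1.
    by rewrite cabsM cabs_real ger0_norm// (le_lt_trans _ u1)// ler_piMl ?cabs_ge0.
  have sw : slit (1 - w) by apply: slit_near1; rewrite cabsN.
  have w0 := slit_neq0 sw.
  have d1 : cdiff (fun w => 1 - w) w (-1).
    by apply: cdiff_eq (cdiffB (cdiff_cst 1 _) (cdiff_id _)) _; rewrite sub0r.
  have d2 : cdiff (fun w => \sum_(j < k) w ^+ j.+1 / j.+1%:R) w (\sum_(j < k) w ^+ j).
    apply: cdiff_sum => j.
    apply: cdiff_eq (cdiffM (cdiffX j.+1 (cdiff_id w)) (cdiff_cst j.+1%:R^-1 w)) _.
    by rewrite /= mulr0 addr0 mulr1 mulrAC mulfV ?mul1r// pnatr_eq0.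
  have d3 := @cdiff_clog_comp (fun w => 1 - w) w _ sw d1.
  apply: cdiff_eq (cdiffD d3 d2) _.
  apply: (mulIf w0); rewrite mulrDl !mulfVK//.
  have H := subrX1 w k; set T := \sum_(i < k) _ in H *.
  by rewrite (_ : T * (1 - w) = - ((w - 1) * T)); [rewrite -H|]; ring.
- move=> t /andP[t0 t1]; rewrite add0r; set w := t%:C * u.
  have wu : cabs w <= cabs u.
    by rewrite cabsM cabs_real ger0_norm// ler_piMl ?cabs_ge0.
  have k1 := cabs_subr 1 w; rewrite cabs1 in k1.
  rewrite cabs_div cabsN cabsX; apply: ler_pM; rewrite ?exprn_ge0 ?invr_ge0 ?cabs_ge0//.
    by rewrite lerXn2r ?nnegrE ?cabs_ge0.
  by rewrite lef_pV2 ?posrE; lra.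
Qed.

End LogarithmAnalytic.

(** * Gudermann's series *)

Section ComplexSequences.
Variable R : realType.
Implicit Types (a b : nat -> R[i]) (z w u l : R[i]) (e d x : R).

(** Convergence with the real modulus; [ctends_lim] identifies the limit with
    that of the normed module. *)
Definition ctends a l := forall e, 0 < e -> exists N, forall n, (N <= n)%N -> cabs (a n - l) < e.

Lemma ctends_cvg a l : ctends a l -> (a : nat -> R[i]^o) @ \oo --> (l : R[i]^o).
Proof.
move=> al; apply/cvgrPdist_lt => e; rewrite ltcE => /andP[/eqP eI eR].
have eE : e = (complex.Re e)%:C by apply: complexP; rewrite ?cReImE.
have [N H] := al _ eR; exists N => // n /= nN.
by rewrite distrC [`|_|]cabs_normC eE ltcR H.
Qed.

Lemma ctends_lim a l : ctends a l -> lim ((a : nat -> R[i]^o) @ \oo) = l.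
Proof. by move=> /ctends_cvg al; apply/cvg_lim => //; exact: norm_hausdorff. Qed.

Lemma ctends_uniq a l l' : ctends a l -> ctends a l' -> l = l'.
Proof. by move=> /ctends_lim <- /ctends_lim <-. Qed.

Lemma ctends_near a b l N : (forall n, (N <= n)%N -> a n = b n) -> ctends a l -> ctends b l.
Proof.
move=> ab al e e0; have [M H] := al e e0; exists (maxn N M) => n.
by rewrite geq_max => /andP[nN nM]; rewrite -ab// H.
Qed.

Lemma ctends_ext a b l : (forall n, a n = b n) -> ctends a l -> ctends b l.
Proof. by move=> ab; apply: (@ctends_near _ _ _ 0) => n _; exact: ab. Qed.

Lemma ctends_cst l : ctends (fun=> l) l.
Proof. by move=> e e0; exists 0%N => n _; rewrite subrr cabs0. Qed.

Lemma ctends_comp a l f : ctends a l -> ccont f l -> ctends (fun n => f (a n)) (f l).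
Proof.
move=> al cf e e0; have [d d0 H] := cf e e0; have [N K] := al d d0.
by exists N => n nN; have := H _ (K n nN); rewrite (addrC l) subrK.
Qed.

Lemma ctendsD a b l m : ctends a l -> ctends b m -> ctends (fun n => a n + b n) (l + m).
Proof.
move=> al bm e e0; have e2 : 0 < e / 2 by rewrite divr_gt0.
have [N H] := al _ e2; have [M K] := bm _ e2; exists (maxn N M) => n.
rewrite geq_max => /andP[/H h1 /K h2].
rewrite opprD addrACA (le_lt_trans (cabsD _ _))//; lra.
Qed.

Lemma ctendsM a b l m : ctends a l -> ctends b m -> ctends (fun n => a n * b n) (l * m).
Proof.
move=> al bm e e0.
have P (y : R[i]) : 0 < cabs y + 1 by rewrite ltr_wpDl ?cabs_ge0.
have [|N H] := al (Num.min 1 (e / 3 / (cabs m + 1))).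
  by rewrite lt_min ltr01 !divr_gt0.
have [|M K] := bm (Num.min (e / 3) (e / 3 / (cabs l + 1))).
  by rewrite lt_min !divr_gt0.
exists (maxn N M) => n.
rewrite geq_max => /andP[/H + /K]; rewrite !lt_min => /andP[a1 a2] /andP[b1 b2].
rewrite (_ : _ - _ = (a n - l) * (b n - m) + ((a n - l) * m + l * (b n - m))); last by ring.
set x := a n - l in a1 a2 *; set y := b n - m in b1 b2 *.
have k1 : cabs (x * y) <= e / 3.
  by rewrite cabsM -[leRHS]mul1r; apply: ler_pM; rewrite ?cabs_ge0 ?(ltW a1) ?(ltW b1).
have k2 : cabs (x * m) < e / 3.
  rewrite cabsM; apply: (@le_lt_trans _ _ (cabs x * (cabs m + 1))).
    by rewrite ler_wpM2l ?cabs_ge0// lerDl.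
  by rewrite -ltr_pdivlMr.
have k3 : cabs (l * y) < e / 3.
  rewrite cabsM mulrC; apply: (@le_lt_trans _ _ (cabs y * (cabs l + 1))).
    by rewrite ler_wpM2l ?cabs_ge0// lerDl.
  by rewrite -ltr_pdivlMr.
have := cabsD (x * y) (x * m + l * y).
have := cabsD (x * m) (l * y).
lra.
Qed.

Lemma ctendsB a b l m : ctends a l -> ctends b m -> ctends (fun n => a n - b n) (l - m).
Proof.
move=> al bm; apply: (ctends_ext (a:=fun n => a n + -1 * b n)) => [n|]; first by rewrite mulN1r.
have -> : l - m = l + -1 * m by rewrite mulN1r.
by apply: ctendsD => //; apply: ctendsM => //; exact: ctends_cst.
Qed.

Lemma ctends_shift a l k : ctends a l -> ctends (fun n => a (k + n)%N) l.
Proof.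
by move=> al e e0; have [N H] := al e e0; exists N => n nN; apply: H; rewrite (leq_trans nN)// leq_addl.
Qed.

Lemma ctends_le a l N x : ctends a l -> (forall n, (N <= n)%N -> cabs (a n) <= x) -> cabs l <= x.
Proof.
move=> al ax; apply/ler_addgt0Pr => e e0; have [M H] := al e e0.
have h1 := H _ (leq_maxr N M); have h2 := ax _ (leq_maxl N M).
rewrite cabsBC in h1; have := cabs_subr l (a (maxn N M)); lra.
Qed.

Lemma ctends_inv_nat : ctends (fun n => n%:R^-1) 0.
Proof.
move=> e e0; exists (Num.bound e^-1) => n nN.
have b : e^-1 < (Num.bound e^-1)%:R by apply: archi_boundP; rewrite invr_ge0 ltW.
have n0 : 0 < n%:R :> R by rewrite (lt_le_trans _ (_ : (Num.bound e^-1)%:R <= _)) ?ler_nat// (lt_trans _ b)// invr_gt0.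
rewrite subr0 cabsV cabs_nat -[ltRHS]invrK ltf_pV2 ?posrE ?invr_gt0//.
by rewrite (lt_le_trans b)// ler_nat.
Qed.

(** Completeness, componentwise. *)
Lemma ccauchy_cvg a : (forall e, 0 < e -> exists N, forall n, (N <= n)%N -> cabs (a n - a N) < e) ->
  exists l, ctends a l.
Proof.
move=> H.
have K (p : R[i] -> R) : (forall z w, `|p z - p w| <= cabs (z - w)) -> cvg ((p \o a) @ \oo).
  move=> pl; apply/cauchy_cvgP/cauchy_exP => e e0.
  have [N HN] := H e e0; exists (p (a N)); exists N => // n /= nN.
  by rewrite /ball/= distrC (le_lt_trans (pl _ _))// HN.
have cR := K (@complex.Re R) (ltac:(by move=> z w; rewrite -cReN -cReD cabs_Re)).
have cI := K (@complex.Im R) (ltac:(by move=> z w; rewrite -cImN -cImD cabs_Im)).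
exists (lim ((@complex.Re R \o a) @ \oo) +i* lim ((@complex.Im R \o a) @ \oo)) => e e0.
have e2 : 0 < e / 2 by rewrite divr_gt0.
move: cR cI => /cvgrPdist_lt/(_ _ e2)[N _ hN] /cvgrPdist_lt/(_ _ e2)[M _ hM].
exists (maxn N M) => n; rewrite geq_max => /andP[/hN h1 /hM h2].
rewrite (le_lt_trans (cabs_le_ReIm _))// !cReImE.
rewrite /= distrC in h1; rewrite /= distrC in h2; lra.
Qed.

(** A quadratic error term that is uniform along the sequence passes to the
    limit; this avoids any statement on uniform convergence of derivatives. *)
Lemma cdiff_limit (f_ : nat -> R[i] -> R[i]) (l_ : nat -> R[i]) f z l B d : 0 < d ->
  (forall u, cabs u < d -> ctends (fun n => f_ n (z + u)) (f (z + u))) ->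
  ctends l_ l ->
  (forall n u, cabs u < d -> cabs (f_ n (z + u) - f_ n z - l_ n * u) <= B * cabs u ^+ 2) ->
  cdiff f z l.
Proof.
move=> d0 cf cl H.
have K u : cabs u < d -> cabs (f (z + u) - f z - l * u) <= B * cabs u ^+ 2.
  move=> ud; apply: (@ctends_le (fun n => f_ n (z + u) - f_ n z - l_ n * u) _ 0); last first.
    by move=> n _; exact: H.
  have c0 := cf 0; rewrite addr0 cabs0 in c0.
  exact: ctendsB (ctendsB (cf u ud) (c0 d0)) (ctendsM cl (ctends_cst u)).
have B0 : 0 <= `|B| + 1 by rewrite addr_ge0.
have B1 : 0 < `|B| + 1 by rewrite ltr_wpDl.
move=> e e0; exists (Num.min d (e / (`|B| + 1))); first by rewrite lt_min d0 divr_gt0.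
move=> u; rewrite lt_min => /andP[ud]; rewrite ltr_pdivlMr// => ue.
rewrite (le_trans (K _ ud))// expr2 mulrA ler_wpM2r ?cabs_ge0//.
rewrite mulrC (le_trans _ (ltW ue))// ler_wpM2l ?cabs_ge0//.
by rewrite (le_trans (ler_norm B))// lerDl.
Qed.

(** Supplies the uniform remainder of [cdiff_limit] from a bound of the second
    derivative. *)
Lemma taylor1_bound f f' f'' z d K :
  (forall u, cabs u < d -> cdiff f (z + u) (f' (z + u))) ->
  (forall u, cabs u < d -> cdiff f' (z + u) (f'' (z + u))) ->
  (forall u, cabs u < d -> cabs (f'' (z + u)) <= K) ->
  forall u, cabs u < d -> cabs (f (z + u) - f z - f' z * u) <= K * cabs u ^+ 2.
Proof.
move=> df df' fK u ud.
have tu (t : R) v : 0 <= t <= 1 -> cabs (t%:C * v) <= cabs v.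
  by move=> /andP[t0 t1]; rewrite cabsM cabs_real ger0_norm// ler_piMl ?cabs_ge0.
have K0 : 0 <= K by rewrite (le_trans _ (fK 0 _)) ?cabs_ge0 ?cabs0// (le_lt_trans _ ud) ?cabs_ge0.
have := @mean_value_cdiff _ (fun w => f w - f' z * w) (fun w => f' w - f' z) z u (K * cabs u).
rewrite -mulrA -expr2 (_ : _ - _ - _ = f (z + u) - f z - f' z * u); last by ring.
apply.
- move=> t t01; apply: cdiff_eq (cdiffB (df _ _) (cdiffZ (f' z) (cdiff_id _))) _; rewrite ?mulr1//.
  exact: le_lt_trans (tu _ _ t01) ud.
- move=> t t01; set v := t%:C * u.
  have vu : cabs v <= cabs u by exact: tu.
  rewrite (le_trans (@mean_value_cdiff _ f' f'' z v K _ _))//.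
  + by move=> s s01; apply: df'; rewrite (le_lt_trans (tu _ _ s01))// (le_lt_trans vu).
  + by move=> s s01; apply: fK; rewrite (le_lt_trans (tu _ _ s01))// (le_lt_trans vu).
  + by rewrite ler_wpM2l.
Qed.

End ComplexSequences.

Section Gudermann.
Variable R : realType.
Implicit Types (z w u l : R[i]) (e d x eta : R) (h : R[i] -> R[i]).

(** The general term of Gudermann's series: the sum of the gud (z + m), m >= 0,
    is log Gamma(z) - (z - 1/2) log z + z - log (2 pi) / 2. *)
Definition gud z := (z + 2^-1) * (clog (z + 1) - clog z) - 1.
Definition gud' z := clog (z + 1) - clog z - (z^-1 + (z + 1)^-1) / 2.
Definition gud'' z := (2 * z ^+ 2 * (z + 1) ^+ 2)^-1.

Lemma slit_add1 z : slit z -> slit (z + 1).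
Proof. by move=> sz; have := slitD sz (@ler01 R); rewrite rmorph1. Qed.

Lemma slit_addn z (n : nat) : slit z -> slit (z + n%:R).
Proof. by move=> sz; have := slitD sz (ler0n R n); rewrite rmorph_nat. Qed.

Lemma cdiff_gud z : slit z -> cdiff gud z (gud' z).
Proof.
move=> sz; have sz1 := slit_add1 sz; have z0 := slit_neq0 sz; have z1 := slit_neq0 sz1.
have dz c : cdiff (fun w => w + c) z 1.
  by apply: cdiff_eq (cdiffD (cdiff_id z) (cdiff_cst c z)) _; rewrite addr0.
have d1 := @cdiff_clog_comp _ (fun w => w + 1) z _ sz1 (dz 1).
apply: cdiff_eq (cdiffB (cdiffM (dz 2^-1) (cdiffB d1 (cdiff_clog sz))) (cdiff_cst 1 z)) _.
by rewrite /gud'; field; rewrite z0 z1.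
Qed.

Lemma cdiff_gud' z : slit z -> cdiff gud' z (gud'' z).
Proof.
move=> sz; have sz1 := slit_add1 sz; have z0 := slit_neq0 sz; have z1 := slit_neq0 sz1.
have dz c : cdiff (fun w => w + c) z 1.
  by apply: cdiff_eq (cdiffD (cdiff_id z) (cdiff_cst c z)) _; rewrite addr0.
have d1 := @cdiff_clog_comp _ (fun w => w + 1) z _ sz1 (dz 1).
have d2 := @cdiff_inv _ (fun w => w + 1) z _ z1 (dz 1).
apply: cdiff_eq (cdiffB (cdiffB d1 (cdiff_clog sz)) (cdiffM (cdiffD (cdiffV z0) d2) (cdiff_cst 2^-1 z))) _.
by rewrite /gud''; field; rewrite z0 z1.
Qed.

Lemma inv_small z : 2 <= cabs z -> [/\ z != 0, cabs z^-1 <= 2^-1 & 1 + z^-1 != 0].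
Proof.
move=> z2; have z0 : z != 0 by rewrite -cabs_gt0; lra.
have zi : cabs z^-1 <= 2^-1 by rewrite cabsV lef_pV2 ?posrE//; lra.
split => //; rewrite -cabs_gt0; have := cabs_subr 1 (- z^-1).
by rewrite opprK cabsN cabs1; lra.
Qed.

(** With u = 1 / z the difference of logarithms is log (1 + u), and the second
    order expansion of (1 / u + 1 / 2) log (1 + u) - 1 starts with u^2 / 12. *)
Lemma gud_bound z : slit z -> 2 <= cabs z -> cabs (gud z) <= 3 * cabs z^-1 ^+ 2.
Proof.
move=> sz z2; have [z0 zi _] := inv_small z2.
have := clog_taylor2 zi.
have := clog_addr_div sz (@ler01 R); rewrite rmorph1 mul1r.
set u := z^-1 in zi * => E.
have -> : gud z = (u^-1 + 2^-1) * clog (1 + u) - 1 by rewrite /gud E invrK.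
set r := clog (1 + u) - u + _ => hr.
have u0 : u != 0 by rewrite invr_eq0.
have -> : clog (1 + u) = r + u - u ^+ 2 / 2 by rewrite /r; ring.
have -> : (u^-1 + 2^-1) * (r + u - u ^+ 2 / 2) - 1 = r / u + (r / 2 - u ^+ 2 / 4) by field.
have a0 : 0 < cabs u by rewrite cabs_gt0.
have k1 : cabs (r / u) <= 2 * cabs u ^+ 2.
  by rewrite cabs_div ler_pdivrMr// -mulrA -exprSr.
have k2 : cabs (r / 2) <= cabs u ^+ 2 / 2.
  rewrite cabs_div (_ : cabs 2 = 2); last exact: cabs_nat.
  rewrite ler_pM2r ?invr_gt0//; apply: (le_trans hr).
  by rewrite exprS mulrA ler_piMl ?sqr_ge0//; lra.
have k3 : cabs (u ^+ 2 / 4) = cabs u ^+ 2 / 4.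
  by rewrite cabs_div cabsX (_ : cabs 4 = 4)//; exact: cabs_nat.
have := cabsD (r / u) (r / 2 - u ^+ 2 / 4); have := cabsB (r / 2) (u ^+ 2 / 4).
have : 0 <= cabs u ^+ 2 by rewrite sqr_ge0.
lra.
Qed.

Lemma gud'_bound z : slit z -> 2 <= cabs z -> cabs (gud' z) <= 3 * cabs z^-1 ^+ 2.
Proof.
move=> sz z2; have [z0 zi z1] := inv_small z2.
have := clog_taylor2 zi.
have := clog_addr_div sz (@ler01 R); rewrite rmorph1 mul1r.
set u := z^-1 in zi z1 * => E.
have u0 : u != 0 by rewrite invr_eq0.
have -> : gud' z = clog (1 + u) - (u + u / (1 + u)) / 2.
  rewrite /gud' E -/u; congr (_ - (_ + _) / 2).
  have z1' := slit_neq0 (slit_add1 sz).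
  apply: (mulIf z1'); rewrite mulVf// mulrAC (_ : u * (z + 1) = 1 + u) ?divff//.
  by rewrite mulrDr mulr1 mulVf.
set r := clog (1 + u) - u + _ => hr.
have -> : clog (1 + u) = r + u - u ^+ 2 / 2 by rewrite /r; ring.
have -> : r + u - u ^+ 2 / 2 - (u + u / (1 + u)) / 2 = r - u ^+ 3 / (2 * (1 + u)) by field.
have a0 : 0 < cabs u by rewrite cabs_gt0.
have b1 : 2^-1 <= cabs (1 + u).
  by have := cabs_subr 1 (- u); rewrite opprK cabsN cabs1; lra.
have k2 : cabs (u ^+ 3 / (2 * (1 + u))) <= cabs u ^+ 3.
  rewrite cabs_div (cabsM 2) (_ : cabs 2 = 2); last exact: cabs_nat.
  rewrite ler_pdivrMr; last by lra.
  by rewrite cabsX ler_peMr ?exprn_ge0 ?cabs_ge0//; lra.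
have k3 : cabs u ^+ 3 <= cabs u ^+ 2.
  by rewrite exprS ler_piMl ?sqr_ge0//; lra.
have := cabsB r (u ^+ 3 / (2 * (1 + u))).
lra.
Qed.

(** For 0 < eta <= 1 a closed sector around the positive axis that avoids the
    open negative axis: - cos (arg z) <= 1 - eta. *)
Definition insector eta z := - (1 - eta) * cabs z <= complex.Re z.

Lemma insector_slit eta z : 0 < eta -> z != 0 -> insector eta z -> slit z.
Proof.
rewrite /insector => e0 z0 sz; rewrite /slit; have [iz|//] := eqVneq (complex.Im z) 0.
have a0 : 0 < cabs z by rewrite cabs_gt0.
rewrite /= ltNge; apply/negP => r0.
have cz : cabs z = - complex.Re z by rewrite cabsE iz expr0n addr0 sqrtr_sqr ler0_norm.
have : 0 < eta * cabs z by rewrite mulr_gt0.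
by move: sz; rewrite mulNr mulrBl mul1r; lra.
Qed.

Lemma cabs_sqr z : cabs z ^+ 2 = complex.Re z ^+ 2 + complex.Im z ^+ 2.
Proof. by rewrite cabsE sqr_sqrtr// addr_ge0 ?sqr_ge0. Qed.

(** In the sector, z + x cannot be much smaller than |z| + x. *)
Lemma insector_add eta z x : 0 < eta <= 1 -> insector eta z -> 0 <= x ->
  eta / 2 * (cabs z + x) ^+ 2 <= cabs (z + x%:C) ^+ 2.
Proof.
move=> /andP[e0 e1] sz x0.
have -> : cabs (z + x%:C) ^+ 2 = cabs z ^+ 2 + 2 * x * complex.Re z + x ^+ 2.
  by rewrite !cabs_sqr !cReImE addr0; ring.
have h1 : 2 * x * (- (1 - eta) * cabs z) <= 2 * x * complex.Re z by rewrite ler_wpM2l// mulr_ge0.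
have := mulr_ge0 (_ : 0 <= 1 - eta / 2) (sqr_ge0 (cabs z - x)); rewrite subr_ge0 => /(_ (ltac:(lra))).
have : 0 <= eta * (cabs z * x) by rewrite !mulr_ge0 ?cabs_ge0// ltW.
have : 0 <= eta * cabs z ^+ 2 by rewrite mulr_ge0 ?sqr_ge0// ltW.
rewrite !expr2; nra.
Qed.

(** 1 / y^2 <= 1 / (y - 1) - 1 / y. *)
Lemma telescope_inv_sqr (x : R) (n : nat) : 1 < x ->
  \sum_(m < n) (x + m%:R) ^- 2 <= (x - 1)^-1.
Proof.
move=> x1; suff : \sum_(m < n) (x + m%:R) ^- 2 <= (x - 1)^-1 - (x - 1 + n%:R)^-1.
  move=> /le_trans; apply; rewrite gerDl oppr_le0 invr_ge0 addr_ge0// subr_ge0 ltW//.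
elim: n => [|n ih]; first by rewrite big_ord0 addr0 subrr.
rewrite big_ord_recr /= (le_trans (lerD ih (lexx _)))//.
have n0 : 0 <= n%:R :> R by [].
set y := x + n%:R; have y1 : 1 < y by rewrite /y; lra.
have -> : x - 1 + n%:R = y - 1 by rewrite /y; ring.
have -> : x - 1 + n.+1%:R = y by rewrite /y -natr1; ring.
suff : y ^- 2 <= (y - 1)^-1 - y^-1 by lra.
have -> : (y - 1)^-1 - y^-1 = ((y - 1) * y)^-1 by field; rewrite !gt_eqF//; lra.
rewrite lef_pV2 ?posrE ?mulr_gt0 ?exprn_gt0 ?subr_gt0//; try lra.
Qed.

Definition hsum h (n : nat) z := \sum_(m < n) h (z + m%:R).

Lemma hsum_split h k n z : hsum h (k + n) z = hsum h k z + hsum h n (z + k%:R).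
Proof.
rewrite /hsum big_split_ord /=; congr (_ + _); apply: eq_bigr => i _.
by rewrite natrD addrA.
Qed.

(** A summand that is O(1 / z^2) has sums that are O(1 / z), because |z + m|^2
    is at least (eta / 2) (|z| + m)^2 in the sector. *)
Lemma hsum_bound h eta : (forall z, slit z -> 2 <= cabs z -> cabs (h z) <= 3 * cabs z^-1 ^+ 2) ->
  0 < eta <= 1 -> forall z, insector eta z -> 2 / eta + 2 <= cabs z -> forall n,
  cabs (hsum h n z) <= 6 / eta / (cabs z - 1).
Proof.
move=> hb e01 z sz zM n; have /andP[e0 e1] := e01.
have ei : 0 < 2 / eta by rewrite divr_gt0.
have z0 : z != 0 by rewrite -cabs_gt0; lra.
have sl := insector_slit e0 z0 sz.
rewrite (le_trans (cabs_sum _ _ _))//.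
apply: (@le_trans _ _ (\sum_(m < n) 6 / eta * (cabs z + m%:R) ^- 2)); last first.
  by rewrite -mulr_sumr ler_wpM2l ?divr_ge0 ?(ltW e0)//; apply: telescope_inv_sqr; lra.
apply: ler_sum => m _.
have := insector_add e01 sz (ler0n R m); rewrite rmorph_nat => k.
have zm : 0 < cabs z + m%:R by rewrite ltr_pwDl// cabs_gt0.
have q0 : 0 < cabs (z + m%:R) ^+ 2.
  by rewrite (lt_le_trans _ k)// mulr_gt0 ?divr_gt0// exprn_gt0.
have big : 2 <= cabs (z + m%:R).
  rewrite -(@ler_pXn2r _ 2)// ?nnegrE ?cabs_ge0// (le_trans _ k)//.
  have : (2 / eta + 2) ^+ 2 <= (cabs z + m%:R) ^+ 2.
    rewrite lerXn2r ?nnegrE//; [lra|exact: ltW|].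
    by rewrite (le_trans zM)// lerDl.
  move=> /(ler_wpM2l (_ : 0 <= eta / 2)) => /(_ (ltac:(by rewrite divr_ge0// ltW))) /(le_trans _); apply.
  rewrite (_ : eta / 2 * _ = 2 / eta + 4 + 2 * eta); last by field; rewrite gt_eqF.
  lra.
rewrite (le_trans (hb _ (slit_addn m sl) big))//.
rewrite cabsV exprVn -mulrA; have -> : 6 = 3 * 2 :> R by rewrite -natrM.
rewrite -!mulrA ler_pM2l// mulrA -[leRHS]invrK lef_pV2 ?posrE//; last first.
  by rewrite invr_gt0 !divr_gt0// exprn_gt0.
by rewrite invfM invf_div invrK.
Qed.

(** The tail from N on is the sum at z + N, which lies in every sector when N
    is large. *)
Lemma hsum_cvg h : (forall z, slit z -> 2 <= cabs z -> cabs (h z) <= 3 * cabs z^-1 ^+ 2) ->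
  forall z, slit z -> exists l, ctends (fun n => hsum h n z) l.
Proof.
move=> hb z sz; apply: ccauchy_cvg => e e0.
pose N := Num.bound (6 / e + 5 + cabs z).
have bN : 6 / e + 5 + cabs z < N%:R.
  by apply: archi_boundP; rewrite !addr_ge0 ?cabs_ge0// divr_ge0// ltW.
have e6 : 0 < 6 / e by rewrite divr_gt0.
have RN : 6 / e + 5 < complex.Re (z + N%:R).
  have := cabs_Re z; rewrite ler_norml => /andP[h1 _].
  rewrite -(rmorph_nat (real_complex R)) !cReImE; lra.
have aN : complex.Re (z + N%:R) <= cabs (z + N%:R) by rewrite (le_trans (ler_norm _))// cabs_Re.
exists N => n nN; rewrite -(subnKC nN) hsum_split addrAC subrr add0r.
have := @hsum_bound h 1 hb _ (z + N%:R) _ _ (n - N)%N.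
rewrite ltr01 lexx !divr1 => /(_ isT) k; rewrite (le_lt_trans (k _ _))//.
- by rewrite /insector subrr oppr0 mul0r; lra.
- by lra.
rewrite ltr_pdivrMr; last by lra.
rewrite mulrC -ltr_pdivrMr//; lra.
Qed.

(** Gudermann's series, which turns out to be log Lambda on the slit plane
    ([LambdaE]). *)
Definition logLam z := xget 0 [set l | ctends (fun n => hsum gud n z) l].

Lemma logLamP z : slit z -> ctends (fun n => hsum gud n z) (logLam z).
Proof.
by move=> /(hsum_cvg gud_bound) [l hl]; exact: (@xgetI _ 0 [set l | ctends (fun n => hsum gud n z) l] l).
Qed.

(** Reduces statements at z to statements far to the right. *)
Lemma logLam_shift z (k : nat) : slit z -> logLam z = hsum gud k z + logLam (z + k%:R).
Proof.
move=> sz; apply: (ctends_uniq (ctends_shift k (logLamP sz))).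
apply: (ctends_ext (a:=fun n => hsum gud k z + hsum gud n (z + k%:R))) => [n|].
  by rewrite hsum_split.
by apply: ctendsD; [exact: ctends_cst|apply: logLamP; exact: slit_addn].
Qed.

Lemma logLam_bound eta z : 0 < eta <= 1 -> insector eta z -> 2 / eta + 2 <= cabs z ->
  cabs (logLam z) <= 6 / eta / (cabs z - 1).
Proof.
move=> e01 sz zM; have /andP[e0 e1] := e01.
have ei : 0 < 2 / eta by rewrite divr_gt0.
have z0 : z != 0 by rewrite -cabs_gt0; lra.
apply: (ctends_le (N:=0) (logLamP (insector_slit e0 z0 sz))) => n _.
exact: hsum_bound gud_bound _ _ _ _ _.
Qed.

Lemma cdiff_hsum h h' n z : (forall w, slit w -> cdiff h w (h' w)) -> slit z ->
  cdiff (hsum h n) z (hsum h' n z).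
Proof.
move=> dh sz; apply: cdiff_sum => m.
have d1 : cdiff (fun w => w + m%:R) z 1.
  by apply: cdiff_eq (cdiffD (cdiff_id z) (cdiff_cst _ z)) _; rewrite addr0.
by apply: cdiff_eq (cdiff_comp d1 (dh _ (slit_addn m sz))) _; rewrite mulr1.
Qed.

Lemma hsum_gud''_bound n z : 1 <= complex.Re z -> cabs (hsum gud'' n z) <= 1.
Proof.
move=> z1; rewrite (le_trans (cabs_sum _ _ _))//.
have z2 : 1 < complex.Re z + 1 by lra.
apply: (@le_trans _ _ (\sum_(m < n) (complex.Re z + 1 + m%:R) ^- 2)); last first.
  apply: (le_trans (telescope_inv_sqr n z2)); rewrite addrK invf_le1//; lra.
apply: ler_sum => m _; set y := z + m%:R.
have yR : complex.Re y = complex.Re z + m%:R.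
  by rewrite /y -(rmorph_nat (real_complex R)) !cReImE.
have m0 : 0 <= m%:R :> R by [].
have h1 : 1 <= cabs y by rewrite (le_trans _ (cabs_Re _))// (le_trans _ (ler_norm _))// yR; lra.
have h2 : complex.Re z + 1 + m%:R <= cabs (y + 1).
  by rewrite (le_trans _ (cabs_Re _))// (le_trans _ (ler_norm _))// cReD cRe1 yR; lra.
have E : cabs (2 * y ^+ 2 * (y + 1) ^+ 2) = 2 * cabs y ^+ 2 * cabs (y + 1) ^+ 2.
  by rewrite (cabsM (2 * y ^+ 2)) (cabsM 2) 2!cabsX cabs_nat.
rewrite /gud'' cabsV E lef_pV2 ?posrE; last 2 first.
- by rewrite !mulr_gt0 ?exprn_gt0//; lra.
- by rewrite exprn_gt0//; lra.
rewrite -[leLHS]mul1r; apply: ler_pM => //; first by rewrite sqr_ge0.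
  have : 1 <= cabs y ^+ 2 by rewrite exprn_ege1.
  lra.
by rewrite lerXn2r ?nnegrE ?cabs_ge0//; lra.
Qed.

(** Far to the right the second derivatives of the partial sums are bounded
    uniformly, so [cdiff_limit] applies; the shift formula carries the result
    to the whole slit plane. *)
Lemma cdiff_logLam z : slit z -> exists l, cdiff logLam z l.
Proof.
suff main w : 3 < complex.Re w -> exists l, cdiff logLam w l.
  (* N shifts z into the half-plane Re w > 3 *)
  move=> sz; pose N := Num.bound (3 + cabs z).
  have bN : 3 + cabs z < N%:R by apply: archi_boundP; rewrite addr_ge0 ?cabs_ge0.
  have [|l dl] := main (z + N%:R).
    have := cabs_Re z; rewrite ler_norml => /andP[h1 _].
    by rewrite -(rmorph_nat (real_complex R)) !cReImE; lra.
  have d1 : cdiff (fun w => w + N%:R) z 1.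
    by apply: cdiff_eq (cdiffD (cdiff_id z) (cdiff_cst _ z)) _; rewrite addr0.
  eexists; apply: (@cdiff_near _ (fun w => hsum gud N w + logLam (w + N%:R))); last first.
    by apply: cdiffD (cdiff_hsum N cdiff_gud sz) (cdiff_comp d1 dl).
  have [d d0 H] := slit_open sz; exists d => // u /H su.
  by rewrite (logLam_shift N su).
move=> w3.
have sl u : cabs u < 1 -> slit (w + u) /\ 1 <= complex.Re (w + u).
  move=> u1; have := cabs_Re u; rewrite ler_norml => /andP[h _].
  by split; rewrite /slit ?cReD; [apply/orP; right|]; lra.
have sw : slit w by rewrite /slit; apply/orP; right; lra.
have [l hl] := hsum_cvg gud'_bound sw.
exists l; apply: (@cdiff_limit _ (hsum gud) (fun n => hsum gud' n w) logLam w l 1 1) => //.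
  by move=> u /sl[su _]; exact: logLamP.
move=> n; apply: (@taylor1_bound _ (hsum gud n) (hsum gud' n) (hsum gud'' n)).
- by move=> u /sl[su _]; apply: cdiff_hsum su; exact: cdiff_gud.
- by move=> u /sl[su _]; apply: cdiff_hsum su; exact: cdiff_gud'.
- by move=> u /sl[_ su]; exact: hsum_gud''_bound.
Qed.

End Gudermann.

(** * Euler's limit and Lambda *)

Section EulerLimit.
Variable R : realType.
Implicit Types (z w u l : R[i]) (e d x : R).

Lemma realCD x y : (x + y)%:C = x%:C + y%:C :> R[i]. Proof. exact: rmorphD. Qed.
Lemma realCB x y : (x - y)%:C = x%:C - y%:C :> R[i]. Proof. exact: rmorphB. Qed.
Lemma realCN x : (- x)%:C = - x%:C :> R[i]. Proof. exact: rmorphN. Qed.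
Lemma realCM x y : (x * y)%:C = x%:C * y%:C :> R[i]. Proof. exact: rmorphM. Qed.
Lemma realCV x : (x^-1)%:C = x%:C^-1 :> R[i]. Proof. exact: fmorphV. Qed.
Lemma realCn (n : nat) : (n%:R)%:C = n%:R :> R[i]. Proof. exact: rmorph_nat. Qed.
Lemma realC1 : 1%:C = 1 :> R[i]. Proof. by []. Qed.
(** Keeps the embedding of the reals in a form on which [ring] and the real
    lemmas can act. *)
Definition realCE := (realCD, realCB, realCN, realCM, realCV, realCn, realC1).

(** The sums of Gudermann's series telescope, except for the logarithms that
    make up Euler's product. *)
Lemma hsum_gudE k w : slit w -> hsum (@gud R) k w =
  (w + k%:R + 2^-1) * clog (w + k%:R) - (w - 2^-1) * clog w
  - \sum_(j < k.+1) clog (w + j%:R) - k%:R.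
Proof.
move=> sw; elim: k => [|k ih].
  by rewrite /hsum big_ord0 big_ord1 addr0; field.
rewrite /hsum big_ord_recr /= -/(hsum (@gud R) k w) ih [\sum_(j < k.+2) _]big_ord_recr /=.
have E : (k.+1%:R : R[i]) = k%:R + 1 by rewrite natr1.
by rewrite /gud E !addrA; field.
Qed.

(** Euler's approximation of Gamma(w). *)
Definition gam (k : nat) w := k`!%:R * cexp (w * (ln k%:R)%:C) / \prod_(0 <= j < k.+1) (w + j%:R).

(** The quotient of k! by Stirling's approximation of it. *)
Definition stirling (k : nat) : R :=
  k`!%:R / Num.sqrt (2 * pi) * expR (k%:R - (k%:R + 2^-1) * ln k%:R).

(** Euler's approximation of Lambda(w). *)
Definition lam (k : nat) w :=
  cexp w * gam k w / ((Num.sqrt (2 * pi))%:C * cexp ((w - 2^-1) * clog w)).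

(** What is left of the exponent of Euler's approximation after the partial sum
    of Gudermann's series and Stirling's factor are split off. *)
Definition gamcorr (k : nat) w := w - (w + k%:R + 2^-1) * (clog (w + k%:R) - (ln k%:R)%:C).

Lemma sqrt_twopi_neq0 : (Num.sqrt (2 * pi))%:C != 0 :> R[i].
Proof. by rewrite realC_eq0 gt_eqF// sqrtr_gt0 mulr_gt0// pi_gt0. Qed.

(** The product in Euler's approximation is the exponential of a sum of
    logarithms, which [hsum_gudE] relates to Gudermann's series. *)
Lemma lam_split k w : slit w ->
  lam k w = (stirling k)%:C * cexp (hsum (@gud R) k w) * cexp (gamcorr k w).
Proof.
move=> sw; have s0 := sqrt_twopi_neq0.
have pE : \prod_(0 <= j < k.+1) (w + j%:R) = cexp (\sum_(j < k.+1) clog (w + j%:R)).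
  rewrite cexp_sum big_mkord; apply: eq_bigr => j _; rewrite cexp_clog//.
  by apply/slit_neq0/slit_addn.
rewrite /lam /gam pE /stirling 2!realCM realCV realCn.
rewrite -(cexp_real (k%:R - _)).
set A := cexp w; set B := cexp (w * _); set C := cexp (\sum_(_ < _) _).
set D := cexp ((w - _) * _).
have D0 : D != 0 := cexp_neq0 _; have C0 : C != 0 := cexp_neq0 _.
have -> : A * (k`!%:R * B / C) / ((Num.sqrt (2 * pi))%:C * D) =
    k`!%:R / (Num.sqrt (2 * pi))%:C * (A * B / C / D) by field; rewrite C0 D0 s0.
suff -> : A * B / C / D = cexp (k%:R - (k%:R + 2^-1) * ln k%:R)%:C *
    cexp (hsum (@gud R) k w) * cexp (gamcorr k w) by rewrite !mulrA.
rewrite /A /B /C /D -!cexpN -!cexpD; congr cexp.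
by rewrite hsum_gudE// /gamcorr !realCE; ring.
Qed.

Lemma ctends_inv_bound (a : nat -> R[i]) l C : 0 <= C -> (exists N, forall n, (N <= n)%N ->
  cabs (a n - l) <= C / n%:R) -> ctends a l.
Proof.
move=> C0 [N H] e e0.
have [|M HM] := ctends_inv_nat (e:=e / (C + 1)) .
  by rewrite divr_gt0// ltr_wpDl.
exists (maxn N M) => n; rewrite geq_max => /andP[/H h1 /HM].
rewrite subr0 cabsV cabs_nat ltr_pdivlMr ?ltr_wpDl// => h2.
rewrite (le_lt_trans h1)// (le_lt_trans _ h2)// mulrC ler_wpM2l ?lerDl//.
Qed.

(** (w + k + 1/2) log (1 + w / k) = w + O(1 / k). *)
Lemma gamcorr_tends w : ctends (gamcorr^~ w) 0.
Proof.
pose C := (cabs w + 1) * cabs w + (cabs w + 2) * (2 * cabs w ^+ 2).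
have w0 := cabs_ge0 w.
have C0 : 0 <= C by rewrite /C addr_ge0// !mulr_ge0 ?addr_ge0// sqr_ge0.
apply: (ctends_inv_bound C0); exists (Num.bound (2 * cabs w)).+1 => k kN.
have k0 : 0 < k%:R :> R by rewrite ltr0n (leq_trans _ kN).
have k1 : 1 <= k%:R :> R by rewrite ler1n (leq_trans _ kN).
have wk : 2 * cabs w <= k%:R.
  have b : 2 * cabs w < (Num.bound (2 * cabs w))%:R by apply: archi_boundP; rewrite mulr_ge0.
  by rewrite (le_trans (ltW b))// ler_nat ltnW.
have kC : (k%:R : R[i]) != 0 by rewrite pnatr_eq0 -lt0n; move: k0; rewrite ltr0n.
set v := w / k%:R.
have vE : cabs v = cabs w / k%:R by rewrite cabs_div cabs_nat.
have v2 : cabs v <= 2^-1 by rewrite vE ler_pdivrMr//; lra.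
have sv : slit (1 + v) by apply: slit_near1; lra.
have LE : clog (w + k%:R) - (ln k%:R)%:C = clog (1 + v).
  rewrite -[RHS](addrK (ln k%:R)%:C); congr (_ - _); apply: clog_unique.
    rewrite cexpD cexp_clog ?slit_neq0// cexp_real lnK ?posrE// rmorph_nat.
    by rewrite mulrDl mul1r mulfVK// addrC.
  by rewrite cImD cImC addr0; exact: carg_slit.
rewrite subr0 /gamcorr LE.
set rho := clog (1 + v) - v.
have rhoB : cabs rho <= 2 * cabs v ^+ 2.
  have := clog_taylor2 v2; rewrite -/rho => k2.
  have := cabsB (rho + v ^+ 2 / 2) (v ^+ 2 / 2); rewrite addrK cabs_div cabsX (cabs_nat R 2).
  have : cabs v ^+ 3 <= 2^-1 * cabs v ^+ 2 by rewrite exprS ler_wpM2r ?sqr_ge0.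
  have : 0 <= cabs v ^+ 2 by rewrite sqr_ge0.
  lra.
have -> : w - (w + k%:R + 2^-1) * clog (1 + v) = - ((w + 2^-1) * v + (w + k%:R + 2^-1) * rho).
  by rewrite /rho /v; field.
have h2 : cabs (2^-1 : R[i]) = 2^-1 by rewrite cabsV cabs_nat.
have -> : C / k%:R = (cabs w + 1) * cabs w / k%:R + (cabs w + 2) * (2 * cabs w ^+ 2) / k%:R.
  by rewrite /C -mulrDl.
rewrite cabsN (le_trans (cabsD _ _))// lerD//.
  rewrite cabsM vE -!mulrA ler_pM ?cabs_ge0 ?divr_ge0// ?(ltW k0)//.
  by rewrite (le_trans (cabsD _ _))// h2 lerD2l; lra.
rewrite cabsM.
have a1 : cabs (w + k%:R + 2^-1) <= (cabs w + 2) * k%:R.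
  rewrite (le_trans (cabsD _ _))// h2.
  have := cabsD w k%:R; rewrite cabs_nat.
  have : cabs w <= cabs w * k%:R by rewrite ler_peMr.
  lra.
rewrite (le_trans (ler_pM _ _ a1 rhoB)) ?cabs_ge0// vE.
have -> : (cabs w + 2) * k%:R * (2 * (cabs w / k%:R) ^+ 2) =
  (cabs w + 2) * (2 * cabs w ^+ 2) / k%:R by field; rewrite gt_eqF.
by [].
Qed.

(** The value 1 of this constant, which is Stirling's formula, is obtained from
    the reflection formula in [tau1]. *)
Definition stirling_limit : R[i] :=
  (expR 1 / Num.sqrt (2 * pi))%:C * cexp (- logLam 1).

(** At w = 1 the logarithms in [hsum_gudE] add up to log k!. *)
Lemma stirlingS k : (stirling k.+1)%:C =
  (expR 1 / Num.sqrt (2 * pi))%:C * cexp (- hsum (@gud R) k 1).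
Proof.
have s1 : slit (1 : R[i]) by rewrite -[1](rmorph1 (real_complex R)); apply: slit_pos.
have E : \sum_(j < k.+1) clog (1 + j%:R) = (ln (k.+1)`!%:R)%:C :> R[i].
  elim: k => [|k ih]; first by rewrite big_ord1 addr0 clog1 ln1.
  have E2 : 1 + k.+1%:R = (k.+2%:R)%:C :> R[i] by rewrite realCn addrC natr1.
  rewrite big_ord_recr /= ih E2 clog_real ?ltr0n//.
  by rewrite -realCD -lnM ?posrE ?ltr0n ?fact_gt0// -natrM mulnC -factS.
have L : clog (1 + k%:R) = (ln k.+1%:R)%:C :> R[i].
  have E2 : 1 + k%:R = (k.+1%:R)%:C :> R[i] by rewrite realCn addrC natr1.
  by rewrite E2 clog_real ?ltr0n.
rewrite hsum_gudE// E L clog1 mulr0 subr0.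
have -> : - ((1 + k%:R + 2^-1) * (ln k.+1%:R)%:C - (ln (k.+1)`!%:R)%:C - k%:R) =
   (ln (k.+1)`!%:R + (k%:R - (1 + k%:R + 2^-1) * ln k.+1%:R))%:C :> R[i].
  by rewrite !realCE; ring.
rewrite cexp_real -realCM expRD lnK ?posrE ?ltr0n ?fact_gt0//; congr (_%:C).
rewrite /stirling.
have -> : expR (k.+1%:R - (k.+1%:R + 2^-1) * ln k.+1%:R) =
    expR 1 * expR (k%:R - (1 + k%:R + 2^-1) * ln k.+1%:R) :> R.
  by rewrite -expRD -natr1; congr expR; ring.
ring.
Qed.

Lemma stirling_tends : ctends (fun k => (stirling k.+1)%:C) stirling_limit.
Proof.
have s1 : slit (1 : R[i]) by rewrite -[1](rmorph1 (real_complex R)); apply: slit_pos.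
apply: (ctends_ext (a:=fun k => (expR 1 / Num.sqrt (2 * pi))%:C * cexp (- hsum (@gud R) k 1))) => [n|].
  by rewrite stirlingS.
apply: ctendsM; first exact: ctends_cst.
apply: (@ctends_comp _ (fun k => hsum (@gud R) k 1) _ (fun w => cexp (- w))); first exact: logLamP.
by apply: cdiff_ccont; apply: cdiff_cexp_comp; apply: cdiffN; exact: cdiff_id.
Qed.

Lemma lam_tends w : slit w -> ctends (fun k => lam k.+1 w) (stirling_limit * cexp (logLam w)).
Proof.
move=> sw.
apply: (ctends_ext (a:=fun k => (stirling k.+1)%:C * cexp (hsum (@gud R) k.+1 w) * cexp (gamcorr k.+1 w))) => [n|].
  by rewrite lam_split.
rewrite -[_ * cexp _]mulr1 -cexp0.
have cE (a : nat -> R[i]) l : ctends a l -> ctends (fun n => cexp (a n)) (cexp l).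
  by move=> al; apply: ctends_comp al (cdiff_ccont (cdiff_cexp _)).
apply: ctendsM; last by apply: cE; exact: (ctends_shift 1 (gamcorr_tends w)).
apply: ctendsM; first exact: stirling_tends.
by apply: cE; exact: (ctends_shift 1 (logLamP sw)).
Qed.

(** Let k tend to infinity in [lam_split]. *)
Lemma Lambda_logLam w : slit w -> Lambda w = stirling_limit * cexp (logLam w).
Proof.
move=> sw; have s0 := sqrt_twopi_neq0.
set c := (Num.sqrt (2 * pi))%:C * cexp ((w - 2^-1) * clog w).
have c0 : c != 0 by rewrite mulf_neq0 ?cexp_neq0.
have H : ctends (fun k => gam k.+1 w) (stirling_limit * cexp (logLam w) * (c / cexp w)).
  apply: (ctends_ext (a:=fun k => lam k.+1 w * (c / cexp w))) => [k|].
    by rewrite /lam -/c; field; rewrite c0 cexp_neq0.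
  by apply: ctendsM (lam_tends sw) (ctends_cst _).
have H' : ctends (gam^~ w) (stirling_limit * cexp (logLam w) * (c / cexp w)).
  move=> e e0; have [N HN] := H e e0; exists N.+1 => -[//|n] nN; exact: HN.
rewrite /Lambda -/c.
have -> : cGamma w = stirling_limit * cexp (logLam w) * (c / cexp w) := ctends_lim H'.
by field; rewrite c0 cexp_neq0.
Qed.

(** Partial products of 2 sinh (u / 2) / u. *)
Definition sinprod (k : nat) u : R[i] := \prod_(j < k) (1 + u ^+ 2 / (2 * pi * j.+1%:R)%:C ^+ 2).

(** The factors z + j and - z + j of the two Euler products multiply to j^2 -
    z^2; with u = 2 pi i z these are the factors of the sine product. *)
Lemma gam_opp k z : complex.Im z != 0 ->
  gam k z * gam k (- z) * (z ^+ 2 * sinprod k (2 * pi%:C * 'i%C * z)) = -1.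
Proof.
move=> iz.
have E : \prod_(0 <= j < k.+1) ((z + j%:R) * (- z + j%:R)) =
    - (k`!%:R ^+ 2 * (z ^+ 2 * sinprod k (2 * pi%:C * 'i%C * z))).
  elim: k => [|k ih].
    by rewrite big_nat1 /sinprod big_ord0 fact0; ring.
  rewrite big_nat_recr //= ih /sinprod big_ord_recr /= factS natrM realCM.
  have P0 : (2 * pi)%:C != 0 :> R[i] := twopiC_neq0 R.
  have k0 : (k.+1%:R)%:C != 0 :> R[i] by rewrite realC_eq0 pnatr_eq0.
  rewrite -(realCn k.+1).
  have -> : (2 * pi%:C * 'i%C * z) ^+ 2 = - (2 * pi)%:C ^+ 2 * z ^+ 2.
    by rewrite realCM realCn !exprMn sqr_i; ring.
  set T := \prod_(i < k) _.
  move: T ((2 * pi)%:C) P0 ((k.+1%:R)%:C) k0 => T a a0 b b0.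
  by field; rewrite a0 b0.
rewrite /gam.
have -> : cexp (- z * (ln k%:R)%:C) = (cexp (z * (ln k%:R)%:C))^-1 by rewrite mulNr cexpN.
have nz (w : R[i]) (j : nat) : complex.Im w != 0 -> w + j%:R != 0.
  move=> iw; apply/eqP => h; have : complex.Im (w + j%:R) = 0 by rewrite h.
  by rewrite -realCn cImD cImC addr0 => h'; rewrite h' eqxx in iw.
have A0 : \prod_(0 <= j < k.+1) (z + j%:R) != 0.
  by rewrite prodf_seq_neq0; apply/allP => j _; exact: nz.
have B0 : \prod_(0 <= j < k.+1) (- z + j%:R) != 0.
  by rewrite prodf_seq_neq0; apply/allP => j _; apply: nz; rewrite cImN oppr_eq0.
move: E; rewrite big_split /=; move: A0 B0.
set A := \prod_(0 <= j < _) (z + _); set B := \prod_(0 <= j < _) (- z + _).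
move=> A0 B0 E; set Q := z ^+ 2 * _ in E *.
set F := cexp _; have F0 : F != 0 := cexp_neq0 _.
have -> : k`!%:R * F / A * (k`!%:R / F / B) * Q = (k`!%:R ^+ 2 * Q) / (A * B).
  by field; rewrite A0 B0 F0.
have X0 : k`!%:R ^+ 2 * Q != 0 by rewrite -oppr_eq0 -E mulf_neq0.
by rewrite E invrN mulrN divff.
Qed.

Lemma cexp_pihalfi : cexp (pi%:C * 'i%C / 2 : R[i]) = 'i%C.
Proof.
have -> : pi%:C * 'i%C / 2 = (0 +i* (pi / 2)) :> R[i].
  by apply: (mulIf (_ : 2 != 0)); rewrite ?pnatr_eq0// mulfVK ?pnatr_eq0//;
    apply: complexP; rewrite !cReImE; field.
by apply: complexP; rewrite ?Re_cexp ?Im_cexp !cReImE expR0 mul1r ?cos_pihalf ?sin_pihalf.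
Qed.

(** The elementary factors of the two approximations cancel up to exp (u / 2)
    and the rotation between the logarithms of z and - z. *)
Lemma lam_opp k z : 0 < complex.Im z ->
  let u := 2 * pi%:C * 'i%C * z in
  lam k z * lam k (- z) * (- u * cexp (u / 2) * sinprod k u) = 1.
Proof.
move=> iz u; have iz0 : complex.Im z != 0 by rewrite gt_eqF.
have z0 : z != 0 by apply: contraNneq iz0 => ->.
have G := gam_opp k iz0; rewrite -/u in G.
have s0 := sqrt_twopi_neq0.
have ss : (Num.sqrt (2 * pi))%:C ^+ 2 = 2 * pi%:C :> R[i].
  by rewrite expr2 -realCM -expr2 sqr_sqrtr ?realCM ?realCn// twopi_ge0.
rewrite /lam clog_opp_gt0//.
set s := (Num.sqrt (2 * pi))%:C in s0 ss *.
set L := clog z; have LE : cexp L = z by exact: cexp_clog.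
(* the rotation by - pi contributes exp (u / 2) and exp (pi i / 2) = i *)
have -> : cexp ((- z - 2^-1) * (L - pi%:C * 'i%C)) =
    cexp (u / 2) * 'i%C * cexp (- (z + 2^-1) * L).
  by rewrite -[in RHS]cexp_pihalfi -!cexpD; congr cexp; rewrite /u; field.
have -> : cexp ((z - 2^-1) * L) = cexp ((z + 2^-1) * L) / z.
  by rewrite -[X in _ / X]LE -cexpB; congr cexp; field.
rewrite mulNr !cexpN.
set E := cexp (_ * L); set F := cexp (u / 2); set A := cexp z.
have E0 : E != 0 := cexp_neq0 _; have F0 : F != 0 := cexp_neq0 _; have A0 : A != 0 := cexp_neq0 _.
move: G; set g := gam k z; set g' := gam k (- z); set p := sinprod k u => G.
have i0 : 'i%C != 0 :> R[i] by rewrite -cabs_gt0 cabs_i.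
have -> : A * g / (s * (E / z)) * (A^-1 * g' / (s * (F * 'i%C * E^-1))) * (- u * F * p) =
    - (g * g' * (z ^+ 2 * p)) * (2 * pi%:C / s ^+ 2).
  by rewrite /u; field; rewrite i0 F0 E0 A0 s0 z0.
by rewrite G ss divff ?mulr1 ?opprK// -ss expf_neq0.
Qed.

End EulerLimit.

(** * The sine product *)

Section SineProduct.
Variable R : realType.
Implicit Types (z w u l : R[i]) (e d x r : R) (f g : R[i] -> R[i]).
Local Notation T := (2 * pi%:C * 'i%C : R[i]).

Lemma T_neq0 : T != 0.
Proof. apply: mulf_neq0; last by rewrite -cabs_gt0 cabs_i.
by apply: mulf_neq0; rewrite ?pnatr_eq0// realC_eq0 gt_eqF// pi_gt0. Qed.

Lemma sqrT : T ^+ 2 = - (2 * pi)%:C ^+ 2.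
Proof. by rewrite realCM realCn exprMn sqr_i mulrN1. Qed.

(** Two logarithms of the same number differ by an integral multiple of T. *)
Lemma exp_periodicP g : (forall w, g (w + T) = g w) -> exp_periodic g.
Proof.
move=> gT w w' ww.
have gn (n : nat) v : g (v + n%:R * T) = g v.
  elim: n => [|n ih]; first by rewrite mul0r addr0.
  by rewrite -natr1 mulrDl mul1r addrA gT.
have [k [k1 k2]] : exists k : int, 0 <= complex.Im w - complex.Im w' - k%:~R * (2 * pi) /\
    complex.Im w - complex.Im w' - k%:~R * (2 * pi) < 2 * pi.
  have p0 : 0 < 2 * pi :> R by rewrite mulr_gt0// pi_gt0.
  exists (Num.floor ((complex.Im w - complex.Im w') / (2 * pi))).
  have /andP[] := floor_itv ((complex.Im w - complex.Im w') / (2 * pi)).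
  by rewrite ler_pdivlMr// ltr_pdivrMr// intrD mulr1z => h1 h2; split; lra.
have cT (k' : int) : cexp (k'%:~R * T) = 1.
  rewrite -[LHS]/(cexpz k' _) cexpzE (_ : cexp _ = 1) ?exp1rz//.
  by have := cexp_2pii (0 : R[i]); rewrite add0r cexp0.
have kC (k' : int) : (k'%:~R : R[i]) = (k'%:~R)%:C by rewrite rmorph_int.
have E : w = w' + k%:~R * T.
  apply: cexp_inj_strip; first by rewrite cexpD cT mulr1.
  rewrite kC !cReImE mulr2n ger0_norm; lra.
rewrite E; case: k {k1 k2 E} => n.
  by rewrite -[n%:~R]/(n%:R) gn.
by rewrite NegzE mulrNz mulNr -[LHS](gn n.+1) -[n.+1%:~R]/(n.+1%:R) subrK.
Qed.

Lemma Im_reduce w : exists w', [/\ cexp w' = cexp w, complex.Re w' = complex.Re w & 0 <= complex.Im w' <= 2 * pi].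
Proof.
have p0 : 0 < 2 * pi :> R by rewrite mulr_gt0// pi_gt0.
pose k := Num.floor (complex.Im w / (2 * pi)).
have kC : (k%:~R : R[i]) = (k%:~R)%:C by rewrite rmorph_int.
exists (w - k%:~R * T); split.
- rewrite cexpB (_ : cexp (k%:~R * T) = 1) ?divr1//.
  rewrite -[LHS]/(cexpz k _) cexpzE (_ : cexp _ = 1) ?exp1rz//.
  by have := cexp_2pii (0 : R[i]); rewrite add0r cexp0.
- by rewrite kC !cReImE; ring.
- rewrite kC !cReImE.
  have /andP[] := floor_itv (complex.Im w / (2 * pi)).
  rewrite ler_pdivlMr// ltr_pdivrMr// intrD mulr1z -/k => h1 h2.
  by apply/andP; split; lra.
Qed.

(** Up to a constant, u * sinprod k u is the product of the u + j T with |j| <=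
    k; the shift by T replaces the factor at j = - k by the one at j = k + 1.
    *)
Lemma sinprod_shift k u :
  (u + T) * sinprod k (u + T) * (u - k%:R * T) = u * sinprod k u * (u + k.+1%:R * T).
Proof.
elim: k => [|k ih]; first by rewrite /sinprod !big_ord0; ring.
rewrite /sinprod !big_ord_recr /= -/(sinprod k (u + T)) -/(sinprod k u).
have fac v : 1 + v ^+ 2 / (2 * pi * k.+1%:R)%:C ^+ 2 =
    (v + k.+1%:R * T) * (v - k.+1%:R * T) / (2 * pi * k.+1%:R)%:C ^+ 2.
  have P0 : (2 * pi)%:C != 0 :> R[i] := twopiC_neq0 R.
  have n0 : (k.+1%:R : R[i]) != 0 by rewrite pnatr_eq0.
  have -> : (v + k.+1%:R * T) * (v - k.+1%:R * T) = v ^+ 2 - k.+1%:R ^+ 2 * T ^+ 2 by ring.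
  rewrite sqrT realCM realCn.
  move: ((2 * pi)%:C) P0 (k.+1%:R : R[i]) n0 => a a0 b b0.
  by field; rewrite a0 b0.
rewrite !fac; set c := (2 * pi * _)%:C ^+ 2.
have -> : u + T + k.+1%:R * T = u + k.+2%:R * T by rewrite -(natr1 k.+1); ring.
have -> : u + T - k.+1%:R * T = u - k%:R * T by rewrite -(natr1 k); ring.
have -> : (u + T) * (sinprod k (u + T) * ((u + k.+2%:R * T) * (u - k%:R * T) / c)) * (u - k.+1%:R * T) =
   ((u + T) * sinprod k (u + T) * (u - k%:R * T)) * ((u + k.+2%:R * T) * (u - k.+1%:R * T) / c).
  by move: (sinprod k (u + T)) => s; ring.
by rewrite ih; ring.
Qed.

(** Bounds the partial sine products on the disc of radius r, uniformly in the
    number of factors. *)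
Definition expsq r := expR (2 * r ^+ 2).

Lemma inv_sqr_sum (N n : nat) : (0 < N)%N -> \sum_(N <= j < n) (j.+1%:R : R) ^- 2 <= N%:R^-1.
Proof.
move=> N0; have [nN|Nn] := leqP n N; first by rewrite big_geq// invr_ge0.
rewrite -{1}(add0n N) big_addn big_mkord.
have N1 : 1 < N.+1%:R :> R by rewrite ltr1n ltnS.
have E : N.+1%:R - 1 = N%:R :> R by rewrite -natr1 addrK.
have := telescope_inv_sqr (n - N) N1; rewrite E => /(le_trans _); apply.
by rewrite le_eqVlt; apply/orP; left; apply/eqP/eq_bigr => j _; rewrite -natrD addSn (addnC N).
Qed.

Lemma sinprod_factor_bound u r (j : nat) : cabs u <= r ->
  cabs (u ^+ 2 / (2 * pi * j.+1%:R)%:C ^+ 2) <= r ^+ 2 * j.+1%:R ^- 2.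
Proof.
move=> ur; have r0 : 0 <= r := le_trans (cabs_ge0 _) ur.
have p1 : 1 <= 2 * pi :> R by have := pi_ge2 R; lra.
rewrite cabs_div !cabsX cabs_real ger0_norm ?mulr_ge0//; last by lra.
apply: ler_pM; rewrite ?invr_ge0 ?exprn_ge0 ?cabs_ge0//; first by rewrite mulr_ge0//; lra.
- by rewrite lerXn2r ?nnegrE ?cabs_ge0.
- rewrite lef_pV2 ?posrE ?exprn_gt0 ?mulr_gt0 ?ltr0n//; last by lra.
  by rewrite lerXn2r ?nnegrE ?mulr_ge0 ?ler_peMl//; lra.
Qed.

(** 1 + x <= exp x, and the sum of the 1 / j^2 is at most 2. *)
Lemma sinprod_bound k u r : cabs u <= r -> cabs (sinprod k u) <= expsq r.
Proof.
move=> ur; rewrite /sinprod cabs_prod.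
apply: (@le_trans _ _ (\prod_(j < k) expR (r ^+ 2 * j.+1%:R ^- 2))).
  apply: ler_prod => j _; rewrite cabs_ge0/= (le_trans _ (expR_ge1Dx _))//.
  rewrite (le_trans (cabsD _ _))// cabs1 lerD2l; exact: sinprod_factor_bound.
rewrite -expR_sum ler_expR -mulr_sumr mulrC ler_wpM2r ?sqr_ge0//.
case: k => [|k]; first by rewrite big_ord0.
rewrite big_ord_recl /= expr1n invr1 -[2]/(1 + 1) lerD2l.
by have := inv_sqr_sum k.+1 (isT : (0 < 1)%N); rewrite invr1 big_add1 big_mkord.
Qed.

Lemma sinprod_step k u r : cabs u <= r ->
  cabs (sinprod k.+1 u - sinprod k u) <= expsq r * r ^+ 2 * k.+1%:R ^- 2.
Proof.
move=> ur; rewrite /sinprod big_ord_recr /= -/(sinprod k u) mulrDr mulr1 addrAC subrr add0r.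
rewrite cabsM -[leRHS]mulrA.
exact: ler_pM (cabs_ge0 _) (cabs_ge0 _) (sinprod_bound _ ur) (sinprod_factor_bound _ ur).
Qed.

Lemma sinprod_cauchy N n u r : (0 < N)%N -> (N <= n)%N -> cabs u <= r ->
  cabs (sinprod n u - sinprod N u) <= expsq r * r ^+ 2 / N%:R.
Proof.
move=> N0 Nn ur; rewrite -(telescope_sumr (fun k => sinprod k u))//.
rewrite (le_trans (cabs_sum _ _ _))//.
apply: (@le_trans _ _ (\sum_(N <= j < n) expsq r * r ^+ 2 * j.+1%:R ^- 2)).
  by apply: ler_sum => j _; exact: sinprod_step.
by rewrite -mulr_sumr ler_wpM2l ?inv_sqr_sum// mulr_ge0 ?sqr_ge0// expR_ge0.
Qed.

(** The sine product, equal to 2 sinh (u / 2) / u by [sinratio1]. *)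
Definition sinlim u := xget 0 [set l | ctends (fun n => sinprod n u) l].

Lemma sinlimP u : ctends (fun n => sinprod n u) (sinlim u).
Proof.
suff [l hl] : exists l, ctends (fun n => sinprod n u) l.
  exact: (@xgetI _ 0 [set l | ctends (fun n => sinprod n u) l] l).
apply: ccauchy_cvg => e e0.
set C := expsq (cabs u) * cabs u ^+ 2.
have C0 : 0 <= C by rewrite mulr_ge0 ?sqr_ge0// expR_ge0.
exists (Num.bound (C / e)).+1 => n Nn.
rewrite (le_lt_trans (sinprod_cauchy _ Nn (lexx _)))// -/C ltr_pdivrMr ?ltr0n//.
have b : C / e < (Num.bound (C / e))%:R by apply: archi_boundP; rewrite divr_ge0// ltW.
rewrite mulrC -ltr_pdivrMr// (lt_trans b)// ltr_nat//.
Qed.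

(** The partial products converge uniformly on discs. *)
Lemma ccont_sinlim u : ccont sinlim u.
Proof.
move=> e e0; set r := cabs u + 1; set C := expsq r * r ^+ 2.
have C0 : 0 <= C by rewrite mulr_ge0 ?sqr_ge0// expR_ge0.
pose N := (Num.bound (3 * C / e)).+1.
have NC : C / N%:R < e / 3.
  have b : 3 * C / e < N%:R.
    rewrite (lt_trans (_ : _ < (Num.bound (3 * C / e))%:R)) ?ltr_nat//.
    by apply: archi_boundP; apply: divr_ge0; [exact: mulr_ge0|exact: ltW].
  rewrite ltr_pdivrMr ?ltr0n//; move: b; rewrite ltr_pdivrMr//; lra.
have lim_close v : cabs v <= r -> cabs (sinlim v - sinprod N v) <= C / N%:R.
  move=> vr; apply: (ctends_le (N:=N) (ctendsB (sinlimP v) (ctends_cst (sinprod N v)))).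
  by move=> n Nn; exact: sinprod_cauchy.
have cN : ccont (sinprod N) u.
  rewrite /sinprod; elim: {NC lim_close} N => [|n ih].
    by apply: ccont_ext (ccont_cst 1 u) => w; rewrite big_ord0.
  apply: (ccont_ext (f:=fun w => (\prod_(j < n) (1 + w ^+ 2 / (2 * pi * j.+1%:R)%:C ^+ 2)) *
      (1 + w ^+ 2 / (2 * pi * n.+1%:R)%:C ^+ 2))) => [w|]; first by rewrite big_ord_recr.
  apply: ccontM ih _; apply: cdiff_ccont (cdiffD (cdiff_cst _ _) (cdiffM (cdiffX 2 (cdiff_id _)) (cdiff_cst _ _))).
have e3 : 0 < e / 3 by rewrite divr_gt0.
have [d d0 H] := cN _ e3.
exists (Num.min d 1); first by rewrite lt_min d0 ltr01.
move=> h; rewrite lt_min => /andP[/H h1 h2].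
have k1 := lim_close u (ltac:(by rewrite /r lerDl)).
have k2 := lim_close (u + h) (ltac:(by rewrite /r (le_trans (cabsD _ _))// lerD2l ltW)).
rewrite (_ : sinlim (u + h) - sinlim u = (sinlim (u + h) - sinprod N (u + h)) +
   ((sinprod N (u + h) - sinprod N u) - (sinlim u - sinprod N u))); last by ring.
rewrite (le_lt_trans (cabsD _ _))//.
have := cabsB (sinprod N (u + h) - sinprod N u) (sinlim u - sinprod N u).
lra.
Qed.

Lemma sinlim0 : sinlim 0 = 1.
Proof.
apply: (ctends_uniq (sinlimP 0)); apply: ctends_ext (ctends_cst 1) => n.
by rewrite /sinprod big1// => j _; rewrite expr0n /= mul0r addr0.
Qed.

Lemma sinlimN u : sinlim (- u) = sinlim u.
Proof.
apply: (ctends_uniq (sinlimP (- u))); apply: ctends_ext (sinlimP u) => n.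
by rewrite /sinprod; apply: eq_bigr => j _; rewrite sqrrN.
Qed.

(** Divide [sinprod_shift] by k + 1 and let k tend to infinity. *)
Lemma sinlim_shift u : (u + T) * sinlim (u + T) = - (u * sinlim u).
Proof.
apply: (mulIf (_ : - T != 0)); first by rewrite oppr_eq0 T_neq0.
have -> : - (u * sinlim u) * - T = u * sinlim u * T by ring.
have i0 : ctends (fun n => (n.+1%:R : R[i])^-1) 0 := ctends_shift 1 (@ctends_inv_nat R).
have c (x : R[i]) : ctends (fun=> x) x := @ctends_cst R x.
have L := ctendsM (ctendsM (c (u + T)) (ctends_shift 1 (sinlimP (u + T))))
   (ctendsB (ctendsM (c u) i0) (c T)).
have Q := ctendsM (ctendsM (c u) (ctends_shift 1 (sinlimP u)))
   (ctendsD (ctendsD (ctendsM (c u) i0) (c T)) (ctendsM i0 (c T))).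
rewrite mulr0 mul0r add0r addr0 in Q; rewrite mulr0 sub0r in L.
apply: (ctends_uniq L); apply: ctends_ext Q => n /=.
rewrite -[(1 + n)%N]/n.+1.
have n0 : (n.+1%:R : R[i]) != 0 by rewrite pnatr_eq0.
have := sinprod_shift n.+1 u; rewrite -(natr1 n.+1) => S.
apply: (mulIf n0); transitivity (u * sinprod n.+1 u * (u + (n.+1%:R + 1) * T)).
  by move: (sinprod n.+1 u) => s; field.
rewrite -S; by move: (sinprod n.+1 (u + T)) => s; field.
Qed.

End SineProduct.

(** * Reflection formula and asymptotics of Lambda *)

Section Reflection.
Variable R : realType.
Implicit Types (z w u l : R[i]) (e d x r : R) (f g : R[i] -> R[i]).
Local Notation T := (2 * pi%:C * 'i%C : R[i]).
Local Notation tau := (@stirling_limit R).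

Lemma invT : T^-1 = - 'i%C / (2 * pi)%:C.
Proof.
apply: (mulIf (T_neq0 R)); rewrite mulVf ?T_neq0//.
have P0 : (2 * pi)%:C != 0 :> R[i] := twopiC_neq0 R.
have -> : T = (2 * pi)%:C * 'i%C by rewrite realCM realCn.
move: P0; set a := (2 * pi)%:C => P0.
by rewrite mulrA divfK// mulNr -expr2 sqr_i opprK.
Qed.

Lemma Im_divT u : complex.Im (u / T) = - complex.Re u / (2 * pi).
Proof. by rewrite invT -realCV !cReImE; ring. Qed.

Lemma Re_divT u : complex.Re (u / T) = complex.Im u / (2 * pi).
Proof. by rewrite invT -realCV !cReImE; ring. Qed.

Lemma slit_Im z : complex.Im z != 0 -> slit z.
Proof. by move=> h; rewrite /slit h. Qed.

Lemma Im_divT_gt0 u : complex.Re u < 0 -> 0 < complex.Im (u / T).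
Proof. by move=> u0; rewrite Im_divT divr_gt0 ?oppr_gt0// mulr_gt0// pi_gt0. Qed.

(** The limit of [lam_opp], with z = u / T. *)
Lemma sinlim_logLam u : complex.Re u < 0 ->
  (tau * cexp (logLam (u / T))) * (tau * cexp (logLam (- (u / T)))) *
  (- u * cexp (u / 2) * sinlim u) = 1.
Proof.
move=> u0; have iz := Im_divT_gt0 u0.
have sz : slit (u / T) by apply: slit_Im; rewrite gt_eqF.
have sz' : slit (- (u / T)) by apply: slit_Im; rewrite cImN oppr_eq0 gt_eqF.
have uT : T * (u / T) = u by rewrite mulrC divfK// T_neq0.
apply: (ctends_uniq (a:=fun k => lam k.+1 (u / T) * lam k.+1 (- (u / T)) *
   (- u * cexp (u / 2) * sinprod k.+1 u))).
  apply: ctendsM; first by apply: ctendsM; exact: lam_tends.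
  by apply: ctendsM; [exact: ctends_cst|exact: (ctends_shift 1 (sinlimP u))].
apply: ctends_ext (ctends_cst 1) => k; have := lam_opp k.+1 iz; rewrite /= uT.
by move=> ->.
Qed.

(** The quotient of u * sinlim u by 2 sinh (u / 2), with the value 1 at the
    zeros of the denominator. *)
Definition sinratio u :=
  if cexp u == 1 then 1 else u * sinlim u * cexp (u / 2) / (cexp u - 1).

(** Numerator and denominator both change sign under the shift by 2 pi i. *)
Lemma sinratio_periodic : exp_periodic sinratio.
Proof.
apply: exp_periodicP => u; rewrite /sinratio cexp_2pii; case: ifP => // _.
rewrite sinlim_shift mulrDl cexpD.
have -> : T / 2 = pi%:C * 'i%C by field.
by rewrite cexp_pii mulrN1 mulrNN.
Qed.

Lemma sinratioN u : sinratio (- u) = sinratio u.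
Proof.
rewrite /sinratio cexpN invr_eq1; case: eqP => // /eqP E.
have E0 := cexp_neq0 u.
rewrite sinlimN.
have -> : cexp (- u / 2) = cexp (u / 2) / cexp u by rewrite -cexpB; congr cexp; field.
have E1 : cexp u - 1 != 0 by rewrite subr_eq0.
have E2 : 1 - cexp u != 0 by rewrite subr_eq0 eq_sym.
move: (sinlim u) E0 E1 E2 => s; move: (cexp u) (cexp (u / 2)) => p q E0 E1 E2.
have -> : p^-1 - 1 = (1 - p) / p by field.
by field; rewrite E1 E0 E2.
Qed.

(** Near a zero of the denominator, move to u = 0 by periodicity and divide
    numerator and denominator by u. *)
Lemma ccont_sinratio u : ccont sinratio u.
Proof.
have [E|ne] := eqVneq (cexp u) 1; last first.
  have E1 : cexp u - 1 != 0 by rewrite subr_eq0.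
  have cE w : ccont (fun w => cexp w - 1) w.
    exact: cdiff_ccont (cdiffB (cdiff_cexp w) (cdiff_cst _ _)).
  apply: (@ccont_near _ (fun w => w * sinlim w * cexp (w / 2) / (cexp w - 1))); last first.
    apply: ccontM; last by apply: ccontV.
    apply: ccontM; last exact: cdiff_ccont (cdiff_cexp_comp (cdiffM (cdiff_id _) (cdiff_cst _ _))).
    by apply: ccontM; [exact: cdiff_ccont (cdiff_id _)|exact: ccont_sinlim].
  have [|d d0 H] := cdiff_ccont (cdiff_cexp u) (e:=cabs (cexp u - 1)); first by rewrite cabs_gt0.
  exists d => // v /H hv; rewrite /sinratio; case: ifPn => // /eqP E.
  by move: hv; rewrite E cabsBC ltxx.
(* near a period the quotient is read off at 0 *)
have s0 : slope (@cexp R) 0 1 0 = 1 by rewrite /slope eqxx.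
have cS : ccont (fun v => sinlim v * cexp (v / 2) / slope (@cexp R) 0 1 v) 0.
  apply: ccontM; last first.
    by apply: ccontV; [rewrite s0 oner_neq0|apply: slope_ccont; exact: cdiff_cexp0].
  apply: ccontM; first exact: ccont_sinlim.
  exact: cdiff_ccont (cdiff_cexp_comp (cdiffM (cdiff_id _) (cdiff_cst _ _))).
have cS' : ccont (fun w => sinlim (w - u) * cexp ((w - u) / 2) / slope (@cexp R) 0 1 (w - u)) u.
  apply: (@ccont_comp _ (fun v => sinlim v * cexp (v / 2) / slope (@cexp R) 0 1 v) (fun w => w - u)).
    exact: cdiff_ccont (cdiffB (cdiff_id u) (cdiff_cst u u)).
  by rewrite subrr.
apply: ccont_near cS'; exists 1 => // v v1.
rewrite (addrC u) addrK.
have -> : sinratio (v + u) = sinratio v by apply: sinratio_periodic; rewrite cexpD E mulr1.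
rewrite /slope /sinratio; have [->|v0] := eqVneq v 0.
  by rewrite cexp0 eqxx sinlim0 mul0r cexp0 divr1 mulr1.
have ne : cexp v != 1.
  apply/eqP => E1; move/eqP: v0; apply; apply: cexp_inj_strip; first by rewrite E1 cexp0.
  rewrite subr0 (le_lt_trans (cabs_Im _))// (lt_trans v1)//.
  by have := pi_ge2 R; rewrite mulr2n; lra.
rewrite (negbTE ne) add0r cexp0.
have ne1 : cexp v - 1 != 0 by rewrite subr_eq0.
by move: (sinlim v) => s; field; rewrite ne1 v0.
Qed.

Lemma cexp_neq1_Re u : complex.Re u != 0 -> cexp u != 1.
Proof.
apply: contraNneq => /(congr1 (@cabs R)); rewrite cabs_cexp cabs1 -expR0.
by move=> /expR_inj ->.
Qed.

(** Off the imaginary axis the sine product is the inverse of an exponential of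
    Gudermann's series, which makes the quotient holomorphic there. *)
Lemma sinratio_logLam u : complex.Re u < 0 -> sinratio u =
  ((tau * cexp (logLam (u / T))) * (tau * cexp (logLam (- (u / T)))) * (1 - cexp u))^-1.
Proof.
move=> u0; have H := sinlim_logLam u0.
have ne : cexp u != 1 by apply: cexp_neq1_Re; rewrite lt_eqF.
have E1 : cexp u - 1 != 0 by rewrite subr_eq0.
have E2 : 1 - cexp u != 0 by rewrite subr_eq0 eq_sym.
rewrite /sinratio (negbTE ne).
set A := (tau * cexp (logLam (u / T))) * (tau * cexp (logLam (- (u / T)))) in H *.
have A0 : A != 0 by apply: contra_eqN H => /eqP ->; rewrite mul0r eq_sym oner_eq0.
have -> : u * sinlim u * cexp (u / 2) = - A^-1.
  apply: (mulfI A0); rewrite mulrN divff// -[X in - X]H; ring.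
by field; rewrite E2 A0 E1.
Qed.

Lemma tau_neq0 : tau != 0.
Proof.
have : sinratio (- 1) != 0 -> tau != 0.
  rewrite sinratio_logLam ?cReN ?cRe1 ?oppr_lt0// invr_eq0.
  by apply: contraNneq => ->; rewrite !mul0r.
by rewrite /stirling_limit mulf_neq0 ?cexp_neq0// realC_eq0 mulf_neq0 ?gt_eqF ?invr_gt0 ?sqrtr_gt0 ?expR_gt0// mulr_gt0// pi_gt0.
Qed.

Lemma cdiff_sinratio_lt0 u : complex.Re u < 0 -> exists l, cdiff sinratio u l.
Proof.
move=> u0.
have iz := Im_divT_gt0 u0.
have sz : slit (u / T) by apply: slit_Im; rewrite gt_eqF.
have sz' : slit (- (u / T)) by apply: slit_Im; rewrite cImN oppr_eq0 gt_eqF.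
have dT : cdiff (fun w => w / T) u (1 / T).
  by apply: cdiff_eq (cdiffM (cdiff_id u) (cdiff_cst T^-1 u)) _; ring.
have [l1 d1] := cdiff_logLam sz; have [l2 d2] := cdiff_logLam sz'.
have D1 := cdiffZ tau (cdiff_cexp_comp (@cdiff_comp _ (@logLam R) (fun w => w / T) u _ _ dT d1)).
have D2 := cdiffZ tau (cdiff_cexp_comp (@cdiff_comp _ (@logLam R) (fun w => - (w / T)) u _ _ (cdiffN dT) d2)).
have D3 := cdiffM (cdiffM D1 D2) (cdiffB (cdiff_cst 1 u) (cdiff_cexp u)).
have ne : cexp u != 1 by apply: cexp_neq1_Re; rewrite lt_eqF.
eexists; apply: cdiff_near; last apply: (cdiff_inv _ D3); last first.
  apply: mulf_neq0; last by rewrite subr_eq0 eq_sym.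
  by apply: mulf_neq0; apply: mulf_neq0; rewrite ?cexp_neq0 ?tau_neq0.
exists (- complex.Re u); first by rewrite oppr_gt0.
move=> v hv /=; rewrite sinratio_logLam// cReD.
by have := cabs_Re v; rewrite ler_norml => /andP[h1 h2]; lra.
Qed.

Lemma cdiff_sinratio u : complex.Re u != 0 -> exists l, cdiff sinratio u l.
Proof.
rewrite neq_lt => /orP[|u0]; first exact: cdiff_sinratio_lt0.
have [|l dl] := @cdiff_sinratio_lt0 (- u); first by rewrite cReN oppr_lt0.
eexists; apply: (@cdiff_ext _ (fun w => sinratio (- w))) => [w|]; first exact: sinratioN.
exact: (@cdiff_comp _ sinratio (fun w => - w) u _ _ (cdiffN (cdiff_id u)) dl).
Qed.

(** Far up in a vertical strip the argument is close to pi / 2, so that z and -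
    z both lie in a sector where the bound of [logLam_bound] holds. *)
Lemma strip_insector z : `|complex.Re z| <= 1 -> 6 <= complex.Im z ->
  [/\ insector 2^-1 z, insector 2^-1 (- z), 6 <= cabs z & cabs (- z) = cabs z].
Proof.
move=> r1 i6.
have a6 : 6 <= cabs z by rewrite (le_trans i6)// (le_trans _ (cabs_Im z))// ler_norm.
move: r1; rewrite ler_norml => /andP[h1 h2].
by split => //; rewrite /insector ?cabsN ?cReN//; lra.
Qed.

Lemma cabs_inv_cexp_bound w (C : R) : cabs w <= C -> cabs (cexp w)^-1 <= expR C.
Proof.
move=> wC; rewrite cabsV cabs_cexp -expRN ler_expR.
by have := cabs_Re w; rewrite ler_norml => /andP[h _]; lra.
Qed.

(** By periodicity it suffices to bound the quotient for Im u between 0 and 2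
    pi; then u / T lies high in the strip 0 <= Re z <= 1. *)
Lemma sinratio_bound : exists2 M, 0 < M & forall u, complex.Re u <= - (12 * pi) -> cabs (sinratio u) <= M.
Proof.
(* the bound of logLam for eta = 1/2 at modulus 6 *)
pose C := 6 / 2^-1 / (6 - 1) : R.
exists (cabs tau^-1 * cabs tau^-1 * expR C * expR C * 2).
  by rewrite !mulr_gt0 ?expR_gt0// cabs_gt0 invr_eq0 tau_neq0.
move=> u uA; have [u' [E1 E2 E3]] := Im_reduce u.
rewrite -(sinratio_periodic E1) -E2 in uA *.
have p0 := pi_gt0 R.
have u0 : complex.Re u' < 0 by lra.
rewrite sinratio_logLam//; set z := u' / T.
have [||s1 s2 a6 aN] := @strip_insector z.
- rewrite /z Re_divT ger0_norm; last by rewrite divr_ge0 ?mulr_ge0 ?(ltW p0)//; lra.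
  by rewrite ler_pdivrMr ?mulr_gt0//; lra.
- by rewrite /z Im_divT ler_pdivlMr ?mulr_gt0//; lra.
have half : 0 < (2^-1 : R) <= 1 by apply/andP; split; lra.
have key v : insector 2^-1 v -> 6 <= cabs v -> cabs (cexp (logLam v))^-1 <= expR C.
  move=> sv a; apply: cabs_inv_cexp_bound; apply: (le_trans (logLam_bound half sv _)); first (clear -a; lra).
  rewrite /C; apply: ler_wpM2l; first by clear; lra.
  by rewrite lef_pV2 ?posrE; clear -a; lra.
have k3 : cabs (1 - cexp u')^-1 <= 2.
  have e2 : expR (complex.Re u') <= 2^-1.
    have : 2 <= expR (- complex.Re u').
      rewrite (le_trans _ (expR_ge1Dx _))//; have := pi_ge2 R; lra.
    rewrite -[expR (complex.Re u')]invrK -expRN => h; rewrite lef_pV2 ?posrE ?expR_gt0//.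
  have := cabs_subr 1 (cexp u'); rewrite cabs1 cabs_cexp => h.
  by rewrite cabsV -[leRHS]invrK lef_pV2 ?posrE; lra.
have -> : (tau * cexp (logLam z) * (tau * cexp (logLam (- z))) * (1 - cexp u'))^-1 =
  tau^-1 * tau^-1 * (cexp (logLam z))^-1 * (cexp (logLam (- z)))^-1 * (1 - cexp u')^-1.
  by rewrite !invfM mulrACA !mulrA.
rewrite 4!cabsM; do 2 (apply: ler_pM; rewrite ?mulr_ge0 ?cabs_ge0//).
  by apply: ler_pM; rewrite ?mulr_ge0 ?cabs_ge0// key.
by rewrite key// aN.
Qed.

(** The quotient is bounded, hence constant by Liouville's theorem, and equal
    to 1 at 0. *)
Theorem sinratio1 u : sinratio u = 1.
Proof.
have [M M0 HM] := sinratio_bound.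
(* growth order 0: the quotient is even, so the bound on the left also holds on
   the right *)
have [c Hc] := @Liouville_exp R sinratio 0 M (12 * pi) 0 sinratio_periodic M0 ccont_sinratio cdiff_sinratio HM
  (ltac:(by move=> w wA; rewrite mul0r expR0 mulr1 -sinratioN HM// cReN lerN2)).
have Hc' w : sinratio w = c 0%N by rewrite Hc big_ord1 /cexpz mul0r cexp0 mulr1.
by rewrite Hc' -(Hc' 0) /sinratio cexp0 eqxx.
Qed.

Lemma logLam_reflection z : 0 < complex.Im z ->
  tau ^+ 2 * cexp (logLam z + logLam (- z)) * (1 - cexp (T * z)) = 1.
Proof.
move=> iz; set u := T * z.
have uz : u / T = z by rewrite /u mulrAC mulfV ?mul1r// T_neq0.
have u0 : complex.Re u < 0.
  have p0 := pi_gt0 R.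
  have -> : complex.Re u = - (2 * pi * complex.Im z).
    have -> : u = (2 * pi)%:C * 'i%C * z by rewrite realCM realCn.
    by rewrite !cReImE; ring.
  by rewrite oppr_lt0 !mulr_gt0.
have := sinratio_logLam u0; rewrite sinratio1 uz => /(congr1 (@GRing.inv _)).
rewrite invrK invr1 => E; rewrite [RHS]E cexpD; ring.
Qed.

(** As z = i n tends to infinity all the other factors of the reflection
    formula tend to 1, so tau^2 = 1; and tau is a limit of positive numbers. *)
Lemma tau1 : tau = 1.
Proof.
have half : 0 < (1 : R) <= 1 by rewrite ltr01 lexx.
pose z (n : nat) : R[i] := 0 +i* n%:R.
have zs n : insector 1 (z n) /\ insector 1 (- z n).
  by rewrite /insector cReN cabsN Re_mk subrr oppr0 mul0r lexx.
have az n : cabs (z n) = n%:R by rewrite cabsE !cReImE expr0n /= add0r sqrtr_sqr ger0_norm.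
have Lb (w : nat -> R[i]) : (forall n, insector 1 (w n)) -> (forall n, cabs (w n) = n%:R) ->
    ctends (fun n => logLam (w n)) 0.
  move=> ws wa; apply: (ctends_inv_bound (C:=12)) => //; exists 4%N => n n4.
  have n4' : 4 <= n%:R :> R by rewrite ler_nat.
  rewrite subr0 (le_trans (logLam_bound half (ws n) _)) ?wa ?divr1//; first by lra.
  move: (n%:R : R) n4' => x x4; clear -x4.
  have x0 : 0 < x by lra.
  rewrite ler_pdivrMr; last by lra.
  rewrite mulrAC ler_pdivlMr//; lra.
have L1 := Lb z (fun n => (zs n).1) az.
have L2 := Lb (fun n => - z n) (fun n => (zs n).2) (fun n => etrans (cabsN _) (az n)).
have cE (a : nat -> R[i]) l : ctends a l -> ctends (fun n => cexp (a n)) (cexp l).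
  by move=> al; apply: ctends_comp al (cdiff_ccont (cdiff_cexp _)).
have E0 : ctends (fun n => cexp (T * z n)) 0.
  apply: (ctends_inv_bound (C:=1)) => //; exists 1%N => n n1; rewrite subr0 cabs_cexp.
  have -> : complex.Re (T * z n) = - (2 * pi * n%:R).
    have -> : T = (2 * pi)%:C * 'i%C by rewrite realCM realCn.
    by rewrite !cReImE; ring.
  have n0 : 0 < n%:R :> R by rewrite ltr0n.
  rewrite expRN mul1r lef_pV2 ?posrE ?expR_gt0// (le_trans _ (expR_ge1Dx _))//.
  have h : 1 <= 2 * (pi : R) by have := pi_ge2 R; lra.
  have : n%:R <= 2 * pi * n%:R :> R by apply: ler_peMl; [exact: ltW|exact: h].
  by move: (2 * pi * n%:R) => y; clear; lra.
have H := ctendsM (ctendsM (ctends_cst (tau ^+ 2)) (cE _ _ (ctendsD L1 L2)))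
   (ctendsB (ctends_cst 1) E0).
rewrite addr0 cexp0 subr0 !mulr1 in H.
have t2 : tau ^+ 2 = 1.
  apply: (ctends_uniq H); apply: (ctends_near (N:=1)) (ctends_cst 1) => n n1.
  by rewrite logLam_reflection// Im_mk ltr0n.
have : (tau - 1) * (tau + 1) == 0 by rewrite -subr_sqr_1 t2 subrr.
rewrite mulf_eq0 subr_eq0 addr_eq0 => /orP[/eqP//|/eqP tN].
have [N HN] := @stirling_tends R 1 ltr01.
have := HN N (leqnn _); rewrite tN opprK -realC1 -realCD cabs_real ltNge.
have s0 : 0 <= stirling R N.+1 by rewrite /stirling mulr_ge0 ?expR_ge0// divr_ge0 ?sqrtr_ge0.
rewrite ger0_norm; first by rewrite lerDr s0.
by rewrite addr_ge0.
Qed.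

Lemma LambdaE w : slit w -> Lambda w = cexp (logLam w).
Proof. by move=> /Lambda_logLam ->; rewrite tau1 mul1r. Qed.

(** On the upper half-plane both z and - z are in the slit plane, and
    [logLam_reflection] applies. *)
Theorem Lambda_reflection z : 0 < complex.Im z ->
  Lambda z * Lambda (- z) * (1 - cexp (T * z)) = 1.
Proof.
move=> iz; rewrite !LambdaE; first last.
- by apply: slit_Im; rewrite gt_eqF.
- by apply: slit_Im; rewrite cImN oppr_eq0 gt_eqF.
by rewrite -cexpD -[RHS](logLam_reflection iz) tau1 expr1n mul1r.
Qed.

Lemma Lambda_neq0 w : slit w -> Lambda w != 0.
Proof. by move=> /LambdaE ->; exact: cexp_neq0. Qed.

Lemma cdiff_Lambda w : slit w -> exists l, cdiff (@Lambda R) w l.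
Proof.
move=> sw; have [l dl] := cdiff_logLam sw.
eexists; apply: (cdiff_near _ (cdiff_cexp_comp dl)).
have [d d0 H] := slit_open sw; exists d => // u /H /LambdaE ->//.
Qed.

(** Stirling's formula, uniformly in a sector: log Lambda is O(1 / w) there. *)
Theorem Lambda_sector eta e : 0 < eta <= 1 -> 0 < e -> exists2 M, 0 < M &
  forall w, insector eta w -> M <= cabs w -> cabs (Lambda w - 1) < e.
Proof.
move=> e01 e0; have /andP[eta0 eta1] := e01.
have [d d0 H] := cdiff_ccont (cdiff_cexp (0 : R[i])) e0.
have E0 : 0 < 6 / eta by rewrite divr_gt0.
have E1 : 0 < 2 / eta by rewrite divr_gt0.
exists (2 / eta + 2 + 6 / eta / d + 1); first by rewrite !addr_gt0// divr_gt0.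
move=> w sw wM; have E2 : 0 < 6 / eta / d by rewrite divr_gt0.
have w0 : w != 0 by rewrite -cabs_gt0; lra.
rewrite LambdaE; last exact: insector_slit sw.
rewrite -[X in cexp X]add0r -cexp0; apply: H.
rewrite (le_lt_trans (logLam_bound e01 sw _))//; first by lra.
have E3 : 6 / eta / d < cabs w - 1 by lra.
rewrite ltr_pdivrMr; last by lra.
by move: E3; rewrite ltr_pdivrMr// (mulrC d).
Qed.

(** By the shift formula Lambda(w) is exp (- (w + 1/2) log w) times a function
    that is continuous and nonzero at 0. Its true order is |w|^(-1/2); the
    weaker powers allow for the factor exp (- w log w). *)
Theorem Lambda_near0 : exists d C, [/\ 0 < d, 0 < C & forall w, slit w -> cabs w < d ->
  C^-1 * cabs w ^+ 2 <= cabs (Lambda w) <= C / cabs w ^+ 2].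
Proof.
(* F is Lambda(w) without its factor exp (- (w + 1/2) log w) *)
pose F (w : R[i]) := cexp ((w + 2^-1) * clog (w + 1) - 1 + logLam (w + 1)).
have s1 : slit (0 + 1 : R[i]) by rewrite add0r -[1](rmorph1 (real_complex R)); apply: slit_pos.
have d1 (c : R[i]) : cdiff (fun w => w + c) 0 1.
  by apply: cdiff_eq (cdiffD (cdiff_id _) (cdiff_cst c _)) _; rewrite addr0.
have [l dl] := cdiff_logLam s1.
have cF : ccont F 0.
  apply: cdiff_ccont; apply: cdiff_cexp_comp.
  apply: cdiffD; last exact: (@cdiff_comp _ (@logLam R) (fun w => w + 1) 0 _ _ (d1 1) dl).
  apply: cdiffB; last exact: cdiff_cst.
  apply: cdiffM (d1 2^-1) _; exact: (@cdiff_clog_comp _ (fun w => w + 1) 0 _ s1 (d1 1)).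
have F0 : 0 < cabs (F 0) by rewrite cabs_gt0 cexp_neq0.
have [|d d0 H] := cF (cabs (F 0) / 2); first by rewrite divr_gt0.
set a := cabs (F 0) in F0 H *.
pose C := expR pi * (a + 2 / a + a / 2 + a).
have ep := expR_gt0 (pi : R).
have a20 : 0 < 2 / a by rewrite divr_gt0.
have C0 : 0 < C by rewrite mulr_gt0//; lra.
exists (Num.min d 1), C; split; rewrite ?lt_min ?d0 ?ltr01//.
move=> w sw; rewrite lt_min => /andP[/H + w1]; rewrite add0r => hF.
have w0 := slit_neq0 sw; have aw : 0 < cabs w by rewrite cabs_gt0.
have L0 : ln (cabs w) < 0 by apply: ln_lt0; rewrite aw.
have E : Lambda w = F w * cexp (- ((w + 2^-1) * clog w)).
  rewrite LambdaE// (logLam_shift 1 sw) /hsum big_ord1 addr0 /F -cexpD /gud.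
  by congr cexp; ring.
have Fu : cabs (F w) <= a + a / 2.
  by have := cabs_subr (F w) (F 0); rewrite -/a; lra.
have Fl : a / 2 <= cabs (F w).
  by have := cabs_subr (F 0) (F w); rewrite cabsBC -/a; lra.
set S := cexp (- _) in E.
have SE : cabs S = expR (- (complex.Re w + 2^-1) * ln (cabs w) + complex.Im w * carg w).
  have h2 : (2^-1 : R[i]) = (2^-1)%:C by rewrite realCV realCn.
  by rewrite /S cabs_cexp /clog h2 !cReImE; congr expR; ring.
have iw : `|complex.Im w * carg w| <= pi.
  have /andP[c1 c2] := carg_itv w.
  rewrite normrM -[leRHS]mul1r; apply: ler_pM => //.
    by rewrite (le_trans (cabs_Im _))// ltW.
  by rewrite ler_norml c1.
have rw : `|complex.Re w| <= 1 by rewrite (le_trans (cabs_Re _))// ltW.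
move: iw rw; rewrite !ler_norml => /andP[i1 i2] /andP[r1 r2].
have sq2 : expR (2 * ln (cabs w)) = cabs w ^+ 2 by rewrite expRM_natl lnK.
(* |Im w arg w| <= pi and |Re w| <= 1, while log |w| < 0 *)
have Su : cabs S <= expR pi / cabs w ^+ 2.
  rewrite SE -sq2 -expRN -expRD ler_expR.
  have : 0 <= (1 - complex.Re w) * - ln (cabs w) by rewrite mulr_ge0; lra.
  lra.
have Sl : (expR pi)^-1 * cabs w ^+ 2 <= cabs S.
  rewrite SE -sq2 -expRN -expRD ler_expR.
  have : 0 <= (1 + complex.Re w) * - ln (cabs w) by rewrite mulr_ge0; lra.
  lra.
rewrite E cabsM; apply/andP; split.
- apply: (@le_trans _ _ (a / 2 * ((expR pi)^-1 * cabs w ^+ 2))); last first.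
    by apply: ler_pM Fl Sl; rewrite ?divr_ge0 ?mulr_ge0 ?invr_ge0 ?sqr_ge0 ?ltW.
  rewrite [leRHS]mulrA ler_wpM2r ?sqr_ge0// mulrC -[a / 2]invrK -invfM lef_pV2 ?posrE//; last first.
    by rewrite mulr_gt0// invr_gt0 divr_gt0.
  by rewrite /C ler_pM2l// invf_div; lra.
- apply: (@le_trans _ _ ((a + a / 2) * (expR pi / cabs w ^+ 2))).
    by apply: ler_pM Fu Su; rewrite ?cabs_ge0.
  rewrite mulrA ler_wpM2r ?invr_ge0 ?sqr_ge0// mulrC /C ler_pM2l//; lra.
Qed.

End Reflection.

(** * The dilogarithm *)

Section Dilogarithm.
Variable R : realType.
Implicit Types (z w u l x : R[i]) (e d r : R) (a : nat -> R[i]).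

Lemma geometric_sum_le r N n : 0 <= r < 1 -> \sum_(i < n) r ^+ (N + i) <= r ^+ N / (1 - r).
Proof.
move=> /andP[r0 r1]; have r1' : 0 < 1 - r by lra.
under eq_bigr => i _ do rewrite exprD.
rewrite -mulr_sumr ler_wpM2l ?exprn_ge0//.
rewrite -[leRHS]mul1r ler_pdivlMr// mulrC.
have := subrX1 r n; have : 0 <= r ^+ n by rewrite exprn_ge0.
move: (\sum_(i < n) _) => s; lra.
Qed.

(** A sum over indices that contain 0, ..., N - 1 differs from the N-th partial
    sum by less than a geometric tail. The unordered sums over the lattice meet
    such index sets. *)
Lemma geometric_subsum a r l N M (c : pred nat) : 0 <= r < 1 -> (forall m, cabs (a m) <= r ^+ m) ->
  (forall m, (m < N)%N -> c m) -> (N <= M)%N ->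
  cabs (\sum_(m < M) (if c m then a m else 0) - \sum_(m < N) a m) <= r ^+ N / (1 - r).
Proof.
move=> r01 ar cN /subnKC <-; rewrite big_split_ord /=.
under eq_bigr => i _ do rewrite cN//.
rewrite addrC addrK (le_trans (cabs_sum _ _ _))// (le_trans _ (geometric_sum_le N (M - N) r01))//.
apply: ler_sum => i _; case: ifP => _; first exact: ar.
by case/andP: r01 => r0 _; rewrite cabs0 exprn_ge0.
Qed.

Lemma geometric_cvg a r : 0 <= r < 1 -> (forall m, cabs (a m) <= r ^+ m) ->
  exists2 l, ctends (fun n => \sum_(m < n) a m) l &
    forall N, cabs (\sum_(m < N) a m - l) <= r ^+ N / (1 - r).
Proof.
move=> r01 ar; have /andP[r0 r1] := r01.
have tail N n : (N <= n)%N -> cabs (\sum_(m < n) a m - \sum_(m < N) a m) <= r ^+ N / (1 - r).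
  by move=> Nn; exact: (@geometric_subsum a r 0 N n xpredT).
have [l hl] : exists l, ctends (fun n => \sum_(m < n) a m) l.
  apply: ccauchy_cvg => e e0; have [N HN] := @expr_lt_eventually _ r (1 - r)^-1 e r01 e0.
  by exists N => n /tail h; exact: le_lt_trans h HN.
exists l => // N; rewrite cabsBC.
apply: (ctends_le (ctendsB hl (ctends_cst (\sum_(m < N) a m))) (N:=N)) => n; exact: tail.
Qed.

Definition dilog_coef x (m : nat) : R[i] := x ^+ m.+1 / m.+1%:R ^+ 2.

Definition dilog x := xget 0 [set l | ctends (fun n => \sum_(m < n) dilog_coef x m) l].

Lemma natC_neq0 m : m.+1%:R != 0 :> R[i].
Proof. by rewrite pnatr_eq0. Qed.

Lemma cabs_divn_le x m k : cabs (x / m.+1%:R ^+ k) <= cabs x.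
Proof.
rewrite cabs_div cabsX cabs_nat ler_pdivrMr ?exprn_gt0 ?ltr0n//.
by rewrite ler_peMr ?cabs_ge0// exprn_ege1// ler1n.
Qed.

Lemma dilog_coef_bound x m : cabs x < 1 -> cabs (dilog_coef x m) <= cabs x ^+ m.
Proof.
move=> x1; rewrite (le_trans (cabs_divn_le _ _ _))// cabsX exprS.
by rewrite ler_piMl ?exprn_ge0 ?cabs_ge0// ltW.
Qed.

Lemma dilogP x : cabs x < 1 -> ctends (fun n => \sum_(m < n) dilog_coef x m) (dilog x).
Proof.
move=> x1; have [|l hl _] := @geometric_cvg _ (cabs x) _ (fun m => dilog_coef_bound m x1).
  by rewrite cabs_ge0.
by rewrite /dilog; apply: xgetPex; exists l.
Qed.

Lemma dilog_subsum x N M (c : pred nat) : cabs x < 1 ->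
  (forall m, (m < N)%N -> c m) -> (N <= M)%N ->
  cabs (\sum_(m < M) (if c m then dilog_coef x m else 0) - dilog x) <=
    2 * (cabs x ^+ N / (1 - cabs x)).
Proof.
move=> x1 cN NM; have r01 : 0 <= cabs x < 1 by rewrite cabs_ge0.
have [l hl Hl] := @geometric_cvg _ (cabs x) r01 (fun m => dilog_coef_bound m x1).
have -> : dilog x = l by apply: ctends_uniq hl; exact: dilogP.
have h1 := @geometric_subsum _ (cabs x) 0 N M c r01 (fun m => dilog_coef_bound m x1) cN NM.
have h2 := Hl N.
set s := \sum_(m < M) _ in h1 *; set t := \sum_(m < N) _ in h1 h2.
have -> : s - l = (s - t) + (t - l) by ring.
by rewrite (le_trans (cabsD _ _))// mulr2n mulrDl mul1r lerD.
Qed.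

(** The derivative is the sum of x^m / (m + 1), whose product with x is
    Mercator's series. Stating x * l covers x = 0 as well. *)
Lemma cdiff_dilog x : cabs x < 1 -> exists2 l, cdiff dilog x l & x * l = - clog (1 - x).
Proof.
(* a radius between |x| and 1 leaves room for a uniform bound of the second
   derivative *)
move=> x1; pose r := (1 + cabs x) / 2.
have r1 : r < 1 by rewrite /r; lra.
have r0 : 0 <= r by rewrite /r; have := cabs_ge0 x; lra.
have xr : cabs x < r by rewrite /r; lra.
pose g (n : nat) w : R[i] := \sum_(m < n) dilog_coef w m.
pose g' (n : nat) w : R[i] := \sum_(m < n) w ^+ m / m.+1%:R.
pose g'' (n : nat) w : R[i] := \sum_(m < n) m%:R * w ^+ m.-1 / m.+1%:R.
have dg n w : cdiff (g n) w (g' n w).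
  apply: cdiff_sum => m; apply: cdiff_eq (cdiffM (cdiffX m.+1 (cdiff_id w)) (cdiff_cst _ w)) _.
  by have := natC_neq0 m; move: (m.+1%:R : R[i]) => q q0; field.
have dg' n w : cdiff (g' n) w (g'' n w).
  apply: cdiff_sum => m; apply: cdiff_eq (cdiffM (cdiffX m (cdiff_id w)) (cdiff_cst _ w)) _.
  by rewrite mulr0 addr0 mulr1.
have g1 : 0 < 1 - r by lra.
have xu u : cabs u < r - cabs x -> cabs (x + u) < r.
  by move=> h; rewrite (le_lt_trans (cabsD _ _))//; lra.
have bg n u : cabs u < r - cabs x -> cabs (g'' n (x + u)) <= 1 + (1 - r)^-1.
  move=> /xu xur; rewrite (le_trans (cabs_sum _ _ _))//.
  apply: (@le_trans _ _ (\sum_(m < n) r ^+ m.-1)).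
    apply: ler_sum => m _; rewrite mulrAC cabsM cabsX.
    rewrite -[leRHS]mul1r; apply: ler_pM; rewrite ?cabs_ge0 ?exprn_ge0 ?cabs_ge0//.
      by rewrite cabs_div !cabs_nat ler_pdivrMr ?ltr0n// mul1r ler_nat.
    by rewrite lerXn2r ?nnegrE ?cabs_ge0// ltW.
  case: n => [|n]; first by rewrite big_ord0 addr_ge0// invr_ge0 ltW.
  rewrite big_ord_recl lerD//=.
  have := @geometric_sum_le r 0 n; rewrite expr0 mul1r r0 r1 => /(_ isT).
  exact.
have [||l hl _] := @geometric_cvg (fun m => x ^+ m / m.+1%:R) (cabs x).
- by rewrite cabs_ge0.
- by move=> m; rewrite -cabsX -[m.+1%:R]expr1 cabs_divn_le.
exists l.
  apply: (@cdiff_limit _ g (fun n => g' n x) dilog x l (1 + (1 - r)^-1) (r - cabs x)) => //.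
  - by rewrite subr_gt0.
  - by move=> u /xu h; apply: dilogP; exact: lt_trans h r1.
  - move=> n; apply: (@taylor1_bound _ (g n) (g' n) (g'' n)).
    + by move=> u _.
    + by move=> u _.
    + exact: bg.
apply: (ctends_uniq (ctendsM (ctends_cst x) hl)) => e e0.
have [|N HN] := @expr_lt_eventually _ (cabs x) (1 - cabs x)^-1 e _ e0.
  by rewrite cabs_ge0.
exists N => n nN; rewrite opprK mulr_sumr addrC.
have -> : \sum_(i < n) x * (x ^+ i / i.+1%:R) = \sum_(j < n) x ^+ j.+1 / j.+1%:R.
  by apply: eq_bigr => i _; rewrite exprS mulrA.
rewrite (le_lt_trans (clog_mercator n x1))// (le_lt_trans _ HN)//.
have y1 : 0 < 1 - cabs x by lra.
rewrite -mulrA ler_pM ?exprn_ge0 ?cabs_ge0// ?mulr_ge0 ?invr_ge0 ?(ltW y1) ?cabs_ge0//.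
  by rewrite ler_wiXn2l ?cabs_ge0// ltW.
by rewrite ler_piMr ?invr_ge0 ?ltW.
Qed.

End Dilogarithm.

(** * The algebra of a BPS structure and the sums DT(l) *)

Section BPSAlgebra.
Variables (R : realType) (G : zmodType) (n : nat) (S : bps R G n).
Implicit Types (a b g : G) (x y : G -> R[i]) (l D : set R[i]).

Lemma bps_norm0 : bps_norm S 0 = 0.
Proof. by rewrite -[X in bps_norm S X](scale0r 0) bps_normZ normr0 mul0r. Qed.

(** 0 = ||v - v|| <= 2 ||v||. *)
Lemma bps_norm_ge0 v : 0 <= bps_norm S v.
Proof.
have := bps_normD S v (- v); rewrite subrr bps_norm0 -scaleN1r bps_normZ normrN normr1 mul1r.
lra.
Qed.

Lemma lnorm_ge0 g : 0 <= lnorm S g. Proof. exact: bps_norm_ge0. Qed.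

(** The support property is strict, also for a vector of norm 0. *)
Lemma active_Z_neq0 g : active S g -> bps_Z S g != 0.
Proof.
move=> ag; have [C C0 H] := bps_support S; have := H g ag; rewrite -cabs_gt0.
by apply: le_lt_trans; rewrite mulr_ge0 ?bps_norm_ge0 ?ltW.
Qed.

Lemma active_neq0 g : active S g -> g != 0.
Proof. by move=> /active_Z_neq0; apply: contraNneq => ->; rewrite raddf0. Qed.

Lemma activeN g : active S g -> active S (- g).
Proof. by rewrite /active/= bps_OmegaN. Qed.

Lemma bps_formDr a b c : bps_form S a (b + c) = bps_form S a b + bps_form S a c.
Proof. by rewrite bps_form_skew bps_formDl opprD -!bps_form_skew. Qed.

Lemma bps_form0l b : bps_form S 0 b = 0.
Proof. by apply: (addrI (bps_form S 0 b)); rewrite -bps_formDl !addr0. Qed.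

Lemma bps_form0r b : bps_form S b 0 = 0.
Proof. by rewrite bps_form_skew bps_form0l oppr0. Qed.

Lemma bps_formNl a b : bps_form S (- a) b = - bps_form S a b.
Proof. by apply: (addrI (bps_form S a b)); rewrite -bps_formDl !subrr bps_form0l. Qed.

Lemma bps_formNr a b : bps_form S a (- b) = - bps_form S a b.
Proof. by rewrite bps_form_skew bps_formNl -bps_form_skew. Qed.

Lemma bps_formMnr a b m : bps_form S a (b *+ m) = bps_form S a b *+ m.
Proof. by elim: m => [|m IH]; rewrite ?mulr0n ?bps_form0r// !mulrS bps_formDr IH. Qed.

Lemma bps_formMzl a b (k : int) : bps_form S (a *~ k) b = k * bps_form S a b.
Proof.
have H m : bps_form S (a *+ m) b = m%:Z * bps_form S a b.
  by rewrite bps_form_skew bps_formMnr -mulNrn -bps_form_skew -mulr_natl natz.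
by case: k => m; [exact: H|rewrite NegzE mulrNz bps_formNl H mulNr].
Qed.

Lemma bps_form_suml (I : finType) (F : I -> G) b :
  bps_form S (\sum_i F i) b = \sum_i bps_form S (F i) b.
Proof. exact: (big_morph (bps_form S ^~ b) (fun u v => bps_formDl S u v b) (bps_form0l b)). Qed.

Lemma bps_form_self a : bps_form S a a = 0.
Proof. by have := bps_form_skew S a a; lia. Qed.

Lemma bps_form_coord a b :
  bps_form S a b = \sum_i bps_coord S a 0 i * bps_form S (bps_basis S i) b.
Proof.
by rewrite -{1}(bps_coordK S a) bps_form_suml; apply: eq_bigr => i _; rewrite bps_formMzl.
Qed.

Lemma bps_coordD a b : bps_coord S (a + b) = bps_coord S a + bps_coord S b.
Proof.
rewrite -[RHS](bps_basisK S); congr bps_coord.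
rewrite -{1}(bps_coordK S a) -{1}(bps_coordK S b) -big_split; apply: eq_bigr => i _ /=.
by rewrite mxE mulrzDr.
Qed.

Lemma bps_coord0 : bps_coord S 0 = 0.
Proof. by apply: (addrI (bps_coord S 0)); rewrite -bps_coordD !addr0. Qed.

Lemma bps_coordMn a m : bps_coord S (a *+ m) = bps_coord S a *+ m.
Proof. by elim: m => [|m IH]; rewrite ?mulr0n ?bps_coord0// !mulrS bps_coordD IH. Qed.

Lemma bps_coord_eq0 a : bps_coord S a = 0 -> a = 0.
Proof.
by move=> E; rewrite -(bps_coordK S a) E big1// => i _; rewrite mxE.
Qed.

(** Bounds the multiplicities m for which g can be m times another class. *)
Definition height g : nat := (\sum_(i < n) absz (bps_coord S g ord0 i))%N.

Lemma height_mul a m : a != 0 -> (m <= height (a *+ m))%N.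
Proof.
move=> a0; have [i ci] : exists i, bps_coord S a 0 i != 0.
  apply: contrapT => H; move/eqP: a0; apply; apply: bps_coord_eq0; apply/rowP => i.
  by rewrite mxE; apply/eqP; apply: contrapT => /negP h; apply: H; exists i.
rewrite /height (bigD1 i)//= bps_coordMn mulmxnE.
apply: leq_trans (leq_addr _ _).
by rewrite -mulr_natr natz abszM leq_pmull// absz_gt0.
Qed.

Lemma torus_neq0 x a : torus S x -> x a != 0.
Proof. by case. Qed.

Lemma torus0 x : torus S x -> x 0 = 1.
Proof.
move=> [x0 xD]; have := xD 0 0; rewrite bps_form0l expr0z mul1r addr0 => E.
by apply: (mulfI (x0 0)); rewrite -E mulr1.
Qed.

(** The sign vanishes because <a, a> = 0. *)
Lemma torusMn x a m : torus S x -> x (a *+ m) = x a ^+ m.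
Proof.
move=> xT; elim: m => [|m IH]; first by rewrite mulr0n expr0 torus0.
by rewrite mulrS xT.2 bps_formMnr bps_form_self mul0rn expr0z mul1r IH exprS.
Qed.

Lemma torus_act0 x : torus_act S 0 x = x.
Proof.
apply/funext => a; rewrite /torus_act big1 ?cexp0 ?mul1r// => i _.
by rewrite mxE mul0r.
Qed.

Lemma torus_coord_add (F : 'I_n -> R[i]) a b :
  \sum_i F i * (bps_coord S (a + b) 0 i)%:~R =
  \sum_i F i * (bps_coord S a 0 i)%:~R + \sum_i F i * (bps_coord S b 0 i)%:~R.
Proof. by rewrite -big_split; apply: eq_bigr => i _; rewrite bps_coordD mxE intrD mulrDr. Qed.

Lemma torus_actT s x : torus S x -> torus S (torus_act S s x).
Proof.
move=> [x0 xD]; split=> [a|a b]; first by rewrite /torus_act mulf_neq0 ?cexp_neq0.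
rewrite /torus_act xD torus_coord_add cexpD.
by move: (cexp _) (cexp _) ((-1) ^ _) (x a) (x b) => p q r u v; ring.
Qed.

End BPSAlgebra.

Section FiniteBPS.
Variables (R : realType) (G : zmodType) (n : nat) (S : bps R G n).
Hypothesis Sfin : bps_finite S.
Implicit Types (a b g : G) (x y : G -> R[i]) (l D : set R[i]).

(** The active classes as a sequence, so that finite products over subsets of
    them are ordinary big operators. *)
Definition acts : seq G := finmap.enum_fset (fset_set (active S)).

Lemma mem_acts g : (g \in acts) = (g \in active S).
Proof. exact: in_fset_set. Qed.

Lemma actsP g : reflect (active S g) (g \in acts).
Proof. by rewrite mem_acts; apply: (iffP idP) => [/set_mem|/mem_set]. Qed.

Lemma acts_uniq : uniq acts. Proof. exact: finmap.fset_uniq. Qed.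

Lemma fsbig_acts (P : G -> Prop) (F : G -> R[i]) :
  \big[*%R/1]_(g \in [set g | active S g /\ P g]) F g = \prod_(g <- acts | `[< P g >]) F g.
Proof.
rewrite -[RHS]big_filter [RHS]fsbig_seq ?filter_uniq ?acts_uniq//.
apply: eq_fsbigl; apply/seteqP; split=> g.
  by move=> [/actsP aA Pg] /=; rewrite mem_filter aA andbT; exact/asboolP.
by move=> /=; rewrite mem_filter => /andP[/asboolP Pg /actsP aA].
Qed.

(** For a given g all the multiplicities that occur are at most the height of
    g, so a common bound can be used for all classes. *)
Lemma DT_acts g M : (height S g <= M)%N -> DT S g =
  \sum_(a <- acts) \sum_(m < M) (if g == a *+ m.+1 then bps_Omega S a / m.+1%:R ^+ 2 else 0).
Proof.
move=> gM; rewrite /DT.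
(* all pairs with an active class and a multiplicity up to M; the index set of
   DT differs from those with g = m a by terms that vanish *)
set ps := [seq (m.+1, a) | a <- acts, m <- iota 0 M].
have ups : uniq ps.
  apply: allpairs_uniq; [exact: acts_uniq|exact: iota_uniq|].
  by move=> [? ?] [? ?] _ _ [-> ->].
transitivity (\sum_(p \in [set` seq.filter (fun p => g == p.2 *+ p.1) ps]) bps_Omega S p.2 / p.1%:R ^+ 2).
  apply/esym/fsbig_widen => p /=.
    rewrite mem_filter => /andP[/eqP gp /allpairsP[[a m] [_ _ pE]]].
    by rewrite pE in gp *.
  move=> [[p0 gp] np]; apply/eqP; rewrite mulf_eq0; apply/orP; left; apply: contrapT => /negP ap.
  apply: np; rewrite mem_filter gp eqxx/=; apply/allpairsP; exists (p.2, p.1.-1); rewrite /= mem_iota/=.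
  split; [exact/actsP| |by case: p p0 {gp ap} => [[]]].
  rewrite add0n prednK// (leq_trans _ gM)// gp height_mul//; exact: active_neq0 ap.
rewrite -fsbig_seq ?filter_uniq// big_filter big_mkcond big_allpairs_dep/=; apply: eq_bigr => a _.
by rewrite -[in LHS](subn0 M) -/(index_iota 0 M) big_mkord.
Qed.

Lemma ray_mulrn l (z : R[i]) m : is_ray l -> (z *+ m.+1 \in l) = (z \in l).
Proof.
move=> [w w0 ->]; apply/idP/idP => /set_mem[c c0 E]; apply/mem_set.
  exists (c / m.+1%:R); first by rewrite divr_gt0.
  apply: (mulfI (natC_neq0 R m)); rewrite mulr_natl E mulrA; congr (_ * _).
  rewrite realCM realCV realCn mulrC divfK ?natC_neq0//.
exists (c *+ m.+1); first by rewrite pmulrn_lgt0.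
by rewrite E -mulr_natr -(mulr_natr c) realCM realCn mulrAC.
Qed.

(** A class g on the ray contributes through the active a with g = a *+ m,
    which lies on the same ray; exchanging the sums groups the contributions by
    a into partial sums of dilogarithms. *)
Lemma DT_partial_sum l x (F : finmap.finset_of (Phant G)) M : is_ray l -> torus S x ->
  (forall g, g \in finmap.enum_fset F -> (height S g <= M)%N) ->
  summability.partial_sum (DT_term S l x) F =
  \sum_(a <- acts | bps_Z S a \in l) ratr (bps_Omega S a) *
    \sum_(m < M) (if a *+ m.+1 \in finmap.enum_fset F then dilog_coef (x a) m else 0).
Proof.
move=> lr xT FM; transitivity (\sum_(g <- finmap.enum_fset F) DT_term S l x g).
  by rewrite finmap.big_seq_fsetE.
transitivity (\sum_(g <- finmap.enum_fset F) \sum_(a <- acts | bps_Z S a \in l) \sum_(m < M)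
   (if g == a *+ m.+1 then ratr (bps_Omega S a) * dilog_coef (x a) m else 0)).
  apply: eq_big_seq => g gF; rewrite /DT_term (DT_acts (FM g gF)).
  rewrite [in RHS]big_mkcond; case: ifPn => gl; last first.
    apply/esym; rewrite big1// => a _; case: ifP => // al.
    by rewrite big1// => m _; case: eqP => // E; move: gl; rewrite E raddfMn/= ray_mulrn// al.
  rewrite rmorph_sum mulr_suml; apply: eq_bigr => a _.
  rewrite rmorph_sum mulr_suml; case: ifPn => al; last first.
    rewrite big1// => m _; case: eqP => E; last by rewrite rmorph0 mul0r.
    by move: gl; rewrite E raddfMn/= ray_mulrn// (negbTE al).
  apply: eq_bigr => m _; case: eqP => [->|_]; last by rewrite rmorph0 mul0r.
  rewrite (torusMn _ _ xT) fmorph_div rmorphXn rmorph_nat /dilog_coef.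
  by rewrite mulrAC -mulrA.
rewrite exchange_big/=; apply: eq_bigr => a _.
rewrite exchange_big/= mulr_sumr; apply: eq_bigr => m _.
case: ifPn => aF; last first.
  rewrite mulr0 big_seq big1// => g gF; case: eqP => // E.
  by move: aF; rewrite -E gF.
rewrite (bigD1_seq (a *+ m.+1)) ?finmap.fset_uniq//= eqxx big1 ?addr0//.
by move=> g /negbTE ->.
Qed.

(** A finite set that contains a, 2 a, ..., N a for an active a contains the
    first N terms of the dilogarithm of x_a. *)
Lemma DT_sum_cvg l x : is_ray l -> torus S x ->
  (forall a, active S a -> l (bps_Z S a) -> cabs (x a) < 1) ->
  summability.partial_sum (DT_term S l x) @ summability.totally -->
  (\sum_(a <- acts | bps_Z S a \in l) ratr (bps_Omega S a) * dilog (x a) : R[i]^o).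
Proof.
move=> lr xT x1; have tF : ProperFilter (@summability.totally G) := summability.totally_filter.
(* M bounds the heights of all the elements of F *)
pose M (F : finmap.finset_of (Phant G)) := (\sum_(g <- finmap.enum_fset F) height S g)%N.
pose T a (F : finmap.finset_of (Phant G)) : R[i]^o :=
  ratr (bps_Omega S a) * \sum_(m < M F) (if a *+ m.+1 \in finmap.enum_fset F then dilog_coef (x a) m else 0).
have -> : summability.partial_sum (DT_term S l x) =
    fun F => \sum_(a <- acts | bps_Z S a \in l) T a F.
  apply/funext => F; rewrite -(DT_partial_sum lr xT)// => g gF.
  by rewrite /M (big_rem g)//= leq_addr.
rewrite big_seq_cond; under eq_fun => F do rewrite big_seq_cond.
apply: cvg_big => [|a /andP[/actsP aa /set_mem al]]; first exact: @add_continuous.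
have xa := x1 a aa al.
apply: cvgMr; apply/cvgrPdist_lt => e; rewrite ltcE => /andP[/eqP eI eR].
have eE : e = (complex.Re e)%:C by apply: complexP; rewrite ?cReImE.
have [|N HN] := @expr_lt_eventually _ (cabs (x a)) (2 / (1 - cabs (x a))) (complex.Re e) _ eR.
  by rewrite cabs_ge0.
exists (finmap.seq_fset tt [seq a *+ m.+1 | m <- iota 0 N]) => // F NF0; have /finmap.fsubsetP NF := NF0.
have aF m : (m < N)%N -> a *+ m.+1 \in finmap.enum_fset F.
  move=> mN; apply: NF; rewrite finmap.seq_fsetE; apply/mapP; exists m => //.
  by rewrite mem_iota.
rewrite distrC [`|_|]cabs_normC eE ltcR (le_lt_trans _ HN)//.
rewrite [leRHS]mulrCA; apply: (dilog_subsum (c:=fun m => a *+ m.+1 \in finmap.enum_fset F)) => //.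
case: N aF {HN NF NF0} => // N aF.
have /aF h : (N < N.+1)%N by [].
rewrite /M (big_rem _ h)/=; apply: leq_trans (leq_addr _ _); apply: height_mul.
exact: active_neq0 aa.
Qed.

Lemma DT_summableP l x : is_ray l -> torus S x ->
  (forall a, active S a -> l (bps_Z S a) -> cabs (x a) < 1) ->
  DT_summable S l x.
Proof. by move=> lr xT x1; apply/cvg_ex; eexists; exact: DT_sum_cvg. Qed.

(** The Hamiltonian is a finite combination of dilogarithms of active
    characters. *)
Lemma DT_rayE l x : is_ray l -> torus S x ->
  (forall a, active S a -> l (bps_Z S a) -> cabs (x a) < 1) ->
  DT_ray S l x = - \sum_(a <- acts | bps_Z S a \in l) ratr (bps_Omega S a) * dilog (x a).
Proof.
move=> lr xT x1; have tF : ProperFilter (@summability.totally G) := summability.totally_filter.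
rewrite /DT_ray /summability.sum; congr (- _).
exact: (@cvg_lim R[i]^o (@norm_hausdorff _ _) _ _ tF _ _ (DT_sum_cvg lr xT x1)).
Qed.

End FiniteBPS.

(** * The Hamiltonian flow of DT(l) *)

Section LinearFlow.
Variable R : realType.
Implicit Types (k z w : R[i]) (s u : R).

(** The componentwise derivative of a complex function of a real variable, as
    it occurs in [ham_curve]. *)
Definition rcderiv (c : R -> R[i]) s (l : R[i]) :=
  is_derive s 1 (fun u => complex.Re (c u)) (complex.Re l) /\
  is_derive s 1 (fun u => complex.Im (c u)) (complex.Im l).

Lemma rcderiv_line f z s l : cdiff f (s%:C * z) l -> rcderiv (fun u => f (u%:C * z)) s (l * z).
Proof.
move=> dl; rewrite -[s%:C * z]add0r in dl; split.
  have := is_derive_Re_line 1 dl; rewrite mul1r; congr is_derive.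
  by apply/funext => u; rewrite mul1r add0r.
have iE w : complex.Re (- 'i%C * w) = complex.Im w by rewrite !cReImE; ring.
have := is_derive_Re_line (- 'i%C) dl; rewrite iE; congr is_derive.
by apply/funext => u; rewrite iE add0r.
Qed.

Lemma rcderivM c d s l m : rcderiv c s l -> rcderiv d s m ->
  rcderiv (fun u => c u * d u) s (l * d s + c s * m).
Proof.
move=> [cR cI] [dR dI]; split.
- have H := is_deriveB (is_deriveM cR dR) (is_deriveM cI dI).
  have -> : (fun u => complex.Re (c u * d u)) =
    (fun u => complex.Re (c u)) * (fun u => complex.Re (d u)) - (fun u => complex.Im (c u)) * (fun u => complex.Im (d u)).
    by apply/funext => u; rewrite cReM.
  by apply: is_derive_eq H _; rewrite !cReImE /GRing.scale/=; ring.
- have H := is_deriveD (is_deriveM cR dI) (is_deriveM cI dR).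
  have -> : (fun u => complex.Im (c u * d u)) =
    (fun u => complex.Re (c u)) * (fun u => complex.Im (d u)) + (fun u => complex.Im (c u)) * (fun u => complex.Re (d u)).
    by apply/funext => u; rewrite cImM.
  by apply: is_derive_eq H _; rewrite !cReImE /GRing.scale/=; ring.
Qed.

Lemma is_derive0_cst (F : R -> R) s : 0 <= s -> (forall u, 0 <= u <= s -> is_derive u 1 F 0) -> F s = F 0.
Proof.
rewrite le_eqVlt => /orP[/eqP <-//|s0] dF.
have [||u _ E] := @MVT R F (fun=> 0) 0 s s0.
- by move=> u; rewrite in_itv => /andP[u0 us]; apply: dF; rewrite !ltW.
- apply: derivable_within_continuous => u; rewrite in_itv => us.
  by have [] := dF u us.
by move/eqP: E; rewrite mul0r subr_eq0 => /eqP.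
Qed.

(** The product of c with exp (- s k) has derivative 0. *)
Lemma linear_flow_unique (c : R -> R[i]) k :
  (forall s, 0 <= s <= 1 -> rcderiv c s (k * c s)) ->
  forall s, 0 <= s <= 1 -> c s = c 0 * cexp (s%:C * k).
Proof.
move=> dc s /andP[s0 s1].
pose E (u : R) := cexp (u%:C * - k).
have dE u : rcderiv E u (E u * - k) by apply: rcderiv_line; exact: cdiff_cexp.
have dcE u : 0 <= u <= s -> rcderiv (fun u => c u * E u) u 0.
  move=> /andP[u0 us]; have := rcderivM (dc u _) (dE u); rewrite u0 (le_trans us s1) => /(_ isT).
  by congr rcderiv; ring.
have H : c s * E s = c 0 * E 0.
  by apply: complexP;
    [apply: (is_derive0_cst (F:=fun u => complex.Re (c u * E u))) s0 _
    |apply: (is_derive0_cst (F:=fun u => complex.Im (c u * E u))) s0 _] => u /dcE[].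
move: H; rewrite /E mul0r cexp0 mulr1 => <-.
by rewrite mulrN -mulrA -cexpD addNr cexp0 mulr1.
Qed.

Lemma linear_flow_curve z k s : rcderiv (fun u => z * cexp (u%:C * k)) s (k * (z * cexp (s%:C * k))).
Proof.
have := @rcderiv_line (fun w => z * cexp w) k s _ (cdiffZ z (cdiff_cexp _)).
by congr rcderiv; ring.
Qed.

End LinearFlow.

Section NearDifferentiable.
Variables (K : numFieldType) (V W : normedModType K).

(** The Hamiltonian equals a combination of dilogarithms only near the point at
    which it is differentiated. *)
Lemma near_eq_differentiable (f g : V -> W) (x : V) :
  (\forall y \near x, f y = g y) -> differentiable f x -> differentiable g x.
Proof.
move=> fg /diff_locallyP[c E].
have gx : f x = g x := nbhs_singleton fg.
have E' : g \o shift x = cst (g x) + 'd f x +o_ (0 : V) id.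
  apply/eqaddoP => e e0; have /eqaddoP/(_ e e0) H := E.
  have fg0 : \forall y \near (0 : V), f (y + x) = g (y + x).
    by move/nbhs0P: fg; apply: filterS => y; rewrite addrC.
  near=> y.
  have h : `|(f \o shift x - (cst (f x) + 'd f x)) y| <= e * `|y| by near: y.
  have h' : f (y + x) = g (y + x) by near: y.
  by move: h; rewrite /= !fctE /= -gx h'.
apply/diff_locallyP; have -> := diff_unique c E'.
by split.
Unshelve. all: by end_near.
Qed.

Lemma near0_row (n : nat) (e : K) : 0 < e ->
  \forall s \near (0 : 'rV[K]_n), forall i, `|(s : 'rV[K]_n) 0 i| < e.
Proof.
move=> e0; apply/nbhs_ballP; exists e => // s bs i.
by have [_ /(_ 0 i)] := bs; rewrite mxE /ball/= sub0r normrN.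
Qed.

End NearDifferentiable.

Section Flow.
Variables (R : realType) (G : zmodType) (n : nat) (S : bps R G n).
Hypothesis Sfin : bps_finite S.
Hypothesis Sunc : bps_uncoupled S.
Hypothesis Sint : bps_integral S.
Implicit Types (a b g : G) (x y : G -> R[i]) (l D : set R[i]) (r s u : R).

Local Notation acts := (acts S).
Local Notation actsP := (actsP Sfin).

(** Finitely many conditions that hold for all small radii hold for a common
    one. *)
Lemma seq_uniform_radius (I : eqType) (q : seq I) (P : I -> R -> Prop) :
  (forall i, i \in q -> exists2 e, 0 < e & forall e', 0 < e' <= e -> P i e') ->
  exists2 e, 0 < e & forall i, i \in q -> P i e.
Proof.
move=> H; suff [e e0 K] : exists2 e, 0 < e & forall i, i \in q -> forall e', 0 < e' <= e -> P i e'.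
  by exists e => // i iq; apply: K iq _ _; rewrite e0 lexx.
elim: q H => [|i q IH] H; first by exists 1.
have [|e e0 K] := IH; first by move=> j jq; apply: H; rewrite inE jq orbT.
have [|d d0 L] := H i; first by rewrite inE eqxx.
exists (Num.min d e); first by rewrite lt_min d0.
move=> j; rewrite inE => /orP[/eqP ->|/K {}K] e'; rewrite le_min => /and3P[e'0 e'd e'e].
  by apply: L; rewrite e'0.
by apply: K; rewrite e'0.
Qed.

(** Makes the conditions on the index available under the sum for rules that
    treat all indices alike. *)
Lemma big_acts_cond (P : pred G) (F : G -> R[i]) :
  \sum_(a <- acts | P a) F a = \sum_(a <- acts) (if (a \in acts) && P a then F a else 0).
Proof. by rewrite big_mkcond big_seq [RHS]big_seq; apply: eq_bigr => a ->. Qed.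

Lemma Udom_torus D r x : Udom S D r x -> torus S x.
Proof. by case. Qed.

Lemma Udom_bound D r x g : Udom S D r x -> active S g -> D (bps_Z S g) ->
  cabs (x g) < expR (- r * lnorm S g).
Proof.
move=> [xT [e e0 /(_ 0)]]; rewrite torus_act0 => H ag Dg.
by apply: (H _).2 => // i; rewrite mxE cabs0.
Qed.

Lemma Udom_lt1 D r x g : 0 < r -> Udom S D r x -> active S g -> D (bps_Z S g) -> cabs (x g) < 1.
Proof.
move=> r0 Ux ag Dg; apply: lt_le_trans (Udom_bound Ux ag Dg) _.
by rewrite -[leRHS]expR0 ler_expR mulNr oppr_le0 mulr_ge0 ?lnorm_ge0// ltW.
Qed.

(** Finitely many strict inequalities between continuous functions define an
    open set, so for a finite structure the interior is all of it. *)
Lemma Udom_intro D r x : torus S x ->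
  (forall g, active S g -> D (bps_Z S g) -> cabs (x g) < expR (- r * lnorm S g)) -> Udom S D r x.
Proof.
move=> xT xD; split => //.
have [|e e0 He] := @seq_uniform_radius G acts (fun g e => D (bps_Z S g) ->
    expR (e * \sum_i `|(bps_coord S g 0 i)%:~R|) * cabs (x g) < expR (- r * lnorm S g)).
  move=> g /actsP ag; have [Dg|nD] := pselect (D (bps_Z S g)); last by exists 1.
  have x0 : 0 < cabs (x g) by rewrite cabs_gt0 (torus_neq0 _ xT).
  set H := \sum_i _; have H0 : 0 <= H by rewrite sumr_ge0.
  have H1 : 0 < H + 1 by rewrite ltr_wpDl.
  have L0 : 0 < ln (expR (- r * lnorm S g) / cabs (x g)).
    by rewrite ln_gt0// ltr_pdivlMr// mul1r xD.
  (* a coordinate shift below e changes log |x_g| by at most e H *)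
  exists (ln (expR (- r * lnorm S g) / cabs (x g)) / (H + 1)); first by rewrite divr_gt0.
  move=> e' /andP[e'0]; rewrite ler_pdivlMr// => h _.
  rewrite -ltr_pdivlMr// -ltr_ln ?posrE ?expR_gt0 ?divr_gt0 ?expR_gt0// expRK.
  by apply: lt_le_trans h; rewrite ltr_pM2l// ltrDl.
exists e => // s se; split; first exact: torus_actT.
move=> g Dg ag; apply: le_lt_trans (He g _ Dg); last exact/actsP.
rewrite cabsM ler_wpM2r ?cabs_ge0// cabs_cexp ler_expR.
rewrite (le_trans (ler_norm _))// (le_trans (cabs_Re _))// (le_trans (cabs_sum _ _ _))//.
rewrite mulr_sumr; apply: ler_sum => i _.
have iE (k : int) : cabs (k%:~R : R[i]) = `|k%:~R|.
  by rewrite -(rmorph_int (real_complex R)) cabs_real.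
by rewrite cabsM iE ler_wpM2r// ltW.
Qed.

Lemma torus_act_near D r x : Udom S D r x -> exists2 e, 0 < e &
  forall s : 'rV[R[i]]_n, (forall i, cabs (s 0 i) < e) -> torus S (torus_act S s x) /\
    forall g, D (bps_Z S g) -> active S g -> cabs (torus_act S s x g) < expR (- r * lnorm S g).
Proof. by move=> [_]. Qed.

Lemma DT_ray_near D l r x : 0 < r -> is_ray l -> l `<=` D -> Udom S D r x -> exists2 e, 0 < e &
  forall s : 'rV[R[i]]_n, (forall i, cabs (s 0 i) < e) ->
    DT_ray S l (torus_act S s x) =
    - \sum_(a <- acts | bps_Z S a \in l) ratr (bps_Omega S a) * dilog (torus_act S s x a).
Proof.
move=> r0 lr lD Ux; have [e e0 H] := torus_act_near Ux; exists e => // s /H[sT sU].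
apply: DT_rayE => // a aa /lD Da; apply: lt_le_trans (sU a Da aa) _.
by rewrite -[leRHS]expR0 ler_expR mulNr oppr_le0 mulr_ge0 ?lnorm_ge0// ltW.
Qed.

(** Composite of the linear form s |-> <s, a> with a holomorphic function of
    one variable. *)
Lemma differentiable_torus_act (f : R[i] -> R[i]) x a (m : R[i]) : cdiff f (x a) m ->
  differentiable (fun s : 'rV[R[i]]_n => f (torus_act S s x a) : R[i]^o) 0.
Proof.
move=> df.
pose L (s : 'rV[R[i]]_n) : R[i]^o := \sum_(i < n) s 0 i * (bps_coord S a 0 i)%:~R.
pose phi (w : R[i]) := f (cexp w * x a).
have dphi : cdiff phi 0 (m * (x a)).
  apply: cdiff_eq.
    apply: (@cdiff_comp _ f (fun w => cexp w * x a) 0).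
      exact: cdiffM (cdiff_cexp _) (cdiff_cst _ _).
    rewrite cexp0 mul1r; exact: df.
  by rewrite cexp0 mul1r mulr0 addr0.
have L0 : L 0 = 0 by rewrite /L big1// => i _; rewrite mxE mul0r.
have dL : differentiable L 0.
  have -> : L = \sum_(i < n) (fun s : 'rV[R[i]]_n => (s 0 i : R[i]^o) *: ((bps_coord S a 0 i)%:~R : R[i]^o)).
    by apply/funext => s; rewrite fct_sumE.
  apply: differentiable_sum => i; apply: differentiableZl; exact: differentiable_coord.
apply: (@differentiable_comp _ _ _ _ L (phi : R[i]^o -> R[i]^o)) => //.
rewrite L0; apply/derivable1_diffP; apply/cdiff_derivable; by eexists; exact: dphi.
Qed.

Lemma DT_ray_holomorphic D l r : 0 < r -> is_ray l -> l `<=` D ->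
  torus_holomorphic S (Udom S D r) (DT_ray S l).
Proof.
move=> r0 lr lD x Ux; have [e e0 H] := DT_ray_near r0 lr lD Ux.
apply: (@near_eq_differentiable _ _ _ (fun s : 'rV[R[i]]_n => (- \sum_(a <- acts | bps_Z S a \in l)
    ratr (bps_Omega S a) * dilog (torus_act S s x a)) : R[i]^o)).
  have e0C : 0 < e%:C by rewrite ltcR.
  move: (near0_row n e0C); apply: filterS => s hs; rewrite H// => i.
  by have := hs i; rewrite [`|_|]cabs_normC ltcR.
apply: differentiableN.
under eq_fun => s do rewrite big_acts_cond.
rewrite (_ : (fun _ => _) = \sum_(i < size acts) (fun s : 'rV[R[i]]_n =>
   (if (nth 0 acts i \in acts) && (bps_Z S (nth 0 acts i) \in l) then ratr (bps_Omega S (nth 0 acts i)) * dilog (torus_act S s x (nth 0 acts i)) else 0) : R[i]^o)); last first.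
  apply/funext => s; by rewrite fct_sumE (big_nth 0) big_mkord.
apply: differentiable_sum => i.
case: (boolP ((acts`_i \in acts) && (bps_Z S acts`_i \in l))) => [/andP[/actsP ai /set_mem il]|_]; last exact: differentiable_cst.
have [dl ddl _] := cdiff_dilog (Udom_lt1 r0 Ux ai (lD _ il)).
by have := differentiable_torus_act (cdiffZ (ratr (bps_Omega S (nth 0 acts i))) ddl).
Qed.

(** A partial derivative is the complex derivative along the line. *)
Lemma derive_line (f : 'rV[R[i]]_n -> R[i]) v (m : R[i]) : cdiff (fun h => f (h *: v)) 0 m ->
  'D_v (f : _ -> R[i]^o) 0 = m.
Proof.
move=> /cdiff_derive df; rewrite -[RHS](@derive_val _ _ _ _ _ _ _ df) /derive.
set F := (fun h : R[i] => h^-1 *: _); set F' := (fun h : R[i] => h^-1 *: _).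
suff -> : F = F' by [].
by apply/funext => h; rewrite /F /F' /= !addr0 scale0r [h *: 1]mulr1.
Qed.

Lemma torus_act_line x b h i : torus_act S (h *: delta_mx 0 i) x b = cexp (h * (bps_coord S b 0 i)%:~R) * x b.
Proof.
rewrite /torus_act; congr (cexp _ * _); rewrite (bigD1 i)//= big1 ?addr0; last first.
  by move=> j ji; rewrite !mxE (negbTE ji) andbF mulr0 mul0r.
by rewrite !mxE !eqxx mulr1.
Qed.

Lemma cdiff_torus_act (f : R[i] -> R[i]) x b i (m : R[i]) : cdiff f (x b) m ->
  cdiff (fun h => f (torus_act S (h *: delta_mx 0 i) x b)) 0 (m * (x b * (bps_coord S b 0 i)%:~R)).
Proof.
move=> df; apply: (@cdiff_ext _ (fun h => f (cexp (h * (bps_coord S b 0 i)%:~R) * x b))).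
  by move=> h; rewrite torus_act_line.
apply: (@cdiff_comp _ f (fun h => cexp (h * (bps_coord S b 0 i)%:~R) * x b)); last first.
  by rewrite mul0r cexp0 mul1r.
apply: cdiff_eq (cdiffM (cdiff_cexp_comp (cdiffM (cdiff_id _) (cdiff_cst _ _))) (cdiff_cst _ _)) _.
by rewrite mul0r cexp0; ring.
Qed.

Lemma log_deriv_tchar x b i : log_deriv S i (tchar b) x = (bps_coord S b 0 i)%:~R * x b.
Proof.
apply: derive_line; rewrite /tchar.
by apply: cdiff_eq (cdiff_torus_act i (cdiff_id (x b))) _; ring.
Qed.

(** x d/dx of the dilogarithm is - log (1 - x). *)
Lemma log_deriv_DT_ray D l r x i : 0 < r -> is_ray l -> l `<=` D -> Udom S D r x ->
  log_deriv S i (DT_ray S l) x =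
  \sum_(a <- acts | bps_Z S a \in l) ratr (bps_Omega S a) * clog (1 - x a) * (bps_coord S a 0 i)%:~R.
Proof.
move=> r0 lr lD Ux; have [e e0 H] := DT_ray_near r0 lr lD Ux.
apply: derive_line; apply: (@cdiff_near _ (fun h => - \sum_(a <- acts) (if (a \in acts) && (bps_Z S a \in l) then
    ratr (bps_Omega S a) * dilog (torus_act S (h *: delta_mx 0 i) x a) else 0))).
  exists e => // u ue; rewrite -big_acts_cond H// => j; rewrite add0r !mxE.
  by case: (_ && _); rewrite ?mulr1// mulr0 cabs0.
pose L a := if (a \in acts) && (bps_Z S a \in l) then
     - (ratr (bps_Omega S a) * clog (1 - x a) * (bps_coord S a 0 i)%:~R) else 0.
apply: (@cdiff_eq _ _ _ (- \sum_(a <- acts) L a)); last first.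
  by rewrite -big_acts_cond -sumrN; apply: eq_bigr => a _; rewrite opprK.
apply: cdiffN; apply: cdiff_sum => a; rewrite /L.
case: ifP => [/andP[/actsP aa /set_mem al]|_]; last exact: cdiff_cst.
have [dl ddl E] := cdiff_dilog (Udom_lt1 r0 Ux aa (lD _ al)).
apply: cdiff_eq (cdiffZ _ (cdiff_torus_act i ddl)) _.
by rewrite [dl * _]mulrA [dl * _]mulrC E; ring.
Qed.

(** Expands the Poisson bracket in coordinates back into the form. *)
Lemma bps_form_bilinear (F : G -> R[i]) (P : pred G) b :
  \sum_(i < n) \sum_(j < n) (bps_form S (bps_basis S i) (bps_basis S j))%:~R *
     (\sum_(a <- acts | P a) F a * (bps_coord S a 0 i)%:~R) * (bps_coord S b 0 j)%:~R =
  \sum_(a <- acts | P a) F a * (bps_form S a b)%:~R.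
Proof.
transitivity (\sum_(i < n) \sum_(a <- acts | P a) F a * (bps_coord S a 0 i)%:~R * (bps_form S (bps_basis S i) b)%:~R).
  apply: eq_bigr => i _; rewrite -mulr_suml.
  rewrite [bps_form S _ b]bps_form_skew bps_form_coord -sumrN rmorph_sum/= mulr_sumr.
  apply: eq_bigr => j _; rewrite [bps_form S _ (bps_basis S i)]bps_form_skew mulrN opprK rmorphM/=.
  by move: (\sum_(a <- _ | _) _) => s; ring.
rewrite exchange_big/=; apply: eq_bigr => a _.
rewrite [bps_form S a b]bps_form_coord rmorph_sum/= mulr_sumr; apply: eq_bigr => i _.
by rewrite rmorphM/= mulrA.
Qed.

(** The eigenvalue of the Hamiltonian vector field on the character x_b:
    {DT(l), x_b} = kappa x_b. Its sign combines the minus signs of DT(l) and of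
    the derivative of the dilogarithm. *)
Definition kappa l x b : R[i] :=
  \sum_(a <- acts | bps_Z S a \in l) ratr (bps_Omega S a) * clog (1 - x a) * (bps_form S a b)%:~R.

Lemma poisson_DT_ray D l r x b : 0 < r -> is_ray l -> l `<=` D -> Udom S D r x ->
  poisson S (DT_ray S l) (tchar b) x = kappa l x b * x b.
Proof.
move=> r0 lr lD Ux; rewrite /kappa -bps_form_bilinear mulr_suml /poisson.
apply: eq_bigr => i _; rewrite mulr_suml; apply: eq_bigr => j _.
by rewrite (log_deriv_DT_ray i r0 lr lD Ux) log_deriv_tchar mulrA.
Qed.

(** The structure is uncoupled. *)
Lemma kappa_active l x b : active S b -> kappa l x b = 0.
Proof.
move=> ab; rewrite /kappa big_seq_cond big1// => a /andP[/actsP aa _].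
by rewrite Sunc// mulr0.
Qed.

Lemma kappa_ext l x y : (forall a, active S a -> x a = y a) -> kappa l x = kappa l y.
Proof.
move=> xy; apply/funext => b; rewrite /kappa big_seq_cond [RHS]big_seq_cond.
by apply: eq_bigr => a /andP[/actsP/xy -> _].
Qed.

(** With kappa constant along the flow, the flow is exponential. *)
Definition ray_flow l x (s : R) b : R[i] := x b * cexp (s%:C * kappa l x b).

Lemma ray_flow_active l x s a : active S a -> ray_flow l x s a = x a.
Proof. by move=> aa; rewrite /ray_flow kappa_active// mulr0 cexp0 mulr1. Qed.

Lemma ray_flow_torus l x s : torus S x -> torus S (ray_flow l x s).
Proof.
move=> [x0 xD]; split=> [a|a b]; first by rewrite /ray_flow mulf_neq0 ?cexp_neq0.
rewrite /ray_flow xD.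
have -> : kappa l x (a + b) = kappa l x a + kappa l x b.
  by rewrite /kappa -big_split; apply: eq_bigr => g _; rewrite bps_formDr intrD mulrDr.
rewrite mulrDr cexpD.
by move: (cexp _) (cexp _) ((-1) ^ _) (x a) (x b) => p q h u v; ring.
Qed.

Lemma Udom_ext D r x y : (forall a, active S a -> x a = y a) -> torus S y -> Udom S D r x -> Udom S D r y.
Proof.
move=> xy yT Ux; apply: Udom_intro => // g ag Dg; rewrite -xy//; exact: Udom_bound Ux ag Dg.
Qed.

(** The active coordinates of an integral curve are constant since their kappa
    vanishes. As kappa depends on active coordinates only, it is constant too,
    and the remaining coordinates solve a linear equation. Conversely the
    exponential curve stays in the domain, which involves active coordinates
    only. *)
Lemma ray_autP D l r x y : 0 < r -> is_ray l -> l `<=` D -> Udom S D r x ->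
  bps_ray_aut S D l x y <-> y = ray_flow l x 1.
Proof.
move=> r0 lr lD Ux; split.
- move=> [q q0 [_ _ [c [hc c0 c1]]]].
  have dc s b : 0 <= s <= 1 -> rcderiv (fun u => c u b) s (kappa l (c s) b * c s b).
    by move=> /hc[Us /(_ b)[]]; rewrite (poisson_DT_ray b q0 lr lD Us).
  (* the active coordinates do not move *)
  have ca s a : active S a -> 0 <= s <= 1 -> c s a = x a.
    move=> aa s01; rewrite -c0 -[RHS]mulr1 -(cexp0 R) -[in RHS](mulr0 s%:C).
    apply: (@linear_flow_unique _ (fun u => c u a)) s01 => u u01.
    by have := dc u a u01; rewrite kappa_active.
  have kE s : 0 <= s <= 1 -> kappa l (c s) = kappa l x.
    by move=> s01; apply: kappa_ext => a aa; exact: ca.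
  apply/funext => b; rewrite -c1 /ray_flow -c0.
  apply: (@linear_flow_unique _ (fun u => c u b)); last by rewrite ler01 lexx.
  by move=> s s01; have := dc s b s01; rewrite kE// c0.
- move=> ->; exists r => //; split.
  + move=> z Uz; apply: DT_summableP => //; first exact: Udom_torus Uz.
    by move=> a aa /lD; exact: Udom_lt1 r0 Uz aa.
  + exact: DT_ray_holomorphic.
  + exists (ray_flow l x); split => //; last first.
      by apply/funext => b; rewrite /ray_flow mul0r cexp0 mulr1.
    move=> s s01; have U : Udom S D r (ray_flow l x s).
      apply: Udom_ext (Ux) => [a aa|]; first by rewrite ray_flow_active.
      by apply: ray_flow_torus; exact: Udom_torus Ux.
    split => // b; rewrite (poisson_DT_ray b r0 lr lD U).
    rewrite (@kappa_ext l _ x); last by move=> a aa; rewrite ray_flow_active.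
    exact: linear_flow_curve.
Qed.

End Flow.

(** * The automorphism of a sector *)

Section Rays.
Variable R : realType.
Implicit Types (z w : R[i]) (a b c theta : R).

Lemma ray_of_self z : ray_of z z.
Proof. by exists 1 => //; rewrite realC1 mul1r. Qed.

Lemma ray_of_eq z w : ray_of z w -> ray_of w = ray_of z.
Proof.
move=> [c c0 ->]; apply/seteqP; split=> _ [d d0 ->].
  by exists (d * c); rewrite ?mulr_gt0// realCM mulrA.
exists (d / c); first by rewrite divr_gt0.
by rewrite mulrA -realCM divfK// gt_eqF.
Qed.

Lemma cis_neq0 theta : cis theta != 0 :> R[i].
Proof. exact: cexp_neq0. Qed.

Lemma is_ray_cis theta : is_ray (ray_of (cis theta) : set R[i]).
Proof. by exists (cis theta) => //; exact: cis_neq0. Qed.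

Lemma cabs_cis theta : cabs (cis theta) = 1 :> R.
Proof. by rewrite /cis cabs_cexp Re_mk expR0. Qed.

(** The two arguments differ by less than 2 pi. *)
Lemma ray_cis_inj a b c d z : 0 < b - a < pi -> a <= c <= b -> a <= d <= b ->
  ray_of (cis c) z -> ray_of (cis d) z -> c = d :> R.
Proof.
move=> /andP[_ ba] /andP[ac cb] /andP[ad db] [p p0 ->] [q q0 E].
have pq : p = q.
  have := congr1 (@cabs R) E; rewrite 2!(cabsM _ (cis _)) !cabs_cis !mulr1 !cabs_real !gtr0_norm//.
have q0C : q%:C != 0 :> R[i] by rewrite realC_eq0 gt_eqF.
move: E; rewrite pq => /(mulfI q0C) /cexp_inj_strip; rewrite !Im_mk => H.
have /(congr1 (@complex.Im R)) : (0 +i* c : R[i]) = 0 +i* d.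
  apply: H; rewrite ltr_norml mulr2n; have := pi_gt0 R; lra.
by rewrite !Im_mk.
Qed.

Lemma ray_cis_sector a b theta : a < theta < b -> ray_of (cis theta) `<=` (sector a b : set R[i]).
Proof. by move=> h z hz; exists theta. Qed.

End Rays.

Section SectorAutomorphism.
Variables (R : realType) (G : zmodType) (n : nat) (S : bps R G n).
Hypothesis Sfin : bps_finite S.
Hypothesis Sunc : bps_uncoupled S.
Hypothesis Sint : bps_integral S.
Implicit Types (g h : G) (x y : G -> R[i]) (l D : set R[i]) (a b r s u theta : R).

Local Notation acts := (acts S).
Local Notation actsP := (actsP Sfin).

(** By [sector_autP] the automorphism of a sector multiplies x_h by this
    product over the active classes of the sector. *)
Definition jump (P : pred G) x h : R[i] :=
  \prod_(g <- acts | P g) (1 - x g) ^ (numq (bps_Omega S g) * bps_form S g h).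

Lemma jump_active P x h : active S h -> jump P x h = 1.
Proof.
move=> ah; rewrite /jump big_seq_cond big1// => g /andP[/actsP ag _].
by rewrite Sunc// mulr0 expr0z.
Qed.

Lemma jump_ext P x y : (forall g, active S g -> x g = y g) -> jump P x = jump P y.
Proof.
move=> xy; apply/funext => h; rewrite /jump big_seq_cond [RHS]big_seq_cond.
by apply: eq_bigr => g /andP[/actsP/xy -> _].
Qed.

(** Integrality makes the exponents integral, so the choice of the logarithm
    disappears. *)
Lemma cexp_kappa l x h : (forall g, active S g -> l (bps_Z S g) -> x g != 1) ->
  cexp (kappa S l x h) = jump (fun g => bps_Z S g \in l) x h.
Proof.
move=> x1; rewrite /kappa cexp_sum /jump big_seq_cond [RHS]big_seq_cond.
apply: eq_bigr => g /andP[/actsP ag /set_mem lg].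
have -> : ratr (bps_Omega S g) = (numq (bps_Omega S g))%:~R :> R[i].
  by rewrite -[in LHS](numqK (Sint g)) ratr_int.
have y0 : 1 - x g != 0 by rewrite subr_eq0 eq_sym x1.
rewrite -[in RHS](cexp_clog y0) -cexpzE /cexpz rmorphM/=; congr cexp.
by rewrite mulrAC.
Qed.

(** The last ray of the list acts first, as in [bps_comp_aut]. *)
Definition rays_flow (ls : seq (set R[i])) x := foldr (fun l z => ray_flow S l z 1) x ls.

Lemma rays_flow_active ls x g : active S g -> rays_flow ls x g = x g.
Proof. by move=> ag; elim: ls => //= l ls IH; rewrite ray_flow_active. Qed.

Lemma rays_flow_torus ls x : torus S x -> torus S (rays_flow ls x).
Proof. by move=> xT; elim: ls => //= l ls IH; exact: ray_flow_torus. Qed.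

Lemma rays_flow_Udom D r ls x : Udom S D r x -> Udom S D r (rays_flow ls x).
Proof.
move=> Ux; apply: (Udom_ext Sfin) (Ux) => [g ag|]; first by rewrite rays_flow_active.
by apply: rays_flow_torus; exact: Udom_torus Ux.
Qed.

(** Each flow preserves the domain, because it preserves the active
    coordinates. *)
Lemma comp_autP D r (thetas : seq R) x y : 0 < r -> Udom S D r x ->
  (forall theta, theta \in thetas -> ray_of (cis theta) `<=` D) ->
  bps_comp_aut S D [seq ray_of (cis theta) | theta <- thetas] x y <->
  y = rays_flow [seq ray_of (cis theta) | theta <- thetas] x.
Proof.
move=> r0 Ux; elim: thetas y => [|t ts IH] y tD //=.
have tsD theta : theta \in ts -> ray_of (cis theta) `<=` D.
  by move=> h; apply: tD; rewrite inE h orbT.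
have lD : ray_of (cis t) `<=` D by apply: tD; rewrite inE eqxx.
have lr := is_ray_cis t.
split=> [[z /(IH z tsD) ->]|->].
  by move/(ray_autP Sfin Sunc _ r0 lr lD (rays_flow_Udom _ Ux)).
exists (rays_flow [seq ray_of (cis theta) | theta <- ts] x); first exact/IH.
exact/(ray_autP Sfin Sunc _ r0 lr lD (rays_flow_Udom _ Ux)).
Qed.

Lemma rays_flowE D r (thetas : seq R) x h : 0 < r -> Udom S D r x ->
  (forall theta, theta \in thetas -> ray_of (cis theta) `<=` D) ->
  rays_flow [seq ray_of (cis theta) | theta <- thetas] x h =
  x h * \prod_(theta <- thetas) jump (fun g => bps_Z S g \in ray_of (cis theta)) x h.
Proof.
move=> r0 Ux; elim: thetas => [|t ts IH] tD /=; first by rewrite big_nil mulr1.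
rewrite big_cons /ray_flow IH; last by move=> u uts; apply: tD; rewrite inE uts orbT.
rewrite realC1 mul1r (kappa_ext Sfin _ (y:=x)); last by move=> g ag; exact: rays_flow_active.
rewrite cexp_kappa; first by rewrite -mulrA [X in _ * X]mulrC.
move=> g ag lg; have : cabs (x g) < 1.
  by apply: Udom_lt1 r0 Ux ag (tD t _ _ lg); rewrite inE eqxx.
by apply: contraTneq => ->; rewrite cabs1 ltxx.
Qed.

(** The arguments of the active classes in the sector, sorted and without
    repetition. *)
Lemma sector_thetas a b : 0 < b - a < pi -> exists thetas : seq R,
  [/\ sorted (fun u v : R => u < v) thetas,
      (forall theta, theta \in thetas -> a < theta < b) &
      (forall l : set R[i], active_ray S l /\ l `<=` sector a b <->
           exists2 theta, theta \in thetas & l = ray_of (cis theta))].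
Proof.
move=> ab; pose arg g : R := xget 0 [set theta | a < theta < b /\ ray_of (cis theta) (bps_Z S g)].
have argP g : sector a b (bps_Z S g) -> a < arg g < b /\ ray_of (cis (arg g)) (bps_Z S g).
  by move=> [theta h1 h2]; rewrite /arg; apply: (xgetPex 0 (P:=fun t => a < t < b /\ ray_of (cis t) (bps_Z S g))); exists theta.
pose ts := [seq arg g | g <- acts & bps_Z S g \in sector a b].
exists (sort <=%O (undup ts)).
have memE theta : theta \in sort <=%O (undup ts) -> exists g, [/\ active S g, sector a b (bps_Z S g) & theta = arg g].
  rewrite mem_sort mem_undup => /mapP[g]; rewrite mem_filter => /andP[/set_mem gs /actsP ag] ->.
  by exists g.
split.
- by rewrite sort_lt_sorted undup_uniq.
- by move=> theta /memE[g [_ /argP[h _] ->]].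
- move=> l; split=> [[[[z z0 ->] [g ag lg]] ls]|[theta /memE[g [ag gs ->]] ->]].
    have gs := ls _ lg; have [_ h] := argP g gs.
    exists (arg g); last by rewrite -(ray_of_eq h) (ray_of_eq lg).
    rewrite mem_sort mem_undup; apply/mapP; exists g => //.
    by rewrite mem_filter mem_set//; exact/actsP.
  have [h1 h2] := argP g gs.
  by split; [split; [exact: is_ray_cis|exists g]|exact: ray_cis_sector].
Qed.

(** Every active class of the sector lies on exactly one of the rays. *)
Lemma prod_over_rays a b (thetas : seq R) x h : 0 < b - a < pi ->
  sorted (fun u v : R => u < v) thetas ->
  (forall theta, theta \in thetas -> a < theta < b) ->
  (forall l : set R[i], active_ray S l /\ l `<=` sector a b <->
           exists2 theta, theta \in thetas & l = ray_of (cis theta)) ->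
  \prod_(theta <- thetas) jump (fun g => bps_Z S g \in ray_of (cis theta)) x h =
  jump (fun g => bps_Z S g \in sector a b) x h.
Proof.
move=> ab tsrt tab tP.
have tu : uniq thetas by have := tsrt; rewrite lt_sorted_uniq_le => /andP[].
rewrite /jump big_seq (exchange_big_dep (fun g => bps_Z S g \in sector a b))/=; last first.
  by move=> t g /tab tt /set_mem h'; apply/mem_set; exact: ray_cis_sector tt _ h'.
rewrite big_seq_cond [RHS]big_seq_cond; apply: eq_bigr => g /andP[/actsP ag /set_mem gs].
have [t tts Et] : exists2 t, t \in thetas & ray_of (bps_Z S g) = ray_of (cis t).
  apply/tP; split.
    split; last by exists g => //; exact: ray_of_self.
    by exists (bps_Z S g) => //; exact: active_Z_neq0.
  by case: gs => s sab /ray_of_eq ->; exact: ray_cis_sector.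
have gt : ray_of (cis t) (bps_Z S g) by rewrite -Et; exact: ray_of_self.
rewrite big_mkcond (bigD1_seq t)//= tts mem_set//= big1 ?mulr1// => u ut.
case: ifPn => // /andP[uts /set_mem gu]; move/eqP: ut; case.
have /andP[u1 u2] := tab u uts; have /andP[t1 t2] := tab t tts.
by apply: (ray_cis_inj ab _ _ gu gt); rewrite !ltW.
Qed.

(** All the flows are evaluated at the same active coordinates, so the factors
    of the rays multiply to one product over the sector. *)
Lemma sector_autP a b r x y : 0 < b - a < pi -> 0 < r -> Udom S (sector a b) r x ->
  bps_sector_aut S a b x y <-> forall h, y h = x h * jump (fun g => bps_Z S g \in sector a b) x h.
Proof.
move=> ab r0 Ux; split.
  move=> [ts [srt tab tP /(comp_autP _ r0 Ux) H]] h.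
  have tD t : t \in ts -> ray_of (cis t) `<=` sector a b by move=> /tab; exact: ray_cis_sector.
  by rewrite H// (rays_flowE h r0 Ux)// (prod_over_rays _ _ ab).
move=> H; have [ts [srt tab tP]] := sector_thetas ab.
have tD t : t \in ts -> ray_of (cis t) `<=` sector a b by move=> /tab; exact: ray_cis_sector.
exists ts; split => //; apply/(comp_autP _ r0 Ux) => //.
by apply/funext => h; rewrite H (rays_flowE h r0 Ux)// (prod_over_rays _ _ ab).
Qed.

End SectorAutomorphism.

(** * Half-planes and sectors *)

Section Geometry.
Variable R : realType.
Implicit Types (z w t Z u : R[i]) (a b c d theta e eta : R).
Local Notation T := (2 * pi%:C * 'i%C : R[i]).

Lemma half_planeP z t : z != 0 -> half_plane (ray_of z) t <-> 0 < complex.Re (t / z).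
Proof.
move=> z0; split=> [[_ [v [[c c0 ->] v0 ->]]]|h].
  by rewrite mulrAC mulfK// !cReImE mul0r subr0 mulr_gt0.
exists z, (t / z); split => //; first exact: ray_of_self.
by rewrite mulrC divfK.
Qed.

(** Z / (i z) has real part Im (Z / z). *)
Lemma i_half_planeP z Z : z != 0 -> (exists2 w, half_plane (ray_of z) w & Z = 'i%C * w) <-> 0 < complex.Im (Z / z).
Proof.
move=> z0; split=> [[w /(half_planeP _ z0) h ->]|h].
  by move: h; rewrite -mulrA; move: (w / z) => u; rewrite !cReImE; lra.
exists (- 'i%C * Z); last by rewrite mulrA mulrN -expr2 sqr_i opprK mul1r.
apply/(half_planeP _ z0); rewrite -mulrA; move: h; move: (Z / z) => u.
by rewrite !cReImE; lra.
Qed.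

Lemma half_plane_neq0 z t : z != 0 -> half_plane (ray_of z) t -> t != 0.
Proof. by move=> z0 /(half_planeP _ z0); apply: contraTneq => ->; rewrite mul0r ltxx. Qed.

Lemma insector_homogeneous eta c w : 0 < c -> insector eta w -> insector eta (c%:C * w).
Proof.
rewrite /insector => c0 h; rewrite cabsM cabs_real gtr0_norm// !cReImE mul0r subr0.
by rewrite mulrCA ler_pM2l.
Qed.

(** |t|^2 Re (v / t) = Re v Re t + Im v Im t, where the first term is positive.
    *)
Lemma quotient_sector v t : 0 < complex.Re v -> 0 < complex.Re t ->
  - `|complex.Im v| / cabs v * cabs (v / t) <= complex.Re (v / t).
Proof.
move=> v0 t0.
have av : 0 < cabs v by rewrite cabs_gt0; apply: contraTneq v0 => ->; rewrite ltxx.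
have at0 : 0 < cabs t by rewrite cabs_gt0; apply: contraTneq t0 => ->; rewrite ltxx.
have E : v / t = (cabs t ^- 2)%:C * (v * (complex.Re t -i* complex.Im t)).
  apply: (mulIf (_ : t != 0)); first by rewrite -cabs_gt0.
  rewrite divfK -?cabs_gt0// -!mulrA.
  have -> : (complex.Re t -i* complex.Im t) * t = (cabs t ^+ 2)%:C.
    by rewrite cabs_sqr; apply: complexP; rewrite !cReImE; ring.
  by rewrite mulrCA -realCM mulVf ?realC1 ?mulr1// expf_neq0// gt_eqF.
rewrite cabs_div mulrA divfK ?gt_eqF//.
rewrite E !cReImE mul0r subr0 -ler_pdivrMl ?invr_gt0 ?exprn_gt0// invrK.
have -> : cabs t ^+ 2 * (- `|complex.Im v| / cabs t) = - (`|complex.Im v| * cabs t).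
  by field; rewrite gt_eqF.
have h1 : `|complex.Im v| * `|complex.Im t| <= `|complex.Im v| * cabs t.
  by rewrite ler_wpM2l// cabs_Im.
have h2 : 0 < complex.Re v * complex.Re t by rewrite mulr_gt0.
have h3 := ler_norm (- (complex.Im v * complex.Im t)).
by rewrite normrN normrM in h3; lra.
Qed.

(** Up to a positive factor the argument is v / tau with v = Z / (i z) and tau
    = t / z, both of positive real part. The aperture of the sector is
    determined by v. *)
Lemma argument_sector z Z : z != 0 -> 0 < complex.Im (Z / z) -> exists2 eta, 0 < eta <= 1 &
  forall t, half_plane (ray_of z) t -> insector eta (Z / (T * t)).
Proof.
move=> z0 iZ; pose v := - 'i%C * (Z / z).
have v0 : 0 < complex.Re v by move: iZ; rewrite /v; move: (Z / z) => u; rewrite !cReImE; lra.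
have vn : v != 0 by apply: contraTneq v0 => ->; rewrite ltxx.
have av : 0 < cabs v by rewrite cabs_gt0.
have lt1 : `|complex.Im v| / cabs v < 1.
  rewrite ltr_pdivrMr// mul1r -(ltr_pXn2r (n:=2)) ?nnegrE ?cabs_ge0//.
  by rewrite cabs_sqr real_normK ?num_real// ltrDr exprn_gt0.
exists (1 - `|complex.Im v| / cabs v).
  by rewrite subr_gt0 lt1/= gerBl divr_ge0 ?cabs_ge0.
move=> t ht; have t0 := half_plane_neq0 z0 ht.
have p0 : 0 < 2 * pi :> R by rewrite mulr_gt0// pi_gt0.
have -> : Z / (T * t) = ((2 * pi)^-1)%:C * (v / (t / z)).
  have -> : T = (2 * pi)%:C * 'i%C by rewrite realCM realCn.
  rewrite /v realCV !invfM invrK.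
  have -> : 'i%C^-1 = - 'i%C :> R[i].
    by apply: (mulIf (_ : 'i%C != 0)); rewrite ?mulVf ?neq0Ci// mulNr -expr2 sqr_i opprK.
  have zz : z^-1 * z = 1 by rewrite mulVf.
  move: ((2 * pi)%:C)^-1 => q; move: (t^-1) => s.
  have -> : - 'i%C * (Z * z^-1) * (s * z) = - 'i%C * Z * s * (z^-1 * z) by ring.
  by rewrite zz; ring.
apply: insector_homogeneous; first by rewrite invr_gt0.
rewrite /insector subKr -mulNr.
by apply: quotient_sector => //; exact/half_planeP.
Qed.

Lemma argument_slit z Z t : z != 0 -> 0 < complex.Im (Z / z) -> half_plane (ray_of z) t -> slit (Z / (T * t)).
Proof.
move=> z0 iZ ht; have [eta /andP[e0 _] /(_ t ht)] := argument_sector z0 iZ.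
have Z0 : Z != 0 by apply: contraTneq iZ => ->; rewrite mul0r ltxx.
have Tt : T * t != 0 by apply: mulf_neq0; [exact: T_neq0|exact: half_plane_neq0 ht].
by apply: insector_slit => //; apply: mulf_neq0 => //; rewrite invr_eq0.
Qed.

Lemma cabs_T : cabs T = 2 * pi.
Proof.
have -> : T = (2 * pi)%:C * 'i%C by rewrite realCM realCn.
by rewrite cabsM cabs_i cabs_real mulr1 ger0_norm// mulr_ge0// pi_ge0.
Qed.

Lemma cis_eq a : cis a = cos a +i* sin a :> R[i].
Proof. by apply: complexP; rewrite /cis ?Re_cexp ?Im_cexp !cReImE expR0 mul1r. Qed.

Lemma cisV a : (cis a)^-1 = cos a -i* sin a :> R[i].
Proof.
apply: (mulIf (cis_neq0 a)); rewrite mulVf ?cis_neq0// cis_eq.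
by apply: complexP; rewrite !cReImE; have := cos2Dsin2 a; lra.
Qed.

Lemma cabs_cis_carg z : z = (cabs z)%:C * cis (carg z).
Proof.
have [->|z0] := eqVneq z 0; first by rewrite cabs0 mul0r.
rewrite -[LHS](cexp_clog z0) /clog /cis.
have -> : (cabs z)%:C = cexp (ln (cabs z))%:C.
  by rewrite cexp_real lnK// posrE cabs_gt0.
by rewrite -cexpD; congr cexp; apply: complexP; rewrite !cReImE ?addr0 ?add0r.
Qed.

Lemma Im_div_cis c theta a : complex.Im (c%:C * cis theta / cis a) = c * sin (theta - a).
Proof. by rewrite cisV cis_eq !cReImE sinB; ring. Qed.

(** In polar form the two conditions bound the argument from below and from
    above. *)
Lemma sectorP a b z : 0 < b - a < pi ->
  sector a b z <-> 0 < complex.Im (z / cis a) /\ complex.Im (z / cis b) < 0.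
Proof.
move=> /andP[ab ba]; split=> [[theta /andP[h1 h2] [c c0 ->]]|[ia ib]].
  rewrite !Im_div_cis pmulr_rgt0// pmulr_rlt0// -(opprB b) sinN oppr_lt0.
  by split; apply: sin_gt0_pi; lra.
set u := z / cis a in ia.
have /andP[u0 u1] := carg_gt0 ia.
have zE : z = (cabs u)%:C * cis (a + carg u).
  rewrite -[LHS](divfK (cis_neq0 a)) -/u {1}(cabs_cis_carg u) -mulrA; congr (_ * _).
  by rewrite /cis -cexpD; congr cexp; apply: complexP; rewrite !cReImE ?addr0// addrC.
have cu : 0 < cabs u by rewrite cabs_gt0; apply: contraTneq ia => ->; rewrite ltxx.
exists (a + carg u); last by exists (cabs u).
rewrite ltrDl u0/=; move: ib; rewrite zE Im_div_cis pmulr_rlt0//.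
by apply: contraTT; rewrite -!leNgt => h; apply: sin_ge0_pi; lra.
Qed.

(** Z is a combination p cis a + q cis b with p, q > 0, so |t|^2 Re (Z / t) = p
    A + q B where A and B are the components of t along the two directions.
    Since t can be recovered from A and B, their sum is at least sin (b - a)
    |t|. *)
Lemma Re_quotient_lower a b Z : 0 < b - a < pi -> sector a b Z -> exists2 m, 0 < m &
  forall t, half_plane (ray_of (cis a)) t -> half_plane (ray_of (cis b)) t ->
    m / cabs t <= complex.Re (Z / t).
Proof.
move=> /andP[ab ba] [theta /andP[h1 h2] [c c0 ->]].
have s0 : 0 < sin (b - a) by apply: sin_gt0_pi; lra.
have p0 : 0 < sin (b - theta) by apply: sin_gt0_pi; lra.
have q0 : 0 < sin (theta - a) by apply: sin_gt0_pi; lra.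
set s := sin (b - a) in s0; set p := sin (b - theta) in p0; set q := sin (theta - a) in q0.
exists (c * Num.min p q); first by rewrite mulr_gt0// lt_min p0.
move=> t hta htb; have t0 := half_plane_neq0 (cis_neq0 a) hta.
have at0 : 0 < cabs t by rewrite cabs_gt0.
move: hta htb => /(half_planeP _ (cis_neq0 a)) + /(half_planeP _ (cis_neq0 b)).
set A := complex.Re (t / cis a); set B := complex.Re (t / cis b) => A0 B0.
have AE : A = complex.Re t * cos a + complex.Im t * sin a by rewrite /A cisV !cReImE; ring.
have BE : B = complex.Re t * cos b + complex.Im t * sin b by rewrite /B cisV !cReImE; ring.
(* t is expressed through the dual basis of the two directions *)
have h : s * cabs t <= A + B.
  have -> : s * cabs t = cabs (s%:C * t) by rewrite cabsM cabs_real gtr0_norm.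
  have -> : s%:C * t = B%:C * ('i%C * cis a) - A%:C * ('i%C * cis b).
    by apply: complexP; rewrite !cis_eq AE BE /s sinB !cReImE; ring.
  rewrite (le_trans (cabsB _ _))// 4!cabsM !cabs_i !cabs_cis !cabs_real !mulr1 !gtr0_norm//.
  by rewrite addrC.
have E : complex.Re (c%:C * cis theta / t) = c / s * (p * A + q * B) / cabs t ^+ 2.
  have -> : t^-1 = (cabs t ^- 2)%:C * (complex.Re t -i* complex.Im t).
    apply: (mulIf t0); rewrite mulVf// -mulrA.
    have -> : (complex.Re t -i* complex.Im t) * t = (cabs t ^+ 2)%:C.
      by rewrite cabs_sqr; apply: complexP; rewrite !cReImE; ring.
    by rewrite -realCM mulVf ?realC1// expf_neq0// gt_eqF.
  have key : p * A + q * B = s * (complex.Re t * cos theta + complex.Im t * sin theta).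
    by rewrite AE BE /p /q /s !sinB; ring.
  rewrite key cis_eq !cReImE; field.
  by rewrite !gt_eqF.
rewrite E; have : Num.min p q * (s * cabs t) <= p * A + q * B.
  apply: (@le_trans _ _ (Num.min p q * (A + B))); first by rewrite ler_wpM2l// le_min !ltW.
  by rewrite mulrDr lerD// ler_wpM2r ?(ltW A0) ?(ltW B0)// ge_min lexx ?orbT.
move=> H; rewrite ler_pdivrMr// mulrAC ler_pdivlMr ?exprn_gt0//.
have -> : c / s * (p * A + q * B) * cabs t = c * cabs t / s * (p * A + q * B) by field; rewrite gt_eqF.
apply: le_trans (_ : c * cabs t / s * (Num.min p q * (s * cabs t)) <= _); last first.
  by rewrite ler_wpM2l// divr_ge0 ?mulr_ge0 ?cabs_ge0 ?ltW.
by rewrite le_eqVlt; apply/orP; left; apply/eqP; field; rewrite gt_eqF.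
Qed.

End Geometry.

(** * Holomorphy, limits and growth of products *)

Section Asymptotics.
Variables (R : realType) (G : eqType).
Implicit Types (g h : G) (H : set R[i]) (e d : R) (t z w l : R[i]) (f : R[i] -> R[i]).
Local Notation T := (2 * pi%:C * 'i%C : R[i]).

Definition cholo f z := exists l, cdiff f z l.

Lemma cholo_derivable f z : cholo f z <-> derivable (f : R[i]^o -> R[i]^o) z 1.
Proof. by rewrite cdiff_derivable. Qed.

Lemma cholo_cst c z : cholo (fun=> c) z.
Proof. by exists 0; exact: cdiff_cst. Qed.

Lemma choloM f f' z : cholo f z -> cholo f' z -> cholo (fun w => f w * f' w) z.
Proof. by move=> [l dl] [m dm]; eexists; exact: cdiffM dl dm. Qed.

Lemma choloV f z : f z != 0 -> cholo f z -> cholo (fun w => (f w)^-1) z.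
Proof. by move=> fz [l dl]; eexists; exact: cdiff_inv dl. Qed.

Lemma cholo_exprz f z (k : int) : f z != 0 -> cholo f z -> cholo (fun w => f w ^ k) z.
Proof.
move=> fz [l dl]; case: k => k; first by eexists; exact: cdiffX k dl.
by apply: (choloV (f:=fun w => f w ^+ k.+1)); [rewrite expf_neq0|eexists; exact: cdiffX dl].
Qed.

Lemma cholo_prod (s : seq G) (P : pred G) (F : G -> R[i] -> R[i]) z :
  (forall g, g \in s -> P g -> cholo (F g) z) -> cholo (fun w => \prod_(g <- s | P g) F g w) z.
Proof.
elim: s => [|g s IH] H.
  have [l dl] := cholo_cst 1 z; exists l; apply: cdiff_ext dl => w.
  by rewrite big_nil.
have {IH} Hs : cholo (fun w => \prod_(g <- s | P g) F g w) z.
  by apply: IH => h hs; apply: H; rewrite inE hs orbT.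
have [Pg|nPg] := boolP (P g).
  have [|l dl] := choloM (H g _ Pg) Hs; first by rewrite inE eqxx.
  by exists l; apply: cdiff_ext dl => w; rewrite big_cons Pg.
by case: Hs => l dl; exists l; apply: cdiff_ext dl => w; rewrite big_cons (negbTE nPg).
Qed.

(** Convergence at 0 within a set, in terms of the real modulus. *)
Definition wtends H f (l : R[i]) := forall e, 0 < e -> exists2 d, 0 < d &
  forall t, H t -> cabs t < d -> cabs (f t - l) < e.

Lemma cvg_near0 (P : set R[i]) : (\forall t \near (0 : R[i]^o), P t) <->
  exists2 d : R, 0 < d & forall t, cabs t < d -> P t.
Proof.
split.
  move=> /nbhs_ballP[e /=]; rewrite ltcE => /andP[/eqP eI eR] He.
  exists (complex.Re e) => // t td; apply: He; rewrite /ball/= sub0r normrN [`|_|]cabs_normC.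
  have -> : e = (complex.Re e)%:C by apply: complexP; rewrite ?cReImE.
  by rewrite ltcR.
move=> [d d0 Hd]; apply/nbhs_ballP; exists d%:C => /=; first by rewrite ltcR.
by move=> t; rewrite /ball/= sub0r normrN [`|_|]cabs_normC ltcR => /Hd.
Qed.

Lemma wtends_cvg H f l : wtends H f l <->
  (f t : R[i]^o) @[t --> within H (nbhs (0 : R[i]^o))] --> (l : R[i]^o).
Proof.
split.
  move=> fl; apply/cvgrPdist_lt => e; rewrite ltcE => /andP[/eqP eI eR].
  have [d d0 Hd] := fl _ eR; apply/cvg_near0; exists d => // t td Ht.
  have -> : e = (complex.Re e)%:C by apply: complexP; rewrite ?cReImE.
  by rewrite distrC [`|_|]cabs_normC ltcR Hd.
move=> /cvgrPdist_lt fl e e0; have [|d d0 Hd] := (cvg_near0 _).1 (fl e%:C _); first by rewrite ltcR.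
by exists d => // t Ht td; have := Hd t td Ht; rewrite distrC [`|_|]cabs_normC ltcR.
Qed.

Lemma wtends_cst H l : wtends H (fun=> l) l.
Proof. by move=> e e0; exists 1 => // t _ _; rewrite subrr cabs0. Qed.

Lemma wtends_ext H f f' l : (forall t, H t -> f t = f' t) -> wtends H f l -> wtends H f' l.
Proof. by move=> ff fl e /fl[d d0 Hd]; exists d => // t Ht td; rewrite -ff// Hd. Qed.

Lemma wtends_comp H f f' l : wtends H f l -> ccont f' l -> wtends H (fun t => f' (f t)) (f' l).
Proof.
move=> fl cf e /cf[d d0 Hd]; have [d' d'0 Hd'] := fl d d0; exists d' => // t Ht td.
by have := Hd _ (Hd' t Ht td); rewrite (addrC l) subrK.
Qed.

Lemma wtendsM H f f' l l' : wtends H f l -> wtends H f' l' -> wtends H (fun t => f t * f' t) (l * l').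
Proof. by move=> /wtends_cvg hf /wtends_cvg hf'; apply/wtends_cvg; exact: cvgM hf hf'. Qed.

Lemma wtends_prod1 H (s : seq G) (P : pred G) (F : G -> R[i] -> R[i]) :
  (forall g, g \in s -> P g -> wtends H (F g) 1) -> wtends H (fun w => \prod_(g <- s | P g) F g w) 1.
Proof.
elim: s => [|g s IH] K.
  by apply: wtends_ext (wtends_cst H 1) => t _; rewrite big_nil.
have {IH} Hs : wtends H (fun w => \prod_(g <- s | P g) F g w) 1.
  by apply: IH => h hs; apply: K; rewrite inE hs orbT.
have [Pg|nPg] := boolP (P g); last first.
  by apply: wtends_ext Hs => t _; rewrite big_cons (negbTE nPg).
have Kg : wtends H (F g) 1 by apply: K; rewrite // inE eqxx.
have := wtendsM Kg Hs; rewrite mulr1; apply: wtends_ext => t _.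
by rewrite big_cons Pg.
Qed.

Lemma ccont_exprz1 (k : int) : ccont (fun w : R[i] => w ^ k) 1.
Proof.
have [|l dl] := @cholo_exprz (fun w => w) 1 k (oner_neq0 _); last exact: cdiff_ccont dl.
by exists 1; exact: cdiff_id.
Qed.

(** Two-sided bounds, as in the third condition of the Riemann-Hilbert problem;
    unlike upper bounds they pass to inverses. *)
Definition poly_growth H f := exists N : nat, exists2 M : R, 1 < M & forall t, H t -> M < cabs t ->
  cabs t ^- N <= cabs (f t) <= cabs t ^+ N.

Lemma poly_growth_ext H f f' : (forall t, H t -> f t = f' t) -> poly_growth H f -> poly_growth H f'.
Proof. by move=> ff [N [M M1 K]]; exists N, M => // t Ht Mt; rewrite -ff// K. Qed.

Lemma poly_growthM H f f' : poly_growth H f -> poly_growth H f' -> poly_growth H (fun t => f t * f' t).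
Proof.
move=> [N [M M1 K]] [N' [M' M'1 K']]; exists (N + N')%N, (Num.max M M'); first by rewrite lt_max M1.
move=> t Ht; rewrite gt_max => /andP[Mt M't].
have /andP[h1 h2] := K t Ht Mt; have /andP[h3 h4] := K' t Ht M't.
have t0 : 0 < cabs t by rewrite (lt_trans _ Mt)// (lt_trans _ M1).
rewrite exprD invfM cabsM; apply/andP; split; apply: ler_pM => //;
  by rewrite ?cabs_ge0 ?invr_ge0 ?exprn_ge0 ?cabs_ge0.
Qed.

Lemma poly_growthV H f : poly_growth H f -> poly_growth H (fun t => (f t)^-1).
Proof.
move=> [N [M M1 K]]; exists N, M => // t Ht Mt; have /andP[h1 h2] := K t Ht Mt.
have t0 : 0 < cabs t by rewrite (lt_trans _ Mt)// (lt_trans _ M1).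
have tN : 0 < cabs t ^+ N by rewrite exprn_gt0.
have f0 : 0 < cabs (f t) by rewrite (lt_le_trans _ h1)// invr_gt0.
by rewrite cabsV lef_pV2 ?posrE// h2 -[leRHS]invrK lef_pV2 ?posrE ?invr_gt0.
Qed.

Lemma poly_growth_const H f (c C : R) : 0 < c -> 0 < C -> (exists M, forall t, H t -> M < cabs t ->
  c <= cabs (f t) <= C) -> poly_growth H f.
Proof.
move=> c0 C0 [M K]; exists 1%N, (Num.max 2 (Num.max M (Num.max c^-1 C))).
  by rewrite lt_max ltr1n.
move=> t Ht; rewrite !gt_max => /and4P[t2 tM tc tC]; have /andP[h1 h2] := K t Ht tM.
rewrite expr1 (le_trans h2 (ltW tC)) andbT (le_trans _ h1)//.
by rewrite -[leRHS]invrK lef_pV2 ?posrE ?invr_gt0 ?ltW//; lra.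
Qed.

Lemma poly_growth_cst H (c : R[i]) : c != 0 -> poly_growth H (fun=> c).
Proof.
by move=> c0; apply: (@poly_growth_const _ _ (cabs c) (cabs c)); rewrite ?cabs_gt0//; exists 0 => t; rewrite lexx.
Qed.

Lemma poly_growth_exprz H f (k : int) : poly_growth H f -> poly_growth H (fun t => f t ^ k).
Proof.
move=> hf; have K m : poly_growth H (fun t => f t ^+ m).
  elim: m => [|m IH].
    by apply: poly_growth_ext (poly_growth_cst H (oner_neq0 _)) => t _; rewrite expr0.
  by apply: poly_growth_ext (poly_growthM hf IH) => t _; rewrite exprS.
by case: k => m; [exact: K|exact: poly_growthV (K _)].
Qed.

Lemma poly_growth_prod H (s : seq G) (P : pred G) (F : G -> R[i] -> R[i]) :
  (forall g, g \in s -> P g -> poly_growth H (F g)) -> poly_growth H (fun w => \prod_(g <- s | P g) F g w).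
Proof.
elim: s => [|g s IH] K.
  by apply: poly_growth_ext (poly_growth_cst H (oner_neq0 _)) => t _; rewrite big_nil.
have {IH} Hs : poly_growth H (fun w => \prod_(g <- s | P g) F g w).
  by apply: IH => h hs; apply: K; rewrite inE hs orbT.
have [Pg|nPg] := boolP (P g); last first.
  by apply: poly_growth_ext Hs => t _; rewrite big_cons (negbTE nPg).
have Kg := K g _ Pg; apply: poly_growth_ext (poly_growthM (Kg _) Hs) => [t _|]; last by rewrite inE eqxx.
by rewrite big_cons Pg.
Qed.

(** The exponent tends to 0 at infinity. *)
Lemma poly_growth_cexp H (Z : R[i]) : poly_growth H (fun t => cexp (- (Z / t))).
Proof.
apply: (@poly_growth_const _ _ (expR (- 1)) (expR 1)); rewrite ?expR_gt0//.
exists (cabs Z) => t Ht tZ; have t0 : 0 < cabs t := le_lt_trans (cabs_ge0 _) tZ.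
have : cabs (- (Z / t)) <= 1 by rewrite cabsN cabs_div ler_pdivrMr// mul1r ltW.
rewrite cabs_cexp !ler_expR => h; have := cabs_Re (- (Z / t)).
by rewrite ler_norml => /andP[h1 h2]; apply/andP; split; lra.
Qed.

(** As t tends to infinity the argument of Lambda tends to 0 in the slit plane.
    *)
Lemma poly_growth_Lambda H (Z : R[i]) : Z != 0 -> (forall t, H t -> slit (Z / (T * t))) ->
  poly_growth H (fun t => Lambda (Z / (T * t))).
Proof.
move=> Z0 sl; have [d [C [d0 C0 L]]] := Lambda_near0 R.
have p0 : 0 < 2 * pi :> R by rewrite mulr_gt0// pi_gt0.
pose k := cabs Z / (2 * pi); have k0 : 0 < k by rewrite divr_gt0// cabs_gt0.
have wE t : cabs (Z / (T * t)) = k / cabs t.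
  by rewrite cabs_div (cabsM T) cabs_T invfM mulrA.
(* beyond M the argument is smaller than d, and one more power of |t| absorbs
   the constants *)
pose M := Num.max 2 (Num.max (k / d) (Num.max (C / k ^+ 2) (C * k ^- 2))).
have M2 : 1 < M by rewrite /M lt_max ltr1n.
exists 3%N, M => // t Ht; rewrite /M !gt_max => /and4P[t2 tk tC tC'].
have t0 : 0 < cabs t by lra.
have wd : cabs (Z / (T * t)) < d.
  by rewrite wE ltr_pdivrMr// mulrC -ltr_pdivrMr.
have /andP[h1 h2] := L _ (sl t Ht) wd; rewrite wE in h1 h2.
have k20 : 0 < k ^+ 2 by rewrite exprn_gt0.
have t20 : 0 < cabs t ^+ 2 by rewrite exprn_gt0.
apply/andP; split.
- apply: le_trans h1; rewrite expr_div_n mulrA exprS invfM ler_wpM2r ?invr_ge0 ?(ltW t20)//.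
  rewrite -[leRHS]invrK invfM invrK lef_pV2 ?posrE ?mulr_gt0 ?invr_gt0//.
  by rewrite ltW.
- apply: (le_trans h2); rewrite expr_div_n invf_div mulrA exprS.
  by rewrite mulrAC ler_wpM2r ?(ltW t20)// ltW.
Qed.

(** As t tends to 0 the argument of Lambda tends to infinity in a sector. *)
Lemma wtends_Lambda z (Z : R[i]) : z != 0 -> 0 < complex.Im (Z / z) ->
  wtends (half_plane (ray_of z)) (fun t => Lambda (Z / (T * t))) 1.
Proof.
move=> z0 iZ e e0; have [eta e01 He] := argument_sector z0 iZ.
have [M M0 HM] := Lambda_sector e01 e0.
have Z0 : Z != 0 by apply: contraTneq iZ => ->; rewrite mul0r ltxx.
have p0 : 0 < 2 * pi :> R by rewrite mulr_gt0// pi_gt0.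
have aZ : 0 < cabs Z by rewrite cabs_gt0.
exists (cabs Z / (2 * pi) / M); first by rewrite !divr_gt0.
move=> t Ht; rewrite ltr_pdivlMr// => td; apply: HM; first exact: He.
have t0 : 0 < cabs t by rewrite cabs_gt0 (half_plane_neq0 z0 Ht).
by rewrite cabs_div (cabsM T) cabs_T invfM mulrA ler_pdivlMr// mulrC ltW.
Qed.

End Asymptotics.

(** * Existence *)

Section Existence.
Variables (R : realType) (G : zmodType) (n : nat) (S : bps R G n).
Hypothesis Sfin : bps_finite S.
Hypothesis Sunc : bps_uncoupled S.
Hypothesis Sint : bps_integral S.
Variable xi : G -> R[i].
Hypothesis xiT : torus S xi.
Hypothesis xi1 : forall g, active S g -> xi g = 1.
Implicit Types (g h : G) (x y : G -> R[i]) (r H : set R[i]) (a b s e d : R) (t z w : R[i]).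

Local Notation T := (2 * pi%:C * 'i%C : R[i]).
Local Notation acts := (acts S).
Local Notation actsP := (actsP Sfin).

(** The classes whose factor occurs in the solution for the ray r. *)
Definition above r : pred G := fun g => `[< exists2 w, half_plane r w & bps_Z S g = 'i%C * w >].

Definition solY r t h : R[i] :=
  \prod_(g <- acts | above r g) Lambda (bps_Z S g / (T * t)) ^ (numq (bps_Omega S g) * bps_form S h g).

Definition solution : ray_family R G := fun r t h => cexp (- (bps_Z S h / t)) * xi h * solY r t h.

Lemma aboveP z g : z != 0 -> above (ray_of z) g = (0 < complex.Im (bps_Z S g / z)).
Proof. by move=> z0; apply/asboolP/idP => /(i_half_planeP _ z0). Qed.

Lemma Lambda_above_neq0 r t g : is_ray r -> half_plane r t -> above r g -> Lambda (bps_Z S g / (T * t)) != 0.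
Proof.
move=> [z z0 ->] ht; rewrite aboveP// => iZ.
by apply: Lambda_neq0; exact: argument_slit iZ ht.
Qed.

Lemma solY_active r t h : active S h -> solY r t h = 1.
Proof.
move=> ah; rewrite /solY big_seq_cond big1// => g /andP[/actsP ag _].
by rewrite Sunc// mulr0 expr0z.
Qed.

Lemma solution_active r t h : active S h -> solution r t h = cexp (- (bps_Z S h / t)).
Proof. by move=> ah; rewrite /solution solY_active// xi1// !mulr1. Qed.

Lemma solY_neq0 r t h : is_ray r -> half_plane r t -> solY r t h != 0.
Proof.
move=> hr ht; rewrite /solY prodf_seq_neq0; apply/allP => g _; apply/implyP => rg.
by rewrite expfz_neq0// (Lambda_above_neq0 hr ht).
Qed.

(** The product is a character of the lattice, so the sign rule comes from xi.
    *)
Lemma solution_torus r t : is_ray r -> half_plane r t -> torus S (solution r t).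
Proof.
move=> hr ht; split=> [h|h k].
  apply: mulf_neq0; last exact: solY_neq0.
  by apply: mulf_neq0; [exact: cexp_neq0|exact: torus_neq0 xiT].
have YD : solY r t (h + k) = solY r t h * solY r t k.
  rewrite /solY -big_split/= big_seq_cond [RHS]big_seq_cond; apply: eq_bigr => g /andP[_ rg].
  by rewrite bps_formDl mulrDr expfzDr// (Lambda_above_neq0 hr ht).
rewrite /solution YD xiT.2 raddfD/= mulrDl opprD cexpD.
move: (cexp _) (cexp _) ((-1) ^ _) (xi h) (xi k) (solY _ _ _) (solY _ _ _) => p q u v w y1 y2.
ring.
Qed.

Lemma solution_holomorphic : RH_holomorphic S solution.
Proof.
move=> r [hr _] t ht; split; first exact: solution_torus.
move=> h; apply/cholo_derivable; have [z z0 rz] := hr.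
have t0 : t != 0 by move: ht; rewrite rz; exact: half_plane_neq0.
apply: choloM; first apply: choloM; last 1 first.
- apply: cholo_prod => g _ rg; apply: cholo_exprz; first exact: (Lambda_above_neq0 hr ht rg).
  have iZ : 0 < complex.Im (bps_Z S g / z) by rewrite -aboveP// -rz.
  have [|l dl] := @cdiff_Lambda _ (bps_Z S g / (T * t)).
    by apply: argument_slit iZ _ => //; rewrite -rz.
  have Tt : T * t != 0 by apply: mulf_neq0 => //; exact: T_neq0.
  eexists; apply: (@cdiff_comp _ (@Lambda R) (fun u => bps_Z S g / (T * u))) dl.
  exact: cdiff_div Tt (cdiff_cst _ _) (cdiffZ _ (cdiff_id _)).
- eexists; apply: cdiff_cexp_comp; apply: cdiffN.
  exact: cdiff_div t0 (cdiff_cst _ _) (cdiff_id _).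
- exact: cholo_cst.
Qed.

Lemma solution_Y r t h : is_ray r -> half_plane r t ->
  cexp (bps_Z S h / t) * solution r t h * (xi h)^-1 = solY r t h.
Proof.
move=> hr ht; rewrite /solution cexpN; have := torus_neq0 h xiT; have := cexp_neq0 (bps_Z S h / t).
move: (cexp _) (xi h) (solY _ _ _) => p q y p0 q0; field.
by rewrite p0 q0.
Qed.

Lemma solY_tends r h : is_ray r -> wtends (half_plane r) (fun t => solY r t h) 1.
Proof.
move=> [z z0 ->]; apply: wtends_prod1 => g _ rg.
have iZ : 0 < complex.Im (bps_Z S g / z) by rewrite -aboveP.
have E : (1 : R[i]) = 1 ^ (numq (bps_Omega S g) * bps_form S h g) by rewrite exp1rz.
by rewrite [X in wtends _ _ X]E; apply: wtends_comp (wtends_Lambda z0 iZ) (ccont_exprz1 _).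
Qed.

Lemma solution_RH2 : RH2 S xi solution.
Proof.
move=> r [hr _] h; apply/wtends_cvg.
have := wtendsM (wtends_cst (half_plane r) (xi h)) (solY_tends h hr); rewrite mulr1.
apply: wtends_ext => t ht; rewrite -(solution_Y h hr ht).
have := torus_neq0 h xiT; move: (cexp _ * _) (xi h) => p q q0; field.
by [].
Qed.

Lemma solution_growth r h : is_ray r -> poly_growth (half_plane r) (fun t => solution r t h).
Proof.
move=> hr; have [z z0 rz] := hr; apply: poly_growthM; first apply: poly_growthM.
- exact: poly_growth_cexp.
- by apply: poly_growth_cst; exact: torus_neq0 xiT.
- apply: poly_growth_prod => g /actsP ag rg; apply: poly_growth_exprz.
  apply: poly_growth_Lambda; first exact: active_Z_neq0.
  move=> t ht; have iZ : 0 < complex.Im (bps_Z S g / z) by rewrite -aboveP// -rz.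
  by apply: argument_slit iZ _ => //; rewrite -rz.
Qed.

Lemma solution_RH3 : RH3 S solution.
Proof.
move=> h r [hr _]; have [N [M M1 K]] := solution_growth h hr.
exists N.+1%:R; first by rewrite ltr0n.
exists M => t ht Mt; have t1 : 1 < cabs t by rewrite (lt_trans M1).
have t0 : 0 < cabs t by rewrite (lt_trans _ t1).
have /andP[h1 h2] := K t ht Mt.
rewrite powRN powR_mulrn ?cabs_ge0//.
have lt : cabs t ^+ N < cabs t ^+ N.+1 by rewrite ltr_eXn2l.
rewrite (le_lt_trans h2 lt) andbT (lt_le_trans _ h1)//.
by rewrite ltf_pV2 ?posrE ?exprn_gt0.
Qed.

(** For g in the sector, Re (Z(g) / t) tends to infinity as t tends to 0 in the
    two half-planes. *)
Lemma solution_Udom a b rho : 0 < b - a < pi -> 0 < rho -> exists2 d, 0 < d & forall t, cabs t < d ->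
  half_plane (ray_of (cis b)) t -> half_plane (ray_of (cis a)) t ->
  Udom S (sector a b) rho (solution (ray_of (cis b)) t).
Proof.
move=> ab rho0.
have [|d d0 Hd] := @seq_uniform_radius R G acts (fun g e => sector a b (bps_Z S g) -> forall t, cabs t < e ->
   half_plane (ray_of (cis b)) t -> half_plane (ray_of (cis a)) t ->
   rho * lnorm S g < complex.Re (bps_Z S g / t)).
  move=> g _; have [gs|ng] := pselect (sector a b (bps_Z S g)); last by exists 1.
  have [m m0 Hm] := Re_quotient_lower ab gs.
  have q0 : 0 <= rho * lnorm S g by rewrite mulr_ge0 ?lnorm_ge0// ltW.
  have q1 : 0 < rho * lnorm S g + 1 by rewrite ltr_wpDl.
  exists (m / (rho * lnorm S g + 1)); first by rewrite divr_gt0.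
  move=> e /andP[_ em] _ t te tb ta; apply: lt_le_trans (Hm t ta tb).
  have t0 : 0 < cabs t by rewrite cabs_gt0 (half_plane_neq0 (cis_neq0 b) tb).
  have := lt_le_trans te em; rewrite ltr_pdivlMr// => h.
  rewrite ltr_pdivlMr//; apply: le_lt_trans h; rewrite mulrC ler_wpM2l ?(ltW t0)//.
  by rewrite lerDl.
exists d => // t td tb ta; apply: Udom_intro => //.
  by apply: solution_torus => //; exact: is_ray_cis.
move=> g ag gs; rewrite solution_active// cabs_cexp ltr_expR cReN mulNr ltrN2.
by apply: (Hd g _ gs t td tb ta); exact/actsP.
Qed.

Lemma numq_OmegaN g : numq (bps_Omega S (- g)) = numq (bps_Omega S g).
Proof. by rewrite bps_OmegaN. Qed.

(** The active classes are stable under negation. *)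
Lemma prod_acts_opp (P : pred G) (F : G -> R[i]) :
  \prod_(g <- acts | P g) F g = \prod_(g <- acts | P (- g)) F (- g).
Proof.
have pe : perm_eq acts [seq - g | g <- acts].
  apply: uniq_perm; rewrite ?(map_inj_uniq oppr_inj) ?acts_uniq// => g.
  apply/idP/mapP => [/actsP ag|[h /actsP ah ->]].
    by exists (- g); rewrite ?opprK//; apply/actsP; exact: activeN.
  by apply/actsP; exact: activeN.
by rewrite (perm_big _ pe)/= big_map.
Qed.

(** A class of the line through the ray would be active on the ray, or its
    opposite would. *)
Lemma nonactive_Im a g : nonactive_ray S (ray_of (cis a)) -> active S g ->
  complex.Im (bps_Z S g / cis a) != 0.
Proof.
move=> [_ na] ag; apply/negP => /eqP i0; set u := bps_Z S g / cis a in i0.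
have uE : u = (complex.Re u)%:C by apply: complexP; rewrite ?cReC ?cImC.
have ZE : bps_Z S g = (complex.Re u)%:C * cis a by rewrite -uE divfK ?cis_neq0.
have Z0 := active_Z_neq0 ag.
have : complex.Re u != 0 by apply: contraNneq Z0 => E; rewrite ZE E mul0r.
rewrite neq_lt => /orP[u0|u0]; apply: na; split; try exact: is_ray_cis.
  exists (- g); first exact: activeN.
  by exists (- complex.Re u); [rewrite oppr_gt0|rewrite realCN raddfN/= ZE mulNr].
by exists g => //; exists (complex.Re u).
Qed.

(** A class in the sector has its factor above the first ray and not above the
    second; for its opposite it is the other way around. The classes outside of
    the sector and of its opposite contribute the same to both sides. *)
Lemma solY_jump a b t h : 0 < b - a < pi -> nonactive_ray S (ray_of (cis a)) -> nonactive_ray S (ray_of (cis b)) ->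
  half_plane (ray_of (cis a)) t -> half_plane (ray_of (cis b)) t ->
  solY (ray_of (cis a)) t h = solY (ray_of (cis b)) t h *
    jump S (fun g => bps_Z S g \in sector a b) (solution (ray_of (cis b)) t) h.
Proof.
move=> ab na nb ta tb; pose A g := above (ray_of (cis a)) g; pose B g := above (ray_of (cis b)) g.
pose F g := Lambda (bps_Z S g / (T * t)) ^ (numq (bps_Omega S g) * bps_form S h g).
have AE g : A g = (0 < complex.Im (bps_Z S g / cis a)) by exact/aboveP/cis_neq0.
have BE g : B g = (0 < complex.Im (bps_Z S g / cis b)) by exact/aboveP/cis_neq0.
have oppA g : active S g -> A (- g) = ~~ A g.
  move=> ag; have := nonactive_Im na ag; rewrite !AE raddfN/= mulNr cImN oppr_gt0 neq_lt.
  by case/orP => h1; rewrite h1 (lt_gtF h1).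
have oppB g : active S g -> B (- g) = ~~ B g.
  move=> ag; have := nonactive_Im nb ag; rewrite !BE raddfN/= mulNr cImN oppr_gt0 neq_lt.
  by case/orP => h1; rewrite h1 (lt_gtF h1).
have secE g : active S g -> (bps_Z S g \in sector a b) = A g && ~~ B g.
  move=> ag; rewrite -oppB// AE BE raddfN/= mulNr cImN oppr_gt0; apply/idP/andP.
    by move=> /set_mem/(sectorP _ ab).
  by move=> h1; apply/mem_set/(sectorP _ ab).
rewrite [LHS](_ : _ = \prod_(g <- acts | A g) F g)// [X in _ = X * _](_ : _ = \prod_(g <- acts | B g) F g)//.
rewrite [LHS](bigID B)/= [X in _ = X * _](bigID A)/= -[RHS]mulrA; congr (_ * _).
  by apply: eq_bigl => g; rewrite andbC.
rewrite [X in _ = X * _]prod_acts_opp /jump.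
rewrite big_seq_cond [X in _ = X * _]big_seq_cond [X in _ = _ * X]big_seq_cond.
rewrite [X in _ = X * _](eq_bigl (fun g => (g \in acts) && (A g && ~~ B g))); last first.
  move=> g; case ga: (g \in acts) => //=; have ag : active S g by exact/actsP.
  by rewrite -/(A (- g)) -/(B (- g)) oppA// oppB// negbK andbC.
rewrite [X in _ = _ * X](eq_bigl (fun g => (g \in acts) && (A g && ~~ B g))); last first.
  by move=> g; case ga: (g \in acts) => //=; apply: secE; exact/actsP.
rewrite -big_split/=; apply: eq_bigr => g /andP[/actsP ag Ag].
have gs : sector a b (bps_Z S g) by apply/set_mem; rewrite secE.
have [m m0 Hm] := Re_quotient_lower ab gs.
have t0 := half_plane_neq0 (cis_neq0 a) ta.
have Re0 : 0 < complex.Re (bps_Z S g / t).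
  by apply: lt_le_trans (Hm t ta tb); rewrite divr_gt0// cabs_gt0.
set w := bps_Z S g / (T * t).
have wE : w = bps_Z S g / t / T by rewrite /w invfM mulrA mulrAC.
have iw : 0 < complex.Im (- w).
  by rewrite cImN wE Im_divT mulNr opprK divr_gt0// mulr_gt0// pi_gt0.
(* for g in the sector Re (Z(g) / t) > 0 means Im w < 0, so the reflection
   formula is used at - w *)
have refl := Lambda_reflection iw; rewrite opprK in refl.
have TwE : T * - w = - (bps_Z S g / t).
  by rewrite mulrN wE mulrC divfK// T_neq0.
rewrite TwE in refl.
rewrite solution_active// /F numq_OmegaN bps_formNr raddfN/= !mulNr -/w mulrN.
rewrite [bps_form S g h]bps_form_skew mulrN.
set k := numq _ * _; move: refl.
move: (Lambda w) (Lambda (- w)) (1 - cexp _) => L L' E refl.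
have n0 : L' * L * E != 0 by rewrite refl oner_neq0.
move: n0; rewrite !mulf_eq0 !negb_or => /andP[/andP[L'0 L0] E0].
have -> : L = (L' * E)^-1.
  by apply: (mulIf (_ : L' * E != 0)); rewrite ?mulf_neq0// mulVf ?mulf_neq0// -refl; ring.
by rewrite exprz_inv expfzMl.
Qed.

Lemma solution_RH1 : RH1 S solution.
Proof.
move=> a b ab /= nb na.
near=> rho; have rho0 : 0 < rho by near: rho; exact: nbhs_pinfty_gt.
have [d d0 Hd] := solution_Udom ab rho0.
apply/cvg_near0; exists d => // t td tb ta; have U := Hd t td tb ta.
split => //; apply/(sector_autP Sfin Sunc Sint _ ab rho0 U) => h.
by rewrite /solution (solY_jump h ab na nb ta tb) mulrA.
Unshelve. all: by end_near.
Qed.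

Theorem solution_solves : RH_solution S xi solution.
Proof.
split; [exact: solution_holomorphic|exact: solution_RH1|exact: solution_RH2|exact: solution_RH3].
Qed.

End Existence.

(** * Uniqueness *)

Section Gluing.
Variable R : realType.
Implicit Types (z w t u : R[i]) (r : set R[i]) (a b c d e : R) (F : set R[i] -> R[i] -> R[i]).

Lemma half_plane_cone z t : z != 0 -> half_plane (ray_of z) t -> exists2 d, 0 < d &
  forall u s, cabs u < d -> 0 < s -> half_plane (ray_of z) (s%:C * (t + u)).
Proof.
move=> z0 /(half_planeP _ z0) ht; exists (complex.Re (t / z) * cabs z).
  by rewrite mulr_gt0// cabs_gt0.
move=> u s ud s0; apply/(half_planeP _ z0).
have -> : s%:C * (t + u) / z = s%:C * (t / z + u / z) by field.
rewrite cReM cReC cImC mul0r subr0 pmulr_rgt0// cReD.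
have : cabs (u / z) < complex.Re (t / z) by rewrite cabs_div ltr_pdivrMr// cabs_gt0.
by have := cabs_Re (u / z); rewrite ler_norml => /andP[h _]; lra.
Qed.

Lemma ray_of_carg z : z != 0 -> ray_of z = ray_of (cis (carg z)).
Proof.
move=> z0; apply: ray_of_eq; exists (cabs z); first by rewrite cabs_gt0.
exact: cabs_cis_carg.
Qed.

Lemma cisD a b : cis (a + b) = cis a * cis b :> R[i].
Proof. by rewrite /cis -cexpD; congr cexp; apply: complexP; rewrite !cReImE ?addr0. Qed.

Lemma half_plane_opp z t : z != 0 -> half_plane (ray_of z) t -> half_plane (ray_of (- z)) t -> False.
Proof.
move=> z0 /(half_planeP _ z0) h /half_planeP; rewrite oppr_eq0 => /(_ z0).
by rewrite invrN mulrN cReN; lra.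
Qed.

Variable nonactive : set R[i] -> Prop.
Hypothesis nonactive_rays : forall r, nonactive r -> is_ray r.

(** What the ratio of two solutions satisfies; [sectorial_trivial] shows that
    it is then constant. *)
Definition sectorial_family F := [/\
  forall r t, nonactive r -> half_plane r t -> cholo (F r) t /\ F r t != 0,
  forall a b, 0 < b - a < pi -> nonactive (ray_of (cis a)) -> nonactive (ray_of (cis b)) ->
    exists2 d, 0 < d & forall t, cabs t < d -> half_plane (ray_of (cis b)) t -> half_plane (ray_of (cis a)) t ->
      F (ray_of (cis a)) t = F (ray_of (cis b)) t,
  forall r, nonactive r -> wtends (half_plane r) (F r) 1 &
  forall r, nonactive r -> poly_growth (half_plane r) (F r)].

(** Equality near 0 spreads over the intersection of the half-planes, which is
    a cone. *)
Lemma sectorial_agree_sector F a b t : sectorial_family F -> 0 < b - a < pi ->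
  nonactive (ray_of (cis a)) -> nonactive (ray_of (cis b)) ->
  half_plane (ray_of (cis a)) t -> half_plane (ray_of (cis b)) t ->
  F (ray_of (cis a)) t = F (ray_of (cis b)) t.
Proof.
move=> [Fh Fj _ _] ab na nb ta tb.
have [e e0 He] := Fj a b ab na nb.
have [d d0 Hd] := half_plane_cone (cis_neq0 a) ta.
have [d' d'0 Hd'] := half_plane_cone (cis_neq0 b) tb.
apply/eqP; rewrite -subr_eq0; apply/eqP.
(* the difference vanishes on the part of the cone close to 0 *)
apply: (@cone_identity R (fun w => F (ray_of (cis a)) w - F (ray_of (cis b)) w) t (Num.min d d') e) => //.
- by rewrite lt_min d0.
- move=> s u /andP[s0 _]; rewrite lt_min => /andP[ud ud'].
  have [[l hl] _] := Fh _ _ na (Hd u s ud s0); have [[m hm] _] := Fh _ _ nb (Hd' u s ud' s0).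
  by eexists; exact: cdiffB hl hm.
- move=> s u /andP[s0 _]; rewrite lt_min => /andP[ud ud'] ue.
  by rewrite He ?subrr//; [exact: Hd'|exact: Hd].
Qed.

(** Two half-planes that meet belong to rays at an angle less than pi, hence
    bounding a convex sector in one of the two orders, or to the same ray. *)
Lemma sectorial_agree F r r' t : sectorial_family F -> nonactive r -> nonactive r' ->
  half_plane r t -> half_plane r' t -> F r t = F r' t.
Proof.
move=> HF nr nr'; have [z z0 rz] := nonactive_rays nr; have [z' z'0 rz'] := nonactive_rays nr'.
have q0 : z' / z != 0 by rewrite mulf_neq0 ?invr_eq0.
set a := carg z; set c := carg (z' / z).
have ra : r = ray_of (cis a) by rewrite rz ray_of_carg.
have rac : r' = ray_of (cis (a + c)).
  rewrite rz'; apply: ray_of_eq; exists (cabs z * cabs (z' / z)); first by rewrite mulr_gt0 ?cabs_gt0.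
  rewrite cisD realCM mulrACA -!cabs_cis_carg mulrC divfK//.
rewrite ra rac in nr nr' *; move=> ta tac.
have /andP[c1 c2] := carg_itv (z' / z); rewrite -/c in c1 c2.
(* c is the angle from the first ray to the second; opposite rays have disjoint
   half-planes *)
have opp : cis c = -1 -> F (ray_of (cis a)) t = F (ray_of (cis (a + c))) t.
  move=> cE; rewrite cisD cE mulrN1 in tac.
  by case: (half_plane_opp (cis_neq0 a) ta tac).
have [c0|c0|->] := ltgtP c 0; last by rewrite addr0.
- have [cp|cp] := eqVneq c (- pi); first by apply: opp; apply: complexP; rewrite cis_eq cp !cReImE ?cosN ?sinN ?cospi ?sinpi ?oppr0.
  apply/esym/(sectorial_agree_sector HF) => //; rewrite opprD addrA subrr add0r oppr_gt0 c0/=.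
  by rewrite ltrNl lt_neqAle eq_sym cp.
- have [cp|cp] := eqVneq c pi; first by apply: opp; apply: complexP; rewrite cis_eq cp !cReImE ?cospi ?sinpi ?oppr0.
  apply: (sectorial_agree_sector HF) => //; rewrite addrC addKr c0/=.
  by rewrite lt_neqAle cp.
Qed.

Lemma seq_uniform_growth (I : eqType) (q : seq I) (P : I -> nat -> R -> Prop) :
  (forall i N N' M M', (N <= N')%N -> M <= M' -> P i N M -> P i N' M') ->
  (forall i, i \in q -> exists N, exists M, P i N M) ->
  exists N, exists M, forall i, i \in q -> P i N M.
Proof.
move=> mono; elim: q => [|i q IH] H; first by exists 0%N, 0.
have [|N [M K]] := IH; first by move=> j jq; apply: H; rewrite inE jq orbT.
have [|N' [M' L]] := H i; first by rewrite inE eqxx.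
exists (maxn N N'), (Num.max M M') => j; rewrite inE => /orP[/eqP ->|/K].
  by apply: mono L; rewrite ?leq_maxr// le_max lexx orbT.
by apply: mono; rewrite ?leq_maxl// le_max lexx.
Qed.

(** The values glue to a function f on C^*. In the variable w with t = exp w
    Liouville's theorem makes f a polynomial; it has no root, and its value at
    0 is the limit 1. *)
Theorem sectorial_trivial F (rs : seq (R[i])) :
  (forall z, z \in rs -> z != 0 /\ nonactive (ray_of z)) ->
  (forall t, t != 0 -> exists2 z, z \in rs & half_plane (ray_of z) t) ->
  sectorial_family F -> forall r t, nonactive r -> half_plane r t -> F r t = 1.
Proof.
move=> rsP cover HF; have [Fh Fj F0 Fg] := HF.
pose f t := F (xget set0 [set r | nonactive r /\ half_plane r t]) t.
have fE r t : nonactive r -> half_plane r t -> f t = F r t.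
  move=> nr ht; rewrite /f.
  have [n1 h1] : [set r | nonactive r /\ half_plane r t] (xget set0 [set r | nonactive r /\ half_plane r t]).
    by apply: (xgetPex set0 (P:=[set r | nonactive r /\ half_plane r t])); exists r.
  exact: sectorial_agree.
have near0 e : 0 < e -> exists2 d, 0 < d & forall t, t != 0 -> cabs t < d -> cabs (f t - 1) < e.
  move=> e0; have [|d d0 Hd] := @seq_uniform_radius R (R[i]) rs (fun z d => forall t, half_plane (ray_of z) t -> cabs t < d -> cabs (F (ray_of z) t - 1) < e).
    move=> z /rsP[_ nz]; have [d d0 Hd] := F0 _ nz e e0; exists d => // e' /andP[_ e'd] t ht td.
    by apply: Hd => //; exact: lt_le_trans td e'd.
  exists d => // t /cover[z zs ht] td; rewrite (fE (ray_of z))//; last exact: (rsP z zs).2.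
  exact: (Hd z).
have grow : exists N : nat, exists M : R, 1 <= M /\ forall t, M < cabs t -> cabs (f t) <= cabs t ^+ N.
  have [| |N [M H]] := @seq_uniform_growth (R[i]) rs (fun z N M => forall t, half_plane (ray_of z) t -> 1 < cabs t -> M < cabs t -> cabs (F (ray_of z) t) <= cabs t ^+ N).
  - move=> z N N' M M' NN MM H t ht t1 tM; apply: (le_trans (H t ht t1 _)); first exact: le_lt_trans MM tM.
    by rewrite ler_weXn2l// ltW.
  - move=> z /rsP[_ nz]; have [N [M M1 H]] := Fg _ nz; exists N, M => t ht _ Mt.
    by have /andP[] := H t ht Mt.
  exists N, (Num.max 1 M); split; first by rewrite le_max lexx.
  move=> t; rewrite gt_max => /andP[t1 tM].
  have [|z zs ht] := cover t; first by rewrite -cabs_gt0 (lt_trans _ t1).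
  by rewrite (fE (ray_of z))//; [exact: H|exact: (rsP z zs).2].
have hol t : t != 0 -> exists l, cdiff f t l.
  move=> /cover[z zs ht]; have [z0 nz] := rsP z zs.
  have [[l dl] _] := Fh _ _ nz ht; exists l.
  have [d d0 Hd] := half_plane_cone z0 ht.
  apply: cdiff_near dl; exists d => // u ud; rewrite (fE (ray_of z))//.
  by have := Hd u 1 ud ltr01; rewrite realC1 mul1r.
have [d d0 Hd] := near0 1 ltr01; have [N [M [M1 HM]]] := grow.
(* A is chosen so that exp (- A) < d and M < exp A *)
pose A := `|ln d| + `|ln M| + 1.
pose g w := f (cexp w).
have dg w : exists l, cdiff g w l.
  have [l dl] := hol _ (cexp_neq0 w); eexists; exact: cdiff_comp (cdiff_cexp w) dl.
have M0 : 0 < M by lra.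
have [|||||c Hc] := @Liouville_exp R g 0 2 A N (fun w w' E => congr1 f E).
- by rewrite ltr0n.
- by move=> w; have [l dl] := dg w; exact: cdiff_ccont dl.
- by move=> w _; exact: dg.
- move=> w wA; have : cabs (cexp w) < d.
    rewrite cabs_cexp -[ltRHS]lnK ?posrE// ltr_expR.
    by have := ler_norm (- ln d); rewrite normrN; have : 0 <= `|ln M| by []; rewrite /A in wA; lra.
  move=> /(Hd _ (cexp_neq0 w)); rewrite /g => h; have := cabs_subr (f (cexp w)) 1; rewrite cabs1; lra.
- move=> w wA; have h : M < cabs (cexp w).
    rewrite cabs_cexp -[ltLHS]lnK ?posrE// ltr_expR.
    by have := ler_norm (ln M); have : 0 <= `|ln d| by []; rewrite /A in wA; lra.
  apply: (le_trans (HM _ h)); rewrite cabs_cexp expRM_natl.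
  by rewrite ler_peMl ?exprn_ge0 ?expR_ge0// ler1n.
pose p := \poly_(k < N.+1) c k.
have fp t : t != 0 -> f t = p.[t].
  move=> t0; rewrite -(cexp_clog t0) -/(g _) Hc horner_poly; apply: eq_bigr => k _.
  by rewrite cexpzE.
have p0 : p.[0] = 1.
  apply/eqP; rewrite -subr_eq0; apply/eqP/cabs_eq0_le/ler_addgt0Pr => e e0; rewrite add0r.
  have e2 : 0 < e / 2 by rewrite divr_gt0.
  have cp : ccont (fun w => p.[w]) 0.
    apply: (@ccont_ext _ (fun w => \sum_(k < N.+1) c k * w ^+ k)) => [w|]; first by rewrite horner_poly.
    apply: ccont_sum => k; apply: cdiff_ccont (cdiffZ (c k) (cdiffX k (cdiff_id 0))).
  have [d1 d10 H1] := cp _ e2; have [d2 d20 H2] := near0 _ e2.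
  have m0 : 0 < Num.min d1 d2 by rewrite lt_min d10.
  pose t := (Num.min d1 d2 / 2)%:C : R[i].
  have t0 : t != 0 by rewrite realC_eq0 gt_eqF// divr_gt0.
  have : cabs t < Num.min d1 d2.
    by rewrite cabs_real gtr0_norm ?divr_gt0// ltr_pdivrMr// ltr_pMr// ltr1n.
  rewrite lt_min => /andP[/H1 h1 /(H2 _ t0)]; rewrite add0r in h1; rewrite fp// => h2.
  have -> : p.[0] - 1 = (p.[t] - 1) - (p.[t] - p.[0]) by ring.
  rewrite (le_trans (cabsB _ _))//; lra.
have noroot t : ~~ root p t.
  rewrite /root; have [->|t0] := eqVneq t 0; first by rewrite p0 oner_neq0.
  have [z zs ht] := cover t t0; have [z0 nz] := rsP z zs.
  by rewrite -fp// (fE (ray_of z))//; case: (Fh _ _ nz ht).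
have sp : size p == 1%N.
  by apply: contraT => /closed_rootP[t rt]; move: (noroot t); rewrite rt.
move=> r t nr ht; have [z z0 rz] := nonactive_rays nr.
have t0 : t != 0 by move: ht; rewrite rz; exact: half_plane_neq0.
rewrite -(fE r t nr ht) fp//; have /size_poly1P[k _ pk] := sp.
by move: p0; rewrite pk !hornerC.
Qed.

End Gluing.

Section Uniqueness.
Variables (R : realType) (G : zmodType) (n : nat) (S : bps R G n).
Hypothesis Sfin : bps_finite S.
Hypothesis Sunc : bps_uncoupled S.
Hypothesis Sint : bps_integral S.
Variable xi : G -> R[i].
Hypothesis xiT : torus S xi.
Hypothesis xi1 : forall g, active S g -> xi g = 1.
Implicit Types (g h : G) (x y : G -> R[i]) (r : set R[i]) (a b s e d : R) (t z w : R[i]) (X : ray_family R G).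

Local Notation acts := (acts S).
Local Notation actsP := (actsP Sfin).

(** Only finitely many rays are active, so a small rotation of the four axes
    avoids them all: it suffices that the slope s of the rays, in each of the
    four quadrants, exceeds that of every active class. The half-planes of four
    rays at right angles cover C^*. *)
Lemma nonactive_cross : exists rs : seq R[i],
  (forall z, z \in rs -> z != 0 /\ nonactive_ray S (ray_of z)) /\
  (forall t, t != 0 -> exists2 z, z \in rs & half_plane (ray_of z) t).
Proof.
pose slope_at g (j : nat) := `|complex.Im (bps_Z S g / 'i%C ^+ j) / complex.Re (bps_Z S g / 'i%C ^+ j)|.
(* a ray through i^j (1 + i s) contains only classes of slope s after rotation
   by i^-j *)
pose s := 1 + \sum_(g <- acts) \sum_(j < 4) slope_at g j.
have sl0 g : 0 <= \sum_(j < 4) slope_at g j by apply: sumr_ge0 => j _; exact: normr_ge0.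
have i0 j : 'i%C ^+ j != 0 :> R[i] by rewrite expf_neq0// neq0Ci.
pose q : R[i] := 1 +i* s.
have q0 : q != 0 by apply/negP => /eqP/(congr1 (@complex.Re R))/eqP; rewrite Re_mk oner_eq0.
exists [seq 'i%C ^+ j * q | j <- iota 0 4]; split.
  move=> z /mapP[j]; rewrite mem_iota => /= j4 ->.
  have z0 : 'i%C ^+ j * q != 0 by rewrite mulf_neq0.
  split => //; split; first by exists ('i%C ^+ j * q).
  move=> [_ [g ag [c c0 gE]]].
  have uE : bps_Z S g / 'i%C ^+ j = c%:C * q.
    by rewrite gE; have := i0 j; move: ('i%C ^+ j) => k k0; field.
  have sE : slope_at g j = s.
    rewrite /slope_at uE /q !cReImE !mul0r subr0 addr0 mulr1 mulrAC divff ?gt_eqF// mul1r ger0_norm//.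
    by rewrite /s addr_ge0// sumr_ge0.
  have : slope_at g j <= \sum_(g <- acts) \sum_(j < 4) slope_at g j.
    rewrite (big_rem g)/=; last exact/actsP.
    rewrite (bigD1 (Ordinal j4))//= -addrA lerDl addr_ge0 ?sumr_ge0// => k _.
    exact: normr_ge0.
  by rewrite sE /s; lra.
move=> t t0; set u := t / q.
have u0 : u != 0 by rewrite mulf_neq0 ?invr_eq0.
have key j : (j < 4)%N -> 0 < complex.Re (u / 'i%C ^+ j) ->
    exists2 z, z \in [seq 'i%C ^+ j * q | j <- iota 0 4] & half_plane (ray_of z) t.
  move=> j4 h; exists ('i%C ^+ j * q).
    by apply/mapP; exists j => //; rewrite mem_iota.
  apply/half_planeP; first by rewrite mulf_neq0.
  by rewrite invfM mulrA mulrAC.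
have E (k v : R[i]) : k * v = 1 -> v^-1 = k.
  move=> kv; have v0 : v != 0 by apply: contra_eqN kv => /eqP ->; rewrite mulr0 eq_sym oner_eq0.
  by apply: (mulIf v0); rewrite mulVf.
have [r0|r0|r0] := ltgtP (complex.Re u) 0.
- apply: (key 2%N) => //; rewrite (E (- 1)) ?sqr_i ?mulrNN ?mulr1//.
  by rewrite mulrN mulr1 cReN oppr_gt0.
- by apply: (key 0%N) => //; rewrite expr0 divr1.
- have : complex.Im u != 0.
    by apply: contraNneq u0 => im0; apply/eqP/complexP; rewrite ?r0 ?im0.
  rewrite neq_lt => /orP[m0|m0].
    apply: (key 3%N) => //; rewrite (E 'i%C).
      by rewrite cReM cRei cImi; lra.
    by rewrite exprS sqr_i mulrA -expr2 sqr_i mulrNN mulr1.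
  apply: (key 1%N) => //; rewrite expr1 (E (- 'i%C)).
    by rewrite cReM cReN cImN cRei cImi; lra.
  by rewrite mulNr -expr2 sqr_i opprK.
Qed.

(** The first condition, freed from the composite of flows. *)
Lemma RH1_jump X a b : RH1 S X -> 0 < b - a < pi ->
  nonactive_ray S (ray_of (cis a)) -> nonactive_ray S (ray_of (cis b)) ->
  exists2 d, 0 < d & forall t, cabs t < d -> half_plane (ray_of (cis b)) t -> half_plane (ray_of (cis a)) t ->
    forall h, X (ray_of (cis a)) t h = X (ray_of (cis b)) t h *
      jump S (fun g => bps_Z S g \in sector a b) (X (ray_of (cis b)) t) h.
Proof.
move=> H ab na nb; have /= K := H a b ab nb na.
have [rho [rho0 /cvg_near0[d d0 Hd]]] : exists rho : R, 0 < rho /\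
  \forall t \near (0 : R[i]^o), half_plane (ray_of (cis b)) t -> half_plane (ray_of (cis a)) t ->
      Udom S (sector a b) rho (X (ray_of (cis b)) t) /\
      bps_sector_aut S a b (X (ray_of (cis b)) t) (X (ray_of (cis a)) t).
  by apply: (@filter_ex _ (pinfty_nbhs R)); apply: filterI => //; exact: nbhs_pinfty_gt.
exists d => // t td tb ta h; have [U] := Hd t td tb ta.
by move/(sector_autP Sfin Sunc Sint _ ab rho0 U).
Qed.

Lemma RH3_growth X r h : RH3 S X -> nonactive_ray S r ->
  poly_growth (half_plane r) (fun t => X r t h).
Proof.
move=> H nr; have [k k0 [M HM]] := H h r nr.
have kN : k <= (Num.bound k)%:R by rewrite ltW// archi_boundP// ltW.
exists (Num.bound k), (Num.max 2 M); first by rewrite lt_max ltr1n.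
move=> t ht; rewrite gt_max => /andP[t2 tM]; have /andP[h1 h2] := HM t ht tM.
have t1 : 1 <= cabs t by lra.
have t0 : 0 < cabs t by lra.
(* integral exponents above k are weaker bounds since |t| >= 1 *)
rewrite -powR_mulrn ?cabs_ge0//; apply/andP; split.
  rewrite (le_trans _ (ltW h1))// powRN lef_pV2 ?posrE ?powR_gt0//.
  exact: ler_powR.
by rewrite (le_trans (ltW h2))// ler_powR.
Qed.

(** If both solutions have the same jump factor, it cancels in the ratio. *)
Lemma RH_ratio_sectorial X X' h : RH_solution S xi X -> RH_solution S xi X' ->
  (forall a b, 0 < b - a < pi -> nonactive_ray S (ray_of (cis b)) -> forall t, half_plane (ray_of (cis b)) t ->
    jump S (fun g => bps_Z S g \in sector a b) (X' (ray_of (cis b)) t) h =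
    jump S (fun g => bps_Z S g \in sector a b) (X (ray_of (cis b)) t) h) ->
  sectorial_family (nonactive_ray S) (fun r t => X' r t h / X r t h).
Proof.
move=> [Xh X1 X2 X3] [X'h X'1 X'2 X'3] J.
have X0 r t : nonactive_ray S r -> half_plane r t -> X r t h != 0.
  by move=> nr ht; exact: torus_neq0 (Xh r nr t ht).1.
have X'0 r t : nonactive_ray S r -> half_plane r t -> X' r t h != 0.
  by move=> nr ht; exact: torus_neq0 (X'h r nr t ht).1.
split.
- move=> r t nr ht; split; last by rewrite mulf_neq0 ?invr_eq0 ?X0 ?X'0.
  apply: choloM; first by apply/cholo_derivable; exact: (X'h r nr t ht).2.
  apply: choloV; first exact: X0.
  by apply/cholo_derivable; exact: (Xh r nr t ht).2.
- move=> a b ab na nb; have [d d0 Hd] := RH1_jump X1 ab na nb.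
  have [d' d'0 Hd'] := RH1_jump X'1 ab na nb.
  exists (Num.min d d'); first by rewrite lt_min d0.
  move=> t; rewrite lt_min => /andP[td td'] tb ta.
  have Xa0 := X0 _ _ na ta; have Xb0 := X0 _ _ nb tb.
  have E := Hd t td tb ta h; rewrite E in Xa0 *.
  rewrite (Hd' t td' tb ta h) J//; move: Xa0; move: (jump _ _ _ _) (X _ _ _) Xb0 => q p p0 pq.
  have q0 : q != 0 by apply: contraNneq pq => ->; rewrite mulr0.
  by field; rewrite p0 q0.
- move=> r nr; have x0 := torus_neq0 h xiT.
  have := wtendsM ((wtends_cvg _ _ _).2 (X'2 r nr h)) (wtends_comp ((wtends_cvg _ _ _).2 (X2 r nr h)) (cdiff_ccont (cdiffV x0))).
  rewrite divff//; apply: wtends_ext => t ht.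
  have := X0 r t nr ht; have := cexp_neq0 (bps_Z S h / t); move: (cexp _) (X r t h) => p q p0 q0.
  by field; rewrite q0 p0.
- by move=> r nr; apply: poly_growthM; [exact: RH3_growth|apply: poly_growthV; exact: RH3_growth].
Qed.

(** First for the active classes, which have no jumps; then their agreement
    gives equal jump factors for all classes. *)
Theorem RH_unique X X' : RH_solution S xi X -> RH_solution S xi X' ->
  forall r t, nonactive_ray S r -> half_plane r t -> X' r t = X r t.
Proof.
move=> HX HX'; have [rs [rsP cover]] := nonactive_cross.
have nr1 r : nonactive_ray S r -> is_ray r by case.
have ratio1 h : sectorial_family (nonactive_ray S) (fun r t => X' r t h / X r t h) ->
    forall r t, nonactive_ray S r -> half_plane r t -> X' r t h = X r t h.
  move=> /(sectorial_trivial nr1 rsP cover) H r t nr ht; have := H r t nr ht.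
  have X0 : X r t h != 0 by have [Xh _ _ _] := HX; exact: torus_neq0 (Xh r nr t ht).1.
  by move/(congr1 ( *%R^~ (X r t h))); rewrite divfK// mul1r.
(* the active characters do not jump *)
have act h : active S h -> forall r t, nonactive_ray S r -> half_plane r t -> X' r t h = X r t h.
  move=> ah; apply: ratio1; apply: RH_ratio_sectorial => // a b _ _ t _.
  by rewrite !jump_active.
move=> r t nr ht; apply/funext => h; apply: (ratio1 h) => //.
apply: RH_ratio_sectorial => // a b _ nb u hu.
by rewrite (jump_ext Sfin _ (fun g ag => act g ag _ _ nb hu)).
Qed.

End Uniqueness.

(** * The Riemann-Hilbert problem *)

Theorem theorem5p3 (R : realType) (G : zmodType) (n : nat) (S : bps R G n)
    (Sfin : bps_finite S) (Sunc : bps_uncoupled S) (Sint : bps_integral S)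
    (xi : G -> R[i]) (xiT : torus S xi)
    (xi1 : forall g : G, active S g -> xi g = 1) :
  exists X : ray_family R G,
    [/\ RH_solution S xi X,
        (forall X' : ray_family R G, RH_solution S xi X' ->
           forall r, nonactive_ray S r -> forall t, half_plane r t ->
             X' r t = X r t) &
        forall r, nonactive_ray S r -> forall t, half_plane r t ->
          forall b : G,
            cexp (bps_Z S b / t) * X r t b * (xi b)^-1 =
            \big[*%R/1]_(g \in [set g : G | active S g /\
                exists2 w, half_plane r w & bps_Z S g = 'i%C * w])
              Lambda (bps_Z S g / (2 * pi%:C * 'i%C * t))
                ^ (numq (bps_Omega S g) * bps_form S b g)].
Proof.
have sol := solution_solves Sfin Sunc Sint xiT xi1.
exists (solution S xi); split => //.
  by move=> X' sol' r nr t ht; exact: (RH_unique Sfin Sunc Sint xiT sol sol').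
move=> r [hr _] t ht b.
by rewrite (solution_Y xiT b hr ht) fsbig_acts.
Qed.
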